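(* For $\varepsilon>0$ sufficiently small, the shock reflection problem in $T_\varepsilon$ (as formulated in the context) possesses a solution $\alpha,\beta,t,x\in C^2(T_\varepsilon)$. Also, for $\varepsilon$ sufficiently small, the Jacobian $\frac{\partial(t,x)}{\partial(u,v)}$ does not vanish in $T_\varepsilon$, which implies that $\alpha$, $\beta$ are $C^2$ functions of $(t,x)$ on the image of $T_\varepsilon$ under the map $(u,v)\mapsto(t(u,v),x(u,v))$.
   Context: **Fluid.** $p=p(\rho)$ is a given smooth function of the density $\rho>0$ with $\frac{dp}{d\rho}(\rho)>0$; $\eta(\rho)=\sqrt{dp/d\rho}$ is the sound speed and $w$ is the velocity. The equations of motion are $\partial_t\rho+\partial_x(\rho w)=0$ and $\partial_tw+w\partial_xw=-\frac1\rho\partial_xp$. The Riemann invariants are $\alpha=\int^\rho\frac{\eta(\rho')}{\rho'}d\rho'+w$ and $\beta=\int^\rho\frac{\eta(\rho')}{\rho'}d\rho'-w$ (with a fixed lower limit of integration). Thus $\rho=\rho(\alpha,\beta)$ and $w=w(\alpha,\beta)=\frac{\alpha-\beta}{2}$ are smooth functions of $(\alpha,\beta)$. Put $c_{\rm out}(\alpha,\beta)=w+\eta$ and $c_{\rm in}(\alpha,\beta)=w-\eta$, evaluated at $\rho(\alpha,\beta),w(\alpha,\beta)$. For quantities with subscripts $+$ (behind the shock) and $-$ (ahead of the shock), $[f]=f_+-f_-$. **State ahead (given).** Data for $\rho,w$ are given at $t=0$, $x\ge0$, together with a future development: smooth functions $\rho^\ast(t,x),w^\ast(t,x)$ solving the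 equations of motion and coinciding with the data at $t=0$, on the domain $D=\{(t,x):0\le t\le T,\ x\ge x_0^\ast(t)\}$, where $T>0$ and $x_0^\ast$ is the outgoing characteristic from the origin: $x_0^\ast(0)=0$, $\frac{dx_0^\ast}{dt}=w^\ast+\eta(\rho^\ast)$ along $(t,x_0^\ast(t))$. Let $\alpha^\ast(t,x),\beta^\ast(t,x)$ be the corresponding Riemann invariants. Assume $w^\ast(0,0)\neq0$, and that the jump conditions $[\rho]V=[\rho w]$, $[\rho w]V=[\rho w^2+p]$ with $\rho_-=\rho^\ast(0,0)$, $w_-=w^\ast(0,0)$, $w_+=0$ possess a solution $\rho_+=\rho_0$, $V=V_0$ such that, with $\eta_0=\eta(\rho_0)$, $$w^\ast(0,0)+\eta(\rho^\ast(0,0))<V_0<\eta_0,\qquad 0<V_0 .$$ **Constants.** Set $a=\frac{\eta_0-V_0}{\eta_0+V_0}\in(0,1)$. Let $\alpha_0=\beta_0=\int^{\rho_0}\frac{\eta(\rho')}{\rho'}d\rho'$, $\alpha_{-0}=\alpha^\ast(0,0)$, $\beta_{-0}=\beta^\ast(0,0)$. Let $J(\alpha_+,\beta_+,\alpha_-,\beta_-)=[\rho w]^2-[\rho w^2+p][\rho]$, where $\rho_\pm=\rho(\alpha_\pm,\beta_\pm)$, $w_\pm=w(\alpha_\pm,\beta_\pm)$. One has $J=0$ and $\frac{\partial J}{\partial\beta_+}\ne0$ at $(\alpha_0,\beta_0,\alpha_{-0},\beta_{-0})$; let $H(\alpha_+,\alpha_-,\beta_-)$ be the smooth function, defined near $(\alpha_0,\alpha_{-0},\beta_{-0})$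 by the implicit function theorem, with $H(\alpha_0,\alpha_{-0},\beta_{-0})=\beta_0$ and $J(\alpha_+,H(\alpha_+,\alpha_-,\beta_-),\alpha_-,\beta_-)=0$. Define $$\beta_0'=\frac1{1+a^3}\left(\frac{\partial H}{\partial\beta_-}\,b+\frac{\partial H}{\partial\alpha_-}\,c\right),$$ with derivatives of $H$ at $(\beta_0,\alpha_{-0},\beta_{-0})$ and $b=\frac{\partial\beta^\ast}{\partial t}(0,0)\frac{1+a}{\eta_0}+\frac{\partial\beta^\ast}{\partial x}(0,0)(1-a)$, $c=\frac{\partial\alpha^\ast}{\partial t}(0,0)\frac{1+a}{\eta_0}+\frac{\partial\alpha^\ast}{\partial x}(0,0)(1-a)$. **Domain.** For $\varepsilon>0$, $T_\varepsilon=\{(u,v)\in\mathbb R^2:0\le u\le v\le\frac ua\le\varepsilon\}$. $C^2(T_\varepsilon)$ denotes functions twice continuously differentiable up to the boundary. **Shock reflection problem in $T_\varepsilon$.** Find functions $\alpha,\beta,t,x$ of $(u,v)\in T_\varepsilon$ such that: 1. In $T_\varepsilon$: $\frac{\partial x}{\partial u}=c_{\rm in}(\alpha,\beta)\frac{\partial t}{\partial u}$, $\frac{\partial x}{\partial v}=c_{\rm out}(\alpha,\beta)\frac{\partial t}{\partial v}$, $\frac{\partial\alpha}{\partial v}=0$, $\frac{\partial\beta}{\partial u}=0$. 2. Wall conditions along $u=v$: $\alpha(u,u)=\beta(u,u)$, $x(u,u)=0$. 3. Along $u=av$, $0\le v\le\varepsilon$, with $x_+(v)=x(av,v)$, $t_+(v)=t(av,v)$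 (the curve $(t_+(v),x_+(v))$ lying in $D$), $\alpha_+(v)=\alpha(av,v)$, $\beta_+(v)=\beta(av,v)$, $\alpha_-(v)=\alpha^\ast(t_+(v),x_+(v))$, $\beta_-(v)=\beta^\ast(t_+(v),x_+(v))$, $\rho_\pm=\rho(\alpha_\pm,\beta_\pm)$, $w_\pm=w(\alpha_\pm,\beta_\pm)$ and $V=\frac{[\rho w]}{[\rho]}$: $\frac{dx_+}{dv}=V\frac{dt_+}{dv}$ and $J(\alpha_+,\beta_+,\alpha_-,\beta_-)=0$. 4. At the origin: $t(0,0)=0$, $\frac{\partial x}{\partial v}(0,0)=1$, $\beta(0,0)=\beta_0$, $\frac{\partial\beta}{\partial v}(0,0)=\beta_0'$, $V(0)=V_0$. 5. Determinism condition: $c_{\rm out}(\alpha_-(v),\beta_-(v))<V(v)<c_{\rm out}(\alpha_+(v),\beta_+(v))$ for $v\in[0,\varepsilon]$. *)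

(* Defs.v *)
From Stdlib Require Import Reals List.
From Coquelicot Require Import Coquelicot.
Import ListNotations.
Open Scope R_scope.

Definition interior_pt {E : UniformSpace} (D : E -> Prop) (q : E) : Prop :=
  locally q D.

(** [Cn B n D f]: [f] is [n] times continuously differentiable on [D], up to
    the boundary, with respect to the directions in [B]: the partial derivatives
    exist in the interior of [D] and extend continuously to [D].  When [D] is
    open this is ordinary [C^n] regularity on [D]. *)
Fixpoint Cn {E : NormedModule R_AbsRing} (B : list E) (n : nat)
    (D : E -> Prop) (f : E -> R) : Prop :=
  (forall q, D q -> filterlim f (within D (locally q)) (locally (f q))) /\
  match n with
  | O => True
  | S m => forall e, In e B -> exists g : E -> R,
      (forall q, interior_pt D q ->
         is_derive (fun s : R => f (plus q (scal s e))) 0 (g q)) /\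
      Cn B m D g
  end.

Definition e1 : R * R := (1, 0).
Definition e2 : R * R := (0, 1).

Definition C2 (D : R * R -> Prop) (f : R * R -> R) : Prop :=
  Cn [e1; e2] 2 D f.
Definition smooth2 (D : R * R -> Prop) (f : R * R -> R) : Prop :=
  forall n, Cn [e1; e2] n D f.
Definition smooth3 (D : R * R * R -> Prop) (f : R * R * R -> R) : Prop :=
  forall n, Cn [(1, 0, 0); (0, 1, 0); (0, 0, 1)] n D f.

(** The partial derivative of [f] along [e] at a point [q] of [D], where [q] may
    lie on the boundary: the limit at [q] of the partial derivative in the
    interior of [D].  (At the corners considered below, the line through [q] in
    a coordinate direction may meet [D] only in [q], so that a one-sided
    difference quotient would make no sense.) *)
Definition pd (D : R * R -> Prop) (e : R * R) (f : R * R -> R) (q : R * R) : R :=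
  lim (filtermap (fun z : R * R => Derive (fun s => f (plus z (scal s e))) 0)
                 (within (interior_pt D) (locally q))).

(** [l] is the derivative of [f] at [x] relative to the set [I] (one-sided at
    an endpoint of an interval). *)
Definition is_derive_within (I : R -> Prop) (f : R -> R) (x l : R) : Prop :=
  filterdiff f (within I (locally x)) (fun y : R => scal y l).

(** [p] is the pressure as a function of the density and [rref] is the fixed
    lower limit of integration in the Riemann invariants. *)

Definition eta (p : R -> R) (rho : R) : R := sqrt (Derive p rho).

Definition enthalpy_integral (p : R -> R) (rref rho : R) : R :=
  RInt (fun r => eta p r / r) rref rho.

Definition alpha_of (p : R -> R) (rref rho w : R) : R :=
  enthalpy_integral p rref rho + w.
Definition beta_of (p : R -> R) (rref rho w : R) : R :=
  enthalpy_integral p rref rho - w.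

Definition w_of (al be : R) : R := (al - be) / 2.

Definition has_density (p : R -> R) (rref al be rho : R) : Prop :=
  0 < rho /\ alpha_of p rref rho (w_of al be) = al
          /\ beta_of p rref rho (w_of al be) = be.

(** The pairs [(al, be)] which are the Riemann invariants of some state with
    positive density; [rho_of] is meaningful exactly on these. *)
Definition admissible (p : R -> R) (rref al be : R) : Prop :=
  exists rho, has_density p rref al be rho.

Definition rho_of (p : R -> R) (rref al be : R) : R :=
  iota (has_density p rref al be).

Definition c_out (p : R -> R) (rref al be : R) : R :=
  w_of al be + eta p (rho_of p rref al be).
Definition c_in (p : R -> R) (rref al be : R) : R :=
  w_of al be - eta p (rho_of p rref al be).

(** In the following, [alp], [bep] refer to the state behind the shock and
    [alm], [bem] to the state ahead of it. *)

Definition J (p : R -> R) (rref alp bep alm bem : R) : R :=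
  let rp := rho_of p rref alp bep in
  let rm := rho_of p rref alm bem in
  let wp := w_of alp bep in
  let wm := w_of alm bem in
  (rp * wp - rm * wm) ^ 2
  - ((rp * wp ^ 2 + p rp) - (rm * wm ^ 2 + p rm)) * (rp - rm).

Definition shock_speed (p : R -> R) (rref alp bep alm bem : R) : R :=
  let rp := rho_of p rref alp bep in
  let rm := rho_of p rref alm bem in
  (rp * w_of alp bep - rm * w_of alm bem) / (rp - rm).

Definition jump_conditions (p : R -> R) (rp wp rm wm V : R) : Prop :=
  (rp - rm) * V = rp * wp - rm * wm /\
  (rp * wp - rm * wm) * V = (rp * wp ^ 2 + p rp) - (rm * wm ^ 2 + p rm).

(** Points of the plane carrying the state ahead of the shock are pairs
    [(t, x)]; [x0] is the outgoing characteristic from the origin. *)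

Definition dev_domain (T : R) (x0 : R -> R) (q : R * R) : Prop :=
  0 <= fst q <= T /\ x0 (fst q) <= snd q.

Record future_development (p : R -> R) (T : R) (x0 rho_data w_data : R -> R)
    (rho w : R * R -> R) : Prop := {
  dev_T : 0 < T;
  dev_smooth_rho : smooth2 (dev_domain T x0) rho;
  dev_smooth_w : smooth2 (dev_domain T x0) w;
  dev_rho_pos : forall q, dev_domain T x0 q -> 0 < rho q;
  dev_mass : forall q, dev_domain T x0 q ->
    pd (dev_domain T x0) e1 rho q
    + pd (dev_domain T x0) e2 (fun z => rho z * w z) q = 0;
  dev_momentum : forall q, dev_domain T x0 q ->
    pd (dev_domain T x0) e1 w q + w q * pd (dev_domain T x0) e2 w q
    = - (1 / rho q) * pd (dev_domain T x0) e2 (fun z => p (rho z)) q;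
  dev_data : forall x, 0 <= x -> rho (0, x) = rho_data x /\ w (0, x) = w_data x;
  dev_origin : x0 0 = 0;
  dev_characteristic : forall t, 0 <= t <= T ->
    is_derive_within (fun s => 0 <= s <= T) x0 t
      (w (t, x0 t) + eta p (rho (t, x0 t)))
}.

Definition a_const (eta0 V0 : R) : R := (eta0 - V0) / (eta0 + V0).

(** [H] is a smooth local solution, near [(al0, alm0, bem0)], of
    [J al (H (al, alm, bem)) alm bem = 0] with value [be0] at that point. *)
Definition implicit_solution (p : R -> R) (rref al0 be0 alm0 bem0 : R)
    (H : R * R * R -> R) : Prop :=
  H (al0, alm0, bem0) = be0 /\
  exists U : R * R * R -> Prop,
    open U /\ U (al0, alm0, bem0) /\ smooth3 U H /\
    forall al alm bem, U (al, alm, bem) -> J p rref al (H (al, alm, bem)) alm bem = 0.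

(** [D] is the domain of [als], [bes], the Riemann invariants ahead of the
    shock; [al0] is the common value of both invariants behind it. *)
Definition beta0' (D : R * R -> Prop) (als bes : R * R -> R)
    (H : R * R * R -> R) (eta0 V0 al0 : R) : R :=
  let a := a_const eta0 V0 in
  let alm0 := als (0, 0) in
  let bem0 := bes (0, 0) in
  let b := pd D e1 bes (0, 0) * ((1 + a) / eta0) + pd D e2 bes (0, 0) * (1 - a) in
  let c := pd D e1 als (0, 0) * ((1 + a) / eta0) + pd D e2 als (0, 0) * (1 - a) in
  1 / (1 + a ^ 3) *
    (Derive (fun s => H (al0, alm0, s)) bem0 * b
     + Derive (fun s => H (al0, s, bem0)) alm0 * c).

(** Points of [T_domain a eps] are pairs [(u, v)]. *)

Definition T_domain (a eps : R) (q : R * R) : Prop :=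
  0 <= fst q <= snd q /\ snd q <= fst q / a <= eps.

(** [D] is the domain of the state [als], [bes] ahead of the shock. *)
Record shock_reflection_problem (p : R -> R) (rref : R)
    (D : R * R -> Prop) (als bes : R * R -> R)
    (a be0 be0' V0 eps : R) (al be t x : R * R -> R) : Prop := {
  srp_admissible : forall q, T_domain a eps q -> admissible p rref (al q) (be q);
  srp_in : forall q, T_domain a eps q ->
    pd (T_domain a eps) e1 x q
    = c_in p rref (al q) (be q) * pd (T_domain a eps) e1 t q;
  srp_out : forall q, T_domain a eps q ->
    pd (T_domain a eps) e2 x q
    = c_out p rref (al q) (be q) * pd (T_domain a eps) e2 t q;
  srp_alpha : forall q, T_domain a eps q -> pd (T_domain a eps) e2 al q = 0;
  srp_beta : forall q, T_domain a eps q -> pd (T_domain a eps) e1 be q = 0;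

  srp_wall : forall u, T_domain a eps (u, u) ->
    al (u, u) = be (u, u) /\ x (u, u) = 0;

  srp_shock : forall v, 0 <= v <= eps ->
    let tp := fun s => t (a * s, s) in
    let xp := fun s => x (a * s, s) in
    let alp := al (a * v, v) in
    let bep := be (a * v, v) in
    let alm := als (tp v, xp v) in
    let bem := bes (tp v, xp v) in
    let V := shock_speed p rref alp bep alm bem in
    D (tp v, xp v) /\
    rho_of p rref alp bep <> rho_of p rref alm bem /\
    (exists dt dx : R,
       is_derive_within (fun s => 0 <= s <= eps) tp v dt /\
       is_derive_within (fun s => 0 <= s <= eps) xp v dx /\
       dx = V * dt) /\
    J p rref alp bep alm bem = 0 /\
    c_out p rref alm bem < V < c_out p rref alp bep;

  srp_t0 : t (0, 0) = 0;
  srp_dx0 : pd (T_domain a eps) e2 x (0, 0) = 1;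
  srp_beta0 : be (0, 0) = be0;
  srp_dbeta0 : pd (T_domain a eps) e2 be (0, 0) = be0';
  srp_V0 : shock_speed p rref (al (0, 0)) (be (0, 0))
             (als (t (0, 0), x (0, 0))) (bes (t (0, 0), x (0, 0))) = V0
}.

Definition jacobian (D : R * R -> Prop) (t x : R * R -> R) (q : R * R) : R :=
  pd D e1 t q * pd D e2 x q - pd D e2 t q * pd D e1 x q.

Definition image_domain (D : R * R -> Prop) (t x : R * R -> R) (z : R * R) : Prop :=
  exists q, D q /\ z = (t q, x q).

(** On the image of [D] under [(t, x)], [f] is a [C^2] function of [(t, x)]. *)
Definition C2_function_of (D : R * R -> Prop) (t x f : R * R -> R) : Prop :=
  exists F : R * R -> R,
    C2 (image_domain D t x) F /\ forall q, D q -> F (t q, x q) = f q.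

(* Main.v *)
Require Import Defs.
From Stdlib Require Import Reals List Lra Lia Ranalysis5 FunctionalExtensionality.
From Coquelicot Require Import Coquelicot.
Import ListNotations.
Open Scope R_scope.

(** In the characteristic coordinates [alpha = alpha(u)] and [beta = beta(v)], and the wall
    condition makes [alpha] and [beta] the same function [be].  Extending [t] and [x] across
    the wall by [t(u,v) = t(v,u)] and [x(u,v) = - x(v,u)] absorbs the wall into a symmetry, so
    that [t_u(u,v) = nu(v,u)] with [nu = t_v], and the first order system becomes the single
    hodograph equation for [nu] on a full square around the origin.  On the shock [u = a v]
    the relation [beta_+ = H(alpha_+, alpha_-, beta_-)] expresses [be v] through [be (a v)] and
    the position of the shock.  Differentiating it, and the relation [dx = V dt], once more
    gives equations for the highest derivatives which are contractions: the coefficients at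
    the origin are [- a^4] and [a], because [dH/d alpha_+ = - a^2] there.  All lower order terms
    are small on a small square, so that the unknowns [be], [nu] and their derivatives are the
    fixed point of a contraction for a weighted sup norm whose weights grow with the order
    of the derivative.  Then [t] and [x] are potentials of the closed forms
    [nu(v,u) du + nu(u,v) dv] and [c_in nu(v,u) du + c_out nu(u,v) dv].  The map [(t, x)] is
    close to a linear isomorphism, hence expanding, and Cramer's rule gives the derivatives
    of [alpha] and [beta] on the image. *)

(** The relation [nu (a v, v) = g * nu (v, a v)] has coefficient $1$ at the origin, so iterating on
    values does not contract. Differentiating along the shock supplies the factor $a<1$, and what
    differentiation loses is restored by data at the origin: $\partial x/\partial v=1$ with $c_{\rm
    out}=\eta_0$ forces [nu (0, 0)] to be $1/\eta_0$, and $\beta'(0)=\beta_0'$ is prescribed. Taking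
    the derivatives as components of the unknown avoids a loss of derivatives; the relations between
    a component and its derivative are then an invariant of the iteration.

    The second obstacle is the state ahead. It is given only on one side of the outgoing
    characteristic, and the shock starts at a corner of that domain. Since the shock is initially
    faster than this characteristic, a thin cone about the line $x=V_0t$ lies in the domain, all its
    points but the apex being interior. The coefficients are controlled on such a cone, with
    Lipschitz bounds up to the apex, and the iteration must keep the shock in it; this is why
    deviations of the shock position are measured relative to [v]. *)

(** * Calculus in one variable *)

Lemma continuous_pt (f : R -> R) (x : R) : continuity_pt f x <-> continuous f x.
Proof. apply continuity_pt_filterlim. Qed.

Lemma continuous_eps (f : R -> R) (x : R) :
  continuous f x <->
  forall e, 0 < e -> exists d, 0 < d /\
    forall y, Rabs (y - x) < d -> Rabs (f y - f x) < e.
Proof.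
  split; intros Hf.
  - intros e He.
    destruct (proj1 (filterlim_locally f (f x)) Hf (mkposreal e He)) as [d Hd].
    exists d; split; [apply cond_pos|]. intros y Hy. exact (Hd y Hy).
  - apply filterlim_locally. intros e. destruct (Hf e (cond_pos e)) as [d [Hd H]].
    exists (mkposreal d Hd). intros y Hy. exact (H y Hy).
Qed.

Lemma is_derive_continuous (f : R -> R) (x l : R) :
  is_derive f x l -> continuous f x.
Proof. intros H. apply @ex_derive_continuous. exists l; exact H. Qed.

Lemma locally_abs_lt (r v : R) : Rabs v < r -> locally v (fun s => Rabs s < r).
Proof.
  intros Hv. assert (Hp : 0 < r - Rabs v) by lra. exists (mkposreal _ Hp). intros y Hy.
  unfold ball in Hy; simpl in Hy; unfold AbsRing_ball, abs, minus, plus, opp in Hy; simpl in Hy.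
  split_Rabs; lra.
Qed.

Lemma continuous_locally (f : R -> R) (v e : R) :
  0 < e -> continuous f v -> locally v (fun s => Rabs (f s - f v) <= e).
Proof.
  intros He Hf. destruct (proj1 (continuous_eps f v) Hf e He) as [dd [Hd H]].
  exists (mkposreal dd Hd). intros y Hy. left. apply H, Hy.
Qed.

Lemma is_derive_linear (c v : R) : is_derive (fun s => c * s) v c.
Proof.
  evar_last; [apply (is_derive_scal (fun x => x)), @is_derive_id|]. apply Rmult_1_r.
Qed.

Lemma continuous_linear (c v : R) : continuous (fun s => c * s) v.
Proof. exact (is_derive_continuous _ _ _ (is_derive_linear c v)). Qed.

Lemma is_derive_const_plus (f : R -> R) (c x l : R) :
  is_derive f x l -> is_derive (fun s => c + f s) x l.
Proof.
  intros H. evar_last; [apply @is_derive_plus; [apply @is_derive_const|exact H]|]. apply Rplus_0_l.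
Qed.

Lemma mean_value_bound (f df : R -> R) (a b M : R) :
  (forall x, Rmin a b <= x <= Rmax a b -> is_derive f x (df x)) ->
  (forall x, Rmin a b <= x <= Rmax a b -> Rabs (df x) <= M) ->
  Rabs (f b - f a) <= M * Rabs (b - a).
Proof.
  intros H HM. destruct (MVT_gen f a b df) as [c [Hc E]].
  - intros x Hx; apply H; lra.
  - intros x Hx. apply continuous_pt. eapply is_derive_continuous, H; lra.
  - rewrite E, Rabs_mult. apply Rmult_le_compat_r; [apply Rabs_pos|auto].
Qed.

(** Along the shock the chain rule is available for positive parameters only, while one-sided
    continuity survives at $0$. In this form the lemma turns differentiated relations on the shock
    line, and on the wall, back into the relations themselves. *)
Lemma constant_of_zero_derive (f : R -> R) (r : R) :
  (forall s, 0 < s < r -> is_derive f s 0) ->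
  (forall e, 0 < e -> exists d, 0 < d /\ forall s, 0 < s < d -> Rabs (f s - f 0) < e) ->
  forall s, 0 <= s < r -> f s = f 0.
Proof.
  intros Hd Hc s Hs. destruct (Req_dec s 0) as [->|Hn]; [reflexivity|].
  destruct (Req_dec (f s) (f 0)) as [|Hne]; [assumption|exfalso].
  destruct (Hc (Rabs (f s - f 0))) as [d [Hd0 H]]; [apply Rabs_pos_lt; lra|].
  (* The mean value theorem is applied between [y] and [s], away from the endpoint $0$; continuity
     then compares [f y] with [f 0]. *)
  pose (y := Rmin (s / 2) (d / 2)).
  assert (Hy : 0 < y /\ y <= s / 2 /\ y <= d / 2).
  { unfold y; repeat split; [apply Rmin_case; lra|apply Rmin_l|apply Rmin_r]. }
  assert (f s = f y).
  { assert (Rabs (f s - f y) <= 0 * Rabs (s - y)).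
    { apply (mean_value_bound f (fun _ => 0)).
      - intros x Hx. rewrite Rmin_left, Rmax_right in Hx by lra. apply Hd; lra.
      - intros; rewrite Rabs_R0; lra. }
    rewrite Rmult_0_l in H0. assert (HH := Rabs_pos (f s - f y)).
    destruct (Req_dec (f s - f y) 0); [lra|]. assert (0 < Rabs (f s - f y)) by (apply Rabs_pos_lt; auto). lra. }
  specialize (H y ltac:(lra)). rewrite <- H0 in H. lra.
Qed.

Lemma RInt_abs_le (f : R -> R) (a b M : R) :
  (forall x, Rmin a b <= x <= Rmax a b -> continuous f x) ->
  (forall x, Rmin a b <= x <= Rmax a b -> Rabs (f x) <= M) ->
  Rabs (RInt f a b) <= M * Rabs (b - a).
Proof.
  intros Hc HM. destruct (Rle_dec a b) as [Hab|Hab].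
  - rewrite Rmin_left, Rmax_right in * by lra.
    rewrite (Rabs_pos_eq (b - a)), Rmult_comm by lra.
    apply abs_RInt_le_const; auto. apply @ex_RInt_continuous.
    rewrite Rmin_left, Rmax_right by lra; auto.
  - rewrite Rmin_right, Rmax_left in * by lra.
    rewrite <- (@opp_RInt_swap R_CompleteNormedModule f b a).
    2:{ apply @ex_RInt_continuous. rewrite Rmin_left, Rmax_right by lra; auto. }
    rewrite (Rabs_left (b - a)) by lra.
    replace (M * - (b - a)) with ((a - b) * M) by ring.
    unfold opp; simpl. rewrite Rabs_Ropp.
    apply abs_RInt_le_const; auto; [lra|]. apply @ex_RInt_continuous.
    rewrite Rmin_left, Rmax_right by lra; auto.
Qed.

Lemma between_abs (u r s : R) : Rabs u < r -> Rmin 0 u <= s <= Rmax 0 u -> Rabs s < r /\ Rabs s <= Rabs u.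
Proof.
  intros Hu. unfold Rmin, Rmax. destruct (Rle_dec 0 u); intros Hs;
  split_Rabs; lra.
Qed.

Lemma RInt_interval_derive (f : R -> R) (r u : R) :
  (forall x, Rabs x < r -> continuous f x) -> Rabs u < r ->
  is_derive (fun u => RInt f 0 u) u (f u).
Proof.
  intros Hc Hu. apply (@is_derive_RInt R_NormedModule f (fun u => RInt f 0 u) 0 u).
  - assert (Hp : 0 < r - Rabs u) by lra. exists (mkposreal _ Hp). intros y Hy.
    apply @RInt_correct, @ex_RInt_continuous. intros z Hz.
    apply Hc. apply (between_abs y r z); auto.
    unfold ball in Hy; simpl in Hy; unfold AbsRing_ball, abs, minus, plus, opp in Hy; simpl in Hy.
    split_Rabs; lra.
  - apply Hc, Hu.
Qed.

Lemma RInt_diff_bound (f g : R -> R) (r u K : R) :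
  (forall x, Rabs x < r -> continuous f x) -> (forall x, Rabs x < r -> continuous g x) ->
  (forall x, Rabs x < r -> Rabs (f x - g x) <= K) -> Rabs u < r ->
  Rabs (RInt f 0 u - RInt g 0 u) <= K * Rabs u.
Proof.
  intros Hf Hg HK Hu.
  assert (In : forall y, Rmin 0 u <= y <= Rmax 0 u -> Rabs y < r).
  { intros y Hy. apply (between_abs u r y); auto. }
  replace (RInt f 0 u - RInt g 0 u) with (RInt (fun s => f s - g s) 0 u).
  - replace (Rabs u) with (Rabs (u - 0)) by (f_equal; ring). apply RInt_abs_le; intros; auto.
    apply (@continuous_minus R_UniformSpace R_AbsRing R_NormedModule); auto.
  - apply (@RInt_minus R_CompleteNormedModule); apply @ex_RInt_continuous; auto.
Qed.

(** Passing to the limit in $f_n(x)=f_n(0)+\int_0^x f_n'$ gives the same formula for [f] and [df],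
    and the fundamental theorem differentiates it. This is what makes the regularity class of the
    iteration closed. *)
Lemma uniform_limit_derive (f df : R -> R) (fn dfn : nat -> R -> R) (r : R) :
  (forall n x, Rabs x < r -> is_derive (fn n) x (dfn n x)) ->
  (forall n x, Rabs x < r -> continuous (dfn n) x) ->
  (forall e, 0 < e -> exists n, forall x, Rabs x < r ->
     Rabs (fn n x - f x) <= e /\ Rabs (dfn n x - df x) <= e) ->
  (forall x, Rabs x < r -> continuous df x) /\
  (forall x, Rabs x < r -> is_derive f x (df x)).
Proof.
  intros Hd Hc Hu.
  assert (Hdf : forall x, Rabs x < r -> continuous df x).
  { intros x Hx. apply continuous_eps. intros e He.
    destruct (Hu (e / 4) ltac:(lra)) as [n Hn].
    destruct (proj1 (continuous_eps _ _) (Hc n x Hx) (e / 4) ltac:(lra)) as [d [Hd0 H]].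
    exists (Rmin d (r - Rabs x)). split; [apply Rmin_case; lra|].
    intros y Hy. assert (H1 := Rmin_l d (r - Rabs x)). assert (H2 := Rmin_r d (r - Rabs x)).
    specialize (H y ltac:(lra)). assert (Hy' : Rabs y < r) by (split_Rabs; lra).
    assert (A := proj2 (Hn y Hy')). assert (B := proj2 (Hn x Hx)).
    split_Rabs; lra. }
  split; [exact Hdf|].
  assert (E : forall x, Rabs x < r -> f x = f 0 + RInt df 0 x).
  { intros x Hx. assert (H0r : Rabs 0 < r) by (rewrite Rabs_R0; generalize (Rabs_pos x); lra).
    destruct (Req_dec (f x) (f 0 + RInt df 0 x)) as [|Hne]; [assumption|exfalso].
    set (g := Rabs (f x - (f 0 + RInt df 0 x))).
    assert (Hg : 0 < g) by (apply Rabs_pos_lt; lra).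
    assert (Hr : 0 < r) by (generalize (Rabs_pos x); lra).
    (* The defect [g] is at most [e * (2 + r)]: one [e] at each of the points [x] and $0$, and
       [e * r] from the integral. With this [e] the bound falls below [g]. *)
    pose (e := g / (2 * (3 + r))).
    assert (He : 0 < e) by (unfold e; apply Rdiv_lt_0_compat; lra).
    destruct (Hu e He) as [n Hn].
    assert (En : RInt (dfn n) 0 x = fn n x - fn n 0).
    { apply is_RInt_unique. apply (@is_RInt_derive R_CompleteNormedModule (fn n) (dfn n)).
      - intros y Hy. apply Hd. apply (between_abs x r y); auto.
      - intros y Hy. apply Hc. apply (between_abs x r y); auto. }
    assert (Ed : Rabs (RInt (fun s => dfn n s - df s) 0 x) <= e * Rabs (x - 0)).
    { apply RInt_abs_le.
      - intros y Hy. destruct (between_abs x r y Hx Hy).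
        apply (@continuous_minus R_UniformSpace R_AbsRing R_NormedModule); [apply Hc|apply Hdf]; auto.
      - intros y Hy. apply Hn. apply (between_abs x r y); auto. }
    assert (Em : RInt (fun s => dfn n s - df s) 0 x = RInt (dfn n) 0 x - RInt df 0 x).
    { apply (@RInt_minus R_CompleteNormedModule); apply @ex_RInt_continuous; intros y Hy;
      [apply Hc|apply Hdf]; apply (between_abs x r y); auto. }
    rewrite Em, En, Rminus_0_r in Ed.
    assert (A := proj1 (Hn x Hx)). assert (B := proj1 (Hn 0 H0r)).
    assert (e * Rabs x <= e * r) by (apply Rmult_le_compat_l; lra).
    assert (g <= e * (2 + r)) by (unfold g; replace (e * (2 + r)) with (2 * e + e * r) by ring; split_Rabs; lra).
    assert (e * (2 * (3 + r)) = g) by (unfold e; field; lra).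
    assert (0 < e * r) by (apply Rmult_lt_0_compat; lra). lra. }
  intros x Hx.
  apply (is_derive_ext_loc (fun x => f 0 + RInt df 0 x)).
  - assert (Hp : 0 < r - Rabs x) by lra. exists (mkposreal _ Hp). intros y Hy. symmetry. apply E.
    unfold ball in Hy; simpl in Hy; unfold AbsRing_ball, abs, minus, plus, opp in Hy; simpl in Hy.
    split_Rabs; lra.
  - apply is_derive_const_plus. apply RInt_interval_derive with r; auto.
Qed.

(** * Continuously differentiable functions on a square *)

Definition square (r u v : R) : Prop := Rabs u < r /\ Rabs v < r.

Lemma square_swap (r u v : R) : square r u v -> square r v u.
Proof. intros [H1 H2]; split; auto. Qed.

Lemma square_locally (r u v : R) : square r u v -> locally_2d (square r) u v.
Proof.
  intros [Hu Hv]. assert (Hp : 0 < Rmin (r - Rabs u) (r - Rabs v)) by (apply Rmin_case; lra).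
  exists (mkposreal _ Hp); simpl. intros u' v' H1 H2.
  generalize (Rmin_l (r - Rabs u) (r - Rabs v)) (Rmin_r (r - Rabs u) (r - Rabs v)).
  split; split_Rabs; lra.
Qed.

(** The partial derivatives are parameters rather than existential witnesses, because mixed
    derivatives of different functions have to be identified with each other later. *)
Definition C1_square (r : R) (f fu fv : R -> R -> R) : Prop :=
  forall u v, square r u v ->
    is_derive (fun s => f s v) u (fu u v) /\ is_derive (fun s => f u s) v (fv u v) /\
    continuity_2d_pt fu u v /\ continuity_2d_pt fv u v.

Lemma locally_2d_pair (P : R -> R -> Prop) (u v : R) :
  locally_2d P u v -> locally (u, v) (fun z : R * R => P (fst z) (snd z)).
Proof. intros H. apply locally_2d_locally. exact H. Qed.

(** One partial derivative has to be continuous at the point; for the other, existence at the point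
    is enough. *)
Lemma differentiable_of_partials (f fu : R -> R -> R) (l u v : R) :
  locally_2d (fun u v => is_derive (fun s => f s v) u (fu u v)) u v ->
  continuity_2d_pt fu u v ->
  is_derive (fun s => f u s) v l ->
  differentiable_pt_lim f u v (fu u v) l.
Proof.
  intros H1 H2 H3. apply filterdiff_differentiable_pt_lim.
  apply (is_derive_filterdiff f u v fu l).
  - apply locally_2d_pair in H1. exact H1.
  - exact H3.
  - apply continuity_2d_pt_filterlim in H2. exact H2.
Qed.

Lemma C1_square_differentiable (r : R) (f fu fv : R -> R -> R) :
  C1_square r f fu fv -> forall u v, square r u v ->
  differentiable_pt_lim f u v (fu u v) (fv u v).
Proof.
  intros H u v Huv. apply differentiable_of_partials.
  - destruct (square_locally r u v Huv) as [d Hd]. exists d. intros u' v' A B.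
    apply (H u' v' (Hd u' v' A B)).
  - apply (H u v Huv).
  - apply (H u v Huv).
Qed.

Lemma C1_square_continuous (r : R) (f fu fv : R -> R -> R) :
  C1_square r f fu fv -> forall u v, square r u v -> continuity_2d_pt f u v.
Proof.
  intros H u v Huv. apply differentiable_continuity_pt.
  exists (fu u v), (fv u v). eapply C1_square_differentiable; eauto.
Qed.

Lemma is_derive_curve (f : R -> R -> R) (x y : R -> R) (s l1 l2 x' y' : R) :
  differentiable_pt_lim f (x s) (y s) l1 l2 ->
  is_derive x s x' -> is_derive y s y' ->
  is_derive (fun s => f (x s) (y s)) s (l1 * x' + l2 * y').
Proof.
  intros H Hx Hy. apply is_derive_Reals in Hx. apply is_derive_Reals in Hy.
  apply is_derive_Reals. apply derivable_pt_lim_comp_2d; auto.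
Qed.

Lemma continuity_2d_curve (f : R -> R -> R) (x y : R -> R) (s : R) :
  continuity_2d_pt f (x s) (y s) -> continuous x s -> continuous y s ->
  continuous (fun s => f (x s) (y s)) s.
Proof.
  intros Hf Hx Hy. apply continuous_eps. intros e He.
  destruct (Hf (mkposreal e He)) as [d Hd].
  destruct (proj1 (continuous_eps _ _) Hx d (cond_pos d)) as [d1 [P1 H1]].
  destruct (proj1 (continuous_eps _ _) Hy d (cond_pos d)) as [d2 [P2 H2]].
  exists (Rmin d1 d2). split; [apply Rmin_case; auto|]. intros z Hz.
  generalize (Rmin_l d1 d2) (Rmin_r d1 d2); intros.
  apply Hd; [apply H1|apply H2]; lra.
Qed.

Lemma continuity_2d_swap (f : R -> R -> R) (u v : R) :
  continuity_2d_pt f v u -> continuity_2d_pt (fun u v => f v u) u v.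
Proof. intros H e. destruct (H e) as [d Hd]. exists d. intros; apply Hd; auto. Qed.

Lemma continuity_2d_left (f : R -> R) (u v : R) :
  continuous f u -> continuity_2d_pt (fun u _ => f u) u v.
Proof.
  intros H. apply (continuity_1d_2d_pt_comp f (fun u _ => u)).
  apply continuous_pt, H. apply continuity_2d_pt_id1.
Qed.

Lemma continuity_2d_right (f : R -> R) (u v : R) :
  continuous f v -> continuity_2d_pt (fun _ v => f v) u v.
Proof.
  intros H. apply (continuity_1d_2d_pt_comp f (fun _ v => v)).
  apply continuous_pt, H. apply continuity_2d_pt_id2.
Qed.

Lemma continuity_2d_section (f : R -> R -> R) (u v : R) :
  continuity_2d_pt f u v -> continuous (fun s => f s v) u /\ continuous (fun s => f u s) v.
Proof.
  intros H; split.
  - apply (continuity_2d_curve f (fun s => s) (fun _ => v)); auto using continuous_id, continuous_const.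
  - apply (continuity_2d_curve f (fun _ => u) (fun s => s)); auto using continuous_id, continuous_const.
Qed.

(** The increment splits into an integral from [u] to [u'], short with bounded integrand, and the
    integral over [[0, u]] of a difference that is small by uniform continuity on a compact
    segment. *)
Lemma RInt_left_continuous (r : R) (g : R -> R -> R) :
  (forall u v, square r u v -> continuity_2d_pt g u v) ->
  forall u v, square r u v -> continuity_2d_pt (fun u v => RInt (fun s => g s v) 0 u) u v.
Proof.
  intros Hg u v Huv e. destruct Huv as [Hu Hv].
  set (b := (Rabs u + r) / 2).
  assert (Hb : Rabs u < b < r) by (unfold b; lra).
  assert (Hb0 : 0 < b) by (generalize (Rabs_pos u); lra).
  assert (He := cond_pos e).
  assert (Hcont : forall x, - b <= x <= b -> continuity_2d_pt g x v).
  { intros x Hx; apply Hg; split; auto. split_Rabs; lra. }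
  assert (Hee : 0 < Rmin 1 (e / (2 * b + 2))) by (apply Rmin_case; [lra|apply Rdiv_lt_0_compat; lra]).
  destruct (uniform_continuity_2d_1d g (- b) b v Hcont (mkposreal _ Hee)) as [d Hd].
  destruct (bounded_continuity (fun x => g x v) (- b) b) as [M HM].
  { intros x Hx. apply (continuity_2d_section g x v (Hcont x Hx)). }
  assert (HM0 : 0 < M).
  { apply Rle_lt_trans with (2 := HM 0 ltac:(lra)). apply norm_ge_0. }
  (* The four entries give, in turn, uniform continuity in [v], the bounds [Rabs v' < r] and
     [Rabs u' < b], and half of [e] for the short integral. *)
  set (dd := Rmin (Rmin d (r - Rabs v)) (Rmin (b - Rabs u) (e / (2 * (M + 1))))).
  assert (Hdd : 0 < dd).
  { unfold dd. repeat apply Rmin_case; try lra. apply cond_pos. apply Rdiv_lt_0_compat; lra. }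
  exists (mkposreal dd Hdd). simpl. intros u' v' Hu' Hv'.
  assert (Q : dd <= d /\ dd <= r - Rabs v /\ dd <= b - Rabs u /\ dd <= e / (2 * (M + 1))).
  { unfold dd. generalize (Rmin_l (Rmin d (r - Rabs v)) (Rmin (b - Rabs u) (e / (2 * (M + 1)))))
     (Rmin_r (Rmin d (r - Rabs v)) (Rmin (b - Rabs u) (e / (2 * (M + 1))))) (Rmin_l d (r - Rabs v))
     (Rmin_r d (r - Rabs v)) (Rmin_l (b - Rabs u) (e / (2 * (M + 1))))
     (Rmin_r (b - Rabs u) (e / (2 * (M + 1)))). intros; repeat split; lra. }
  destruct Q as [Q1 [Q2 [Q3 Q4]]].
  assert (Bv' : Rabs v' < r) by (split_Rabs; lra).
  assert (Bu' : Rabs u' < b) by (split_Rabs; lra).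
  assert (Cg : forall w x, Rabs w < r -> Rabs x <= b -> continuous (fun s => g s w) x).
  { intros w x Hw Hx. apply (continuity_2d_section g x w), Hg. split; [lra|auto]. }
  assert (Hclose : forall x, Rabs x <= b -> Rabs (g x v' - g x v) <= Rmin 1 (e / (2 * b + 2))).
  { intros x Hx. left. apply (Hd x v x v'); generalize (cond_pos d); split_Rabs; lra. }
  assert (E1 : RInt (fun s => g s v') 0 u' - RInt (fun s => g s v) 0 u =
               RInt (fun s => g s v') u u' + RInt (fun s => g s v' - g s v) 0 u).
  { assert (X1 : ex_RInt (fun s => g s v') 0 u).
    { apply @ex_RInt_continuous. intros z Hz. apply Cg; auto.
      destruct (between_abs u r z); auto; lra. }
    assert (X2 : ex_RInt (fun s => g s v) 0 u).
    { apply @ex_RInt_continuous. intros z Hz. apply Cg; auto.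
      destruct (between_abs u r z); auto; lra. }
    assert (X3 : ex_RInt (fun s => g s v') u u').
    { apply @ex_RInt_continuous. intros z Hz. apply Cg; auto.
      unfold Rmin, Rmax in Hz. destruct (Rle_dec u u'); split_Rabs; lra. }
    generalize (@RInt_Chasles R_CompleteNormedModule _ _ _ _ X1 X3). unfold plus; simpl.
    generalize (@RInt_minus R_CompleteNormedModule _ _ _ _ X1 X2). unfold minus, plus, opp; simpl.
    intros F1 F2. unfold Rminus. rewrite F1, <- F2. ring. }
  rewrite E1.
  assert (F1 : Rabs (RInt (fun s => g s v') u u') <= (M + 1) * Rabs (u' - u)).
  { apply RInt_abs_le.
    - intros z Hz. apply Cg; auto. unfold Rmin, Rmax in Hz. destruct (Rle_dec u u'); split_Rabs; lra.
    - intros z Hz. assert (Bz : Rabs z <= b) by (unfold Rmin, Rmax in Hz; destruct (Rle_dec u u'); split_Rabs; lra).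
      assert (A := Hclose z Bz). assert (B := HM z ltac:(split_Rabs; lra)).
      unfold norm in B; simpl in B; unfold abs in B; simpl in B.
      assert (Cc := Rmin_l 1 (e / (2 * b + 2))). split_Rabs; lra. }
  assert (F2 : Rabs (RInt (fun s => g s v' - g s v) 0 u) <= (e / (2 * b + 2)) * Rabs (u - 0)).
  { apply RInt_abs_le.
    - intros z Hz. destruct (between_abs u r z Hu Hz).
      apply (@continuous_minus R_UniformSpace R_AbsRing R_NormedModule); apply Cg; auto; lra.
    - intros z Hz. destruct (between_abs u r z Hu Hz).
      apply Rle_trans with (1 := Hclose z ltac:(lra)). apply Rmin_r. }
  rewrite Rminus_0_r in F2.
  assert (F3 : (M + 1) * Rabs (u' - u) < (M + 1) * (e / (2 * (M + 1)))) by (apply Rmult_lt_compat_l; lra).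
  replace ((M + 1) * (e / (2 * (M + 1)))) with (e / 2) in F3 by (field; lra).
  assert (F4 : e / (2 * b + 2) * Rabs u <= e / (2 * b + 2) * (b + 1)).
  { apply Rmult_le_compat_l; [|lra]. left; apply Rdiv_lt_0_compat; lra. }
  replace (e / (2 * b + 2) * (b + 1)) with (e / 2) in F4 by (field; lra).
  eapply Rle_lt_trans; [apply Rabs_triang|]. lra.
Qed.

(** The fundamental theorem in [u] and differentiation under the integral in [v]. Integration in [u]
    gains the derivative in [u], which is how [nu] becomes $C^1$ from its right-hand side [E]. *)
Lemma C1_square_RInt (r : R) (g gv : R -> R -> R) :
  (forall u v, square r u v -> is_derive (fun s => g u s) v (gv u v)) ->
  (forall u v, square r u v -> continuity_2d_pt g u v) ->
  (forall u v, square r u v -> continuity_2d_pt gv u v) ->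
  C1_square r (fun u v => RInt (fun s => g s v) 0 u) g
    (fun u v => RInt (fun s => gv s v) 0 u).
Proof.
  intros Hd Hg Hgv u v Huv. split; [|split; [|split]].
  - apply (RInt_interval_derive (fun s => g s v) r).
    + intros x Hx. apply (continuity_2d_section g x v), Hg. split; [auto|apply Huv].
    + apply Huv.
  - destruct Huv as [Hu Hv].
    assert (E : RInt (fun s => gv s v) 0 u = RInt (fun s => Derive (fun y => g s y) v) 0 u).
    { apply RInt_ext. intros x Hx. symmetry. apply is_derive_unique, Hd.
      split; auto. apply (between_abs u r x); auto. lra. }
    rewrite E. apply (is_derive_RInt_param (fun v s => g s v)).
    + assert (Hp : 0 < r - Rabs v) by lra. exists (mkposreal _ Hp). intros y Hy t Ht.
      exists (gv t y). apply Hd. split. apply (between_abs u r t); auto.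
      unfold ball in Hy; simpl in Hy; unfold AbsRing_ball, abs, minus, plus, opp in Hy; simpl in Hy.
      split_Rabs; lra.
    + intros t Ht. destruct (between_abs u r t Hu Ht) as [Ht' _].
      apply continuity_2d_pt_ext_loc with (fun y s => gv s y).
      * destruct (square_locally r v t) as [d Hd']; [split; auto|]. exists d. intros v' t' A B.
        symmetry. apply is_derive_unique, Hd. apply square_swap, Hd'; auto.
      * apply (continuity_2d_swap gv v t). apply Hgv. split; auto.
    + assert (Hp : 0 < r - Rabs v) by lra. exists (mkposreal _ Hp). intros y Hy.
      apply @ex_RInt_continuous. intros z Hz. apply (continuity_2d_section g z y), Hg.
      split. apply (between_abs u r z); auto.
      unfold ball in Hy; simpl in Hy; unfold AbsRing_ball, abs, minus, plus, opp in Hy; simpl in Hy.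
      split_Rabs; lra.
  - apply Hg; auto.
  - apply RInt_left_continuous with r; auto.
Qed.

(** Closedness of $A\,du+B\,dv$ is expressed by the shared function [C], which is both $A_v$ and
    $B_u$. The potential integrates along the axis $u=0$ and then in the direction of [u]. *)
Lemma closed_form_potential (r : R) (A Au B Bv C : R -> R -> R) :
  0 < r -> C1_square r A Au C -> C1_square r B C Bv ->
  exists f, C1_square r f A B /\ f 0 0 = 0.
Proof.
  intros Hr HA HB.
  assert (CA := C1_square_continuous _ _ _ _ HA). assert (CB := C1_square_continuous _ _ _ _ HB).
  assert (Z : Rabs 0 < r) by (rewrite Rabs_R0; auto).
  exists (fun u v => RInt (fun s => B 0 s) 0 v + RInt (fun s => A s v) 0 u). split.
  2:{ rewrite !RInt_point. unfold zero; simpl; ring. }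
  assert (HI := C1_square_RInt r A C (fun u v H => proj1 (proj2 (HA u v H))) CA
     (fun u v H => proj2 (proj2 (proj2 (HA u v H))))).
  intros u v Huv. destruct (HI u v Huv) as [I1 [I2 [I3 I4]]]. destruct Huv as [Hu Hv].
  split; [|split; [|split]].
  - apply is_derive_const_plus. exact I1.
  - replace (B u v) with (B 0 v + RInt (fun s => C s v) 0 u).
    + apply @is_derive_plus; [|exact I2].
      apply (RInt_interval_derive (fun s => B 0 s) r); auto.
      intros x Hx. apply (continuity_2d_section B 0 x), CB. split; auto.
    + rewrite (is_RInt_unique (fun s => C s v) 0 u (B u v - B 0 v)); [ring|].
      apply (@is_RInt_derive R_CompleteNormedModule (fun s => B s v) (fun s => C s v)).
      * intros x Hx. apply HB. split; auto. apply (between_abs u r x); auto.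
      * intros x Hx. apply (continuity_2d_section C x v). apply HB. split; auto. apply (between_abs u r x); auto.
  - apply CA; split; auto.
  - apply CB; split; auto.
Qed.

(** * Fixed points in weighted sup norms *)

Section WeightedFixpoint.

Variables (I : Type) (dom : I -> Prop) (w : I -> R) (F : (I -> R) -> I -> R)
  (S : (I -> R) -> Prop) (X0 : I -> R) (k : R).

(** Indexing by [I] lets functions of different arity share one sup norm. A weight may vanish at
    some index, which pins the value there. *)
Definition weighted_ball (X : I -> R) : Prop :=
  forall i, dom i -> Rabs (X i - X0 i) <= w i.

Hypothesis k_range : 0 <= k < 1.
Hypothesis w_nonneg : forall i, dom i -> 0 <= w i.
Hypothesis S_start : S X0.
Hypothesis S_step : forall X, S X -> weighted_ball X -> S (F X).
Hypothesis F_start : forall i, dom i -> Rabs (F X0 i - X0 i) <= (1 - k) * w i.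
Hypothesis F_contraction : forall X Y M, 0 <= M -> S X -> S Y ->
  weighted_ball X -> weighted_ball Y ->
  (forall i, dom i -> Rabs (X i - Y i) <= M * w i) ->
  forall i, dom i -> Rabs (F X i - F Y i) <= k * M * w i.
Hypothesis S_closed : forall (Xn : nat -> I -> R) X,
  (forall n, S (Xn n)) ->
  (forall e, 0 < e -> exists n, forall i, dom i -> Rabs (Xn n i - X i) <= e * w i) ->
  S X.

Let x (n : nat) : I -> R := Nat.iter n F X0.

(** The last bound keeps all iterates in the ball, where the contraction estimate holds: the first
    step costs [(1 - k) * w], and the geometric sum of the steps never exceeds [w]. *)
Lemma iterate_invariant (n : nat) :
  S (x n) /\ weighted_ball (x n) /\
  (forall i, dom i -> Rabs (x (Datatypes.S n) i - x n i) <= k ^ n * (1 - k) * w i) /\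
  (forall i, dom i -> Rabs (x n i - X0 i) <= (1 - k ^ n) * w i).
Proof.
  assert (kn : forall m, 0 <= k ^ m) by (intros; apply pow_le; lra).
  assert (ball0 : weighted_ball X0).
  { intros i Hi. rewrite Rminus_diag, Rabs_R0. auto. }
  assert (Hb : forall n, (forall i, dom i -> Rabs (x n i - X0 i) <= (1 - k ^ n) * w i) ->
     weighted_ball (x n)).
  { intros m H i Hi. apply Rle_trans with (1 := H i Hi).
    specialize (kn m). specialize (w_nonneg i Hi).
    assert (0 <= k ^ m * w i) by (apply Rmult_le_pos; auto). lra. }
  induction n as [|n [IS [IB [IC ID]]]].
  - split; [exact S_start|]. split; [exact ball0|]. split.
    + intros i Hi. simpl. rewrite Rmult_1_l. apply F_start; auto.
    + intros i Hi. simpl. rewrite Rminus_diag, Rabs_R0. lra.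
  - assert (D : forall i, dom i -> Rabs (x (Datatypes.S n) i - X0 i) <= (1 - k ^ Datatypes.S n) * w i).
    { intros i Hi. replace (x (Datatypes.S n) i - X0 i)
        with ((x (Datatypes.S n) i - x n i) + (x n i - X0 i)) by ring.
      eapply Rle_trans; [apply Rabs_triang|]. specialize (IC i Hi). specialize (ID i Hi).
      change (k ^ Datatypes.S n) with (k * k ^ n). lra. }
    split; [apply S_step; auto|]. split; [apply Hb, D|]. split; [|exact D].
    intros i Hi. simpl.
    replace (k * k ^ n * (1 - k) * w i) with (k * (k ^ n * (1 - k)) * w i) by ring.
    apply (F_contraction (x (Datatypes.S n)) (x n)); auto.
    + apply Rmult_le_pos; [auto|lra].
    + apply (S_step (x n)); auto.
Qed.

Lemma iterate_cauchy (i : I) (n m : nat) :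
  dom i -> Rabs (x (n + m) i - x n i) <= k ^ n * (1 - k ^ m) * w i.
Proof.
  intros Hi. induction m as [|m IH].
  - rewrite Nat.add_0_r, Rminus_diag, Rabs_R0. simpl. lra.
  - rewrite Nat.add_succ_r.
    replace (x (Datatypes.S (n + m)) i - x n i)
      with ((x (Datatypes.S (n + m)) i - x (n + m) i) + (x (n + m) i - x n i)) by ring.
    eapply Rle_trans; [apply Rabs_triang|].
    destruct (iterate_invariant (n + m)) as [_ [_ [A _]]]. specialize (A i Hi).
    rewrite pow_add in A. change (k ^ Datatypes.S m) with (k * k ^ m). lra.
Qed.

Let X (i : I) : R := real (Lim_seq (fun n => x n i)).

Lemma iterate_limit (i : I) (n : nat) : dom i -> Rabs (x n i - X i) <= k ^ n * w i.
Proof.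
  intros Hi.
  assert (Hc : forall n m, Rabs (x (n + m) i - x n i) <= k ^ n * w i).
  { intros n' m. apply Rle_trans with (1 := iterate_cauchy i n' m Hi).
    assert (0 <= k ^ n') by (apply pow_le; lra). assert (0 <= k ^ m) by (apply pow_le; lra).
    specialize (w_nonneg i Hi).
    assert (0 <= (k ^ n' * k ^ m) * w i) by (repeat apply Rmult_le_pos; auto). lra. }
  assert (Hl : is_lim_seq (fun n => x n i) (X i)).
  { apply Lim_seq_correct', ex_lim_seq_cauchy_corr.
    (* The denominator uses [w i + 1] because the weight may be zero. *)
    intros e. assert (Hq : 0 < e / (2 * (w i + 1))).
    { apply Rdiv_lt_0_compat; [apply cond_pos|]. specialize (w_nonneg i Hi). lra. }
    destruct (pow_lt_1_zero k ltac:(rewrite Rabs_pos_eq; lra) _ Hq) as [N HN].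
    exists N.
    assert (HH : forall n, (n >= N)%nat -> Rabs (x n i - x N i) < e / 2).
    { intros n' Hn'. replace n' with (N + (n' - N))%nat by lia.
      apply Rle_lt_trans with (1 := Hc N (n' - N)%nat).
      specialize (HN N (le_n N)). rewrite Rabs_pos_eq in HN by (apply pow_le; lra).
      specialize (w_nonneg i Hi).
      assert (0 <= k ^ N) by (apply pow_le; lra).
      apply Rle_lt_trans with (k ^ N * (w i + 1)).
      { apply Rmult_le_compat_l; lra. }
      apply Rlt_le_trans with (e / (2 * (w i + 1)) * (w i + 1)).
      { apply Rmult_lt_compat_r; lra. } right; field; lra. }
    intros p q Hp Hq'. assert (A := HH p Hp). assert (B := HH q Hq'). split_Rabs; lra. }
  assert (Hl2 : is_lim_seq (fun m => Rabs (x n i - x (m + n)%nat i)) (Rabs (x n i - X i))).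
  { apply (is_lim_seq_abs _ (Finite (x n i - X i))).
    apply (is_lim_seq_minus _ _ (Finite (x n i)) (Finite (X i))).
    - apply is_lim_seq_const.
    - apply -> (is_lim_seq_incr_n (fun n => x n i) n). exact Hl.
    - reflexivity. }
  apply (is_lim_seq_le _ _ (Finite _) (Finite (k ^ n * w i)) ) with (2 := Hl2) (3 := is_lim_seq_const _).
  intros m. rewrite Rabs_minus_sym, Nat.add_comm. apply Hc.
Qed.

(** The contraction principle without a function space: limits are taken pointwise, the rate
    [k ^ n * w] makes the convergence uniform relative to the weight, and [S_closed] carries the
    regularity over to the limit. *)
Lemma weighted_fixpoint :
  exists X, S X /\ weighted_ball X /\ forall i, dom i -> F X i = X i.
Proof.
  exists X.
  assert (kn : forall e, 0 < e -> exists n, k ^ n < e).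
  { intros e He. destruct (pow_lt_1_zero k ltac:(rewrite Rabs_pos_eq; lra) e He) as [N HN].
    exists N. specialize (HN N (le_n N)). rewrite Rabs_pos_eq in HN by (apply pow_le; lra). exact HN. }
  assert (SX : S X).
  { apply (S_closed x); [intros; apply iterate_invariant|].
    intros e He. destruct (kn e He) as [n Hn]. exists n. intros i Hi.
    apply Rle_trans with (1 := iterate_limit i n Hi).
    apply Rmult_le_compat_r; [auto|lra]. }
  assert (BX : weighted_ball X).
  { intros i Hi. generalize (iterate_limit i 0 Hi). simpl. rewrite Rmult_1_l, Rabs_minus_sym. auto. }
  split; [exact SX|]. split; [exact BX|].
  intros i Hi. destruct (Req_dec (F X i) (X i)) as [|Hne]; [assumption|exfalso].
  assert (Hg : 0 < Rabs (F X i - X i)) by (apply Rabs_pos_lt; lra).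
  specialize (w_nonneg i Hi) as Hw.
  destruct (kn (Rabs (F X i - X i) / (2 * (w i + 1)))) as [n Hn].
  { apply Rdiv_lt_0_compat; lra. }
  destruct (iterate_invariant n) as [Sn [Bn _]].
  assert (A : Rabs (F (x n) i - F X i) <= k * k ^ n * w i).
  { apply F_contraction; auto. apply pow_le; lra. intros j Hj. apply iterate_limit; auto. }
  assert (A2 := iterate_limit i (Datatypes.S n) Hi). simpl in A2. fold (x n) in A2.
  assert (0 <= k ^ n) by (apply pow_le; lra).
  assert (k * k ^ n * w i <= k ^ n * (w i + 1)).
  { rewrite Rmult_assoc. rewrite <- (Rmult_1_l (k ^ n * (w i + 1))).
    apply Rmult_le_compat; try lra; try (apply Rmult_le_pos; lra); apply Rmult_le_compat_l; lra. }
  assert (k ^ n * (w i + 1) < Rabs (F X i - X i) / 2).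
  { apply Rlt_le_trans with (Rabs (F X i - X i) / (2 * (w i + 1)) * (w i + 1)).
    apply Rmult_lt_compat_r; lra. right; field; lra. }
  change (F (Nat.iter n F X0) i) with (F (x n) i) in A2. split_Rabs; lra.
Qed.

End WeightedFixpoint.

(** * The iteration on the shock and in the interior *)

Lemma mult_diff_bound (x x' y y' X Y dx dy : R) :
  Rabs x <= X -> Rabs y' <= Y -> Rabs (x - x') <= dx -> Rabs (y - y') <= dy ->
  Rabs (x * y - x' * y') <= X * dy + dx * Y.
Proof.
  intros H1 H2 H3 H4. replace (x * y - x' * y') with (x * (y - y') + (x - x') * y') by ring.
  eapply Rle_trans; [apply Rabs_triang|]. rewrite !Rabs_mult.
  apply Rplus_le_compat; apply Rmult_le_compat; auto using Rabs_pos.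
Qed.

Lemma mult_bound (x y X Y : R) : Rabs x <= X -> Rabs y <= Y -> Rabs (x * y) <= X * Y.
Proof. intros. rewrite Rabs_mult. apply Rmult_le_compat; auto using Rabs_pos. Qed.

Lemma plus_bound (x y X Y : R) : Rabs x <= X -> Rabs y <= Y -> Rabs (x + y) <= X + Y.
Proof. intros. eapply Rle_trans; [apply Rabs_triang|]. lra. Qed.

(** A point of the shock together with the invariants behind it, $(\alpha_+,\beta_+,t,x)$, with the
    $\ell^1$ norm; tangent vectors have the same type. *)
Definition q4 : Type := (R * R * R * R)%type.
Definition q4_norm (h : q4) : R :=
  let '(h1, h2, h3, h4) := h in Rabs h1 + Rabs h2 + Rabs h3 + Rabs h4.
Definition q4_dist (y z : q4) : R :=
  let '(y1, y2, y3, y4) := y in let '(z1, z2, z3, z4) := z in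
  Rabs (y1 - z1) + Rabs (y2 - z2) + Rabs (y3 - z3) + Rabs (y4 - z4).

Lemma q4_dist_nonneg (y z : q4) : 0 <= q4_dist y z.
Proof. destruct y as [[[? ?] ?] ?], z as [[[? ?] ?] ?]. simpl. repeat apply Rplus_le_le_0_compat; apply Rabs_pos. Qed.

Lemma q4_norm_nonneg (y : q4) : 0 <= q4_norm y.
Proof. destruct y as [[[? ?] ?] ?]. simpl. repeat apply Rplus_le_le_0_compat; apply Rabs_pos. Qed.

(** [C] will be a closed cone with apex at the origin of the shock and [Co] its
    part without the apex: at the apex the state ahead of the shock is only
    known to be Lipschitz, so that the chain rule is required on [Co] only. *)
Record C11 (C Co : q4 -> Prop) (B : R) (f : q4 -> R) (Df : q4 -> q4 -> R) : Prop := {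
  C11_bound : forall z, C z -> Rabs (f z) <= B;
  C11_lip : forall z z', C z -> C z' -> Rabs (f z - f z') <= B * q4_dist z z';
  C11_dbound : forall z h, C z -> Rabs (Df z h) <= B * q4_norm h;
  C11_dlip : forall z z' h h', C z -> C z' ->
    Rabs (Df z h - Df z' h') <= B * (q4_dist z z' * q4_norm h + q4_dist h h');
  C11_chain : forall (x1 x2 x3 x4 : R -> R) s h1 h2 h3 h4,
    is_derive x1 s h1 -> is_derive x2 s h2 -> is_derive x3 s h3 -> is_derive x4 s h4 ->
    Co (x1 s, x2 s, x3 s, x4 s) ->
    is_derive (fun s => f (x1 s, x2 s, x3 s, x4 s)) s (Df (x1 s, x2 s, x3 s, x4 s) (h1, h2, h3, h4))
}.

(** The components [b, th, be, tp, xp, nu, E, N] of an iterate; the functions of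
    one variable are read off at [u = 0]. *)
Inductive component := Cb | Cth | Cbe | Ctp | Cxp | Cnu | CE | CN.
Definition state : Type := component * R * R -> R.

(** The problem on the shock [u = a v], with [q v = (be (a v), be v, tp v, xp v)]:
    [tp' = (a + g q) nu (v, a v)], [xp' = Q q nu (v, a v)], [nu (a v, v) = g q nu (v, a v)],
    [th v = P q th (a v) + S q nu (v, a v)], where [be' = th], coupled with the hodograph
    equation [nu_u = E u v = - r (be u + be v) (th v nu (v, u) + th u nu (u, v))]. *)
Section ShockIteration.

Variables (a kappa B delta be0 th0 nu0 : R) (C Co : q4 -> Prop)
  (P S g Q : q4 -> R) (DP DS Dg DQ : q4 -> q4 -> R) (r r' : R -> R).

Hypothesis a_range : 0 < a < 1.
Hypothesis kappa_range : 0 <= kappa < 1.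
Hypothesis delta_pos : 0 < delta.
Hypothesis HP : C11 C Co B P DP.
Hypothesis HS : C11 C Co B S DS.
Hypothesis Hg : C11 C Co B g Dg.
Hypothesis HQ : C11 C Co B Q DQ.
Hypothesis P_small : forall z, C z -> a * Rabs (P z) <= kappa.
Hypothesis g_small : forall z, C z -> a * Rabs (g z) <= kappa.
Hypothesis r_bound : forall s, Rabs (s - 2 * be0) <= 2 * delta ->
  Rabs (r s) <= B /\ Rabs (r' s) <= B /\ is_derive r s (r' s).
Hypothesis r_lip : forall s s', Rabs (s - 2 * be0) <= 2 * delta ->
  Rabs (s' - 2 * be0) <= 2 * delta ->
  Rabs (r s - r s') <= B * Rabs (s - s') /\ Rabs (r' s - r' s') <= B * Rabs (s - s').

Let q0 : q4 := (be0, be0, 0, 0).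
(** With [g = 1] at the origin, [tau0] and [xi0] are the initial velocities $t_+'(0)$ and $x_+'(0)$
    of the shock point. *)
Let tau0 : R := (1 + a) * nu0.
Let xi0 : R := Q q0 * nu0.

Hypothesis C_cone : forall v al be t x, 0 <= v <= delta ->
  Rabs (al - be0) <= delta -> Rabs (be - be0) <= delta ->
  Rabs (t - tau0 * v) <= delta * v -> Rabs (x - xi0 * v) <= delta * v ->
  C (al, be, t, x) /\ (0 < v -> Co (al, be, t, x)).
Hypothesis g_origin : g q0 = 1.
Hypothesis th_origin : th0 = P q0 * th0 + S q0 * nu0.

Lemma q0_C : C q0.
Proof.
  apply (C_cone 0 be0 be0 0 0); rewrite ?Rminus_diag, ?Rmult_0_r, ?Rminus_0_r, ?Rabs_R0; lra.
Qed.

Lemma B_ge_1 : 1 <= B.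
Proof. generalize (C11_bound _ _ _ _ _ Hg q0 q0_C). rewrite g_origin, Rabs_R1. auto. Qed.

(** The velocity of the shock point along the shock, where $t_+'$ and $x_+'$ have been replaced by
    the right-hand sides of their equations. *)
Definition q_dot (q : q4) (tha th nu : R) : q4 :=
  (a * tha, th, (a + g q) * nu, Q q * nu).
(** Derivatives along the shock of [P q * th (a v) + S q * nu (v, a v)] and
    of [g q * nu (v, a v)]; [ba = th' (a v)] and [n1 = d/dv nu (v, a v)]. *)
Definition th_rate (q : q4) (tha th nu ba n1 : R) : R :=
  P q * (a * ba) + S q * n1
  + (tha * DP q (q_dot q tha th nu) + nu * DS q (q_dot q tha th nu)).
Definition nu_rate (q : q4) (tha th nu n1 : R) : R :=
  g q * n1 + nu * Dg q (q_dot q tha th nu).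
(** Pointwise form of the hodograph right-hand side. In its [v]-derivative [hodo_v], differentiating
    [nu (v, u)] produces [E (v, u)], and differentiating [nu (u, v)] produces [N (u, v)]. *)
Definition hodo (bu bv tu tv nuv nvu : R) : R :=
  - (r (bu + bv) * (tv * nvu + tu * nuv)).
Definition hodo_v (bu bv tu tv nuv nvu bbv Evu Nuv : R) : R :=
  - (r' (bu + bv) * tv * (tv * nvu + tu * nuv)
     + r (bu + bv) * (bbv * nvu + tv * Evu + tu * Nuv)).

(** * Bounds for the differentiated equations *)

Section Weights.

Variables (A T : R).
Hypothesis A_pos : 0 <= A <= T.

(** [A] bounds [th] and [nu], while [T] also bounds the highest derivatives. The constants that
    depend on [T], namely [kC2], [kK3] and [kC4], will occur only with a factor [lam] or [eps];
    otherwise the choice of the weights would be circular, since [T] contains them. *)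
Definition kN1 : R := (3 + 2 * B) * A.
Definition kK1 : R := A * (B * kN1).
Definition kC1 : R := B * kN1 + A * (B * (4 * kN1 + (3 + 2 * B + 8 * B * A))).
Definition kC2 : R := 8 * B * T + 2 * kC1.
Definition kC3 : R := 4 * B * A * A + 4 * B * A.
Definition kK3 : R := 2 * B * T * T * T + 3 * B * T * T.
Definition kC4 : R := B * (4 * T * T * T + 12 * T * T + 6 * T).

Lemma q_dot_norm (q : q4) (tha th nu : R) :
  C q -> Rabs tha <= A -> Rabs th <= A -> Rabs nu <= A ->
  q4_norm (q_dot q tha th nu) <= kN1.
Proof.
  intros Cq H1 H2 H3. assert (B1 := B_ge_1). unfold q_dot, q4_norm, kN1.
  assert (E1 : Rabs (a * tha) <= 1 * A) by (apply mult_bound; auto; rewrite Rabs_pos_eq; lra).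
  assert (E3 : Rabs ((a + g q) * nu) <= (1 + B) * A).
  { apply mult_bound; auto. apply plus_bound; [rewrite Rabs_pos_eq; lra|apply (C11_bound _ _ _ _ _ Hg); auto]. }
  assert (E4 : Rabs (Q q * nu) <= B * A) by (apply mult_bound; auto; apply (C11_bound _ _ _ _ _ HQ); auto).
  lra.
Qed.

Lemma q_dot_dist (q q' : q4) (tha th nu tha' th' nu' e : R) :
  C q -> C q' -> Rabs nu <= A -> Rabs nu' <= A -> q4_dist q q' <= 4 * e ->
  Rabs (tha - tha') <= e -> Rabs (th - th') <= e -> Rabs (nu - nu') <= e ->
  q4_dist (q_dot q tha th nu) (q_dot q' tha' th' nu') <= (3 + 2 * B + 8 * B * A) * e.
Proof.
  intros Cq Cq' Hn Hn' Hq H1 H2 H3. assert (B1 := B_ge_1).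
  assert (Hd : B * q4_dist q q' <= B * (4 * e)) by (apply Rmult_le_compat_l; lra).
  unfold q_dot, q4_dist at 1.
  assert (E1 : Rabs (a * tha - a * tha') <= e).
  { replace (a * tha - a * tha') with (a * (tha - tha')) by ring.
    rewrite Rabs_mult, (Rabs_pos_eq a) by lra.
    apply Rle_trans with (1 * Rabs (tha - tha')); [apply Rmult_le_compat_r; [apply Rabs_pos|lra]|lra]. }
  assert (E3 : Rabs ((a + g q) * nu - (a + g q') * nu') <= (1 + B) * e + (B * (4 * e)) * A).
  { apply mult_diff_bound; auto.
    - apply plus_bound; [rewrite Rabs_pos_eq; lra|apply (C11_bound _ _ _ _ _ Hg); auto].
    - replace (a + g q - (a + g q')) with (g q - g q') by ring.
      eapply Rle_trans; [apply (C11_lip _ _ _ _ _ Hg); auto|auto]. }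
  assert (E4 : Rabs (Q q * nu - Q q' * nu') <= B * e + (B * (4 * e)) * A).
  { apply mult_diff_bound; auto.
    - apply (C11_bound _ _ _ _ _ HQ); auto.
    - eapply Rle_trans; [apply (C11_lip _ _ _ _ _ HQ); auto|auto]. }
  lra.
Qed.

Lemma dterm_bound (f : q4 -> R) (Df : q4 -> q4 -> R) (q : q4) (y tha th nu : R) :
  C11 C Co B f Df -> C q -> Rabs y <= A -> Rabs tha <= A -> Rabs th <= A -> Rabs nu <= A ->
  Rabs (y * Df q (q_dot q tha th nu)) <= kK1.
Proof.
  intros Hf Cq H0 H1 H2 H3. assert (B1 := B_ge_1). apply mult_bound; auto.
  eapply Rle_trans; [apply (C11_dbound _ _ _ _ _ Hf); auto|].
  apply Rmult_le_compat_l; [lra|]. apply q_dot_norm; auto.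
Qed.

Lemma dterm_lip (f : q4 -> R) (Df : q4 -> q4 -> R) (q q' : q4) (y y' tha th nu tha' th' nu' e : R) :
  C11 C Co B f Df -> C q -> C q' ->
  Rabs y <= A -> Rabs tha <= A -> Rabs th <= A -> Rabs nu <= A ->
  Rabs y' <= A -> Rabs tha' <= A -> Rabs th' <= A -> Rabs nu' <= A ->
  q4_dist q q' <= 4 * e -> Rabs (y - y') <= e ->
  Rabs (tha - tha') <= e -> Rabs (th - th') <= e -> Rabs (nu - nu') <= e ->
  Rabs (y * Df q (q_dot q tha th nu) - y' * Df q' (q_dot q' tha' th' nu')) <= kC1 * e.
Proof.
  intros Hf Cq Cq' H0 H1 H2 H3 H0' H1' H2' H3' Hq D0 D1 D2 D3. assert (B1 := B_ge_1).
  assert (He : 0 <= e) by (generalize (Rabs_pos (y - y')); lra).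
  assert (HN : 0 <= q4_norm (q_dot q tha th nu) <= kN1) by (split; [apply q4_norm_nonneg|apply q_dot_norm; auto]).
  eapply Rle_trans.
  - apply (mult_diff_bound y y' _ _ A (B * kN1) e (B * (4 * e * kN1 + (3 + 2 * B + 8 * B * A) * e))); auto.
    + eapply Rle_trans; [apply (C11_dbound _ _ _ _ _ Hf); auto|].
      apply Rmult_le_compat_l; [lra|]. apply q_dot_norm; auto.
    + eapply Rle_trans; [apply (C11_dlip _ _ _ _ _ Hf); auto|].
      apply Rmult_le_compat_l; [lra|]. apply Rplus_le_compat.
      * apply Rmult_le_compat; auto; try lra. apply q4_dist_nonneg.
      * apply q_dot_dist; auto.
  - unfold kC1. right; ring.
Qed.

Lemma th_rate_bound (q : q4) (tha th nu ba n1 : R) :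
  C q -> Rabs tha <= A -> Rabs th <= A -> Rabs nu <= A ->
  Rabs (th_rate q tha th nu ba n1) <= kappa * Rabs ba + B * Rabs n1 + 2 * kK1.
Proof.
  intros Cq H1 H2 H3. unfold th_rate.
  assert (E1 : Rabs (P q * (a * ba)) <= kappa * Rabs ba).
  { rewrite !Rabs_mult, (Rabs_pos_eq a) by lra. replace (Rabs (P q) * (a * Rabs ba)) with (a * Rabs (P q) * Rabs ba) by ring.
    apply Rmult_le_compat_r; [apply Rabs_pos|auto]. }
  assert (E2 : Rabs (S q * n1) <= B * Rabs n1) by (apply mult_bound; [apply (C11_bound _ _ _ _ _ HS); auto|lra]).
  assert (E3 := dterm_bound P DP q tha tha th nu HP Cq H1 H1 H2 H3).
  assert (E4 := dterm_bound S DS q nu tha th nu HS Cq H3 H1 H2 H3).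
  apply Rle_trans with (kappa * Rabs ba + B * Rabs n1 + (kK1 + kK1)); [|lra].
  repeat apply plus_bound; auto.
Qed.

Lemma nu_rate_bound (q : q4) (tha th nu n1 : R) :
  C q -> Rabs tha <= A -> Rabs th <= A -> Rabs nu <= A ->
  Rabs (nu_rate q tha th nu n1) <= B * Rabs n1 + kK1.
Proof.
  intros Cq H1 H2 H3. unfold nu_rate. apply plus_bound.
  - apply mult_bound; [apply (C11_bound _ _ _ _ _ Hg); auto|lra].
  - apply (dterm_bound g Dg); auto.
Qed.

(** The highest derivatives enter linearly. The difference of [ba] carries the coefficient [a * P],
    bounded by [kappa], and everything else is of the order of [e] or of the difference of [n1]. *)
Lemma th_rate_lip (q q' : q4) (tha th nu ba n1 tha' th' nu' ba' n1' e : R) :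
  C q -> C q' ->
  Rabs tha <= A -> Rabs th <= A -> Rabs nu <= A ->
  Rabs tha' <= A -> Rabs th' <= A -> Rabs nu' <= A -> Rabs ba' <= T -> Rabs n1' <= T ->
  q4_dist q q' <= 4 * e ->
  Rabs (tha - tha') <= e -> Rabs (th - th') <= e -> Rabs (nu - nu') <= e ->
  Rabs (th_rate q tha th nu ba n1 - th_rate q' tha' th' nu' ba' n1')
    <= kappa * Rabs (ba - ba') + B * Rabs (n1 - n1') + kC2 * e.
Proof.
  intros Cq Cq' H1 H2 H3 H1' H2' H3' Hb Hn Hq D1 D2 D3. assert (B1 := B_ge_1).
  assert (He : 0 <= e) by (generalize (Rabs_pos (th - th')); lra).
  unfold th_rate.
  assert (Hd : B * q4_dist q q' <= B * (4 * e)) by (apply Rmult_le_compat_l; lra).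
  assert (E1 : Rabs (P q * (a * ba) - P q' * (a * ba')) <= kappa * Rabs (ba - ba') + B * (4 * e) * T).
  { replace (P q * (a * ba) - P q' * (a * ba')) with (P q * (a * (ba - ba')) + (P q - P q') * (a * ba')) by ring.
    apply plus_bound.
    - rewrite !Rabs_mult, (Rabs_pos_eq a) by lra. replace (Rabs (P q) * (a * Rabs (ba - ba'))) with (a * Rabs (P q) * Rabs (ba - ba')) by ring.
      apply Rmult_le_compat_r; [apply Rabs_pos|auto].
    - apply mult_bound. eapply Rle_trans; [apply (C11_lip _ _ _ _ _ HP); auto|auto].
      rewrite Rabs_mult, (Rabs_pos_eq a) by lra.
      apply Rle_trans with (1 * Rabs ba'); [apply Rmult_le_compat_r; [apply Rabs_pos|lra]|lra]. }
  assert (E2 : Rabs (S q * n1 - S q' * n1') <= B * Rabs (n1 - n1') + B * (4 * e) * T).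
  { apply mult_diff_bound; auto; try lra. apply (C11_bound _ _ _ _ _ HS); auto.
    eapply Rle_trans; [apply (C11_lip _ _ _ _ _ HS); auto|auto]. }
  assert (E3 := dterm_lip P DP q q' tha tha' tha th nu tha' th' nu' e HP Cq Cq' H1 H1 H2 H3 H1' H1' H2' H3' Hq D1 D1 D2 D3).
  assert (E4 := dterm_lip S DS q q' nu nu' tha th nu tha' th' nu' e HS Cq Cq' H3 H1 H2 H3 H3' H1' H2' H3' Hq D3 D1 D2 D3).
  unfold kC2. match goal with |- Rabs (?x1 + ?x2 + (?x3 + ?x4) - (?y1 + ?y2 + (?y3 + ?y4))) <= _ =>
    replace (x1 + x2 + (x3 + x4) - (y1 + y2 + (y3 + y4))) with ((x1 - y1) + (x2 - y2) + ((x3 - y3) + (x4 - y4))) by ring end.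
  eapply Rle_trans; [apply plus_bound; apply plus_bound; eassumption|]. right; ring.
Qed.

(** The factor [Rabs (g q)] is kept instead of its bound [B]: the part of [n1] that matters contains
    [a * N], and only the product [a * Rabs (g q)] is below [kappa]. *)
Lemma nu_rate_lip (q q' : q4) (tha th nu n1 tha' th' nu' n1' e : R) :
  C q -> C q' ->
  Rabs tha <= A -> Rabs th <= A -> Rabs nu <= A ->
  Rabs tha' <= A -> Rabs th' <= A -> Rabs nu' <= A -> Rabs n1' <= T ->
  q4_dist q q' <= 4 * e ->
  Rabs (tha - tha') <= e -> Rabs (th - th') <= e -> Rabs (nu - nu') <= e ->
  Rabs (nu_rate q tha th nu n1 - nu_rate q' tha' th' nu' n1')
    <= Rabs (g q) * Rabs (n1 - n1') + kC2 * e.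
Proof.
  intros Cq Cq' H1 H2 H3 H1' H2' H3' Hn Hq D1 D2 D3. assert (B1 := B_ge_1).
  assert (He : 0 <= e) by (generalize (Rabs_pos (th - th')); lra).
  assert (Hd : B * q4_dist q q' <= B * (4 * e)) by (apply Rmult_le_compat_l; lra).
  assert (E2 : Rabs (g q * n1 - g q' * n1') <= Rabs (g q) * Rabs (n1 - n1') + B * (4 * e) * T).
  { apply mult_diff_bound; auto; try lra.
    eapply Rle_trans; [apply (C11_lip _ _ _ _ _ Hg); auto|auto]. }
  assert (E4 := dterm_lip g Dg q q' nu nu' tha th nu tha' th' nu' e Hg Cq Cq' H3 H1 H2 H3 H3' H1' H2' H3' Hq D3 D1 D2 D3).
  unfold nu_rate, kC2.
  assert (HC1 : 0 <= kC1).
  { assert (0 <= B * A) by (apply Rmult_le_pos; lra).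
    assert (HN : 0 <= kN1) by (unfold kN1; apply Rmult_le_pos; lra).
    unfold kC1. apply Rplus_le_le_0_compat; apply Rmult_le_pos; try lra.
    apply Rmult_le_pos; lra. }
  assert (0 <= kC1 * e) by (apply Rmult_le_pos; lra).
  assert (0 <= B * e * T) by (repeat apply Rmult_le_pos; lra).
  match goal with |- Rabs (?x1 + ?x2 - (?y1 + ?y2)) <= _ =>
    replace (x1 + x2 - (y1 + y2)) with ((x1 - y1) + (x2 - y2)) by ring end.
  eapply Rle_trans; [apply plus_bound; eassumption|]. lra.
Qed.

Definition near_be0 (x : R) : Prop := Rabs (x - be0) <= delta.

Lemma near_be0_sum (x y : R) : near_be0 x -> near_be0 y -> Rabs (x + y - 2 * be0) <= 2 * delta.
Proof. unfold near_be0. intros. split_Rabs; lra. Qed.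

Lemma hodo_bound (bu bv tu tv nuv nvu : R) :
  near_be0 bu -> near_be0 bv -> Rabs tu <= A -> Rabs tv <= A -> Rabs nuv <= A -> Rabs nvu <= A ->
  Rabs (hodo bu bv tu tv nuv nvu) <= B * (2 * A * A).
Proof.
  intros. unfold hodo. rewrite Rabs_Ropp. apply mult_bound.
  - apply r_bound, near_be0_sum; auto.
  - replace (2 * A * A) with (A * A + A * A) by ring. apply plus_bound; apply mult_bound; auto.
Qed.

Lemma sum_diff_bound (x y x' y' e : R) :
  Rabs (x - x') <= e -> Rabs (y - y') <= e -> Rabs (x + y - (x' + y')) <= 2 * e.
Proof. intros. split_Rabs; lra. Qed.

Lemma hodo_lip (bu bv tu tv nuv nvu bu' bv' tu' tv' nuv' nvu' e : R) :
  near_be0 bu -> near_be0 bv -> Rabs tu <= A -> Rabs tv <= A -> Rabs nuv <= A -> Rabs nvu <= A ->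
  near_be0 bu' -> near_be0 bv' -> Rabs tu' <= A -> Rabs tv' <= A -> Rabs nuv' <= A -> Rabs nvu' <= A ->
  Rabs (bu - bu') <= e -> Rabs (bv - bv') <= e -> Rabs (tu - tu') <= e -> Rabs (tv - tv') <= e ->
  Rabs (nuv - nuv') <= e -> Rabs (nvu - nvu') <= e ->
  Rabs (hodo bu bv tu tv nuv nvu - hodo bu' bv' tu' tv' nuv' nvu') <= kC3 * e.
Proof.
  intros H1 H2 H3 H4 H5 H6 H1' H2' H3' H4' H5' H6' D1 D2 D3 D4 D5 D6. unfold hodo. assert (B1 := B_ge_1).
  replace (- (r (bu + bv) * (tv * nvu + tu * nuv)) - - (r (bu' + bv') * (tv' * nvu' + tu' * nuv')))
    with (- (r (bu + bv) * (tv * nvu + tu * nuv) - r (bu' + bv') * (tv' * nvu' + tu' * nuv'))) by ring.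
  rewrite Rabs_Ropp.
  eapply Rle_trans.
  - apply (mult_diff_bound _ _ _ _ B (A * A + A * A) (B * (2 * e)) ((A * e + e * A) + (A * e + e * A))).
    + apply r_bound, near_be0_sum; auto.
    + apply plus_bound; apply mult_bound; auto.
    + eapply Rle_trans; [apply r_lip; apply near_be0_sum; auto|]. apply Rmult_le_compat_l; [lra|].
      apply sum_diff_bound; auto.
    + replace (tv * nvu + tu * nuv - (tv' * nvu' + tu' * nuv')) with
        ((tv * nvu - tv' * nvu') + (tu * nuv - tu' * nuv')) by ring.
      apply plus_bound; apply mult_diff_bound; auto.
  - unfold kC3. right; ring.
Qed.

Lemma hodo_v_bound (bu bv tu tv nuv nvu bbv Evu Nuv : R) :
  near_be0 bu -> near_be0 bv -> Rabs tu <= T -> Rabs tv <= T -> Rabs nuv <= T -> Rabs nvu <= T ->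
  Rabs bbv <= T -> Rabs Evu <= T -> Rabs Nuv <= T ->
  Rabs (hodo_v bu bv tu tv nuv nvu bbv Evu Nuv) <= kK3.
Proof.
  intros. unfold hodo_v. rewrite Rabs_Ropp.
  apply Rle_trans with (B * T * (T * T + T * T) + B * (T * T + T * T + T * T)).
  - apply plus_bound; [apply mult_bound; [apply mult_bound|]|apply mult_bound]; auto.
    + apply r_bound, near_be0_sum; auto.
    + apply plus_bound; apply mult_bound; auto.
    + apply r_bound, near_be0_sum; auto.
    + repeat apply plus_bound; apply mult_bound; auto.
  - unfold kK3. right; ring.
Qed.

Lemma hodo_v_lip (bu bv tu tv nuv nvu bbv Evu Nuv bu' bv' tu' tv' nuv' nvu' bbv' Evu' Nuv' e : R) :
  near_be0 bu -> near_be0 bv -> Rabs tu <= T -> Rabs tv <= T -> Rabs nuv <= T -> Rabs nvu <= T ->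
  Rabs bbv <= T -> Rabs Evu <= T -> Rabs Nuv <= T ->
  near_be0 bu' -> near_be0 bv' -> Rabs tu' <= T -> Rabs tv' <= T -> Rabs nuv' <= T -> Rabs nvu' <= T ->
  Rabs bbv' <= T -> Rabs Evu' <= T -> Rabs Nuv' <= T ->
  Rabs (bu - bu') <= e -> Rabs (bv - bv') <= e -> Rabs (tu - tu') <= e -> Rabs (tv - tv') <= e ->
  Rabs (nuv - nuv') <= e -> Rabs (nvu - nvu') <= e ->
  Rabs (bbv - bbv') <= e -> Rabs (Evu - Evu') <= e -> Rabs (Nuv - Nuv') <= e ->
  Rabs (hodo_v bu bv tu tv nuv nvu bbv Evu Nuv - hodo_v bu' bv' tu' tv' nuv' nvu' bbv' Evu' Nuv') <= kC4 * e.
Proof.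
  intros H1 H2 H3 H4 H5 H6 H7 H8 H9 H1' H2' H3' H4' H5' H6' H7' H8' H9' D1 D2 D3 D4 D5 D6 D7 D8 D9.
  assert (B1 := B_ge_1). unfold hodo_v.
  match goal with |- Rabs (- (?x1 + ?x2) - - (?y1 + ?y2)) <= _ =>
    replace (- (x1 + x2) - - (y1 + y2)) with (- ((x1 - y1) + (x2 - y2))) by ring end.
  rewrite Rabs_Ropp.
  assert (Hs : Rabs (bu + bv - (bu' + bv')) <= 2 * e) by (apply sum_diff_bound; auto).
  assert (M : forall x x' y y', Rabs x <= T -> Rabs y' <= T -> Rabs (x - x') <= e -> Rabs (y - y') <= e ->
    Rabs (x * y - x' * y') <= T * e + e * T) by (intros; apply mult_diff_bound; auto).
  eapply Rle_trans.
  - apply plus_bound.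
    + apply (mult_diff_bound _ _ _ _ (B * T) (T * T + T * T) (B * e + B * (2 * e) * T) ((T * e + e * T) + (T * e + e * T))).
      * apply mult_bound; auto. apply r_bound, near_be0_sum; auto.
      * apply plus_bound; apply mult_bound; auto.
      * apply mult_diff_bound; auto. apply r_bound, near_be0_sum; auto.
        eapply Rle_trans; [apply r_lip; apply near_be0_sum; auto|]. apply Rmult_le_compat_l; [lra|auto].
      * match goal with |- Rabs (?x1 + ?x2 - (?y1 + ?y2)) <= _ =>
          replace (x1 + x2 - (y1 + y2)) with ((x1 - y1) + (x2 - y2)) by ring end.
        apply plus_bound; auto.
    + apply (mult_diff_bound _ _ _ _ B (T * T + T * T + T * T) (B * (2 * e)) ((T * e + e * T) + (T * e + e * T) + (T * e + e * T))).
      * apply r_bound, near_be0_sum; auto.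
      * repeat apply plus_bound; apply mult_bound; auto.
      * eapply Rle_trans; [apply r_lip; apply near_be0_sum; auto|]. apply Rmult_le_compat_l; [lra|auto].
      * match goal with |- Rabs (?x1 + ?x2 + ?x3 - (?y1 + ?y2 + ?y3)) <= _ =>
          replace (x1 + x2 + x3 - (y1 + y2 + y3)) with ((x1 - y1) + (x2 - y2) + (x3 - y3)) by ring end.
        apply plus_bound; [apply plus_bound|]; auto.
  - unfold kC4. right; ring.
Qed.

(** * The iteration map and its weights *)

Definition bX (X : state) (v : R) : R := X (Cb, 0, v).
Definition thX (X : state) (v : R) : R := X (Cth, 0, v).
Definition beX (X : state) (v : R) : R := X (Cbe, 0, v).
Definition tpX (X : state) (v : R) : R := X (Ctp, 0, v).
Definition xpX (X : state) (v : R) : R := X (Cxp, 0, v).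
Definition nuX (X : state) (u v : R) : R := X (Cnu, u, v).
Definition EX (X : state) (u v : R) : R := X (CE, u, v).
Definition NX (X : state) (u v : R) : R := X (CN, u, v).

Definition qX (X : state) (v : R) : q4 := (beX X (a * v), beX X v, tpX X v, xpX X v).
Definition n1X (X : state) (v : R) : R := EX X v (a * v) + a * NX X v (a * v).
Definition thr (X : state) (v : R) : R :=
  th_rate (qX X v) (thX X (a * v)) (thX X v) (nuX X v (a * v)) (bX X (a * v)) (n1X X v).
Definition nur (X : state) (v : R) : R :=
  nu_rate (qX X v) (thX X (a * v)) (thX X v) (nuX X v (a * v)) (n1X X v).
Definition tpr (X : state) (v : R) : R := (a + g (qX X v)) * nuX X v (a * v).
Definition xpr (X : state) (v : R) : R := Q (qX X v) * nuX X v (a * v).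
Definition GX (X : state) (u v : R) : R :=
  hodo (beX X u) (beX X v) (thX X u) (thX X v) (nuX X u v) (nuX X v u).
Definition GvX (X : state) (u v : R) : R :=
  hodo_v (beX X u) (beX X v) (thX X u) (thX X v) (nuX X u v) (nuX X v u)
    (bX X v) (EX X v u) (NX X u v).

(** The shock relations make sense for $v\ge0$ only. Extending their rates to negative [v] by the
    value at $0$ lets all components live on a symmetric interval, where two-sided derivatives and
    integrals from $0$ can be used. *)
Definition clamp (v : R) : R := Rmax 0 v.

Definition th_next (X : state) (v : R) : R := th0 + RInt (fun s => thr X (clamp s)) 0 v.

(** The components [Cth], [Cbe] and [Cnu] are recovered by integrating rates, so that each step
    produces exact derivative relations. For [Cnu], the value on the line $u=av$ comes from
    integrating [nur], and the hodograph equation transports it in the direction of [u]. [CN] is the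
    [v]-derivative of that formula; its term [a * GX] comes from the moving endpoint $av$. *)
Definition shock_step (X : state) : state := fun i =>
  let '(c, u, v) := i in
  match c with
  | Cb => thr X (clamp v)
  | Cth => th_next X v
  | Cbe => be0 + RInt (th_next X) 0 v
  | Ctp => RInt (fun s => tpr X (clamp s)) 0 v
  | Cxp => RInt (fun s => xpr X (clamp s)) 0 v
  | Cnu => nu0 + RInt (fun s => nur X (clamp s)) 0 v
           - RInt (fun s => GX X s v) 0 (a * v) + RInt (fun s => GX X s v) 0 u
  | CE => GX X u v
  | CN => nur X (clamp v)
          - (a * GX X (a * v) v + RInt (fun s => GvX X s v) 0 (a * v))
          + RInt (fun s => GvX X s v) 0 u
  end.

(** The first order expansion at the origin of the shock, with the highest derivatives set to
    zero. *)
Definition shock_start : state := fun i =>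
  let '(c, u, v) := i in
  match c with
  | Cth => th0
  | Cbe => be0 + th0 * v
  | Ctp => tau0 * v
  | Cxp => xi0 * v
  | Cnu => nu0
  | _ => 0
  end.

Variables (eps wb wN wE lam : R).

(** Three scales: fixed, possibly large weights for the highest derivatives, the small [lam] for the
    lower ones, and for the shock point a weight proportional to [v]. The last one keeps the point
    in the cone of [C_cone], where the coefficients are defined. *)
Definition shock_weight (i : component * R * R) : R :=
  let '(c, u, v) := i in
  match c with
  | Cb => wb
  | CN => wN
  | CE => wE
  | Ctp | Cxp => delta * Rabs v
  | _ => lam
  end.
Definition idx_dom (i : component * R * R) : Prop := let '(c, u, v) := i in square eps u v.

(** [GvX] is a formal expression in the components; it is the [v]-derivative of [GX] only for states
    whose components satisfy these derivative relations. *)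
Definition regular_state (X : state) : Prop :=
  (forall v, Rabs v < eps ->
     continuous (bX X) v /\ is_derive (thX X) v (bX X v) /\ is_derive (beX X) v (thX X v) /\
     continuous (tpX X) v /\ continuous (xpX X) v) /\
  C1_square eps (nuX X) (EX X) (NX X).

(** The contraction constant lies midway between [kappa] and $1$, so that [d] is both [1 - k], the
    allowance for the first step, and [k - kappa], the slack that absorbs lower order terms. *)
Let k : R := (1 + kappa) / 2.
Let d : R := (1 - kappa) / 2.

Hypothesis w_pos : 0 <= wb /\ 0 <= wN /\ 0 <= wE.
Hypothesis lam_range : 0 < lam <= 1.
Hypothesis eps_range : 0 < eps <= 1 /\ eps <= delta.
Hypothesis A_large : Rabs th0 + Rabs nu0 + 1 <= A.
Hypothesis T_large : A + wb + wN + wE <= T.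
Hypothesis eps_lam : delta * eps <= lam.
Hypothesis eps_be : lam + Rabs th0 * eps < delta.
Hypothesis wb_large : B * (wE + wN) + kC2 * lam + 2 * kK1 <= d * wb.
Hypothesis wN_large : B * wE + kC2 * lam + kC3 * lam + 2 * eps * (kC4 * T + kK3) + kK1 + B * (2 * A * A) <= d * wN.
Hypothesis wE_large : B * (2 * A * A) + kC3 * lam <= d * wE.
Hypothesis lam_delta : (1 + B + 4 * B * A) * lam <= k * delta.
Hypothesis eps_th : eps * (wb + 2 * kK1) <= d * lam.
Hypothesis eps_nu : eps * (B * wE + wN + kC2 * lam + 2 * kC3 * lam + kK1 + 2 * (B * (2 * A * A))) <= d * lam.
Hypothesis eps_tp : eps * (A * (B * (4 * A + B * A))) <= d * delta.

Let ball := weighted_ball _ idx_dom shock_weight shock_start.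

(** * Bounds and differences on the ball of states *)

Lemma k_bounds : 0 < d /\ d <= k /\ k < 1 /\ 1 - k = d.
Proof. unfold k, d. repeat split; lra. Qed.

Lemma clamp_bounds (v : R) : 0 <= clamp v /\ (Rabs v < eps -> 0 <= clamp v < eps) /\ Rabs (clamp v) <= Rabs v.
Proof.
  unfold clamp, Rmax. destruct (Rle_dec 0 v); split_Rabs; repeat split; intros; lra.
Qed.

Lemma clamp_id (v : R) : 0 <= v -> clamp v = v.
Proof. intros; unfold clamp; rewrite Rmax_right; lra. Qed.

Lemma clamp_lip (v w : R) : Rabs (clamp v - clamp w) <= Rabs (v - w).
Proof.
  unfold clamp, Rmax. destruct (Rle_dec 0 v), (Rle_dec 0 w); split_Rabs; lra.
Qed.

Lemma clamp_continuous (v : R) : continuous clamp v.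
Proof.
  apply continuous_eps. intros e He. exists e; split; auto. intros y Hy.
  eapply Rle_lt_trans; [apply clamp_lip|auto].
Qed.

Lemma a_abs (v : R) : Rabs (a * v) <= Rabs v.
Proof.
  rewrite Rabs_mult, (Rabs_pos_eq a) by lra. rewrite <- (Rmult_1_l (Rabs v)) at 2.
  apply Rmult_le_compat_r; [apply Rabs_pos|lra].
Qed.

Lemma zero_in : Rabs 0 < eps.
Proof. rewrite Rabs_R0. lra. Qed.

Lemma ball_bounds (X : state) (v : R) : ball X -> Rabs v < eps ->
  Rabs (bX X v) <= wb /\ Rabs (thX X v - th0) <= lam /\ Rabs (thX X v) <= A /\
  near_be0 (beX X v) /\ Rabs (beX X v - be0) < delta /\
  Rabs (tpX X v - tau0 * v) <= delta * Rabs v /\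
  Rabs (xpX X v - xi0 * v) <= delta * Rabs v.
Proof.
  intros HX Hv. assert (Z := zero_in).
  assert (H : forall c, Rabs (X (c, 0, v) - shock_start (c, 0, v)) <= shock_weight (c, 0, v)).
  { intros c. apply HX. split; auto. }
  assert (H1 := H Cb). assert (H2 := H Cth). assert (H3 := H Cbe). assert (H4 := H Ctp). assert (H5 := H Cxp).
  simpl in H1, H2, H3, H4, H5. rewrite Rminus_0_r in H1.
  assert (Hbe : Rabs (beX X v - be0) < delta).
  { unfold beX. replace (X (Cbe, 0, v) - be0) with ((X (Cbe, 0, v) - (be0 + th0 * v)) + th0 * v) by ring.
    eapply Rle_lt_trans; [apply Rabs_triang|]. rewrite Rabs_mult.
    assert (Rabs th0 * Rabs v <= Rabs th0 * eps) by (apply Rmult_le_compat_l; [apply Rabs_pos|lra]). lra. }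
  repeat split; auto; [|unfold near_be0; lra].
  assert (Hn := Rabs_pos nu0). unfold thX. replace (X (Cth, 0, v)) with ((X (Cth, 0, v) - th0) + th0) by ring.
  eapply Rle_trans; [apply Rabs_triang|]. lra.
Qed.

Lemma ball_bounds_2 (X : state) (u v : R) : ball X -> square eps u v ->
  Rabs (nuX X u v - nu0) <= lam /\ Rabs (nuX X u v) <= A /\
  Rabs (EX X u v) <= wE /\ Rabs (NX X u v) <= wN.
Proof.
  intros HX Hv.
  assert (H : forall c, Rabs (X (c, u, v) - shock_start (c, u, v)) <= shock_weight (c, u, v)) by (intros c; apply HX, Hv).
  assert (H1 := H Cnu). assert (H2 := H CE). assert (H3 := H CN). simpl in H1, H2, H3.
  rewrite Rminus_0_r in H2, H3. repeat split; auto.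
  unfold nuX. replace (X (Cnu, u, v)) with ((X (Cnu, u, v) - nu0) + nu0) by ring.
  eapply Rle_trans; [apply Rabs_triang|]. generalize (Rabs_pos th0). lra.
Qed.

Lemma shock_square (v : R) : Rabs v < eps -> square eps v (a * v) /\ square eps (a * v) v /\ Rabs (a * v) < eps.
Proof. intros Hv. generalize (a_abs v). intros; repeat split; lra. Qed.

Lemma n1X_bound (X : state) (v : R) : ball X -> Rabs v < eps -> Rabs (n1X X v) <= wE + wN.
Proof.
  intros HX Hv. destruct (shock_square v Hv) as [H1 [H2 H3]].
  destruct (ball_bounds_2 X _ _ HX H1) as [_ [_ [E1 E2]]].
  unfold n1X. apply plus_bound; auto. generalize (a_abs (NX X v (a * v))). lra.
Qed.

Lemma qX_C (X : state) (v : R) : ball X -> 0 <= v < eps -> C (qX X v) /\ (0 < v -> Co (qX X v)).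
Proof.
  intros HX Hv. assert (Hv' : Rabs v < eps) by (rewrite Rabs_pos_eq; lra).
  destruct (shock_square v Hv') as [_ [_ Ha]].
  destruct (ball_bounds X v HX Hv') as [_ [_ [_ [N1' [_ [E1 E2]]]]]].
  destruct (ball_bounds X _ HX Ha) as [_ [_ [_ [N2 _]]]].
  rewrite (Rabs_pos_eq v) in E1, E2 by lra.
  apply (C_cone v); auto. lra.
Qed.

(** Comparing [X] at [v] with [Y] at [w] serves two purposes: [X = Y] gives the continuity of the
    rates, and [v = w] gives the contraction estimate. *)
Definition low_close (X Y : state) (v w e : R) : Prop :=
  Rabs (beX X (a * v) - beX Y (a * w)) <= e /\ Rabs (beX X v - beX Y w) <= e /\
  Rabs (tpX X v - tpX Y w) <= e /\ Rabs (xpX X v - xpX Y w) <= e /\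
  Rabs (thX X (a * v) - thX Y (a * w)) <= e /\ Rabs (thX X v - thX Y w) <= e /\
  Rabs (nuX X v (a * v) - nuX Y w (a * w)) <= e.

Lemma low_close_dist (X Y : state) (v w e : R) :
  low_close X Y v w e -> q4_dist (qX X v) (qX Y w) <= 4 * e.
Proof. intros [H1 [H2 [H3 [H4 _]]]]. unfold qX, q4_dist. lra. Qed.

Lemma state_facts (X : state) (v : R) : ball X -> 0 <= v < eps ->
  C (qX X v) /\ Rabs (thX X (a * v)) <= A /\ Rabs (thX X v) <= A /\ Rabs (nuX X v (a * v)) <= A /\
  Rabs (bX X (a * v)) <= wb /\ Rabs (n1X X v) <= wE + wN.
Proof.
  intros HX Hv. assert (Hv' : Rabs v < eps) by (rewrite Rabs_pos_eq; lra).
  destruct (shock_square v Hv') as [H1 [H2 Ha]].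
  split; [apply qX_C; auto|]. split; [apply ball_bounds; auto|]. split; [apply ball_bounds; auto|].
  split; [apply ball_bounds_2; auto|]. split; [apply ball_bounds; auto|]. apply n1X_bound; auto.
Qed.

Lemma thr_lip (X Y : state) (v w e : R) :
  ball X -> ball Y -> 0 <= v < eps -> 0 <= w < eps -> low_close X Y v w e ->
  Rabs (thr X v - thr Y w) <=
    kappa * Rabs (bX X (a * v) - bX Y (a * w)) + B * Rabs (n1X X v - n1X Y w) + kC2 * e.
Proof.
  intros HX HY Hv Hw Hl. assert (Hq := low_close_dist _ _ _ _ _ Hl).
  destruct (state_facts X v HX Hv) as [F1 [F2 [F3 [F4 [F5 F6]]]]].
  destruct (state_facts Y w HY Hw) as [F1' [F2' [F3' [F4' [F5' F6']]]]].
  destruct Hl as [L1 [L2 [L3 [L4 [L5 [L6 L7]]]]]].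
  apply th_rate_lip; auto; lra.
Qed.

Lemma nur_lip (X Y : state) (v w e : R) :
  ball X -> ball Y -> 0 <= v < eps -> 0 <= w < eps -> low_close X Y v w e ->
  Rabs (nur X v - nur Y w) <= Rabs (g (qX X v)) * Rabs (n1X X v - n1X Y w) + kC2 * e.
Proof.
  intros HX HY Hv Hw Hl. assert (Hq := low_close_dist _ _ _ _ _ Hl).
  destruct (state_facts X v HX Hv) as [F1 [F2 [F3 [F4 [F5 F6]]]]].
  destruct (state_facts Y w HY Hw) as [F1' [F2' [F3' [F4' [F5' F6']]]]].
  destruct Hl as [L1 [L2 [L3 [L4 [L5 [L6 L7]]]]]].
  apply nu_rate_lip; auto; lra.
Qed.

Lemma curve_rate_lip (X Y : state) (v w e : R) :
  ball X -> ball Y -> 0 <= v < eps -> 0 <= w < eps -> low_close X Y v w e ->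
  Rabs (tpr X v - tpr Y w) <= (1 + B + 4 * B * A) * e /\
  Rabs (xpr X v - xpr Y w) <= (1 + B + 4 * B * A) * e.
Proof.
  intros HX HY Hv Hw Hl. assert (Hq := low_close_dist _ _ _ _ _ Hl). assert (B1 := B_ge_1).
  destruct (state_facts X v HX Hv) as [F1 [F2 [F3 [F4 [F5 F6]]]]].
  destruct (state_facts Y w HY Hw) as [F1' [F2' [F3' [F4' [F5' F6']]]]].
  destruct Hl as [L1 [L2 [L3 [L4 [L5 [L6 L7]]]]]].
  assert (He : 0 <= e) by (eapply Rle_trans; [apply Rabs_pos|exact L1]).
  assert (Hd : B * q4_dist (qX X v) (qX Y w) <= B * (4 * e)) by (apply Rmult_le_compat_l; lra).
  split.
  - apply Rle_trans with ((1 + B) * e + (B * (4 * e)) * A); [|right; ring].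
    apply mult_diff_bound; auto.
    + apply plus_bound; [rewrite Rabs_pos_eq; lra|apply (C11_bound _ _ _ _ _ Hg); auto].
    + replace (a + g (qX X v) - (a + g (qX Y w))) with (g (qX X v) - g (qX Y w)) by ring.
      eapply Rle_trans; [apply (C11_lip _ _ _ _ _ Hg); auto|auto].
  - apply Rle_trans with (B * e + (B * (4 * e)) * A); [|lra].
    apply mult_diff_bound; auto.
    + apply (C11_bound _ _ _ _ _ HQ); auto.
    + eapply Rle_trans; [apply (C11_lip _ _ _ _ _ HQ); auto|auto].
Qed.

Lemma kC2_nonneg : 0 <= kC2.
Proof.
  assert (B1 := B_ge_1). assert (0 <= B * A) by (apply Rmult_le_pos; lra).
  assert (0 <= B * T) by (apply Rmult_le_pos; lra).
  assert (HN : 0 <= kN1) by (unfold kN1; apply Rmult_le_pos; lra).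
  assert (0 <= kC1).
  { unfold kC1. apply Rplus_le_le_0_compat; apply Rmult_le_pos; try lra. apply Rmult_le_pos; lra. }
  unfold kC2. lra.
Qed.

(** * Regularity of the iterates *)

Lemma continuous_clamp (f : R -> R) (v : R) :
  (forall s, Rabs s < eps -> continuous f s) -> Rabs v < eps ->
  continuous (fun s => f (clamp s)) v /\ continuous (fun s => f (a * clamp s)) v.
Proof.
  intros Hf Hv. destruct (clamp_bounds v) as [P1 [P2 P3]].
  assert (Hap : continuous (fun s => a * clamp s) v).
  { apply (@continuous_mult R_UniformSpace R_AbsRing (fun _ => a) clamp); [apply continuous_const|apply clamp_continuous]. }
  split; apply continuous_comp; auto using clamp_continuous; apply Hf; [lra|].
  generalize (a_abs (clamp v)); lra.
Qed.

Lemma continuous_clamp_curve (f : R -> R -> R) (v : R) :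
  (forall u w, square eps u w -> continuity_2d_pt f u w) -> Rabs v < eps ->
  continuous (fun s => f (clamp s) (a * clamp s)) v.
Proof.
  intros Hf Hv. destruct (clamp_bounds v) as [P1 [P2 P3]].
  apply (continuity_2d_curve f clamp (fun s => a * clamp s)).
  - apply Hf, shock_square. lra.
  - apply clamp_continuous.
  - apply (@continuous_mult R_UniformSpace R_AbsRing (fun _ => a) clamp); [apply continuous_const|apply clamp_continuous].
Qed.

Lemma regular_nu (X : state) : regular_state X -> forall u v, square eps u v ->
  continuity_2d_pt (nuX X) u v /\ continuity_2d_pt (EX X) u v /\ continuity_2d_pt (NX X) u v.
Proof.
  intros [_ HX] u v Huv. split; [eapply C1_square_continuous; eauto|]. split; apply HX; auto.
Qed.

Lemma low_close_locally (X : state) (v e : R) :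
  regular_state X -> 0 < e -> Rabs v < eps ->
  locally v (fun s => low_close X X (clamp s) (clamp v) e /\
    Rabs (bX X (a * clamp s) - bX X (a * clamp v)) <= e /\
    Rabs (n1X X (clamp s) - n1X X (clamp v)) <= e /\ Rabs s < eps).
Proof.
  intros HX He Hv. assert (HN := regular_nu X HX). destruct HX as [H1 HX].
  assert (L := fun f Hf => continuous_clamp f v Hf Hv).
  assert (Cth : forall s, Rabs s < eps -> continuous (thX X) s).
  { intros s Hs. exact (is_derive_continuous _ _ _ (proj1 (proj2 (H1 s Hs)))). }
  assert (Cbe : forall s, Rabs s < eps -> continuous (beX X) s).
  { intros s Hs. exact (is_derive_continuous _ _ _ (proj1 (proj2 (proj2 (H1 s Hs))))). }
  assert (Cn : continuous (fun s => n1X X (clamp s)) v).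
  { unfold n1X. apply (@continuous_plus R_UniformSpace R_AbsRing R_NormedModule).
    - apply (continuous_clamp_curve (EX X)); auto. intros; apply HN; auto.
    - apply (@continuous_mult R_UniformSpace R_AbsRing (fun _ => a)); [apply continuous_const|].
      apply (continuous_clamp_curve (NX X)); auto. intros; apply HN; auto. }
  assert (Cnu : continuous (fun s => nuX X (clamp s) (a * clamp s)) v).
  { apply continuous_clamp_curve; auto. intros; apply HN; auto. }
  generalize (filter_and _ _ (continuous_locally _ _ e He (proj2 (L _ Cbe)))
    (filter_and _ _ (continuous_locally _ _ e He (proj1 (L _ Cbe)))
    (filter_and _ _ (continuous_locally _ _ e He (proj1 (L (tpX X) (fun s Hs => proj1 (proj2 (proj2 (proj2 (H1 s Hs))))))))
    (filter_and _ _ (continuous_locally _ _ e He (proj1 (L (xpX X) (fun s Hs => proj2 (proj2 (proj2 (proj2 (H1 s Hs))))))))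
    (filter_and _ _ (continuous_locally _ _ e He (proj2 (L _ Cth)))
    (filter_and _ _ (continuous_locally _ _ e He (proj1 (L _ Cth)))
    (filter_and _ _ (continuous_locally _ _ e He Cnu)
    (filter_and _ _ (continuous_locally _ _ e He (proj2 (L (bX X) (fun s Hs => proj1 (H1 s Hs)))))
    (filter_and _ _ (continuous_locally _ _ e He Cn) (locally_abs_lt eps v Hv)))))))))).
  apply filter_imp. intros s [A1 [A2 [A3 [A4 [A5 [A6 [A7 [A8 [A9 A10]]]]]]]]].
  unfold low_close. repeat split; auto.
Qed.

(** The Lipschitz estimates above, applied to a single state at two parameters, bound the
    oscillation of the rates by that of the components. *)
Lemma rates_continuous (X : state) (v : R) :
  regular_state X -> ball X -> Rabs v < eps ->
  continuous (fun s => thr X (clamp s)) v /\ continuous (fun s => nur X (clamp s)) v /\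
  continuous (fun s => tpr X (clamp s)) v /\ continuous (fun s => xpr X (clamp s)) v.
Proof.
  intros HX HB Hv. assert (B1 := B_ge_1). assert (HC2 := kC2_nonneg).
  (* The sum of the Lipschitz constants of all four rates, increased by $1$ to obtain strict
     inequalities. *)
  set (K := kappa + B + kC2 + (1 + B + 4 * B * A) + 1).
  assert (0 <= B * A) by (apply Rmult_le_pos; lra).
  assert (HK : 0 < K) by (unfold K; lra).
  destruct (clamp_bounds v) as [_ [Pv _]]. specialize (Pv Hv).
  assert (main : forall e, 0 < e -> locally v (fun s =>
     Rabs (thr X (clamp s) - thr X (clamp v)) < e /\ Rabs (nur X (clamp s) - nur X (clamp v)) < e /\
     Rabs (tpr X (clamp s) - tpr X (clamp v)) < e /\ Rabs (xpr X (clamp s) - xpr X (clamp v)) < e)).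
  { intros e He. assert (Hf : 0 < e / K) by (apply Rdiv_lt_0_compat; auto).
    generalize (low_close_locally X v (e / K) HX Hf Hv). apply filter_imp.
    intros s [L [Lb [Ln Hs]]]. destruct (clamp_bounds s) as [_ [Ps _]]. specialize (Ps Hs).
    assert (Ef : e = K * (e / K)) by (field; lra). set (f := e / K) in *.
    assert (0 <= kC2 * f) by (apply Rmult_le_pos; lra).
    assert (0 <= B * A * f) by (apply Rmult_le_pos; lra).
    assert (0 <= B * f) by (apply Rmult_le_pos; lra).
    assert (0 <= kappa * f) by (apply Rmult_le_pos; lra).
    assert (M1 := thr_lip X X _ _ _ HB HB Ps Pv L). assert (M2 := nur_lip X X _ _ _ HB HB Ps Pv L).
    destruct (curve_rate_lip X X _ _ _ HB HB Ps Pv L) as [M3 M4].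
    assert (kappa * Rabs (bX X (a * clamp s) - bX X (a * clamp v)) <= kappa * f) by (apply Rmult_le_compat_l; lra).
    assert (B * Rabs (n1X X (clamp s) - n1X X (clamp v)) <= B * f) by (apply Rmult_le_compat_l; lra).
    assert (Rabs (g (qX X (clamp s))) * Rabs (n1X X (clamp s) - n1X X (clamp v)) <= B * f).
    { apply Rmult_le_compat; auto using Rabs_pos. apply (C11_bound _ _ _ _ _ Hg). apply qX_C; auto. }
    unfold K in Ef. repeat split; lra. }
  repeat split; apply filterlim_locally; intros e; generalize (main e (cond_pos e)); apply filter_imp; intros s M; apply M.
Qed.

(** The Lipschitz bound for [r'] holds on a closed interval, and continuity needs a neighbourhood in
    it. The strict inequality [eps_be] provides one for all sums of values of [be]. *)
Lemma r_derivative_continuous (s : R) : Rabs (s - 2 * be0) < 2 * delta -> continuous r' s.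
Proof.
  intros Hs. assert (B1 := B_ge_1). apply continuous_eps. intros e He.
  exists (Rmin (e / (B + 1)) (2 * delta - Rabs (s - 2 * be0))).
  split; [apply Rmin_case; [apply Rdiv_lt_0_compat; lra|lra]|].
  intros y Hy. assert (M1 := Rmin_l (e / (B + 1)) (2 * delta - Rabs (s - 2 * be0))).
  assert (M2 := Rmin_r (e / (B + 1)) (2 * delta - Rabs (s - 2 * be0))).
  assert (Hy2 : Rabs (y - 2 * be0) <= 2 * delta).
  { replace (y - 2 * be0) with ((y - s) + (s - 2 * be0)) by ring.
    eapply Rle_trans; [apply Rabs_triang|]. lra. }
  apply Rle_lt_trans with (B * Rabs (y - s)); [apply r_lip; auto; lra|].
  apply Rle_lt_trans with (B * (e / (B + 1))); [apply Rmult_le_compat_l; lra|].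
  apply Rlt_le_trans with ((B + 1) * (e / (B + 1))); [|right; field; lra].
  apply Rmult_lt_compat_r; [apply Rdiv_lt_0_compat; lra|lra].
Qed.

Lemma be_sum_strict (X : state) (u v : R) : ball X -> square eps u v ->
  Rabs (beX X u + beX X v - 2 * be0) < 2 * delta.
Proof.
  intros HX [Hu Hv]. destruct (ball_bounds X u HX Hu) as [_ [_ [_ [_ [H1 _]]]]].
  destruct (ball_bounds X v HX Hv) as [_ [_ [_ [_ [H2 _]]]]].
  replace (beX X u + beX X v - 2 * be0) with ((beX X u - be0) + (beX X v - be0)) by ring.
  eapply Rle_lt_trans; [apply Rabs_triang|]. lra.
Qed.

Lemma hodo_regular (X : state) : regular_state X -> ball X -> forall u v, square eps u v ->
  is_derive (fun s => GX X u s) v (GvX X u v) /\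
  continuity_2d_pt (GX X) u v /\ continuity_2d_pt (GvX X) u v.
Proof.
  intros HX HB u v Huv. assert (Hvu := square_swap _ _ _ Huv).
  assert (HN := regular_nu X HX). destruct (HN u v Huv) as [N1c [N2c N3c]].
  destruct (HN v u Hvu) as [M1c [M2c M3c]]. destruct HX as [H1 HX].
  destruct (H1 u (proj1 Huv)) as [U1 [U2 [U3 _]]]. destruct (H1 v (proj2 Huv)) as [V1 [V2 [V3 _]]].
  assert (Hs := be_sum_strict X u v HB Huv).
  destruct (r_bound (beX X u + beX X v) ltac:(lra)) as [_ [_ Hr]].
  assert (Cr' := r_derivative_continuous _ Hs).
  destruct (HX u v Huv) as [_ [D1 _]]. destruct (HX v u Hvu) as [D2 _].
  assert (Csum : continuity_2d_pt (fun u v => beX X u + beX X v) u v).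
  { apply continuity_2d_pt_plus; [apply continuity_2d_left|apply continuity_2d_right]; eapply is_derive_continuous; eassumption. }
  assert (Ctu : continuity_2d_pt (fun u _ => thX X u) u v) by (apply continuity_2d_left; eapply is_derive_continuous; eassumption).
  assert (Ctv : continuity_2d_pt (fun _ v => thX X v) u v) by (apply continuity_2d_right; eapply is_derive_continuous; eassumption).
  assert (Cbv : continuity_2d_pt (fun _ v => bX X v) u v) by (apply continuity_2d_right; assumption).
  assert (Cr : continuity_2d_pt (fun u v => r (beX X u + beX X v)) u v).
  { apply (continuity_1d_2d_pt_comp r (fun u v => beX X u + beX X v)); auto.
    apply continuous_pt. eapply is_derive_continuous; eassumption. }
  assert (Cr2 : continuity_2d_pt (fun u v => r' (beX X u + beX X v)) u v).
  { apply (continuity_1d_2d_pt_comp r' (fun u v => beX X u + beX X v)); auto.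
    apply continuous_pt. assumption. }
  assert (Cm : continuity_2d_pt (fun u v => thX X v * nuX X v u + thX X u * nuX X u v) u v).
  { apply continuity_2d_pt_plus; apply continuity_2d_pt_mult; auto. apply (continuity_2d_swap (nuX X)); auto. }
  split; [|split].
  - unfold GX, hodo.
    replace (GvX X u v) with (- ((thX X v * r' (beX X u + beX X v)) * (thX X v * nuX X v u + thX X u * nuX X u v)
       + r (beX X u + beX X v) * ((bX X v * nuX X v u + thX X v * EX X v u) + thX X u * NX X u v)))
      by (unfold GvX, hodo_v; ring).
    apply @is_derive_opp. apply (is_derive_mult (fun s => r (beX X u + beX X s)) (fun s => thX X s * nuX X s u + thX X u * nuX X u s)); [| |intros; apply Rmult_comm].
    + apply (is_derive_comp r (fun s => beX X u + beX X s)); auto.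
      apply (is_derive_const_plus (beX X)); auto.
    + apply @is_derive_plus.
      * apply (is_derive_mult (thX X) (fun s => nuX X s u)); auto. intros; apply Rmult_comm.
      * apply (is_derive_scal (fun s => nuX X u s)). auto.
  - unfold GX, hodo. apply continuity_2d_pt_opp, continuity_2d_pt_mult; auto.
  - unfold GvX, hodo_v. apply continuity_2d_pt_opp, continuity_2d_pt_plus.
    + apply continuity_2d_pt_mult; auto. apply continuity_2d_pt_mult; auto.
    + apply continuity_2d_pt_mult; auto. repeat apply continuity_2d_pt_plus; apply continuity_2d_pt_mult; auto.
      * apply (continuity_2d_swap (nuX X)); auto.
      * apply (continuity_2d_swap (EX X)); auto.
Qed.

Lemma step_regular (X : state) : regular_state X -> ball X -> regular_state (shock_step X).
Proof.
  intros HX HB. assert (HR1 := fun v H => proj1 (rates_continuous X v HX HB H)).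
  assert (HR2 := fun v H => proj1 (proj2 (rates_continuous X v HX HB H))).
  assert (HR3 := fun v H => proj1 (proj2 (proj2 (rates_continuous X v HX HB H)))).
  assert (HR4 := fun v H => proj2 (proj2 (proj2 (rates_continuous X v HX HB H)))).
  assert (HH := hodo_regular X HX HB).
  assert (Dth : forall v, Rabs v < eps -> is_derive (th_next X) v (thr X (clamp v))).
  { intros v Hv. apply is_derive_const_plus.
    apply (RInt_interval_derive (fun s => thr X (clamp s)) eps); auto. }
  split.
  - intros v Hv. split; [apply HR1; auto|]. split; [apply Dth; auto|]. split; [|split].
    + apply is_derive_const_plus.
      apply (RInt_interval_derive (th_next X) eps); auto.
      intros x Hx. exact (is_derive_continuous _ _ _ (Dth x Hx)).
    + eapply is_derive_continuous. apply (RInt_interval_derive (fun s => tpr X (clamp s)) eps); auto.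
    + eapply is_derive_continuous. apply (RInt_interval_derive (fun s => xpr X (clamp s)) eps); auto.
  - assert (HI := C1_square_RInt eps (GX X) (GvX X) (fun u v H => proj1 (HH u v H))
       (fun u v H => proj1 (proj2 (HH u v H))) (fun u v H => proj2 (proj2 (HH u v H)))).
    set (I := fun u v => RInt (fun s => GX X s v) 0 u) in HI.
    set (Iv := fun u v => RInt (fun s => GvX X s v) 0 u) in HI.
    intros u v Huv. destruct (HI u v Huv) as [I1 [I2 [I3 I4]]].
    destruct (shock_square v (proj2 Huv)) as [_ [Hs _]]. destruct (HI _ _ Hs) as [J1 [J2 [J3 J4]]].
    split; [|split; [|split]].
    + apply is_derive_const_plus. exact I1.
    + unfold nuX, NX; simpl. apply @is_derive_plus; [|exact I2].
      apply @is_derive_minus.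
      * apply is_derive_const_plus.
        apply (RInt_interval_derive (fun s => nur X (clamp s)) eps); [auto|apply Huv].
      (* The integral with moving endpoint is [I] on the curve $(av,v)$; the chain rule yields the
         endpoint term and the derivative under the integral. *)
      * replace (a * GX X (a * v) v + RInt (fun s => GvX X s v) 0 (a * v))
          with (GX X (a * v) v * a + Iv (a * v) v * 1) by (unfold Iv; ring).
        apply (is_derive_curve I (fun v => a * v) (fun v => v)).
        -- apply (C1_square_differentiable _ _ _ _ HI); auto.
        -- apply is_derive_linear.
        -- apply @is_derive_id.
    + exact I3.
    + unfold NX; simpl. apply continuity_2d_pt_plus; [|exact I4].
      apply (continuity_2d_right (fun v => nur X (clamp v) - (a * GX X (a * v) v + Iv (a * v) v))).
      apply (@continuous_minus R_UniformSpace R_AbsRing R_NormedModule); [apply HR2, Huv|].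
      apply (@continuous_plus R_UniformSpace R_AbsRing R_NormedModule).
      * apply (@continuous_mult R_UniformSpace R_AbsRing (fun _ => a)); [apply continuous_const|].
        apply (continuity_2d_curve (GX X) (fun v => a * v) (fun v => v)); auto using continuous_id, continuous_linear.
      * apply (continuity_2d_curve Iv (fun v => a * v) (fun v => v)); auto using continuous_id, continuous_linear.
Qed.

Lemma start_regular : regular_state shock_start.
Proof.
  split.
  - intros v Hv. split; [|split; [|split; [|split]]].
    + apply continuous_const.
    + apply @is_derive_const.
    + apply (is_derive_const_plus (fun s => th0 * s) be0 v th0), is_derive_linear.
    + apply continuous_linear.
    + apply continuous_linear.
  - intros u v Huv. split; [exact (is_derive_const nu0 u)|]. split; [exact (is_derive_const nu0 v)|].
    split; apply continuity_2d_pt_const.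
Qed.

(** Convergence relative to the weights is uniform for a component and its derivative at once, so
    the derivative relations pass to the limit. *)
Lemma regular_closed (Xn : nat -> state) (X : state) :
  (forall n, regular_state (Xn n)) ->
  (forall e, 0 < e -> exists n, forall i, idx_dom i -> Rabs (Xn n i - X i) <= e * shock_weight i) ->
  regular_state X.
Proof.
  intros Hreg Hlim. assert (Z := zero_in).
  (* [W] dominates every weight on the square; [delta * eps] accounts for those of the shock
     point. *)
  set (W := wb + wN + wE + lam + delta * eps + 1).
  assert (0 < delta * eps) by (apply Rmult_lt_0_compat; lra).
  assert (HW : 0 < W) by (unfold W; lra).
  assert (Hu : forall e, 0 < e -> exists n, forall i, idx_dom i -> Rabs (Xn n i - X i) <= e).
  { intros e He. destruct (Hlim (e / W)) as [n Hn]; [apply Rdiv_lt_0_compat; auto|].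
    exists n. intros i Hi. apply Rle_trans with (1 := Hn i Hi).
    apply Rle_trans with (e / W * W); [|right; field; lra].
    apply Rmult_le_compat_l; [left; apply Rdiv_lt_0_compat; auto|].
    destruct i as [[c u] v]. destruct Hi as [_ Hv].
    assert (delta * Rabs v <= delta * eps) by (apply Rmult_le_compat_l; lra).
    unfold W. destruct c; simpl; lra. }
  assert (Hu1 : forall c c' e, 0 < e -> exists n, forall v, Rabs v < eps ->
     Rabs (Xn n (c, 0, v) - X (c, 0, v)) <= e /\ Rabs (Xn n (c', 0, v) - X (c', 0, v)) <= e).
  { intros c c' e He. destruct (Hu e He) as [n Hn]. exists n. intros v Hv.
    split; apply Hn; split; auto. }
  assert (Ucont : forall (f : R -> R) (fn : nat -> R -> R), (forall n v, Rabs v < eps -> continuous (fn n) v) ->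
    (forall e, 0 < e -> exists n, forall v, Rabs v < eps -> Rabs (fn n v - f v) <= e) ->
    forall v, Rabs v < eps -> continuous f v).
  { intros f fn Hc Hl v Hv. apply continuous_eps. intros e He.
    destruct (Hl (e / 4) ltac:(lra)) as [n Hn].
    destruct (proj1 (continuous_eps _ _) (Hc n v Hv) (e / 4) ltac:(lra)) as [dd [Hd0 H']].
    exists (Rmin dd (eps - Rabs v)). split; [apply Rmin_case; lra|].
    intros y Hy. assert (H1 := Rmin_l dd (eps - Rabs v)). assert (H2 := Rmin_r dd (eps - Rabs v)).
    specialize (H' y ltac:(lra)).
    assert (Hy' : Rabs y < eps).
    { replace y with ((y - v) + v) by ring. eapply Rle_lt_trans; [apply Rabs_triang|]. lra. }
    assert (A1 := Hn y Hy'). assert (A2 := Hn v Hv). clear - H' A1 A2 He. split_Rabs; lra. }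
  split.
  - assert (T1 := uniform_limit_derive (thX X) (bX X) (fun n => thX (Xn n)) (fun n => bX (Xn n)) eps
      (fun n x Hx => proj1 (proj2 (proj1 (Hreg n) x Hx)))
      (fun n x Hx => proj1 (proj1 (Hreg n) x Hx)) (Hu1 Cth Cb)).
    assert (T2 := uniform_limit_derive (beX X) (thX X) (fun n => beX (Xn n)) (fun n => thX (Xn n)) eps
      (fun n x Hx => proj1 (proj2 (proj2 (proj1 (Hreg n) x Hx))))
      (fun n x Hx => is_derive_continuous _ _ _ (proj1 (proj2 (proj1 (Hreg n) x Hx)))) (Hu1 Cbe Cth)).
    intros v Hv. split; [apply T1; auto|]. split; [apply T1; auto|]. split; [apply T2; auto|].
    split.
    + apply (Ucont (tpX X) (fun n => tpX (Xn n))); auto.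
      * intros n s Hs. apply (proj1 (Hreg n) s Hs).
      * intros e He. destruct (Hu1 Ctp Ctp e He) as [n Hn]. exists n. intros; apply Hn; auto.
    + apply (Ucont (xpX X) (fun n => xpX (Xn n))); auto.
      * intros n s Hs. apply (proj1 (Hreg n) s Hs).
      * intros e He. destruct (Hu1 Cxp Cxp e He) as [n Hn]. exists n. intros; apply Hn; auto.
  - assert (Uc2 : forall c, (forall n u v, square eps u v -> continuity_2d_pt (fun u v => Xn n (c, u, v)) u v) ->
      forall u v, square eps u v -> continuity_2d_pt (fun u v => X (c, u, v)) u v).
    { intros c Hc u v Huv e. assert (He := cond_pos e).
      destruct (Hu (e / 4) ltac:(lra)) as [n Hn].
      assert (He4 : 0 < e / 4) by lra.
      destruct (Hc n u v Huv (mkposreal _ He4)) as [d1 H1].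
      destruct (square_locally eps u v Huv) as [d2 H2].
      exists (mkposreal _ (Rmin_stable_in_posreal d1 d2)). simpl. intros u' v' B1 B2.
      assert (M1 := Rmin_l d1 d2). assert (M2 := Rmin_r d1 d2).
      specialize (H1 u' v' ltac:(lra) ltac:(lra)). simpl in H1.
      assert (A1 := Hn (c, u', v') (H2 u' v' ltac:(lra) ltac:(lra))). assert (A2 := Hn (c, u, v) Huv).
      clear - A1 A2 H1 He. split_Rabs; lra. }
    assert (HE := Uc2 CE (fun n u v H => proj1 (proj2 (regular_nu _ (Hreg n) u v H)))).
    assert (HNc := Uc2 CN (fun n u v H => proj2 (proj2 (regular_nu _ (Hreg n) u v H)))).
    intros u v Huv. split; [|split; [|split; [apply HE|apply HNc]; auto]].
    + apply (uniform_limit_derive (fun s => nuX X s v) (fun s => EX X s v)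
        (fun n s => nuX (Xn n) s v) (fun n s => EX (Xn n) s v) eps).
      * intros n x Hx. apply (proj2 (Hreg n)). split; [auto|apply Huv].
      * intros n x Hx. apply (continuity_2d_section (EX (Xn n)) x v).
        apply (regular_nu _ (Hreg n)). split; [auto|apply Huv].
      * intros e He. destruct (Hu e He) as [n Hn]. exists n. intros x Hx.
        split; apply Hn; (split; [auto|apply Huv]).
      * apply Huv.
    + apply (uniform_limit_derive (fun s => nuX X u s) (fun s => NX X u s)
        (fun n s => nuX (Xn n) u s) (fun n s => NX (Xn n) u s) eps).
      * intros n x Hx. apply (proj2 (Hreg n)). split; [apply Huv|auto].
      * intros n x Hx. apply (continuity_2d_section (NX (Xn n)) u x).
        apply (regular_nu _ (Hreg n)). split; [apply Huv|auto].
      * intros e He. destruct (Hu e He) as [n Hn]. exists n. intros x Hx.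
        split; apply Hn; (split; [apply Huv|auto]).
      * apply Huv.
Qed.

Lemma constants_nonneg : 0 <= kN1 /\ 0 <= kK1 /\ 0 <= kC3 /\ 0 <= kK3 /\ 0 <= kC4 /\ 0 <= B * (2 * A * A) /\ 1 <= A.
Proof.
  assert (B1 := B_ge_1). assert (HA : 1 <= A) by (generalize (Rabs_pos th0) (Rabs_pos nu0); lra).
  assert (HBA : 0 <= B * A) by (apply Rmult_le_pos; lra).
  assert (HN : 0 <= kN1) by (unfold kN1; apply Rmult_le_pos; lra).
  assert (HT : 0 <= T * T) by (apply Rmult_le_pos; lra).
  assert (HT3 : 0 <= T * T * T) by (apply Rmult_le_pos; lra).
  assert (HBAA : 0 <= B * A * A) by (apply Rmult_le_pos; lra).
  repeat split; auto; try lra.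
  - unfold kK1. apply Rmult_le_pos; [lra|]. apply Rmult_le_pos; lra.
  - unfold kC3. lra.
  - unfold kK3. assert (0 <= B * (T * T * T)) by (apply Rmult_le_pos; lra).
    assert (0 <= B * (T * T)) by (apply Rmult_le_pos; lra). lra.
  - unfold kC4. apply Rmult_le_pos; lra.
Qed.

(** * Contraction of the iteration map *)

Section Contraction.

Variables (X Y : state) (M : R).
Hypothesis M_nonneg : 0 <= M.
Hypothesis X_regular : regular_state X.
Hypothesis Y_regular : regular_state Y.
Hypothesis X_ball : ball X.
Hypothesis Y_ball : ball Y.
Hypothesis X_Y_close : forall i, idx_dom i -> Rabs (X i - Y i) <= M * shock_weight i.

Lemma close_1 (v : R) : Rabs v < eps ->
  Rabs (bX X v - bX Y v) <= M * wb /\ Rabs (thX X v - thX Y v) <= lam * M /\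
  Rabs (beX X v - beX Y v) <= lam * M /\
  Rabs (tpX X v - tpX Y v) <= lam * M /\ Rabs (xpX X v - xpX Y v) <= lam * M.
Proof.
  intros Hv. assert (H : forall c, Rabs (X (c, 0, v) - Y (c, 0, v)) <= M * shock_weight (c, 0, v)).
  { intros c. apply X_Y_close. split; auto. apply zero_in. }
  assert (Hl : delta * Rabs v <= lam).
  { apply Rle_trans with (delta * eps); [apply Rmult_le_compat_l; lra|lra]. }
  assert (Hm : M * (delta * Rabs v) <= M * lam) by (apply Rmult_le_compat_l; lra).
  assert (H1 := H Cb). assert (H2 := H Cth). assert (H3 := H Cbe). assert (H4 := H Ctp). assert (H5 := H Cxp).
  simpl in H1, H2, H3, H4, H5. unfold bX, thX, beX, tpX, xpX. repeat split; lra.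
Qed.

Lemma close_2 (u v : R) : square eps u v ->
  Rabs (nuX X u v - nuX Y u v) <= lam * M /\ Rabs (EX X u v - EX Y u v) <= M * wE /\
  Rabs (NX X u v - NX Y u v) <= M * wN.
Proof.
  intros Hv. assert (H : forall c, Rabs (X (c, u, v) - Y (c, u, v)) <= M * shock_weight (c, u, v)).
  { intros c. apply X_Y_close, Hv. }
  assert (H1 := H Cnu). assert (H2 := H CE). assert (H3 := H CN).
  simpl in H1, H2, H3. unfold nuX, EX, NX. repeat split; lra.
Qed.

(** In [thr] the difference of [b] carries [a * Rabs P], in [nur] the difference of [N] carries
    [a * Rabs g], both at most [kappa]. In the first bound the other terms are paid for by the slack
    [d * wb]; the amount [2 * kK1] left over is the part of [wb_large] reserved for the first
    step. *)
Lemma close_rates (v : R) : 0 <= v < eps ->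
  Rabs (thr X v - thr Y v) <= (k * wb - 2 * kK1) * M /\
  Rabs (nur X v - nur Y v) <= (B * wE + kappa * wN + kC2 * lam) * M /\
  Rabs (tpr X v - tpr Y v) <= k * delta * M /\
  Rabs (xpr X v - xpr Y v) <= k * delta * M.
Proof.
  intros Hv. assert (Hv' : Rabs v < eps) by (rewrite Rabs_pos_eq; lra). assert (B1 := B_ge_1).
  destruct (shock_square v Hv') as [S1 [S2 Ha]].
  destruct (close_1 v Hv') as [_ [T1 [T2 [T3 T4]]]].
  destruct (close_1 _ Ha) as [U1 [U2 [U3 _]]].
  destruct (close_2 _ _ S1) as [V1 [V2 V3]].
  assert (L : low_close X Y v v (lam * M)) by (repeat split; auto).
  assert (Hn : Rabs (n1X X v - n1X Y v) <= M * wE + a * (M * wN)).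
  { unfold n1X. replace (EX X v (a * v) + a * NX X v (a * v) - (EX Y v (a * v) + a * NX Y v (a * v)))
      with ((EX X v (a * v) - EX Y v (a * v)) + a * (NX X v (a * v) - NX Y v (a * v))) by ring.
    apply plus_bound; auto. rewrite Rabs_mult, (Rabs_pos_eq a) by lra. apply Rmult_le_compat_l; lra. }
  assert (R1 := thr_lip X Y v v _ X_ball Y_ball Hv Hv L).
  assert (R2 := nur_lip X Y v v _ X_ball Y_ball Hv Hv L).
  destruct (curve_rate_lip X Y v v _ X_ball Y_ball Hv Hv L) as [R3 R4].
  destruct (qX_C X v X_ball Hv) as [Cq _].
  assert (G1 := C11_bound _ _ _ _ _ Hg _ Cq). assert (G2 := g_small _ Cq).
  assert (MN : 0 <= M * wN) by (apply Rmult_le_pos; lra).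
  assert (ME : 0 <= M * wE) by (apply Rmult_le_pos; lra).
  assert (aMN : a * (M * wN) <= M * wN) by (rewrite <- (Rmult_1_l (M * wN)) at 2; apply Rmult_le_compat_r; lra).
  assert (Lm : (1 + B + 4 * B * A) * lam * M <= k * delta * M) by (apply Rmult_le_compat_r; lra).
  repeat split; try lra.
  - apply Rle_trans with (1 := R1).
    assert (kappa * Rabs (bX X (a * v) - bX Y (a * v)) <= kappa * (M * wb)) by (apply Rmult_le_compat_l; lra).
    assert (B * Rabs (n1X X v - n1X Y v) <= B * (M * wE + M * wN)) by (apply Rmult_le_compat_l; lra).
    assert (W : (B * (wE + wN) + kC2 * lam + 2 * kK1) * M <= d * wb * M) by (apply Rmult_le_compat_r; lra).
    assert (kappa * (M * wb) + d * wb * M = k * wb * M) by (unfold k, d; field). lra.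
  - apply Rle_trans with (1 := R2).
    assert (Rabs (g (qX X v)) * Rabs (n1X X v - n1X Y v) <= Rabs (g (qX X v)) * (M * wE + a * (M * wN)))
      by (apply Rmult_le_compat_l; [apply Rabs_pos|lra]).
    assert (Rabs (g (qX X v)) * (M * wE) <= B * (M * wE)) by (apply Rmult_le_compat_r; lra).
    assert (a * Rabs (g (qX X v)) * (M * wN) <= kappa * (M * wN)) by (apply Rmult_le_compat_r; lra).
    lra.
Qed.

(** [GX] involves components of weight [lam] only, so its difference is small. [GvX] also involves
    the highest derivatives and has no small factor, but it enters [shock_step] only under integrals
    of length at most [eps]. *)
Lemma close_hodo (u v : R) : square eps u v ->
  Rabs (GX X u v - GX Y u v) <= kC3 * lam * M /\ Rabs (GvX X u v - GvX Y u v) <= kC4 * T * M.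
Proof.
  intros Huv. assert (Hvu := square_swap _ _ _ Huv). destruct constants_nonneg as [_ [_ [_ [_ [_ [_ HA]]]]]].
  destruct (close_1 u (proj1 Huv)) as [P1 [P2 [P3 _]]]. destruct (close_1 v (proj2 Huv)) as [Q1 [Q2 [Q3 _]]].
  destruct (close_2 u v Huv) as [R1 [R2 R3]]. destruct (close_2 v u Hvu) as [R1' [R2' R3']].
  destruct (ball_bounds X u X_ball (proj1 Huv)) as [F1 [_ [F2 [F3 _]]]].
  destruct (ball_bounds X v X_ball (proj2 Huv)) as [G1 [_ [G2 [G3 _]]]].
  destruct (ball_bounds Y u Y_ball (proj1 Huv)) as [F1' [_ [F2' [F3' _]]]].
  destruct (ball_bounds Y v Y_ball (proj2 Huv)) as [G1' [_ [G2' [G3' _]]]].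
  destruct (ball_bounds_2 X u v X_ball Huv) as [_ [J1 [J2 J3]]].
  destruct (ball_bounds_2 X v u X_ball Hvu) as [_ [K1' [K2 K3']]].
  destruct (ball_bounds_2 Y u v Y_ball Huv) as [_ [J1' [J2' J3']]].
  destruct (ball_bounds_2 Y v u Y_ball Hvu) as [_ [L1 [L2 L3]]].
  split.
  - rewrite Rmult_assoc. apply hodo_lip; auto.
  - rewrite Rmult_assoc.
    assert (lam * M <= T * M) by (apply Rmult_le_compat_r; lra).
    assert (M * wb <= T * M) by (rewrite Rmult_comm; apply Rmult_le_compat_r; lra).
    assert (M * wE <= T * M) by (rewrite Rmult_comm; apply Rmult_le_compat_r; lra).
    assert (M * wN <= T * M) by (rewrite Rmult_comm; apply Rmult_le_compat_r; lra).
    apply hodo_v_lip; auto; lra.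
Qed.

(** Each component is a sum of terms of three kinds: highest derivatives with coefficient at most
    [kappa] or already dominated by the weight being estimated, lower order terms small by [lam],
    and integrals small by [eps]. *)
Lemma step_contraction (i : component * R * R) :
  idx_dom i -> Rabs (shock_step X i - shock_step Y i) <= k * M * shock_weight i.
Proof.
  destruct i as [[c u] v]. intros Huv. destruct constants_nonneg as [_ [HK1 [HC3 [HK3 [HC4 [HBA HA]]]]]].
  assert (B1 := B_ge_1). destruct k_bounds as [d0 [dk [k1 kd]]]. assert (HC2 := kC2_nonneg).
  assert (Hu := proj1 Huv). assert (Hv := proj2 Huv). assert (Z := zero_in).
  assert (R1 := fun s H => close_rates (clamp s) (proj1 (proj2 (clamp_bounds s)) H)).
  assert (CX1 := fun s H => proj1 (rates_continuous X s X_regular X_ball H)).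
  assert (CY1 := fun s H => proj1 (rates_continuous Y s Y_regular Y_ball H)).
  assert (CX2 := fun s H => proj1 (proj2 (rates_continuous X s X_regular X_ball H))).
  assert (CY2 := fun s H => proj1 (proj2 (rates_continuous Y s Y_regular Y_ball H))).
  assert (CX3 := fun s H => proj1 (proj2 (proj2 (rates_continuous X s X_regular X_ball H)))).
  assert (CY3 := fun s H => proj1 (proj2 (proj2 (rates_continuous Y s Y_regular Y_ball H)))).
  assert (CX4 := fun s H => proj2 (proj2 (proj2 (rates_continuous X s X_regular X_ball H)))).
  assert (CY4 := fun s H => proj2 (proj2 (proj2 (rates_continuous Y s Y_regular Y_ball H)))).
  assert (Hth : forall s, Rabs s < eps -> Rabs (th_next X s - th_next Y s) <= k * lam * M).
  { intros s Hs. unfold th_next.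
    match goal with |- Rabs (?x + ?y - (?x + ?z)) <= _ => replace (x + y - (x + z)) with (y - z) by ring end.
    eapply Rle_trans.
    - apply (RInt_diff_bound _ _ eps s _ CX1 CY1 (fun x H => proj1 (R1 x H)) Hs).
    - assert (W : (k * wb - 2 * kK1) * M <= wb * M).
      { apply Rmult_le_compat_r; [lra|]. assert (k * wb <= 1 * wb) by (apply Rmult_le_compat_r; lra). lra. }
      apply Rle_trans with (wb * M * eps).
      + apply Rmult_le_compat; try lra; [|apply Rabs_pos].
        eapply Rle_trans; [apply Rabs_pos|apply (proj1 (R1 0 Z))].
      + assert (eps * (wb + 2 * kK1) * M <= d * lam * M) by (apply Rmult_le_compat_r; lra).
        assert (0 <= eps * kK1 * M) by (apply Rmult_le_pos; [apply Rmult_le_pos|]; lra).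
        assert (d * lam * M <= k * lam * M) by (apply Rmult_le_compat_r; [lra|apply Rmult_le_compat_r; lra]).
        lra. }
  assert (Cn : forall Z0, regular_state Z0 -> ball Z0 -> forall s, Rabs s < eps -> continuous (th_next Z0) s).
  { intros Z0 HZ HB s Hs.
    exact (is_derive_continuous _ _ _ (proj1 (proj2 (proj1 (step_regular Z0 HZ HB) s Hs)))). }
  assert (GcX : forall u v, square eps u v -> continuous (fun s => GX X s v) u).
  { intros x y Hxy. apply (continuity_2d_section (GX X) x y). apply (hodo_regular X X_regular X_ball); auto. }
  assert (GcY : forall u v, square eps u v -> continuous (fun s => GX Y s v) u).
  { intros x y Hxy. apply (continuity_2d_section (GX Y) x y). apply (hodo_regular Y Y_regular Y_ball); auto. }
  assert (HcX : forall u v, square eps u v -> continuous (fun s => GvX X s v) u).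
  { intros x y Hxy. apply (continuity_2d_section (GvX X) x y). apply (hodo_regular X X_regular X_ball); auto. }
  assert (HcY : forall u v, square eps u v -> continuous (fun s => GvX Y s v) u).
  { intros x y Hxy. apply (continuity_2d_section (GvX Y) x y). apply (hodo_regular Y Y_regular Y_ball); auto. }
  assert (IG : forall u, Rabs u < eps ->
     Rabs (RInt (fun s => GX X s v) 0 u - RInt (fun s => GX Y s v) 0 u) <= eps * (kC3 * lam * M)).
  { intros x Hx. eapply Rle_trans.
    - apply (RInt_diff_bound _ _ eps x (kC3 * lam * M)); auto;
        [intros s Hs; apply GcX|intros s Hs; apply GcY|intros s Hs; apply close_hodo]; split; auto.
    - rewrite Rmult_comm. apply Rmult_le_compat_r; [|lra]. apply Rmult_le_pos; [apply Rmult_le_pos|]; lra. }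
  assert (IH : forall u, Rabs u < eps ->
     Rabs (RInt (fun s => GvX X s v) 0 u - RInt (fun s => GvX Y s v) 0 u) <= eps * (kC4 * T * M)).
  { intros x Hx. eapply Rle_trans.
    - apply (RInt_diff_bound _ _ eps x (kC4 * T * M)); auto;
        [intros s Hs; apply HcX|intros s Hs; apply HcY|intros s Hs; apply close_hodo]; split; auto.
    - rewrite Rmult_comm. apply Rmult_le_compat_r; [|lra]. apply Rmult_le_pos; [apply Rmult_le_pos|]; lra. }
  destruct (shock_square v Hv) as [_ [Sv Hav]].
  assert (Hnur : 0 <= (B * wE + kappa * wN + kC2 * lam) * M).
  { eapply Rle_trans; [apply Rabs_pos|apply (proj1 (proj2 (R1 0 Z)))]. }
  destruct c; simpl.
  - apply Rle_trans with (1 := proj1 (R1 v Hv)).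
    assert (0 <= kK1 * M) by (apply Rmult_le_pos; lra). lra.
  - apply Rle_trans with (1 := Hth v Hv). lra.
  - match goal with |- Rabs (?x + ?y - (?x + ?z)) <= _ => replace (x + y - (x + z)) with (y - z) by ring end.
    eapply Rle_trans; [apply (RInt_diff_bound _ _ eps v (k * lam * M)); auto|].
    apply Rle_trans with (k * lam * M * 1); [|lra]. apply Rmult_le_compat_l; [|lra].
    apply Rmult_le_pos; [apply Rmult_le_pos|]; lra.
  - eapply Rle_trans; [apply (RInt_diff_bound _ _ eps v (k * delta * M) CX3 CY3); auto|lra].
    intros x Hx; apply R1; auto.
  - eapply Rle_trans; [apply (RInt_diff_bound _ _ eps v (k * delta * M) CX4 CY4); auto|lra].
    intros x Hx; apply R1; auto.
  - match goal with |- Rabs (?x + ?y1 - ?y2 + ?y3 - (?x + ?z1 - ?z2 + ?z3)) <= _ =>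
      replace (x + y1 - y2 + y3 - (x + z1 - z2 + z3)) with ((y1 - z1) + (- (y2 - z2) + (y3 - z3))) by ring end.
    assert (E1 : Rabs (RInt (fun s => nur X (clamp s)) 0 v - RInt (fun s => nur Y (clamp s)) 0 v)
       <= eps * ((B * wE + kappa * wN + kC2 * lam) * M)).
    { eapply Rle_trans; [apply (RInt_diff_bound _ _ eps v ((B * wE + kappa * wN + kC2 * lam) * M) CX2 CY2); auto|].
      intros x Hx; apply (R1 x Hx). rewrite Rmult_comm. apply Rmult_le_compat_r; lra. }
    eapply Rle_trans.
    + apply plus_bound; [exact E1|]. apply plus_bound; [rewrite Rabs_Ropp; apply IG; auto|apply IG; auto].
    + assert (W := Rmult_le_compat_r M _ _ M_nonneg eps_nu).
      assert (0 <= eps * kK1 * M) by (apply Rmult_le_pos; [apply Rmult_le_pos|]; lra).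
      assert (0 <= eps * (B * (2 * A * A)) * M) by (apply Rmult_le_pos; [apply Rmult_le_pos|]; lra).
      assert (d * lam * M <= k * lam * M) by (apply Rmult_le_compat_r; [lra|apply Rmult_le_compat_r; lra]).
      assert (eps * (kappa * (wN * M)) <= eps * (1 * (wN * M))).
      { apply Rmult_le_compat_l; [lra|]. apply Rmult_le_compat_r; [apply Rmult_le_pos|]; lra. }
      lra.
  - apply Rle_trans with (1 := proj1 (close_hodo u v Huv)).
    assert (W := Rmult_le_compat_r M _ _ M_nonneg wE_large).
    assert (0 <= B * (2 * A * A) * M) by (apply Rmult_le_pos; lra).
    assert (d * wE * M <= k * wE * M) by (apply Rmult_le_compat_r; [lra|apply Rmult_le_compat_r; lra]). lra.
  - match goal with |- Rabs (?x1 - (a * ?x2 + ?x3) + ?x4 - (?y1 - (a * ?y2 + ?y3) + ?y4)) <= _ =>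
      replace (x1 - (a * x2 + x3) + x4 - (y1 - (a * y2 + y3) + y4))
      with ((x1 - y1) + (- (a * (x2 - y2)) + (- (x3 - y3) + (x4 - y4)))) by ring end.
    eapply Rle_trans.
    + apply plus_bound; [apply (R1 v Hv)|]. apply plus_bound; [rewrite Rabs_Ropp; eapply Rle_trans;
        [apply a_abs|apply close_hodo; auto]|]. apply plus_bound; [rewrite Rabs_Ropp; apply IH; auto|apply IH; auto].
    + assert (W := Rmult_le_compat_r M _ _ M_nonneg wN_large).
      assert (0 <= eps * kK3 * M) by (apply Rmult_le_pos; [apply Rmult_le_pos|]; lra).
      assert (0 <= B * (2 * A * A) * M) by (apply Rmult_le_pos; lra).
      assert (0 <= kK1 * M) by (apply Rmult_le_pos; lra).
      assert (kappa * wN * M + d * wN * M = k * wN * M) by (unfold k, d; field). lra.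
Qed.

End Contraction.

(** * The first step and the fixed point *)

Lemma start_ball : ball shock_start.
Proof.
  intros i Hi. rewrite Rminus_diag, Rabs_R0. destruct i as [[c u] v].
  assert (0 <= delta * Rabs v) by (apply Rmult_le_pos; [lra|apply Rabs_pos]).
  destruct c; simpl; lra.
Qed.

Lemma weight_nonneg (i : component * R * R) : idx_dom i -> 0 <= shock_weight i.
Proof. intros Hi. generalize (start_ball i Hi). rewrite Rminus_diag, Rabs_R0. auto. Qed.

(** With vanishing highest derivatives only the terms containing derivatives of the coefficients
    remain, whence [kK1]. The shock point of [shock_start] stays within $O(\varepsilon)$ of [q0], so
    its velocities stay that close to [tau0] and [xi0]. *)
Lemma start_rates (v : R) : 0 <= v < eps ->
  Rabs (thr shock_start v) <= 2 * kK1 /\ Rabs (nur shock_start v) <= kK1 /\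
  Rabs (tpr shock_start v - tau0) <= A * (B * (4 * A + B * A)) * eps /\
  Rabs (xpr shock_start v - xi0) <= A * (B * (4 * A + B * A)) * eps.
Proof.
  intros Hv. assert (B1 := B_ge_1). destruct (qX_C shock_start v start_ball Hv) as [Cq _].
  destruct (state_facts shock_start v start_ball Hv) as [_ [F2 [F3 [F4 _]]]].
  assert (Hn : n1X shock_start v = 0) by (unfold n1X, EX, NX; simpl; ring).
  assert (Hd : q4_dist (qX shock_start v) q0 <= (4 * A + B * A) * eps).
  { unfold q4_dist, qX, q0, beX, tpX, xpX; simpl. assert (Z := Rabs_pos nu0). assert (Z' := Rabs_pos th0).
    assert (HQ0 := C11_bound _ _ _ _ _ HQ _ q0_C).
    assert (E : forall x c, Rabs c <= x -> Rabs (c * v) <= x * eps).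
    { intros x c Hc. apply mult_bound; auto. rewrite Rabs_pos_eq; lra. }
    assert (E1 : Rabs (be0 + th0 * (a * v) - be0) <= A * eps).
    { replace (be0 + th0 * (a * v) - be0) with (th0 * a * v) by ring. apply E.
      rewrite Rabs_mult, Rmult_comm, (Rabs_pos_eq a) by lra.
      apply Rle_trans with (1 * Rabs th0); [apply Rmult_le_compat_r; lra|lra]. }
    assert (E2 : Rabs (be0 + th0 * v - be0) <= A * eps).
    { replace (be0 + th0 * v - be0) with (th0 * v) by ring. apply E. lra. }
    assert (E3 : Rabs (tau0 * v - 0) <= (2 * A) * eps).
    { rewrite Rminus_0_r. apply E. unfold tau0. apply mult_bound; [rewrite Rabs_pos_eq; lra|lra]. }
    assert (E4 : Rabs (xi0 * v - 0) <= (B * A) * eps).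
    { rewrite Rminus_0_r. apply E. unfold xi0. apply mult_bound; [auto|lra]. }
    lra. }
  assert (Hd2 : B * q4_dist (qX shock_start v) q0 <= B * ((4 * A + B * A) * eps)) by (apply Rmult_le_compat_l; lra).
  assert (Hnu : Rabs nu0 <= A) by (generalize (Rabs_pos th0); lra).
  repeat split.
  - eapply Rle_trans; [apply th_rate_bound; auto|]. rewrite Hn. unfold bX; simpl. rewrite Rabs_R0. lra.
  - eapply Rle_trans; [apply nu_rate_bound; auto|]. rewrite Hn, Rabs_R0. lra.
  - unfold tpr, tau0, nuX; simpl. rewrite <- g_origin at 1.
    replace ((a + g (qX shock_start v)) * nu0 - (g q0 + a) * nu0) with (nu0 * (g (qX shock_start v) - g q0)) by ring.
    rewrite !Rmult_assoc. apply mult_bound; auto.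
    eapply Rle_trans; [apply (C11_lip _ _ _ _ _ Hg); auto using q0_C|auto].
  - unfold xpr, xi0, nuX; simpl.
    replace (Q (qX shock_start v) * nu0 - Q q0 * nu0) with (nu0 * (Q (qX shock_start v) - Q q0)) by ring.
    rewrite !Rmult_assoc. apply mult_bound; auto.
    eapply Rle_trans; [apply (C11_lip _ _ _ _ _ HQ); auto using q0_C|auto].
Qed.

Lemma RInt_const_0 (c v : R) : RInt (fun _ => c) 0 v = c * v.
Proof. rewrite RInt_const. unfold scal; simpl; unfold mult; simpl. ring. Qed.

Lemma step_start (i : component * R * R) :
  idx_dom i -> Rabs (shock_step shock_start i - shock_start i) <= (1 - k) * shock_weight i.
Proof.
  destruct k_bounds as [d0 [dk [k1 kd]]]. rewrite kd.
  destruct i as [[c u] v]. intros Huv. destruct constants_nonneg as [_ [HK1 [HC3 [HK3 [HC4 [HBA HA]]]]]].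
  assert (B1 := B_ge_1). assert (HC2 := kC2_nonneg).
  assert (Hu := proj1 Huv). assert (Hv := proj2 Huv). assert (Z := zero_in).
  assert (R1 := fun s H => start_rates (clamp s) (proj1 (proj2 (clamp_bounds s)) H)).
  assert (C1' := fun s H => proj1 (rates_continuous shock_start s start_regular start_ball H)).
  assert (C2' := fun s H => proj1 (proj2 (rates_continuous shock_start s start_regular start_ball H))).
  assert (C3' := fun s H => proj1 (proj2 (proj2 (rates_continuous shock_start s start_regular start_ball H)))).
  assert (C4' := fun s H => proj2 (proj2 (proj2 (rates_continuous shock_start s start_regular start_ball H)))).
  assert (S1 := proj1 (step_regular shock_start start_regular start_ball)).
  assert (HG : forall x y, square eps x y -> Rabs (GX shock_start x y) <= B * (2 * A * A)).
  { intros x y [Hx Hy]. destruct (ball_bounds shock_start x start_ball Hx) as [_ [_ [T1 [T2 _]]]].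
    destruct (ball_bounds shock_start y start_ball Hy) as [_ [_ [T3 [T4 _]]]].
    apply hodo_bound; auto; apply ball_bounds_2; try apply start_ball; split; auto. }
  assert (HGv : forall x y, square eps x y -> Rabs (GvX shock_start x y) <= kK3).
  { intros x y [Hx Hy]. destruct (ball_bounds shock_start x start_ball Hx) as [_ [_ [T1 [T2 _]]]].
    destruct (ball_bounds shock_start y start_ball Hy) as [_ [_ [T3 [T4 _]]]].
    assert (Rabs nu0 <= T) by (generalize (Rabs_pos th0); lra).
    apply hodo_v_bound; auto; try lra; unfold bX, EX, NX; simpl; rewrite ?Rabs_R0; lra. }
  assert (HR := hodo_regular shock_start start_regular start_ball).
  assert (zc : forall x, Rabs x < eps -> continuous (fun _ : R => 0) x) by (intros; apply continuous_const).
  assert (I0 : forall (f : R -> R) x K, (forall s, Rabs s < eps -> continuous f s) ->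
     (forall s, Rabs s < eps -> Rabs (f s) <= K) -> Rabs x < eps -> Rabs (RInt f 0 x) <= K * eps).
  { intros f x K Hf HK Hx. replace (RInt f 0 x) with (RInt f 0 x - RInt (fun _ => 0) 0 x).
    - eapply Rle_trans; [apply (RInt_diff_bound f (fun _ => 0) eps x K); auto|].
      + intros s Hs. rewrite Rminus_0_r; auto.
      + apply Rmult_le_compat_l; [|lra]. eapply Rle_trans; [apply Rabs_pos|apply (HK 0 Z)].
    - rewrite RInt_const_0. ring. }
  assert (IG : forall x, Rabs x < eps -> Rabs (RInt (fun s => GX shock_start s v) 0 x) <= B * (2 * A * A) * eps).
  { intros x Hx. apply I0; auto.
    - intros s Hs. apply (continuity_2d_section (GX shock_start) s v), HR. split; auto.
    - intros s Hs. apply HG; split; auto. }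
  assert (IH : forall x, Rabs x < eps -> Rabs (RInt (fun s => GvX shock_start s v) 0 x) <= kK3 * eps).
  { intros x Hx. apply I0; auto.
    - intros s Hs. apply (continuity_2d_section (GvX shock_start) s v), HR. split; auto.
    - intros s Hs. apply HGv; split; auto. }
  assert (Hth : forall s, Rabs s < eps -> Rabs (th_next shock_start s - th0) <= d * lam).
  { intros s Hs. unfold th_next.
    rewrite Rplus_minus_l.
    eapply Rle_trans; [apply (I0 _ s (2 * kK1)); auto|].
    - intros x Hx. apply (R1 x Hx).
    - assert (0 <= eps * wb) by (apply Rmult_le_pos; lra). lra. }
  destruct (shock_square v Hv) as [_ [Sv Hav]].
  assert (Hdv : A * (B * (4 * A + B * A)) * eps * Rabs v <= d * (delta * Rabs v)).
  { replace (d * (delta * Rabs v)) with (d * delta * Rabs v) by ring.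
    apply Rmult_le_compat_r; [apply Rabs_pos|]. lra. }
  destruct c; simpl.
  - rewrite Rminus_0_r. apply Rle_trans with (1 := proj1 (R1 v Hv)).
    assert (0 <= B * (wE + wN)) by (apply Rmult_le_pos; lra).
    assert (0 <= kC2 * lam) by (apply Rmult_le_pos; lra). lra.
  - apply Hth; auto.
  - replace (be0 + RInt (th_next shock_start) 0 v - (be0 + th0 * v)) with (RInt (th_next shock_start) 0 v - RInt (fun _ => th0) 0 v)
      by (rewrite RInt_const_0; ring).
    eapply Rle_trans; [apply (RInt_diff_bound _ _ eps v (d * lam)); auto|].
    + intros x Hx. exact (is_derive_continuous _ _ _ (proj1 (proj2 (S1 x Hx)))).
    + intros; apply continuous_const.
    + apply Rle_trans with (d * lam * 1); [|lra]. apply Rmult_le_compat_l; [|lra]. apply Rmult_le_pos; lra.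
  - rewrite <- RInt_const_0. eapply Rle_trans; [apply (RInt_diff_bound _ _ eps v (A * (B * (4 * A + B * A)) * eps) C3'); auto|auto].
    + intros; apply continuous_const.
    + intros x Hx; apply (R1 x Hx).
  - rewrite <- RInt_const_0. eapply Rle_trans; [apply (RInt_diff_bound _ _ eps v (A * (B * (4 * A + B * A)) * eps) C4'); auto|auto].
    + intros; apply continuous_const.
    + intros x Hx; apply (R1 x Hx).
  - match goal with |- Rabs (?x + ?y1 - ?y2 + ?y3 - ?x) <= _ =>
      replace (x + y1 - y2 + y3 - x) with (y1 + (- y2 + y3)) by ring end.
    eapply Rle_trans.
    + apply plus_bound; [apply (I0 _ v kK1 C2'); auto; intros s Hs; apply (R1 s Hs)|].
      apply plus_bound; [rewrite Rabs_Ropp|]; apply IG; auto.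
    + assert (0 <= B * wE) by (apply Rmult_le_pos; lra).
      assert (0 <= kC2 * lam) by (apply Rmult_le_pos; lra).
      assert (0 <= kC3 * lam) by (apply Rmult_le_pos; lra).
      assert (0 <= eps * (B * wE + wN + kC2 * lam + 2 * kC3 * lam)) by (apply Rmult_le_pos; lra). lra.
  - rewrite Rminus_0_r. apply Rle_trans with (1 := HG u v Huv).
    assert (0 <= kC3 * lam) by (apply Rmult_le_pos; lra). lra.
  - match goal with |- Rabs (?x1 - (a * ?x2 + ?x3) + ?x4 - 0) <= _ =>
      replace (x1 - (a * x2 + x3) + x4 - 0) with (x1 + (- (a * x2) + (- x3 + x4))) by ring end.
    eapply Rle_trans.
    + apply plus_bound; [apply (R1 v Hv)|]. apply plus_bound; [rewrite Rabs_Ropp; eapply Rle_trans;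
        [apply a_abs|apply HG; auto]|]. apply plus_bound; [rewrite Rabs_Ropp|]; apply IH; auto.
    + assert (0 <= B * wE) by (apply Rmult_le_pos; lra).
      assert (0 <= kC2 * lam) by (apply Rmult_le_pos; lra).
      assert (0 <= kC3 * lam) by (apply Rmult_le_pos; lra).
      assert (0 <= eps * (kC4 * T)) by (apply Rmult_le_pos; [|apply Rmult_le_pos]; lra). lra.
Qed.

Lemma q_continuous_at_0 (X : state) : regular_state X -> ball X ->
  forall e, 0 < e -> exists dd, 0 < dd /\ forall s, 0 < s < dd -> s < eps /\ low_close X X s 0 e.
Proof.
  intros HX HB e He. destruct (low_close_locally X 0 e HX He zero_in) as [dd Hd].
  exists dd. split; [apply cond_pos|]. intros s Hs.
  destruct (Hd s) as [L [_ [_ Hs']]].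
  - change (Rabs (s + - 0) < dd). rewrite Rabs_pos_eq; lra.
  - rewrite !clamp_id in L by lra. rewrite Rabs_pos_eq in Hs' by lra. auto.
Qed.

(** For $s>0$ the shock point is off the apex, where the chain rule for the coefficients is
    available. The equations for [tp] and [xp], true at the fixed point, identify the velocity with
    [q_dot]. *)
Lemma q_chain (X : state) (f : q4 -> R) (Df : q4 -> q4 -> R) (s : R) :
  C11 C Co B f Df -> regular_state X -> ball X -> 0 < s < eps ->
  is_derive (tpX X) s (tpr X s) -> is_derive (xpX X) s (xpr X s) ->
  is_derive (fun s => f (qX X s)) s
    (Df (qX X s) (q_dot (qX X s) (thX X (a * s)) (thX X s) (nuX X s (a * s)))).
Proof.
  intros Hf [HX _] HB Hs Ht Hx. unfold qX.
  assert (Hs' : Rabs s < eps) by (rewrite Rabs_pos_eq; lra).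
  assert (Ha : Rabs (a * s) < eps) by (apply shock_square; auto).
  unfold q_dot.
  apply (C11_chain _ _ _ _ _ Hf (fun s => beX X (a * s)) (beX X) (tpX X) (xpX X)).
  - apply (is_derive_comp (beX X) (fun s => a * s)); [apply HX; auto|apply is_derive_linear].
  - apply HX; auto.
  - exact Ht.
  - exact Hx.
  - apply (qX_C X s HB); lra.
Qed.

(** The fixed point satisfies the shock relations in differentiated form. The defect of each
    relation has zero derivative for $v>0$ and vanishes at $0$, by [th_origin] for [th] and by
    [g_origin] for [nu]. *)
Lemma shock_iteration_fixpoint :
  exists (th b be tp xp : R -> R) (nu E N : R -> R -> R),
    (forall v, Rabs v < eps -> continuous b v /\ is_derive th v (b v) /\ is_derive be v (th v) /\
       Rabs (be v - be0) <= delta) /\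
    C1_square eps nu E N /\
    be 0 = be0 /\ th 0 = th0 /\ nu 0 0 = nu0 /\ tp 0 = 0 /\ xp 0 = 0 /\
    (forall u v, square eps u v -> E u v = - (r (be u + be v) * (th v * nu v u + th u * nu u v))) /\
    forall v, 0 <= v < eps -> let q := (be (a * v), be v, tp v, xp v) in
      C q /\ (0 < v -> Co q) /\
      is_derive tp v ((a + g q) * nu v (a * v)) /\ is_derive xp v (Q q * nu v (a * v)) /\
      th v = P q * th (a * v) + S q * nu v (a * v) /\ nu (a * v) v = g q * nu v (a * v).
Proof.
  destruct k_bounds as [d0 [dk [k1 kd]]]. assert (B1 := B_ge_1). assert (Z := zero_in).
  destruct (weighted_fixpoint (component * R * R) idx_dom shock_weight shock_step regular_state shock_start k)
    as [X [HX [HB HF]]].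
  - lra.
  - exact weight_nonneg.
  - exact start_regular.
  - exact step_regular.
  - exact step_start.
  - intros X Y M HM HX HY BX BY HXY i Hi. apply step_contraction; auto.
  - intros Xn X Hn Hl. apply (regular_closed Xn); auto.
  - exists (thX X), (bX X), (beX X), (tpX X), (xpX X), (nuX X), (EX X), (NX X).
    assert (F1 : forall c v, Rabs v < eps -> X (c, 0, v) = shock_step X (c, 0, v)).
    { intros c v Hv. symmetry. apply HF. split; auto. }
    assert (F2 : forall c u v, square eps u v -> X (c, u, v) = shock_step X (c, u, v)).
    { intros c u v Hv. symmetry. apply HF. auto. }
    assert (R1 := fun s H => proj1 (rates_continuous X s HX HB H)).
    assert (R2 := fun s H => proj1 (proj2 (rates_continuous X s HX HB H))).
    assert (R3 := fun s H => proj1 (proj2 (proj2 (rates_continuous X s HX HB H)))).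
    assert (R4 := fun s H => proj2 (proj2 (proj2 (rates_continuous X s HX HB H)))).
    assert (V0 : thX X 0 = th0 /\ beX X 0 = be0 /\ tpX X 0 = 0 /\ xpX X 0 = 0 /\ nuX X 0 0 = nu0).
    { unfold thX, beX, tpX, xpX, nuX. rewrite !F1 by auto. simpl.
      unfold th_next. rewrite !Rmult_0_r, !RInt_point. unfold zero; simpl. repeat split; ring. }
    destruct V0 as [V1 [V2 [V3 [V4 V5]]]].
    assert (Dtp : forall v, 0 <= v < eps -> is_derive (tpX X) v (tpr X v)).
    { intros v Hv. assert (Hv' : Rabs v < eps) by (rewrite Rabs_pos_eq; lra).
      apply (is_derive_ext_loc (fun v => RInt (fun s => tpr X (clamp s)) 0 v)).
      - generalize (locally_abs_lt eps v Hv'). apply filter_imp. intros s Hs. symmetry. apply (F1 Ctp s Hs).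
      - replace (tpr X v) with (tpr X (clamp v)) by (rewrite clamp_id; [reflexivity|lra]).
        apply (RInt_interval_derive (fun s => tpr X (clamp s)) eps); auto. }
    assert (Dxp : forall v, 0 <= v < eps -> is_derive (xpX X) v (xpr X v)).
    { intros v Hv. assert (Hv' : Rabs v < eps) by (rewrite Rabs_pos_eq; lra).
      apply (is_derive_ext_loc (fun v => RInt (fun s => xpr X (clamp s)) 0 v)).
      - generalize (locally_abs_lt eps v Hv'). apply filter_imp. intros s Hs. symmetry. apply (F1 Cxp s Hs).
      - replace (xpr X v) with (xpr X (clamp v)) by (rewrite clamp_id; [reflexivity|lra]).
        apply (RInt_interval_derive (fun s => xpr X (clamp s)) eps); auto. }
    assert (Dnu1 : forall v, Rabs v < eps -> is_derive (fun s => nuX X s (a * s)) v (n1X X v)).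
    { intros v Hv. replace (n1X X v) with (EX X v (a * v) * 1 + NX X v (a * v) * a) by (unfold n1X; ring).
      apply (is_derive_curve (nuX X) (fun s => s) (fun s => a * s)).
      - apply (C1_square_differentiable eps _ _ _ (proj2 HX)). apply shock_square; auto.
      - apply @is_derive_id.
      - apply is_derive_linear. }
    (* At $u=av$ the two integrals of [GX] in the component [Cnu] cancel, which leaves [nu0] plus
       the integral of [nur]. *)
    assert (Dnu2 : forall v, 0 < v < eps -> is_derive (fun s => nuX X (a * s) s) v (nur X v)).
    { intros v Hv. assert (Hv' : Rabs v < eps) by (rewrite Rabs_pos_eq; lra).
      apply (is_derive_ext_loc (fun v => nu0 + RInt (fun s => nur X (clamp s)) 0 v)).
      - generalize (locally_abs_lt eps v Hv'). apply filter_imp. intros s Hs. unfold nuX.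
        rewrite F2 by (apply shock_square; auto). simpl. ring.
      - apply is_derive_const_plus. replace (nur X v) with (nur X (clamp v)) by (rewrite clamp_id; [reflexivity|lra]).
        apply (RInt_interval_derive (fun s => nur X (clamp s)) eps); auto. }
    assert (Q0 : qX X 0 = q0) by (unfold qX; rewrite Rmult_0_r, V2, V3, V4; reflexivity).
    assert (St : forall v, 0 <= v < eps ->
      C (qX X v) /\ Rabs (thX X (a * v)) <= A /\ Rabs (nuX X v (a * v)) <= A).
    { intros v Hv. destruct (state_facts X v HB Hv) as [G1 [G2 [_ [G3 _]]]]. auto. }
    assert (Cc : forall f Df (y : R -> R) s e, C11 C Co B f Df -> 0 < s < eps ->
       low_close X X s 0 e -> Rabs (y 0) <= A -> Rabs (y s - y 0) <= e ->
       Rabs (f (qX X s) * y s - f (qX X 0) * y 0) <= B * e + 4 * B * A * e).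
    { intros f Df y s e Hf Hs HL Hy0 Hys. assert (Hq := low_close_dist _ _ _ _ _ HL).
      assert (B * q4_dist (qX X s) (qX X 0) <= B * (4 * e)) by (apply Rmult_le_compat_l; lra).
      apply Rle_trans with (B * e + (B * (4 * e)) * A); [|lra].
      apply mult_diff_bound; auto.
      - apply (C11_bound _ _ _ _ _ Hf). apply St; lra.
      - eapply Rle_trans; [apply (C11_lip _ _ _ _ _ Hf); apply St; lra|auto]. }
    assert (KP : 0 < 1 + 2 * (B + 4 * B * A)).
    { assert (0 <= B * A) by (apply Rmult_le_pos; lra). lra. }
    assert (Hsm : forall e, 0 < e -> exists e', 0 < e' /\ e' + 2 * (B * e' + 4 * B * A * e') = e / 2 /\ e / 2 < e).
    { intros e He. exists (e / 2 / (1 + 2 * (B + 4 * B * A))). split; [apply Rdiv_lt_0_compat; lra|].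
      split; [field; lra|lra]. }
    assert (L0 : Rabs (nuX X 0 (a * 0)) <= A /\ Rabs (thX X (a * 0)) <= A /\ Rabs (nuX X (a * 0) 0) <= A).
    { split; [apply St; lra|]. split; [apply St; lra|]. apply ball_bounds_2; auto. apply shock_square; auto. }
    assert (E1 : forall v, 0 <= v < eps -> thX X v = P (qX X v) * thX X (a * v) + S (qX X v) * nuX X v (a * v)).
    { intros v Hv. apply Rminus_diag_uniq.
      rewrite (constant_of_zero_derive (fun v => thX X v - (P (qX X v) * thX X (a * v) + S (qX X v) * nuX X v (a * v))) eps); auto.
      - rewrite Q0, Rmult_0_r, V1, V5. lra.
      - intros s Hs. assert (Hs' : Rabs s < eps) by (rewrite Rabs_pos_eq; lra).
        evar_last.
        + apply @is_derive_minus; [exact (proj1 (proj2 (proj1 HX s Hs')))|]. apply @is_derive_plus.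
          * apply (is_derive_mult (fun v => P (qX X v)) (fun v => thX X (a * v))); [| |intros; apply Rmult_comm].
            -- apply (q_chain X P DP s HP HX HB Hs); [apply Dtp|apply Dxp]; lra.
            -- apply (is_derive_comp (thX X) (fun s => a * s)); [|apply is_derive_linear].
               exact (proj1 (proj2 (proj1 HX (a * s) (proj2 (proj2 (shock_square s Hs')))))).
          * apply (is_derive_mult (fun v => S (qX X v)) (fun v => nuX X v (a * v))); [| |intros; apply Rmult_comm].
            -- apply (q_chain X S DS s HS HX HB Hs); [apply Dtp|apply Dxp]; lra.
            -- apply Dnu1; auto.
        (* The fixed point equation of the component [Cb] says that [b] is [thr], exactly the
           derivative of the right-hand side. *)
        + unfold bX at 1. rewrite F1 by auto. simpl. rewrite clamp_id by lra.
          unfold thr, th_rate, minus, plus, opp, mult, scal; simpl; unfold mult; simpl. ring.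
      - intros e He. destruct (Hsm e He) as [e' [He' [Ee1 Ee2]]].
        destruct (q_continuous_at_0 X HX HB e' He') as [dd [Hdd Hd]]. exists dd; split; auto.
        intros s Hs. destruct (Hd s Hs) as [Hse HL]. assert (HL' := HL).
        destruct HL' as [_ [_ [_ [_ [L5 [L6 L7]]]]]].
        assert (M1 := Cc P DP (fun s => thX X (a * s)) s e' HP ltac:(lra) HL (proj1 (proj2 L0)) L5).
        assert (M2 := Cc S DS (fun s => nuX X s (a * s)) s e' HS ltac:(lra) HL (proj1 L0) L7).
        match goal with |- Rabs (?x1 - (?x2 + ?x3) - (?y1 - (?y2 + ?y3))) < _ =>
          replace (x1 - (x2 + x3) - (y1 - (y2 + y3))) with ((x1 - y1) + (- (x2 - y2) + - (x3 - y3))) by ring end.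
        eapply Rle_lt_trans; [apply plus_bound; [exact L6|apply plus_bound; rewrite Rabs_Ropp; eassumption]|]. lra. }
    assert (E2 : forall v, 0 <= v < eps -> nuX X (a * v) v = g (qX X v) * nuX X v (a * v)).
    { intros v Hv. apply Rminus_diag_uniq.
      rewrite (constant_of_zero_derive (fun v => nuX X (a * v) v - g (qX X v) * nuX X v (a * v)) eps); auto.
      - rewrite Q0, Rmult_0_r, V5, g_origin. ring.
      - intros s Hs. assert (Hs' : Rabs s < eps) by (rewrite Rabs_pos_eq; lra).
        evar_last.
        + apply @is_derive_minus; [apply Dnu2; auto|].
          apply (is_derive_mult (fun v => g (qX X v)) (fun v => nuX X v (a * v))); [| |intros; apply Rmult_comm].
          * apply (q_chain X g Dg s Hg HX HB Hs); [apply Dtp|apply Dxp]; lra.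
          * apply Dnu1; auto.
        + unfold nur, nu_rate, minus, plus, opp, mult; simpl. ring.
      - intros e He. destruct (Hsm e He) as [e' [He' [Ee1 Ee2]]].
        destruct (q_continuous_at_0 X HX HB e' He') as [dd [Hdd Hd]].
        (* [low_close] compares [nu] on the curve $(v,av)$ only; on the reflected curve $(av,v)$
           continuity has to be supplied separately. *)
        assert (Cn : continuous (fun s => nuX X (a * s) s) 0).
        { apply (continuity_2d_curve (nuX X) (fun s => a * s) (fun s => s)); auto using continuous_id, continuous_linear.
          apply (regular_nu X HX). apply shock_square; auto. }
        destruct (proj1 (continuous_eps _ _) Cn e' He') as [dd2 [Hdd2 Hd2]].
        exists (Rmin dd dd2); split; [apply Rmin_case; auto|].
        intros s Hs. assert (W1 := Rmin_l dd dd2). assert (W2 := Rmin_r dd dd2).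
        destruct (Hd s ltac:(lra)) as [Hse HL]. assert (HL' := HL).
        destruct HL' as [_ [_ [_ [_ [L5 [L6 L7]]]]]].
        assert (M2 := Cc g Dg (fun s => nuX X s (a * s)) s e' Hg ltac:(lra) HL (proj1 L0) L7).
        assert (M1 := Hd2 s ltac:(rewrite Rminus_0_r, Rabs_pos_eq; lra)).
        match goal with |- Rabs (?x1 - ?x2 - (?y1 - ?y2)) < _ =>
          replace (x1 - x2 - (y1 - y2)) with ((x1 - y1) + - (x2 - y2)) by ring end.
        eapply Rle_lt_trans; [apply plus_bound; [left; exact M1|rewrite Rabs_Ropp; eassumption]|].
        assert (0 <= B * A * e') by (apply Rmult_le_pos; [apply Rmult_le_pos|]; lra).
        assert (0 <= B * e') by (apply Rmult_le_pos; lra). lra. }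
    split; [|split; [|split; [|split; [|split; [|split; [|split; [|split]]]]]]]; auto.
    + intros v Hv. destruct (proj1 HX v Hv) as [W1 [W2 [W3 _]]]. repeat (split; auto).
      left. apply ball_bounds; auto.
    + apply HX.
    + intros u v Huv. unfold EX. rewrite F2 by auto. reflexivity.
    + intros v Hv q. destruct (qX_C X v HB Hv) as [W1 W2].
      split; [exact W1|]. split; [exact W2|]. split; [apply (Dtp v Hv)|]. split; [apply (Dxp v Hv)|].
      split; [apply (E1 v Hv)|apply (E2 v Hv)].
Qed.

End Weights.

(** The order of the choices matters: [A] from the data at the origin; then [wE], [wN], [wb], each
    large against the preceding ones; then [T]; then [lam] small against constants containing [T];
    and [eps] last. *)
Lemma shock_iteration_solution :
  exists eps, 0 < eps <= delta /\
  exists (th b be tp xp : R -> R) (nu E N : R -> R -> R),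
    (forall v, Rabs v < eps -> continuous b v /\ is_derive th v (b v) /\ is_derive be v (th v) /\
       Rabs (be v - be0) <= delta) /\
    C1_square eps nu E N /\
    be 0 = be0 /\ th 0 = th0 /\ nu 0 0 = nu0 /\ tp 0 = 0 /\ xp 0 = 0 /\
    (forall u v, square eps u v -> E u v = - (r (be u + be v) * (th v * nu v u + th u * nu u v))) /\
    forall v, 0 <= v < eps -> let q := (be (a * v), be v, tp v, xp v) in
      C q /\ (0 < v -> Co q) /\
      is_derive tp v ((a + g q) * nu v (a * v)) /\ is_derive xp v (Q q * nu v (a * v)) /\
      th v = P q * th (a * v) + S q * nu v (a * v) /\ nu (a * v) v = g q * nu v (a * v).
Proof.
  assert (B1 := B_ge_1).
  set (d := (1 - kappa) / 2). set (k := (1 + kappa) / 2).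
  assert (Hd : 0 < d /\ d <= k) by (unfold d, k; lra).
  set (A := Rabs th0 + Rabs nu0 + 1).
  assert (HA : 1 <= A) by (unfold A; generalize (Rabs_pos th0) (Rabs_pos nu0); lra).
  set (G0 := B * (2 * A * A)).
  assert (HAA : 0 <= A * A) by (apply Rmult_le_pos; lra).
  assert (HBA : 0 <= B * A) by (apply Rmult_le_pos; lra).
  assert (HG0 : 0 <= G0) by (unfold G0; apply Rmult_le_pos; lra).
  assert (HN : 0 <= kN1 A) by (unfold kN1; apply Rmult_le_pos; lra).
  assert (HK1 : 0 <= kK1 A) by (unfold kK1; apply Rmult_le_pos; [lra|apply Rmult_le_pos; lra]).
  assert (HC1 : 0 <= kC1 A).
  { unfold kC1. apply Rplus_le_le_0_compat; apply Rmult_le_pos; try lra. apply Rmult_le_pos; lra. }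
  assert (HC3 : 0 <= kC3 A).
  { unfold kC3. assert (0 <= B * A * A) by (apply Rmult_le_pos; lra). lra. }
  (* The summands $1$ and $3$ leave room for the terms with a factor [lam] or [eps], which are made
     at most $1$ below. *)
  set (wE := (G0 + 1) / d). set (wN := (B * wE + kK1 A + G0 + 3) / d).
  assert (HwE : 0 <= wE) by (apply Rdiv_le_0_compat; lra).
  assert (HBwE : 0 <= B * wE) by (apply Rmult_le_pos; lra).
  assert (HwN : 0 <= wN) by (apply Rdiv_le_0_compat; lra).
  set (wb := (B * (wE + wN) + 2 * kK1 A + 1) / d).
  assert (HBw : 0 <= B * (wE + wN)) by (apply Rmult_le_pos; lra).
  assert (Hwb : 0 <= wb) by (apply Rdiv_le_0_compat; lra).
  assert (EwE : d * wE = G0 + 1) by (unfold wE; field; lra).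
  assert (EwN : d * wN = B * wE + kK1 A + G0 + 3) by (unfold wN; field; lra).
  assert (Ewb : d * wb = B * (wE + wN) + 2 * kK1 A + 1) by (unfold wb; field; lra).
  clearbody wE wN wb.
  set (T := A + wb + wN + wE).
  assert (HT : 1 <= T) by (unfold T; lra).
  assert (HTT : 0 <= T * T) by (apply Rmult_le_pos; lra).
  assert (HTTT : 0 <= T * T * T) by (apply Rmult_le_pos; lra).
  assert (HC2 : 0 <= kC2 A T).
  { unfold kC2. assert (0 <= B * T) by (apply Rmult_le_pos; lra). lra. }
  assert (HC4 : 0 <= kC4 T) by (unfold kC4; apply Rmult_le_pos; lra).
  assert (HK3 : 0 <= kK3 T).
  { unfold kK3. assert (0 <= B * (T * T * T)) by (apply Rmult_le_pos; lra).
    assert (0 <= B * (T * T)) by (apply Rmult_le_pos; lra). lra. }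
  (* One number serves several conditions at once, being chosen for the sum of their constants. *)
  assert (small : forall K c, 0 <= K -> 0 < c -> exists e, 0 < e /\ forall K', 0 <= K' <= K -> e * K' <= c).
  { intros K c HK Hc. exists (c / (K + 1)). split; [apply Rdiv_lt_0_compat; lra|].
    intros K' HK'. apply Rle_trans with (c / (K + 1) * (K + 1)); [|right; field; lra].
    apply Rmult_le_compat_l; [left; apply Rdiv_lt_0_compat|]; lra. }
  assert (Hkd : 0 < k * delta) by (apply Rmult_lt_0_compat; lra).
  set (c1 := Rmin 1 (Rmin (k * delta) (delta / 2))).
  assert (Hc1 : 0 < c1 /\ c1 <= 1 /\ c1 <= k * delta /\ c1 <= delta / 2).
  { unfold c1. generalize (Rmin_l 1 (Rmin (k * delta) (delta / 2))) (Rmin_r 1 (Rmin (k * delta) (delta / 2)))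
      (Rmin_l (k * delta) (delta / 2)) (Rmin_r (k * delta) (delta / 2)).
    repeat split; try lra. repeat apply Rmin_case; lra. }
  destruct (small (1 + (kC2 A T + kC3 A) + (1 + B + 4 * B * A)) c1) as [lam [Hlam L]]; [lra|lra|].
  assert (L1 := L 1 ltac:(lra)). assert (L2 := L (kC2 A T + kC3 A) ltac:(lra)).
  assert (L3 := L (1 + B + 4 * B * A) ltac:(lra)). clear L.
  assert (L4 : 0 <= kC2 A T * lam) by (apply Rmult_le_pos; lra).
  assert (L5 : 0 <= kC3 A * lam) by (apply Rmult_le_pos; lra).
  set (c2 := Rmin (Rmin 1 (delta / 4)) (Rmin (d * lam) (Rmin (d * delta) lam))).
  assert (Hdl : 0 < d * lam) by (apply Rmult_lt_0_compat; lra).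
  assert (Hdd : 0 < d * delta) by (apply Rmult_lt_0_compat; lra).
  assert (Hc2 : 0 < c2 /\ c2 <= 1 /\ c2 <= delta / 4 /\ c2 <= d * lam /\ c2 <= d * delta /\ c2 <= lam).
  { unfold c2. generalize (Rmin_l (Rmin 1 (delta / 4)) (Rmin (d * lam) (Rmin (d * delta) lam)))
     (Rmin_r (Rmin 1 (delta / 4)) (Rmin (d * lam) (Rmin (d * delta) lam)))
     (Rmin_l 1 (delta / 4)) (Rmin_r 1 (delta / 4)) (Rmin_l (d * lam) (Rmin (d * delta) lam))
     (Rmin_r (d * lam) (Rmin (d * delta) lam)) (Rmin_l (d * delta) lam) (Rmin_r (d * delta) lam).
    repeat split; try lra. repeat apply Rmin_case; lra. }
  set (k1 := 2 * (kC4 T * T + kK3 T)). set (k2 := wb + 2 * kK1 A).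
  set (k3 := B * wE + wN + kC2 A T * lam + 2 * kC3 A * lam + kK1 A + 2 * G0).
  set (k4 := A * (B * (4 * A + B * A))).
  assert (Hk1 : 0 <= k1) by (unfold k1; assert (0 <= kC4 T * T) by (apply Rmult_le_pos; lra); lra).
  assert (Hk2 : 0 <= k2) by (unfold k2; lra).
  assert (Hk3 : 0 <= k3) by (unfold k3; lra).
  assert (Hk4 : 0 <= k4) by (unfold k4; apply Rmult_le_pos; [lra|apply Rmult_le_pos; lra]).
  assert (Hth := Rabs_pos th0).
  destruct (small (1 + delta + Rabs th0 + k1 + k2 + k3 + k4) c2) as [eps [Heps L]]; [lra|lra|].
  assert (M1 := L 1 ltac:(lra)). assert (M2 := L delta ltac:(lra)). assert (M3 := L (Rabs th0) ltac:(lra)).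
  assert (M4 := L k1 ltac:(lra)). assert (M5 := L k2 ltac:(lra)). assert (M6 := L k3 ltac:(lra)).
  assert (M7 := L k4 ltac:(lra)). clear L.
  exists eps. split; [lra|].
  apply (shock_iteration_fixpoint A T) with wb wN wE lam; fold d k G0; try lra.
  - unfold T; lra.
  - unfold A; lra.
  - unfold T; lra.
  - unfold k1 in M4. lra.
  - unfold k2 in M5. lra.
  - unfold k3 in M6. lra.
  - unfold k4 in M7. lra.
Qed.

End ShockIteration.

(** * Thermodynamic functions *)

(** Derivatives are witnesses, so that closure under arithmetic and composition is an induction on
    [k] with the derivative formula as the witness. *)
Fixpoint smooth1 (k : nat) (D : R -> Prop) (f : R -> R) : Prop :=
  match k with
  | O => forall x, D x -> continuous f x
  | S k' => exists g, (forall x, D x -> is_derive f x (g x)) /\ smooth1 k' D g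
  end.

Lemma smooth1_continuous (k : nat) (D : R -> Prop) (f : R -> R) :
  smooth1 k D f -> forall x, D x -> continuous f x.
Proof.
  destruct k; [auto|]. intros [g [Hg _]] x Hx. exact (is_derive_continuous _ _ _ (Hg x Hx)).
Qed.

Lemma smooth1_pred (k : nat) (D : R -> Prop) : forall f, smooth1 (S k) D f -> smooth1 k D f.
Proof.
  induction k; intros f H.
  - exact (smooth1_continuous 1 D f H).
  - destruct H as [g [Hg H]]. exists g. split; auto.
Qed.

Lemma smooth1_const (k : nat) (D : R -> Prop) (c : R) : smooth1 k D (fun _ => c).
Proof.
  revert c. induction k; intros c.
  - intros x _. apply continuous_const.
  - exists (fun _ => 0). split; [|apply IHk]. intros x _. exact (is_derive_const c x).
Qed.

Lemma smooth1_id (k : nat) (D : R -> Prop) : smooth1 k D (fun x => x).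
Proof.
  destruct k.
  - intros x _. apply continuous_id.
  - exists (fun _ => 1). split; [|apply smooth1_const]. intros x _. exact (is_derive_id x).
Qed.

Lemma smooth1_plus (k : nat) (D : R -> Prop) : forall f g,
  smooth1 k D f -> smooth1 k D g -> smooth1 k D (fun x => f x + g x).
Proof.
  induction k; intros f g Hf Hg.
  - intros x Hx. apply (@continuous_plus R_UniformSpace R_AbsRing R_NormedModule); auto.
  - destruct Hf as [f' [Hf Hf']], Hg as [g' [Hg Hg']]. exists (fun x => f' x + g' x). split; auto.
    intros x Hx. apply @is_derive_plus; auto.
Qed.

Lemma smooth1_mult (k : nat) (D : R -> Prop) : forall f g,
  smooth1 k D f -> smooth1 k D g -> smooth1 k D (fun x => f x * g x).
Proof.
  induction k; intros f g Hf Hg.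
  - intros x Hx. apply (@continuous_mult R_UniformSpace R_AbsRing); auto.
  - assert (Hfp := smooth1_pred _ _ _ Hf). assert (Hgp := smooth1_pred _ _ _ Hg).
    destruct Hf as [f' [Hf Hf']], Hg as [g' [Hg Hg']]. exists (fun x => f' x * g x + f x * g' x). split.
    + intros x Hx. apply (is_derive_mult f g); auto. intros; apply Rmult_comm.
    + apply smooth1_plus; apply IHk; auto.
Qed.

Lemma smooth1_comp (k : nat) (D D' : R -> Prop) : forall f h,
  smooth1 k D' f -> smooth1 k D h -> (forall x, D x -> D' (h x)) -> smooth1 k D (fun x => f (h x)).
Proof.
  induction k; intros f h Hf Hh HD.
  - intros x Hx. apply (continuous_comp h f); auto.
  - assert (Hhp := smooth1_pred _ _ _ Hh).
    destruct Hf as [f' [Hf Hf']], Hh as [h' [Hh Hh']]. exists (fun x => h' x * f' (h x)). split.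
    + intros x Hx. apply (is_derive_comp f h); auto.
    + apply smooth1_mult; auto.
Qed.

Lemma smooth1_inv (k : nat) (D : R -> Prop) : forall f,
  smooth1 k D f -> (forall x, D x -> f x <> 0) -> smooth1 k D (fun x => / f x).
Proof.
  induction k; intros f Hf H0.
  - intros x Hx. apply continuous_comp; [auto|]. apply continuous_pt, continuity_pt_filterlim.
    apply (filterlim_Rbar_inv (f x)). intros E; injection E; apply H0; auto.
  - assert (Hfp := smooth1_pred _ _ _ Hf). destruct Hf as [f' [Hf Hf']].
    exists (fun x => - 1 * f' x * (/ f x * / f x)). split.
    + intros x Hx. evar_last; [apply is_derive_inv; auto|]. specialize (H0 x Hx). field. auto.
    + apply smooth1_mult; apply smooth1_mult; auto using smooth1_const.
Qed.

Lemma smooth1_div (k : nat) (D : R -> Prop) (f g : R -> R) :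
  smooth1 k D f -> smooth1 k D g -> (forall x, D x -> g x <> 0) -> smooth1 k D (fun x => f x / g x).
Proof. intros Hf Hg H0. apply smooth1_mult; auto. apply smooth1_inv; auto. Qed.

Lemma smooth1_sqrt (k : nat) (D : R -> Prop) : forall f,
  smooth1 k D f -> (forall x, D x -> 0 < f x) -> smooth1 k D (fun x => sqrt (f x)).
Proof.
  induction k; intros f Hf H0.
  - intros x Hx. apply (continuous_comp f sqrt); auto. apply continuous_sqrt.
  - assert (Hfp := smooth1_pred _ _ _ Hf). destruct Hf as [f' [Hf Hf']].
    exists (fun x => f' x / (2 * sqrt (f x))). split.
    + intros x Hx. apply is_derive_sqrt; auto.
    + apply smooth1_div; auto.
      * apply smooth1_mult; auto using smooth1_const.
      * intros x Hx. specialize (H0 x Hx). assert (0 < sqrt (f x)) by (apply sqrt_lt_R0; auto). lra.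
Qed.

Lemma smooth1_ext (k : nat) (D : R -> Prop) (f g : R -> R) :
  (forall x, D x -> locally x D) -> (forall x, D x -> f x = g x) -> smooth1 k D f -> smooth1 k D g.
Proof.
  intros HD E. destruct k.
  - intros H x Hx. apply (continuous_ext_loc g f); auto.
    generalize (HD x Hx). apply filter_imp. auto.
  - intros [f' [Hf Hf']]. exists f'. split; auto.
    intros x Hx. apply (is_derive_ext_loc f g); auto. generalize (HD x Hx). apply filter_imp. auto.
Qed.

Section Thermodynamics.

Variables (p : R -> R) (rref : R).
Hypothesis p_smooth : forall (n : nat) (r : R), 0 < r -> ex_derive_n p n r.
Hypothesis dp_pos : forall r : R, 0 < r -> 0 < Derive p r.
Hypothesis rref_pos : 0 < rref.

Let positive (r : R) : Prop := 0 < r.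

Lemma positive_locally (r : R) : positive r -> locally r positive.
Proof. intros H. apply (open_gt 0). exact H. Qed.

Lemma smooth1_p (k n : nat) : smooth1 k positive (Derive_n p n).
Proof.
  revert n. induction k; intros n.
  - intros x Hx. apply @ex_derive_continuous. exact (p_smooth (S n) x Hx).
  - exists (Derive_n p (S n)). split; auto. intros x Hx. apply Derive_correct. exact (p_smooth (S n) x Hx).
Qed.

Lemma smooth1_eta (k : nat) : smooth1 k positive (eta p).
Proof. apply smooth1_sqrt; [apply (smooth1_p k 1)|exact dp_pos]. Qed.

Lemma eta_pos (r : R) : 0 < r -> 0 < eta p r.
Proof. intros Hr. apply sqrt_lt_R0, dp_pos, Hr. Qed.

Lemma eta_sqr (r : R) : 0 < r -> eta p r * eta p r = Derive p r.
Proof. intros Hr. apply sqrt_sqrt. left. apply dp_pos, Hr. Qed.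

Let Fe := enthalpy_integral p rref.

Lemma smooth1_eta_over (k : nat) : smooth1 k positive (fun r => eta p r / r).
Proof.
  apply smooth1_div; [apply smooth1_eta|apply smooth1_id|]. unfold positive. intros; lra.
Qed.

Lemma enthalpy_derive (r : R) : 0 < r -> is_derive Fe r (eta p r / r).
Proof.
  intros Hr. apply (@is_derive_RInt R_NormedModule (fun r => eta p r / r) Fe rref r).
  - generalize (positive_locally r Hr). apply filter_imp. intros y Hy.
    apply (@RInt_correct R_CompleteNormedModule), @ex_RInt_continuous. intros z Hz.
    apply (smooth1_eta_over 0). unfold positive in *. revert Hz. apply Rmin_case; lra.
  - apply (smooth1_eta_over 0). exact Hr.
Qed.

Lemma enthalpy_increasing (r s : R) : 0 < r -> r < s -> Fe r < Fe s.
Proof.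
  intros Hr Hs. destruct (MVT_gen Fe r s (fun r => eta p r / r)) as [c [Hc E]].
  - intros x Hx. rewrite Rmin_left, Rmax_right in Hx by lra. apply enthalpy_derive; lra.
  - intros x Hx. rewrite Rmin_left, Rmax_right in Hx by lra.
    apply continuous_pt. exact (is_derive_continuous _ _ _ (enthalpy_derive x ltac:(lra))).
  - rewrite Rmin_left, Rmax_right in Hc by lra.
    assert (0 < eta p c / c) by (apply Rdiv_lt_0_compat; [apply eta_pos|]; lra).
    assert (0 < eta p c / c * (s - r)) by (apply Rmult_lt_0_compat; lra). lra.
Qed.

Lemma enthalpy_injective (r s : R) : 0 < r -> 0 < s -> Fe r = Fe s -> r = s.
Proof.
  intros Hr Hs E. destruct (Rtotal_order r s) as [L|[L|L]]; auto;
    [generalize (enthalpy_increasing r s Hr L)|generalize (enthalpy_increasing s r Hs L)]; lra.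
Qed.

Lemma has_density_iff (al be r : R) :
  has_density p rref al be r <-> 0 < r /\ Fe r = (al + be) / 2.
Proof.
  unfold has_density, alpha_of, beta_of, w_of. fold Fe. split.
  - intros [H1 [H2 H3]]; split; [auto|lra].
  - intros [H1 H2]; repeat split; auto; rewrite H2; field.
Qed.

(** Strict monotonicity of the enthalpy integral makes the density unique, and uniqueness is what
    gives [iota] its meaning. *)
Lemma rho_of_enthalpy (al be r : R) : 0 < r -> Fe r = (al + be) / 2 -> rho_of p rref al be = r.
Proof.
  intros Hr E.
  assert (H : has_density p rref al be (rho_of p rref al be)).
  { apply (iota_correct (has_density p rref al be)). exists r. split; [apply has_density_iff; auto|].
    intros s Hs. apply has_density_iff in Hs. destruct Hs as [Hs1 Hs2].
    apply enthalpy_injective; auto. congruence. }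
  apply has_density_iff in H. destruct H as [H1 H2]. apply enthalpy_injective; auto. congruence.
Qed.

Lemma rho_of_state (r w : R) : 0 < r -> rho_of p rref (alpha_of p rref r w) (beta_of p rref r w) = r.
Proof. intros Hr. apply rho_of_enthalpy; auto. unfold alpha_of, beta_of. fold Fe. field. Qed.

Lemma w_of_state (r w : R) : w_of (alpha_of p rref r w) (beta_of p rref r w) = w.
Proof. unfold w_of, alpha_of, beta_of. field. Qed.

(** Density as a function of [s = (alpha + beta) / 2]. *)
Definition density (s : R) : R := rho_of p rref s s.
Definition enthalpy_range (s : R) : Prop := exists r, 0 < r /\ Fe r = s.

Lemma density_enthalpy (r : R) : 0 < r -> density (Fe r) = r.
Proof. intros Hr. apply rho_of_enthalpy; auto. field. Qed.

Lemma density_spec (s : R) : enthalpy_range s -> 0 < density s /\ Fe (density s) = s.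
Proof. intros [r [Hr <-]]. rewrite density_enthalpy; auto. Qed.

Lemma rho_of_density (al be : R) : enthalpy_range ((al + be) / 2) ->
  rho_of p rref al be = density ((al + be) / 2).
Proof. intros H. destruct (density_spec _ H). apply rho_of_enthalpy; auto. Qed.

Lemma enthalpy_range_between (r1 r2 s : R) :
  0 < r1 -> r1 < r2 -> Fe r1 <= s <= Fe r2 -> exists r, r1 <= r <= r2 /\ Fe r = s.
Proof.
  intros H1 H2 [[Ha|Ha] [Hb|Hb]]; try (exists r1; split; [lra|auto]; fail); try (exists r2; split; [lra|auto]; fail).
  destruct (IVT_interv (fun r => Fe r - s) r1 r2) as [z [Hz E]]; try lra.
  - intros x Hx. apply continuous_pt. apply (@continuous_minus R_UniformSpace R_AbsRing R_NormedModule).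
    + exact (is_derive_continuous _ _ _ (enthalpy_derive x ltac:(lra))).
    + apply continuous_const.
  - exists z. split; auto. lra.
Qed.

Lemma enthalpy_range_locally (s : R) : enthalpy_range s -> locally s enthalpy_range.
Proof.
  intros [r [Hr <-]].
  assert (H1 := enthalpy_increasing (r / 2) r ltac:(lra) ltac:(lra)).
  assert (H2 := enthalpy_increasing r (2 * r) ltac:(lra) ltac:(lra)).
  assert (Hp : 0 < Rmin (Fe r - Fe (r / 2)) (Fe (2 * r) - Fe r)) by (apply Rmin_case; lra).
  exists (mkposreal _ Hp). intros y Hy. change (Rabs (y - Fe r) < Rmin (Fe r - Fe (r / 2)) (Fe (2 * r) - Fe r)) in Hy.
  generalize (Rmin_l (Fe r - Fe (r / 2)) (Fe (2 * r) - Fe r)) (Rmin_r (Fe r - Fe (r / 2)) (Fe (2 * r) - Fe r)). intros.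
  destruct (enthalpy_range_between (r / 2) (2 * r) y) as [z [Hz E]]; try lra.
  - clear - Hy H H0. split_Rabs; lra.
  - exists z. split; [lra|auto].
Qed.

(** The inverse function rule on [[r / 2, 2 * r]], where the enthalpy integral is continuous and
    strictly increasing with derivative $\eta/\rho$. *)
Lemma density_derive (s : R) : enthalpy_range s ->
  is_derive density s (density s / eta p (density s)).
Proof.
  intros [r [Hr <-]]. rewrite density_enthalpy by auto.
  assert (H1 := enthalpy_increasing (r / 2) r ltac:(lra) ltac:(lra)).
  assert (H2 := enthalpy_increasing r (2 * r) ltac:(lra) ltac:(lra)).
  assert (HI : forall x, Fe (r / 2) <= x -> x <= Fe (2 * r) -> r / 2 <= density x <= 2 * r /\ Fe (density x) = x).
  { intros x Hx1 Hx2. destruct (enthalpy_range_between (r / 2) (2 * r) x) as [z [Hz <-]]; try lra.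
    rewrite density_enthalpy by lra. auto. }
  assert (Hc : forall x, r / 2 <= x <= 2 * r -> continuity_pt Fe x).
  { intros x Hx. apply continuous_pt. exact (is_derive_continuous _ _ _ (enthalpy_derive x ltac:(lra))). }
  assert (Prf : forall x, density (Fe (r / 2)) <= x <= density (Fe (2 * r)) -> derivable_pt Fe x).
  { intros x Hx. rewrite !density_enthalpy in Hx by lra.
    exists (eta p x / x). apply is_derive_Reals, enthalpy_derive. lra. }
  assert (Prg : density (Fe (r / 2)) <= density (Fe r) <= density (Fe (2 * r))) by (rewrite !density_enthalpy by lra; lra).
  assert (He := eta_pos r Hr).
  assert (Ed : derive_pt Fe (density (Fe r)) (Prf _ Prg) = eta p r / r).
  { apply derive_pt_eq_0. rewrite density_enthalpy by auto. apply is_derive_Reals, enthalpy_derive, Hr. }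
  apply is_derive_Reals. replace (r / eta p r) with (1 / derive_pt Fe (density (Fe r)) (Prf _ Prg))
    by (rewrite Ed; field; lra).
  apply derivable_pt_lim_recip_interv; try lra.
  - apply (continuity_pt_recip_interv Fe density (r / 2) (2 * r)); try lra; auto.
    + intros x y Hx Hxy Hy. apply enthalpy_increasing; lra.
    + intros x Hx1 Hx2. apply HI; auto.
    + intros x Hx1 Hx2. apply HI; auto.
  - intros x Hx. exact (proj2 (HI x (proj1 Hx) (proj2 Hx))).
  - rewrite Ed. assert (0 < eta p r / r) by (apply Rdiv_lt_0_compat; lra). lra.
Qed.

(** The equation $\rho'=\rho/\eta(\rho)$ bootstraps: its right-hand side is as smooth as the density
    is already known to be. *)
Lemma smooth1_density (k : nat) : smooth1 k enthalpy_range density.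
Proof.
  induction k.
  - intros s Hs. exact (is_derive_continuous _ _ _ (density_derive s Hs)).
  - exists (fun s => density s / eta p (density s)). split; [exact density_derive|].
    apply smooth1_div; auto.
    + apply (smooth1_comp k enthalpy_range positive); auto using smooth1_eta.
      intros x Hx. apply density_spec; auto.
    + intros x Hx. generalize (eta_pos (density x) (proj1 (density_spec x Hx))). lra.
Qed.

Definition sound_speed (s : R) : R := eta p (density s).

Lemma smooth1_sound_speed (k : nat) : smooth1 k enthalpy_range sound_speed.
Proof.
  apply (smooth1_comp k enthalpy_range positive (eta p) density); auto using smooth1_eta, smooth1_density.
  intros; apply density_spec; auto.
Qed.

Lemma sound_speed_pos (s : R) : enthalpy_range s -> 0 < sound_speed s.
Proof. intros Hs. apply eta_pos, density_spec, Hs. Qed.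

Lemma smooth1_enthalpy (k : nat) : smooth1 (S k) positive Fe.
Proof. exists (fun r => eta p r / r). split; [exact enthalpy_derive|apply smooth1_eta_over]. Qed.

End Thermodynamics.

(** * Functions with Lipschitz derivatives near the origin of the shock *)

Definition box (x0 y0 z0 m x y z : R) : Prop :=
  Rabs (x - x0) <= m /\ Rabs (y - y0) <= m /\ Rabs (z - z0) <= m.

(** $C^{1,1}$ bounds on a closed box with one constant. Three slots are enough for [H]; sums,
    products and functions of one variable leave some of them idle. *)
Record box11 (x0 y0 z0 m B : R) (ph p1 p2 p3 : R -> R -> R -> R) : Prop := {
  box_bound : forall x y z, box x0 y0 z0 m x y z ->
    Rabs (ph x y z) <= B /\ Rabs (p1 x y z) <= B /\ Rabs (p2 x y z) <= B /\ Rabs (p3 x y z) <= B;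
  box_lip : forall x y z x' y' z', box x0 y0 z0 m x y z -> box x0 y0 z0 m x' y' z' ->
    let e := Rabs (x - x') + Rabs (y - y') + Rabs (z - z') in
    Rabs (ph x y z - ph x' y' z') <= B * e /\ Rabs (p1 x y z - p1 x' y' z') <= B * e /\
    Rabs (p2 x y z - p2 x' y' z') <= B * e /\ Rabs (p3 x y z - p3 x' y' z') <= B * e;
  box_chain : forall (X Y Z : R -> R) s X' Y' Z', box x0 y0 z0 m (X s) (Y s) (Z s) ->
    is_derive X s X' -> is_derive Y s Y' -> is_derive Z s Z' ->
    is_derive (fun s => ph (X s) (Y s) (Z s)) s
      (p1 (X s) (Y s) (Z s) * X' + p2 (X s) (Y s) (Z s) * Y' + p3 (X s) (Y s) (Z s) * Z')
}.

Lemma box11_weaken (x0 y0 z0 m m' B B' : R) (ph p1 p2 p3 : R -> R -> R -> R) :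
  m' <= m -> B <= B' -> box11 x0 y0 z0 m B ph p1 p2 p3 -> box11 x0 y0 z0 m' B' ph p1 p2 p3.
Proof.
  intros Hm HB [H1 H2 H3].
  assert (S : forall x y z, box x0 y0 z0 m' x y z -> box x0 y0 z0 m x y z).
  { intros x y z [A1 [A2 A3]]. repeat split; lra. }
  split.
  - intros x y z H. destruct (H1 x y z (S _ _ _ H)) as [A1 [A2 [A3 A4]]]. repeat split; lra.
  - intros x y z x' y' z' H H' e. destruct (H2 _ _ _ _ _ _ (S _ _ _ H) (S _ _ _ H')) as [A1 [A2 [A3 A4]]].
    assert (He : B * e <= B' * e).
    { apply Rmult_le_compat_r; [|lra]. unfold e. repeat apply Rplus_le_le_0_compat; apply Rabs_pos. }
    fold e in A1, A2, A3, A4. repeat split; lra.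
  - intros; apply H3; auto.
Qed.

Lemma C11_weaken (C Co C' Co' : q4 -> Prop) (B B' : R) (f : q4 -> R) (Df : q4 -> q4 -> R) :
  (forall z, C' z -> C z) -> (forall z, Co' z -> Co z) -> B <= B' ->
  C11 C Co B f Df -> C11 C' Co' B' f Df.
Proof.
  intros HC HCo HB [H1 H2 H3 H4 H5].
  assert (L : forall x, 0 <= x -> B * x <= B' * x) by (intros; apply Rmult_le_compat_r; lra).
  split.
  - intros z Hz. eapply Rle_trans; [apply H1; auto|auto].
  - intros z z' Hz Hz'. eapply Rle_trans; [apply H2; auto|apply L, q4_dist_nonneg].
  - intros z h Hz. eapply Rle_trans; [apply H3; auto|apply L, q4_norm_nonneg].
  - intros z z' h h' Hz Hz'. eapply Rle_trans; [apply H4; auto|apply L].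
    apply Rplus_le_le_0_compat; [apply Rmult_le_pos|]; auto using q4_dist_nonneg, q4_norm_nonneg.
  - intros; apply H5; auto.
Qed.

(** The constant collects [B] for the values, [3 * (B * B)] for the Lipschitz and derivative bounds,
    and for the variation of the derivative three products: in each, [B * B] comes from the inner
    derivative and [B * (3 * B) * B] from the outer one. *)
Lemma C11_comp (C Co : q4 -> Prop) (B x0 y0 z0 m : R) (ph p1 p2 p3 : R -> R -> R -> R)
  (f1 f2 f3 : q4 -> R) (D1 D2 D3 : q4 -> q4 -> R) :
  0 <= B -> (forall z, Co z -> C z) ->
  box11 x0 y0 z0 m B ph p1 p2 p3 ->
  C11 C Co B f1 D1 -> C11 C Co B f2 D2 -> C11 C Co B f3 D3 ->
  (forall z, C z -> box x0 y0 z0 m (f1 z) (f2 z) (f3 z)) ->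
  C11 C Co (B + 3 * (B * B) + 3 * (B * B + B * (3 * B) * B)) (fun z => ph (f1 z) (f2 z) (f3 z))
    (fun z h => p1 (f1 z) (f2 z) (f3 z) * D1 z h + p2 (f1 z) (f2 z) (f3 z) * D2 z h
                + p3 (f1 z) (f2 z) (f3 z) * D3 z h).
Proof.
  intros HB HC Hp F1 F2 F3 Hbox.
  set (B' := B + 3 * (B * B) + 3 * (B * B + B * (3 * B) * B)).
  assert (HBB : 0 <= B * B) by (apply Rmult_le_pos; lra).
  assert (HBBB : 0 <= B * (3 * B) * B) by (apply Rmult_le_pos; [apply Rmult_le_pos|]; lra).
  assert (Hd : forall z z', C z -> C z' ->
    B * (Rabs (f1 z - f1 z') + Rabs (f2 z - f2 z') + Rabs (f3 z - f3 z')) <= B * (3 * B) * q4_dist z z').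
  { intros z z' Hz Hz'. rewrite Rmult_assoc. apply Rmult_le_compat_l; auto.
    generalize (C11_lip _ _ _ _ _ F1 z z' Hz Hz') (C11_lip _ _ _ _ _ F2 z z' Hz Hz') (C11_lip _ _ _ _ _ F3 z z' Hz Hz'). lra. }
  split.
  - intros z Hz. generalize (proj1 (box_bound _ _ _ _ _ _ _ _ _ Hp _ _ _ (Hbox z Hz))). unfold B'; lra.
  - intros z z' Hz Hz'. eapply Rle_trans; [apply (box_lip _ _ _ _ _ _ _ _ _ Hp); auto|].
    eapply Rle_trans; [apply Hd; auto|]. apply Rmult_le_compat_r; [apply q4_dist_nonneg|]. unfold B'; lra.
  - intros z h Hz. destruct (box_bound _ _ _ _ _ _ _ _ _ Hp _ _ _ (Hbox z Hz)) as [_ [P1 [P2 P3]]].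
    apply Rle_trans with (B * (B * q4_norm h) + B * (B * q4_norm h) + B * (B * q4_norm h)).
    + apply plus_bound; [apply plus_bound|]; apply mult_bound; auto;
      [apply (C11_dbound _ _ _ _ _ F1)|apply (C11_dbound _ _ _ _ _ F2)|apply (C11_dbound _ _ _ _ _ F3)]; auto.
    + replace (B * (B * q4_norm h) + B * (B * q4_norm h) + B * (B * q4_norm h)) with (3 * (B * B) * q4_norm h) by ring.
      apply Rmult_le_compat_r; [apply q4_norm_nonneg|]. unfold B'; lra.
  - intros z z' h h' Hz Hz'. set (e := q4_dist z z' * q4_norm h + q4_dist h h').
    assert (He : 0 <= e /\ q4_dist z z' * q4_norm h <= e).
    { assert (0 <= q4_dist z z' * q4_norm h) by (apply Rmult_le_pos; auto using q4_dist_nonneg, q4_norm_nonneg).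
      generalize (q4_dist_nonneg h h'). unfold e. lra. }
    assert (T : forall x x' y y', Rabs x' <= B -> Rabs y <= B * q4_norm h ->
      Rabs (x - x') <= B * (3 * B) * q4_dist z z' -> Rabs (y - y') <= B * e ->
      Rabs (x * y - x' * y') <= (B * B + B * (3 * B) * B) * e).
    { intros x x' y y' H1 H2 H3 H4.
      replace (x * y - x' * y') with ((x - x') * y + x' * (y - y')) by ring.
      apply Rle_trans with (B * (3 * B) * q4_dist z z' * (B * q4_norm h) + B * (B * e)).
      - apply plus_bound; apply mult_bound; auto.
      - assert (B * (3 * B) * B * (q4_dist z z' * q4_norm h) <= B * (3 * B) * B * e) by (apply Rmult_le_compat_l; lra). lra. }
    destruct (box_bound _ _ _ _ _ _ _ _ _ Hp _ _ _ (Hbox z' Hz')) as [_ [P1 [P2 P3]]].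
    destruct (box_lip _ _ _ _ _ _ _ _ _ Hp _ _ _ _ _ _ (Hbox z Hz) (Hbox z' Hz')) as [_ [Q1 [Q2 Q3]]].
    specialize (Hd z z' Hz Hz').
    assert (E1 := T _ _ _ _ P1 (C11_dbound _ _ _ _ _ F1 z h Hz) (Rle_trans _ _ _ Q1 Hd) (C11_dlip _ _ _ _ _ F1 z z' h h' Hz Hz')).
    assert (E2 := T _ _ _ _ P2 (C11_dbound _ _ _ _ _ F2 z h Hz) (Rle_trans _ _ _ Q2 Hd) (C11_dlip _ _ _ _ _ F2 z z' h h' Hz Hz')).
    assert (E3 := T _ _ _ _ P3 (C11_dbound _ _ _ _ _ F3 z h Hz) (Rle_trans _ _ _ Q3 Hd) (C11_dlip _ _ _ _ _ F3 z z' h h' Hz Hz')).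
    match goal with |- Rabs (?x1 + ?x2 + ?x3 - (?y1 + ?y2 + ?y3)) <= _ =>
      replace (x1 + x2 + x3 - (y1 + y2 + y3)) with ((x1 - y1) + (x2 - y2) + (x3 - y3)) by ring end.
    eapply Rle_trans; [apply plus_bound; [apply plus_bound|]; eassumption|].
    assert (0 <= (B + 3 * (B * B)) * e) by (apply Rmult_le_pos; lra). unfold B'. lra.
  - intros x1 x2 x3 x4 s h1 h2 h3 h4 H1 H2 H3 H4 Hco.
    apply (box_chain _ _ _ _ _ _ _ _ _ Hp (fun s => f1 (x1 s, x2 s, x3 s, x4 s))
      (fun s => f2 (x1 s, x2 s, x3 s, x4 s)) (fun s => f3 (x1 s, x2 s, x3 s, x4 s))).
    + apply Hbox, HC, Hco.
    + apply (C11_chain _ _ _ _ _ F1); auto.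
    + apply (C11_chain _ _ _ _ _ F2); auto.
    + apply (C11_chain _ _ _ _ _ F3); auto.
Qed.

Lemma continuous_bounded_near (f : R -> R) (x : R) : continuous f x ->
  exists d, 0 < d /\ forall y, Rabs (y - x) < d -> Rabs (f y) <= Rabs (f x) + 1.
Proof.
  intros H. destruct (proj1 (continuous_eps f x) H 1 ltac:(lra)) as [d [Hd Hf]].
  exists d. split; auto. intros y Hy. specialize (Hf y Hy).
  replace (f y) with ((f y - f x) + f x) by ring. eapply Rle_trans; [apply Rabs_triang|]. lra.
Qed.

(** A continuous second derivative is bounded near the point, and the mean value theorem turns this
    into Lipschitz bounds for [f] and [f']. *)
Lemma smooth1_box11 (D : R -> Prop) (f : R -> R) (x0 y0 z0 : R) :
  locally x0 D -> smooth1 2 D f ->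
  exists m B f', 0 < m /\ 0 <= B /\
    box11 x0 y0 z0 m B (fun x _ _ => f x) (fun x _ _ => f' x) (fun _ _ _ => 0) (fun _ _ _ => 0).
Proof.
  intros [d0 HD] [f' [Hf [f'' [Hf' Hf'']]]].
  assert (Dx : forall x, Rabs (x - x0) < d0 -> D x) by (intros x Hx; apply HD, Hx).
  assert (D0 : D x0) by (apply Dx; rewrite Rminus_diag, Rabs_R0; apply cond_pos).
  destruct (continuous_bounded_near f x0 (is_derive_continuous _ _ _ (Hf _ D0))) as [d1 [P1 H1]].
  destruct (continuous_bounded_near f' x0 (is_derive_continuous _ _ _ (Hf' _ D0))) as [d2 [P2 H2]].
  destruct (continuous_bounded_near f'' x0 (Hf'' _ D0)) as [d3 [P3 H3]].
  set (m := Rmin (Rmin d0 d1) (Rmin d2 d3) / 2).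
  assert (Hm : 0 < m /\ m < d0 /\ m < d1 /\ m < d2 /\ m < d3).
  { assert (0 < Rmin (Rmin d0 d1) (Rmin d2 d3)) by (repeat apply Rmin_case; try lra; apply cond_pos).
    generalize (Rmin_l (Rmin d0 d1) (Rmin d2 d3)) (Rmin_r (Rmin d0 d1) (Rmin d2 d3)) (Rmin_l d0 d1) (Rmin_r d0 d1)
      (Rmin_l d2 d3) (Rmin_r d2 d3). unfold m. intros. repeat split; lra. }
  set (B := Rabs (f x0) + Rabs (f' x0) + Rabs (f'' x0) + 1).
  assert (HB : 0 <= Rabs (f x0) /\ 0 <= Rabs (f' x0) /\ 0 <= Rabs (f'' x0)) by (repeat split; apply Rabs_pos).
  exists m, B, f'. split; [lra|]. split; [unfold B; lra|].
  assert (Seg : forall x x' c, Rabs (x - x0) <= m -> Rabs (x' - x0) <= m -> Rmin x' x <= c <= Rmax x' x -> Rabs (c - x0) <= m).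
  { intros x x' c Hx Hx'. unfold Rmin, Rmax. destruct (Rle_dec x' x); intros Hc; clear - Hx Hx' Hc; split_Rabs; lra. }
  split.
  - intros x y z [Hx _]. specialize (H1 x ltac:(lra)). specialize (H2 x ltac:(lra)).
    rewrite Rabs_R0. unfold B. repeat split; lra.
  - intros x y z x' y' z' [Hx _] [Hx' _] e.
    assert (He : Rabs (x - x') <= e).
    { unfold e. generalize (Rabs_pos (y - y')) (Rabs_pos (z - z')). lra. }
    assert (HBe : B * Rabs (x - x') <= B * e) by (apply Rmult_le_compat_l; [unfold B; lra|auto]).
    assert (H0e : 0 <= B * e) by (apply Rmult_le_pos; [unfold B; lra|generalize (Rabs_pos (x - x')); lra]).
    rewrite Rminus_diag, Rabs_R0. repeat split; auto; eapply Rle_trans; try apply HBe.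
    + apply (mean_value_bound f f' x' x B).
      * intros c Hc. apply Hf, Dx. specialize (Seg x x' c Hx Hx' Hc). lra.
      * intros c Hc. specialize (Seg x x' c Hx Hx' Hc). specialize (H2 c ltac:(lra)). unfold B; lra.
    + apply (mean_value_bound f' f'' x' x B).
      * intros c Hc. apply Hf', Dx. specialize (Seg x x' c Hx Hx' Hc). lra.
      * intros c Hc. specialize (Seg x x' c Hx Hx' Hc). specialize (H3 c ltac:(lra)). unfold B; lra.
  - intros X Y Z s X' Y' Z' [Hx _] HX HY HZ.
    evar_last; [apply (is_derive_comp f X); [apply Hf, Dx; lra|exact HX]|].
    unfold scal; simpl; unfold mult; simpl; ring.
Qed.

Lemma plus_box11 (x0 y0 z0 : R) : exists m B, 0 < m /\ 0 <= B /\
  box11 x0 y0 z0 m B (fun x y _ => x + y) (fun _ _ _ => 1) (fun _ _ _ => 1) (fun _ _ _ => 0).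
Proof.
  exists 1, (Rabs x0 + Rabs y0 + 2). assert (Hx := Rabs_pos x0). assert (Hy := Rabs_pos y0).
  split; [lra|]. split; [lra|]. split.
  - intros x y z [H1 [H2 _]]. rewrite Rabs_R1, Rabs_R0. repeat split; try lra.
    replace (x + y) with ((x - x0) + x0 + ((y - y0) + y0)) by ring.
    eapply Rle_trans; [apply plus_bound; apply plus_bound; apply Rle_refl|]. lra.
  - intros x y z x' y' z' _ _ e.
    assert (He : Rabs (x - x') + Rabs (y - y') <= e) by (unfold e; generalize (Rabs_pos (z - z')); lra).
    assert (He0 : 0 <= e) by (generalize (Rabs_pos (x - x')) (Rabs_pos (y - y')); lra).
    assert (1 * e <= (Rabs x0 + Rabs y0 + 2) * e) by (apply Rmult_le_compat_r; lra).
    rewrite !Rminus_diag, Rabs_R0. repeat split; try lra.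
    replace (x + y - (x' + y')) with ((x - x') + (y - y')) by ring.
    eapply Rle_trans; [apply Rabs_triang|]. lra.
  - intros X Y Z s X' Y' Z' _ HX HY _. evar_last; [apply @is_derive_plus; eassumption|]. unfold plus; simpl. ring.
Qed.

Lemma mult_box11 (x0 y0 z0 : R) : exists m B, 0 < m /\ 0 <= B /\
  box11 x0 y0 z0 m B (fun x y _ => x * y) (fun _ y _ => y) (fun x _ _ => x) (fun _ _ _ => 0).
Proof.
  set (A := Rabs x0 + Rabs y0 + 1).
  assert (Hx := Rabs_pos x0). assert (Hy := Rabs_pos y0).
  assert (HA : 1 <= A) by (unfold A; lra). assert (HAA : A <= A * A) by (rewrite <- (Rmult_1_l A) at 1; apply Rmult_le_compat_r; lra).
  assert (S : forall x y z, box x0 y0 z0 1 x y z -> Rabs x <= A /\ Rabs y <= A).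
  { intros x y z [H1 [H2 _]]. split.
    - replace x with ((x - x0) + x0) by ring. eapply Rle_trans; [apply Rabs_triang|]. unfold A; lra.
    - replace y with ((y - y0) + y0) by ring. eapply Rle_trans; [apply Rabs_triang|]. unfold A; lra. }
  exists 1, (A * A). split; [lra|]. split; [lra|]. split.
  - intros x y z H. destruct (S x y z H) as [Sx Sy]. rewrite Rabs_R0.
    repeat split; try lra. apply mult_bound; auto.
  - intros x y z x' y' z' H H' e. destruct (S _ _ _ H) as [Sx Sy]. destruct (S _ _ _ H') as [Sx' Sy'].
    assert (P1 := Rabs_pos (x - x')). assert (P2 := Rabs_pos (y - y')). assert (P3 := Rabs_pos (z - z')).
    assert (He : Rabs (x - x') + Rabs (y - y') <= e) by (unfold e; lra).
    assert (HAe : A * e <= A * A * e) by (apply Rmult_le_compat_r; lra).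
    assert (HAe2 : 1 * e <= A * e) by (apply Rmult_le_compat_r; lra).
    rewrite !Rminus_diag, Rabs_R0. repeat split; try lra.
    eapply Rle_trans; [apply (mult_diff_bound x x' y y' A A _ _ Sx Sy' (Rle_refl _) (Rle_refl _))|].
    assert (A * (Rabs (x - x') + Rabs (y - y')) <= A * e) by (apply Rmult_le_compat_l; lra). lra.
  - intros X Y Z s X' Y' Z' _ HX HY _.
    evar_last; [apply (is_derive_mult X Y); try eassumption; intros; apply Rmult_comm|].
    unfold plus, mult; simpl. ring.
Qed.

(** * Germs of $C^{1,1}$ functions at the origin of the shock *)

Section NearShock.

Variables (be0 V0 : R).

(** A box in the invariants times a cone about the line $x=V_0t$. Its height and opening are both
    [delta], so shrinking the one parameter shrinks everything towards the origin of the shock. *)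
Definition shock_cone (delta : R) (z : q4) : Prop :=
  let '(al, be, t, x) := z in
  Rabs (al - be0) <= delta /\ Rabs (be - be0) <= delta /\ 0 <= t <= delta /\
  Rabs (x - V0 * t) <= delta * t.
Definition shock_cone_int (delta : R) (z : q4) : Prop :=
  shock_cone delta z /\ let '(al, be, t, x) := z in 0 < t.

Let q0 : q4 := (be0, be0, 0, 0).

Lemma shock_cone_mono (d d' : R) (z : q4) : d <= d' -> shock_cone d z -> shock_cone d' z.
Proof.
  destruct z as [[[al be] t] x]. intros Hd [H1 [H2 [H3 H4]]]. repeat split; try lra.
  assert (d * t <= d' * t) by (apply Rmult_le_compat_r; lra). lra.
Qed.

Lemma shock_cone_int_mono (d d' : R) (z : q4) : d <= d' -> shock_cone_int d z -> shock_cone_int d' z.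
Proof. intros Hd [H1 H2]. split; [eapply shock_cone_mono; eauto|auto]. Qed.

Lemma shock_cone_origin (d : R) : 0 < d -> shock_cone d q0.
Proof. intros Hd. unfold shock_cone, q0. rewrite !Rmult_0_r, !Rminus_diag, Rabs_R0. lra. Qed.

Lemma shock_cone_dist (d : R) (z : q4) : d <= 1 -> shock_cone d z -> q4_dist z q0 <= (4 + Rabs V0) * d.
Proof.
  destruct z as [[[al be] t] x]. intros Hd [H1 [H2 [H3 H4]]]. unfold q4_dist, q0.
  rewrite !Rminus_0_r, (Rabs_pos_eq t) by lra. assert (HV := Rabs_pos V0).
  assert (Hx : Rabs x <= Rabs (x - V0 * t) + Rabs V0 * t).
  { replace x with ((x - V0 * t) + V0 * t) at 1 by ring. eapply Rle_trans; [apply Rabs_triang|].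
    rewrite (Rabs_mult V0), (Rabs_pos_eq t) by lra. lra. }
  assert (d * t <= 1 * d) by (apply Rmult_le_compat; lra).
  assert (Rabs V0 * t <= Rabs V0 * d) by (apply Rmult_le_compat_l; lra). lra.
Qed.

(** The cone and the constant are existential, so that the coefficients are treated by closure rules
    alone; [near11_at] later brings several functions to a common cone and constant. *)
Definition near11 (f : q4 -> R) : Prop :=
  exists d B Df, 0 < d /\ 0 <= B /\ C11 (shock_cone d) (shock_cone_int d) B f Df.

Lemma near11_at (f : q4 -> R) : near11 f ->
  exists d0, 0 < d0 /\ exists B Df, 0 <= B /\ forall d B', d <= d0 -> B <= B' ->
    C11 (shock_cone d) (shock_cone_int d) B' f Df.
Proof.
  intros [d [B [Df [Hd [HB H]]]]]. exists d. split; auto. exists B, Df. split; auto.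
  intros d' B' Hd' HB'. apply (C11_weaken (shock_cone d) (shock_cone_int d) _ _ B); auto.
  - intros z. apply shock_cone_mono; auto.
  - intros z. apply shock_cone_int_mono; auto.
Qed.

Lemma near11_close (f : q4 -> R) (m : R) : near11 f -> 0 < m ->
  exists d0, 0 < d0 /\ forall d z, d <= d0 -> shock_cone d z -> Rabs (f z - f q0) <= m.
Proof.
  intros [d [B [Df [Hd [HB H]]]]] Hm. assert (HV := Rabs_pos V0).
  set (K := B * (4 + Rabs V0) + 1). assert (HK : 0 < K).
  { unfold K. assert (0 <= B * (4 + Rabs V0)) by (apply Rmult_le_pos; lra). lra. }
  exists (Rmin (Rmin d 1) (m / K)).
  assert (M1 := Rmin_l (Rmin d 1) (m / K)). assert (M2 := Rmin_r (Rmin d 1) (m / K)).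
  assert (M3 := Rmin_l d 1). assert (M4 := Rmin_r d 1).
  assert (HmK : 0 < m / K) by (apply Rdiv_lt_0_compat; lra).
  assert (H0 : 0 < Rmin (Rmin d 1) (m / K)) by (repeat apply Rmin_case; lra). split; auto.
  intros d' z Hd' Hz. apply (shock_cone_mono _ _ _ Hd') in Hz.
  eapply Rle_trans; [apply (C11_lip _ _ _ _ _ H)|].
  - apply (shock_cone_mono (Rmin (Rmin d 1) (m / K))); [lra|auto].
  - apply shock_cone_origin; auto.
  - apply Rle_trans with (B * ((4 + Rabs V0) * (m / K))).
    + apply Rmult_le_compat_l; auto. eapply Rle_trans; [apply shock_cone_dist; [|exact Hz]; lra|].
      apply Rmult_le_compat_l; lra.
    + rewrite <- Rmult_assoc. apply Rle_trans with (K * (m / K)); [|right; field; lra].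
      apply Rmult_le_compat_r; [lra|unfold K; lra].
Qed.

Lemma near11_comp (ph p1 p2 p3 : R -> R -> R -> R) (f1 f2 f3 : q4 -> R) (m B : R) :
  near11 f1 -> near11 f2 -> near11 f3 -> 0 < m -> 0 <= B ->
  box11 (f1 q0) (f2 q0) (f3 q0) m B ph p1 p2 p3 ->
  near11 (fun z => ph (f1 z) (f2 z) (f3 z)).
Proof.
  intros N1 N2 N3 Hm HB Hb.
  destruct (near11_close f1 m N1 Hm) as [c1 [Q1 G1]].
  destruct (near11_close f2 m N2 Hm) as [c2 [Q2 G2]].
  destruct (near11_close f3 m N3 Hm) as [c3 [Q3 G3]].
  destruct (near11_at f1 N1) as [d1 [P1 [B1 [D1 [HB1 F1]]]]].
  destruct (near11_at f2 N2) as [d2 [P2 [B2 [D2 [HB2 F2]]]]].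
  destruct (near11_at f3 N3) as [d3 [P3 [B3 [D3 [HB3 F3]]]]].
  set (d := Rmin (Rmin c1 (Rmin c2 c3)) (Rmin d1 (Rmin d2 d3))).
  assert (Hd : 0 < d /\ d <= c1 /\ d <= c2 /\ d <= c3 /\ d <= d1 /\ d <= d2 /\ d <= d3).
  { unfold d. generalize (Rmin_l (Rmin c1 (Rmin c2 c3)) (Rmin d1 (Rmin d2 d3)))
      (Rmin_r (Rmin c1 (Rmin c2 c3)) (Rmin d1 (Rmin d2 d3))) (Rmin_l c1 (Rmin c2 c3)) (Rmin_r c1 (Rmin c2 c3))
      (Rmin_l c2 c3) (Rmin_r c2 c3) (Rmin_l d1 (Rmin d2 d3)) (Rmin_r d1 (Rmin d2 d3)) (Rmin_l d2 d3) (Rmin_r d2 d3).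
    intros. repeat split; try lra. repeat apply Rmin_case; lra. }
  set (B' := B + B1 + B2 + B3).
  assert (HB' : 0 <= B') by (unfold B'; lra).
  exists d, (B' + 3 * (B' * B') + 3 * (B' * B' + B' * (3 * B') * B')). eexists. split; [lra|].
  split; [|apply (C11_comp (shock_cone d) (shock_cone_int d) B' (f1 q0) (f2 q0) (f3 q0) m ph p1 p2 p3 f1 f2 f3 D1 D2 D3); auto].
  - assert (0 <= B' * B') by (apply Rmult_le_pos; lra).
    assert (0 <= B' * (3 * B') * B') by (apply Rmult_le_pos; [apply Rmult_le_pos|]; lra). lra.
  - intros z Hz; apply Hz.
  - apply (box11_weaken _ _ _ m m B); auto; unfold B'; lra.
  - apply F1; unfold B'; lra.
  - apply F2; unfold B'; lra.
  - apply F3; unfold B'; lra.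
  - intros z Hz. repeat split; [apply (G1 d)|apply (G2 d)|apply (G3 d)]; auto; lra.
Qed.

Lemma near11_const (c : R) : near11 (fun _ => c).
Proof.
  exists 1, (Rabs c), (fun _ _ => 0). assert (H := Rabs_pos c). split; [lra|]. split; auto.
  split; intros; rewrite ?Rminus_diag, ?Rabs_R0; try lra.
  - apply Rmult_le_pos; auto using q4_dist_nonneg.
  - apply Rmult_le_pos; auto using q4_norm_nonneg.
  - apply Rmult_le_pos; auto. apply Rplus_le_le_0_compat; [apply Rmult_le_pos|]; auto using q4_dist_nonneg, q4_norm_nonneg.
  - apply (is_derive_const c).
Qed.

Lemma near11_plus (f g : q4 -> R) : near11 f -> near11 g -> near11 (fun z => f z + g z).
Proof.
  intros Hf Hg. destruct (plus_box11 (f q0) (g q0) 0) as [m [B [Hm [HB H]]]].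
  apply (near11_comp (fun x y _ => x + y) (fun _ _ _ => 1) (fun _ _ _ => 1) (fun _ _ _ => 0) f g (fun _ => 0) m B); auto using near11_const.
Qed.

Lemma near11_mult (f g : q4 -> R) : near11 f -> near11 g -> near11 (fun z => f z * g z).
Proof.
  intros Hf Hg. destruct (mult_box11 (f q0) (g q0) 0) as [m [B [Hm [HB H]]]].
  apply (near11_comp (fun x y _ => x * y) (fun _ y _ => y) (fun x _ _ => x) (fun _ _ _ => 0) f g (fun _ => 0) m B); auto using near11_const.
Qed.

Lemma near11_smooth1 (D : R -> Prop) (ph : R -> R) (f : q4 -> R) :
  near11 f -> locally (f q0) D -> smooth1 2 D ph -> near11 (fun z => ph (f z)).
Proof.
  intros Hf HD Hp. destruct (smooth1_box11 D ph (f q0) 0 0 HD Hp) as [m [B [f' [Hm [HB H]]]]].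
  apply (near11_comp (fun x _ _ => ph x) (fun x _ _ => f' x) (fun _ _ _ => 0) (fun _ _ _ => 0) f (fun _ => 0) (fun _ => 0) m B); auto using near11_const.
Qed.

Lemma near11_ext (f g : q4 -> R) : (forall z, f z = g z) -> near11 f -> near11 g.
Proof.
  intros E [d [B [Df [Hd [HB H]]]]]. exists d, B, Df. split; auto. split; auto. destruct H as [H1 H2 H3 H4 H5].
  split; intros; rewrite <- ?E; auto.
  apply (is_derive_ext (fun s => f (x1 s, x2 s, x3 s, x4 s))); auto.
Qed.

Lemma near11_opp (f : q4 -> R) : near11 f -> near11 (fun z => - f z).
Proof.
  intros Hf. apply (near11_ext (fun z => (-1) * f z)); [intros; ring|].
  apply near11_mult; auto using near11_const.
Qed.

Lemma near11_minus (f g : q4 -> R) : near11 f -> near11 g -> near11 (fun z => f z - g z).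
Proof. intros Hf Hg. apply near11_plus; auto using near11_opp. Qed.

Lemma near11_div (f g : q4 -> R) : near11 f -> near11 g -> g q0 <> 0 -> near11 (fun z => f z / g z).
Proof.
  intros Hf Hg H0. apply near11_mult; auto.
  apply (near11_smooth1 (fun x => x <> 0) (fun x => / x)); auto.
  - apply (open_neq 0). exact H0.
  - apply smooth1_inv; [apply smooth1_id|auto].
Qed.

Lemma near11_coordinates : near11 (fun z => let '(al, be, t, x) := z in al) /\
  near11 (fun z => let '(al, be, t, x) := z in be) /\
  near11 (fun z => let '(al, be, t, x) := z in t) /\
  near11 (fun z => let '(al, be, t, x) := z in x).
Proof.
  set (B := Rabs be0 + Rabs V0 + 6).
  assert (Hb := Rabs_pos be0). assert (HV := Rabs_pos V0). assert (HB : 1 <= B) by (unfold B; lra).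
  assert (HBx : forall x, 0 <= x -> x <= B * x).
  { intros x Hx. rewrite <- (Rmult_1_l x) at 1. apply Rmult_le_compat_r; lra. }
  assert (Bd : forall z, shock_cone 1 z -> let '(al, be, t, x) := z in
     Rabs al <= B /\ Rabs be <= B /\ Rabs t <= B /\ Rabs x <= B).
  { intros [[[al be] t] x] Hz. assert (Hd := shock_cone_dist 1 _ ltac:(lra) Hz). unfold q4_dist, q0 in Hd.
    rewrite !Rminus_0_r in Hd. generalize (Rabs_pos (al - be0)) (Rabs_pos (be - be0)) (Rabs_pos t) (Rabs_pos x).
    assert (Rabs al <= Rabs (al - be0) + Rabs be0) by (replace al with ((al - be0) + be0) at 1 by ring; apply Rabs_triang).
    assert (Rabs be <= Rabs (be - be0) + Rabs be0) by (replace be with ((be - be0) + be0) at 1 by ring; apply Rabs_triang).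
    destruct Hz as [Z1 [Z2 _]]. unfold B. intros. repeat split; lra. }
  assert (Dn : forall z h : q4, 0 <= q4_dist z h) by apply q4_dist_nonneg.
  assert (Main : forall pr : q4 -> R, (forall z, shock_cone 1 z -> Rabs (pr z) <= B) ->
     (forall z z', Rabs (pr z - pr z') <= q4_dist z z') -> (forall z, Rabs (pr z) <= q4_norm z) ->
     (forall (x1 x2 x3 x4 : R -> R) s h1 h2 h3 h4,
    is_derive x1 s h1 -> is_derive x2 s h2 -> is_derive x3 s h3 -> is_derive x4 s h4 ->
    is_derive (fun s => pr (x1 s, x2 s, x3 s, x4 s)) s (pr (h1, h2, h3, h4))) -> near11 pr).
  { intros pr M1 M2 M3 M4. exists 1, B, (fun _ => pr). split; [lra|]. split; [lra|]. split; auto.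
    - intros z z' _ _. apply Rle_trans with (1 := M2 z z'). auto.
    - intros z h _. apply Rle_trans with (1 := M3 h). apply HBx, q4_norm_nonneg.
    - intros z z' h h' _ _. apply Rle_trans with (1 := M2 h h').
      assert (0 <= q4_dist z z' * q4_norm h) by (apply Rmult_le_pos; auto using q4_norm_nonneg).
      eapply Rle_trans; [apply HBx, Dn|]. apply Rmult_le_compat_l; lra. }
  repeat split; (apply Main; [intros [[[al be] t] x] Hz; apply (Bd _ Hz)
    |intros [[[al be] t] x] [[[al' be'] t'] x']; unfold q4_dist;
     generalize (Rabs_pos (al - al')) (Rabs_pos (be - be')) (Rabs_pos (t - t')) (Rabs_pos (x - x')); lra
    |intros [[[al be] t] x]; unfold q4_norm;
     generalize (Rabs_pos al) (Rabs_pos be) (Rabs_pos t) (Rabs_pos x); lra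
    |intros; assumption]).
Qed.

End NearShock.

(** * Functions of class [C^n] up to the boundary *)

Lemma is_derive_shift (f : R -> R) (x l : R) :
  is_derive (fun s => f (x + s)) 0 l <-> is_derive f x l.
Proof.
  split; intros H.
  - apply (is_derive_ext (fun y => (fun s => f (x + s)) (- x + y))).
    { intros y; f_equal; ring. }
    evar_last.
    + apply (is_derive_comp (fun s => f (x + s)) (fun y => - x + y)).
      * replace (- x + x) with 0 by ring. exact H.
      * apply is_derive_const_plus. apply @is_derive_id.
    + unfold scal; simpl; unfold mult; simpl. apply Rmult_1_l.
  - evar_last.
    + apply (is_derive_comp f (fun s => x + s)).
      * rewrite Rplus_0_r. exact H.
      * apply is_derive_const_plus. apply @is_derive_id.
    + unfold scal; simpl; unfold mult; simpl. apply Rmult_1_l.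
Qed.

Lemma is_derive_e1 (f : R * R -> R) (t x l : R) :
  is_derive (fun s : R => f (plus (t, x) (scal s e1))) 0 l <-> is_derive (fun s => f (s, x)) t l.
Proof.
  rewrite <- (is_derive_shift (fun s => f (s, x)) t l).
  assert (E : forall s : R, f (plus (t, x) (scal s e1)) = f (t + s, x)).
  { intros s. f_equal. unfold plus, scal, e1; simpl. unfold prod_plus, prod_scal, plus, scal; simpl.
    unfold mult; simpl. f_equal; ring. }
  split; apply is_derive_ext; auto.
Qed.

Lemma is_derive_e2 (f : R * R -> R) (t x l : R) :
  is_derive (fun s : R => f (plus (t, x) (scal s e2))) 0 l <-> is_derive (fun s => f (t, s)) x l.
Proof.
  rewrite <- (is_derive_shift (fun s => f (t, s)) x l).
  assert (E : forall s : R, f (plus (t, x) (scal s e2)) = f (t, x + s)).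
  { intros s. f_equal. unfold plus, scal, e2; simpl. unfold prod_plus, prod_scal, plus, scal; simpl.
    unfold mult; simpl. f_equal; ring. }
  split; apply is_derive_ext; auto.
Qed.

Lemma interior_locally_2d (D : R * R -> Prop) (t x : R) :
  interior_pt D (t, x) -> locally_2d (fun t x => interior_pt D (t, x)) t x.
Proof.
  intros H. apply locally_2d_locally. apply locally_locally in H.
  revert H. apply filter_imp. intros [t' x'] H. exact H.
Qed.

Lemma within_interior_continuity (D : R * R -> Prop) (f : R * R -> R) (t x : R) :
  interior_pt D (t, x) ->
  filterlim f (within D (locally (t, x))) (locally (f (t, x))) ->
  continuity_2d_pt (fun t x => f (t, x)) t x.
Proof.
  intros HI H. apply continuity_2d_pt_filterlim. intros P HP. specialize (H P HP).
  unfold filtermap, within in *. generalize (filter_and _ _ HI H). apply filter_imp.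
  intros [t' x'] [A B]. exact (B A).
Qed.

(** Names the witnesses hidden in one level of [Cn], so that formulas for them can be stated. *)
Definition partials (D : R * R -> Prop) (f f1 f2 : R * R -> R) : Prop :=
  (forall q, D q -> filterlim f (within D (locally q)) (locally (f q))) /\
  (forall q, D q -> filterlim f1 (within D (locally q)) (locally (f1 q))) /\
  (forall q, D q -> filterlim f2 (within D (locally q)) (locally (f2 q))) /\
  forall t x, interior_pt D (t, x) ->
    is_derive (fun s => f (s, x)) t (f1 (t, x)) /\ is_derive (fun s => f (t, s)) x (f2 (t, x)).

Lemma Cn_partials (D : R * R -> Prop) (n : nat) (f : R * R -> R) :
  Cn [e1; e2] (S n) D f -> exists f1 f2, partials D f f1 f2 /\ Cn [e1; e2] n D f1 /\ Cn [e1; e2] n D f2.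
Proof.
  intros [Hc H]. destruct (H e1) as [f1 [A1 B1]]; [left; auto|].
  destruct (H e2) as [f2 [A2 B2]]; [right; left; auto|].
  exists f1, f2. split; [|auto]. split; [exact Hc|].
  split; [destruct n; apply B1|]. split; [destruct n; apply B2|].
  intros t x HI. split; [apply is_derive_e1, A1, HI|apply is_derive_e2, A2, HI].
Qed.

Lemma partials_differentiable (D : R * R -> Prop) (f f1 f2 : R * R -> R) (t x : R) :
  partials D f f1 f2 -> interior_pt D (t, x) ->
  differentiable_pt_lim (fun t x => f (t, x)) t x (f1 (t, x)) (f2 (t, x)).
Proof.
  intros [_ [H1 [_ H]]] HI.
  apply (differentiable_of_partials (fun t x => f (t, x)) (fun t x => f1 (t, x))).
  - destruct (interior_locally_2d D t x HI) as [d Hd]. exists d. intros t' x' A B. apply H, Hd; auto.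
  - apply (within_interior_continuity D); auto. apply H1. exact (locally_singleton _ _ HI).
  - apply H, HI.
Qed.

(** * Functions on a cone with apex at the boundary of their domain *)

Section Cone.

Variables (V0 : R) (D : R * R -> Prop) (d1 : R).
Let K (d : R) (t x : R) : Prop := 0 <= t <= d /\ Rabs (x - V0 * t) <= d * t.
Hypothesis d1_pos : 0 < d1.
Hypothesis K_in_D : forall t x, K d1 t x -> D (t, x) /\ (0 < t -> interior_pt D (t, x)).

Lemma K_mono (d d' t x : R) : d <= d' -> K d t x -> K d' t x.
Proof.
  intros Hd [H1 H2]. split; [lra|]. assert (d * t <= d' * t) by (apply Rmult_le_compat_r; lra). lra.
Qed.

Lemma within_locally_bound (f : R * R -> R) (t x e : R) : 0 < e ->
  filterlim f (within D (locally (t, x))) (locally (f (t, x))) ->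
  exists d, 0 < d /\ forall t' x', D (t', x') -> Rabs (t' - t) < d -> Rabs (x' - x) < d ->
    Rabs (f (t', x') - f (t, x)) < e.
Proof.
  intros He H. destruct (proj1 (filterlim_locally f (f (t, x))) H (mkposreal e He)) as [d Hd].
  exists d. split; [apply cond_pos|]. intros t' x' H1 H2 H3. apply (Hd (t', x')); auto. split; auto.
Qed.

(** The cone is convex and its points with $t>0$ are interior to [D], so the mean value theorem
    applies along segments that avoid the apex. The apex itself is reached as a limit along a
    ray. *)
Lemma cone_lipschitz (f f1 f2 : R * R -> R) : partials D f f1 f2 ->
  exists d B, 0 < d <= d1 /\ 0 <= B /\
    forall t x t' x', K d t x -> K d t' x' -> Rabs (f (t, x)) <= B /\
      Rabs (f (t, x) - f (t', x')) <= B * (Rabs (t - t') + Rabs (x - x')).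
Proof.
  intros Hf. assert (K0 : K d1 0 0).
  { unfold K. rewrite !Rmult_0_r, Rminus_0_r, Rabs_R0. lra. }
  destruct (K_in_D _ _ K0) as [D0 _].
  destruct (within_locally_bound f 0 0 1 ltac:(lra) (proj1 Hf _ D0)) as [c0 [P0 H0]].
  destruct (within_locally_bound f1 0 0 1 ltac:(lra) (proj1 (proj2 Hf) _ D0)) as [c1 [P1 H1]].
  destruct (within_locally_bound f2 0 0 1 ltac:(lra) (proj1 (proj2 (proj2 Hf)) _ D0)) as [c2 [P2 H2]].
  assert (HV := Rabs_pos V0).
  set (c := Rmin c0 (Rmin c1 c2)).
  assert (Hc : 0 < c /\ c <= c0 /\ c <= c1 /\ c <= c2).
  { unfold c. generalize (Rmin_l c0 (Rmin c1 c2)) (Rmin_r c0 (Rmin c1 c2)) (Rmin_l c1 c2) (Rmin_r c1 c2).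
    intros; repeat split; try lra. repeat apply Rmin_case; lra. }
  clearbody c.
  set (d := Rmin d1 (Rmin 1 (c / (2 * (2 + Rabs V0))))).
  assert (Hq : 0 < c / (2 * (2 + Rabs V0))) by (apply Rdiv_lt_0_compat; lra).
  assert (Hd : 0 < d /\ d <= d1 /\ d <= 1 /\ d <= c / (2 * (2 + Rabs V0))).
  { unfold d. generalize (Rmin_l d1 (Rmin 1 (c / (2 * (2 + Rabs V0))))) (Rmin_r d1 (Rmin 1 (c / (2 * (2 + Rabs V0)))))
      (Rmin_l 1 (c / (2 * (2 + Rabs V0)))) (Rmin_r 1 (c / (2 * (2 + Rabs V0)))).
    intros; repeat split; try lra. repeat apply Rmin_case; lra. }
  assert (Hdc : (2 + Rabs V0) * d < c).
  { apply Rle_lt_trans with ((2 + Rabs V0) * (c / (2 * (2 + Rabs V0)))); [apply Rmult_le_compat_l; lra|].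
    replace ((2 + Rabs V0) * (c / (2 * (2 + Rabs V0)))) with (c / 2) by (field; lra). lra. }
  assert (Kc : forall t x, K d t x -> D (t, x) /\ Rabs (t - 0) < c /\ Rabs (x - 0) < c).
  { intros t x HK. split; [apply K_in_D, (K_mono d); auto; lra|]. destruct HK as [Q1 Q2].
    rewrite !Rminus_0_r, (Rabs_pos_eq t) by lra.
    assert (Rabs V0 * t <= Rabs V0 * d) by (apply Rmult_le_compat_l; lra).
    assert (d * t <= 1 * d) by (apply Rmult_le_compat; lra).
    assert (0 <= Rabs V0 * d) by (apply Rmult_le_pos; lra).
    split; [lra|]. replace x with ((x - V0 * t) + V0 * t) by ring.
    eapply Rle_lt_trans; [apply Rabs_triang|]. rewrite (Rabs_mult V0), (Rabs_pos_eq t) by lra. lra. }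
  set (B := Rabs (f (0, 0)) + Rabs (f1 (0, 0)) + Rabs (f2 (0, 0)) + 1).
  assert (Bp : 0 <= Rabs (f (0, 0)) /\ 0 <= Rabs (f1 (0, 0)) /\ 0 <= Rabs (f2 (0, 0))) by (repeat split; apply Rabs_pos).
  assert (Bd : forall t x, K d t x -> Rabs (f (t, x)) <= B /\ Rabs (f1 (t, x)) <= B /\ Rabs (f2 (t, x)) <= B).
  { intros t x HK. destruct (Kc t x HK) as [Q1 [Q2 Q3]].
    assert (W : forall h : R * R -> R, Rabs (h (t, x) - h (0, 0)) < 1 -> Rabs (h (t, x)) <= Rabs (h (0, 0)) + 1).
    { intros h Hh. replace (h (t, x)) with ((h (t, x) - h (0, 0)) + h (0, 0)) by ring.
      eapply Rle_trans; [apply Rabs_triang|]. lra. }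
    assert (W0 := W f (H0 t x Q1 ltac:(lra) ltac:(lra))).
    assert (W1 := W f1 (H1 t x Q1 ltac:(lra) ltac:(lra))).
    assert (W2 := W f2 (H2 t x Q1 ltac:(lra) ltac:(lra))). unfold B; repeat split; lra. }
  assert (HB : 0 <= B) by (unfold B; lra).
  assert (Main : forall t x t' x', 0 < t -> 0 < t' -> K d t x -> K d t' x' ->
     Rabs (f (t, x) - f (t', x')) <= B * (Rabs (t - t') + Rabs (x - x'))).
  { intros t x t' x' Ht Ht' HK HK'.
    set (ts := fun s => t' + (t - t') * s). set (xs := fun s => x' + (x - x') * s).
    assert (Ks : forall s, 0 <= s <= 1 -> 0 < ts s /\ K d (ts s) (xs s)).
    { intros s Hs. unfold ts, xs.
      assert (E1 : t' + (t - t') * s = (1 - s) * t' + s * t) by ring.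
      assert (E2 : x' + (x - x') * s - V0 * (t' + (t - t') * s) = (1 - s) * (x' - V0 * t') + s * (x - V0 * t)) by ring.
      destruct HK as [A1 A2], HK' as [A1' A2'].
      assert (Hpos : 0 < (1 - s) * t' + s * t).
      { destruct (Req_dec s 0) as [->|Hs0]; [lra|].
        assert (0 < s * t) by (apply Rmult_lt_0_compat; lra).
        assert (0 <= (1 - s) * t') by (apply Rmult_le_pos; lra). lra. }
      unfold K. rewrite E2, E1. split; [exact Hpos|]. split; [split; [lra|]|].
      - assert ((1 - s) * t' <= (1 - s) * d) by (apply Rmult_le_compat_l; lra).
        assert (s * t <= s * d) by (apply Rmult_le_compat_l; lra). lra.
      - eapply Rle_trans; [apply Rabs_triang|]. rewrite !Rabs_mult, (Rabs_pos_eq (1 - s)), (Rabs_pos_eq s) by lra.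
        assert ((1 - s) * Rabs (x' - V0 * t') <= (1 - s) * (d * t')) by (apply Rmult_le_compat_l; lra).
        assert (s * Rabs (x - V0 * t) <= s * (d * t)) by (apply Rmult_le_compat_l; lra). lra. }
    assert (E : Rabs (f (ts 1, xs 1) - f (ts 0, xs 0)) <= (B * (Rabs (t - t') + Rabs (x - x'))) * Rabs (1 - 0)).
    { apply (mean_value_bound (fun s => f (ts s, xs s)) (fun s => f1 (ts s, xs s) * (t - t') + f2 (ts s, xs s) * (x - x'))).
      - intros s Hs. rewrite Rmin_left, Rmax_right in Hs by lra. destruct (Ks s Hs) as [S1 S2].
        apply (is_derive_curve (fun t x => f (t, x)) ts xs).
        + apply (partials_differentiable D); auto. apply K_in_D; auto. apply (K_mono d); auto; lra.
        + apply is_derive_const_plus, is_derive_linear.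
        + apply is_derive_const_plus, is_derive_linear.
      - intros s Hs. rewrite Rmin_left, Rmax_right in Hs by lra. destruct (Ks s Hs) as [S1 S2].
        destruct (Bd _ _ S2) as [_ [T1 T2]].
        rewrite Rmult_plus_distr_l. apply plus_bound; apply mult_bound; auto using Rle_refl. }
    unfold ts, xs in E.
    replace (t' + (t - t') * 1) with t in E by ring. replace (x' + (x - x') * 1) with x in E by ring.
    replace (t' + (t - t') * 0) with t' in E by ring. replace (x' + (x - x') * 0) with x' in E by ring.
    rewrite Rminus_0_r, Rabs_R1, Rmult_1_r in E. exact E. }
  (* The scaled point $(st,sx)$ stays in the cone, and for small [s] continuity up to the boundary
     at the apex costs only [e]. *)
  assert (Vertex : forall t x, 0 < t -> K d t x -> Rabs (f (t, x) - f (0, 0)) <= B * (Rabs (t - 0) + Rabs (x - 0))).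
  { intros t x Ht HK. apply le_epsilon. intros e He. rewrite !Rminus_0_r.
    destruct (within_locally_bound f 0 0 e He (proj1 Hf _ D0)) as [c3 [P3 H3]].
    set (M := t + Rabs x + 1). assert (HM : 0 < M) by (unfold M; generalize (Rabs_pos x); lra).
    set (s := Rmin 1 (c3 / (2 * M))).
    assert (Hs : 0 < s /\ s <= 1 /\ s <= c3 / (2 * M)).
    { unfold s. generalize (Rmin_l 1 (c3 / (2 * M))) (Rmin_r 1 (c3 / (2 * M))). intros; repeat split; try lra.
      apply Rmin_case; [lra|apply Rdiv_lt_0_compat; lra]. }
    assert (HsM : s * M < c3).
    { apply Rle_lt_trans with (c3 / (2 * M) * M); [apply Rmult_le_compat_r; lra|].
      replace (c3 / (2 * M) * M) with (c3 / 2) by (field; lra). lra. }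
    assert (Kst : K d (s * t) (s * x)).
    { destruct HK as [A1 A2]. split.
      - assert (s * t <= 1 * t) by (apply Rmult_le_compat_r; lra).
        assert (0 <= s * t) by (apply Rmult_le_pos; lra). lra.
      - replace (s * x - V0 * (s * t)) with (s * (x - V0 * t)) by ring. rewrite Rabs_mult, (Rabs_pos_eq s) by lra.
        replace (d * (s * t)) with (s * (d * t)) by ring. apply Rmult_le_compat_l; lra. }
    assert (Hst : 0 < s * t) by (apply Rmult_lt_0_compat; lra).
    assert (E1 := Main t x (s * t) (s * x) Ht Hst HK Kst).
    assert (0 <= s * Rabs x) by (apply Rmult_le_pos; [lra|apply Rabs_pos]).
    assert (E2 : Rabs (f (s * t, s * x) - f (0, 0)) < e).
    { apply H3; [apply (Kc _ _ Kst)| |]; rewrite Rminus_0_r.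
      - rewrite Rabs_pos_eq by lra. unfold M in HsM. lra.
      - rewrite Rabs_mult, (Rabs_pos_eq s) by lra. unfold M in HsM. lra. }
    assert (E3 : Rabs (t - s * t) + Rabs (x - s * x) <= Rabs t + Rabs x).
    { replace (t - s * t) with ((1 - s) * t) by ring. replace (x - s * x) with ((1 - s) * x) by ring.
      rewrite !Rabs_mult, (Rabs_pos_eq (1 - s)) by lra. rewrite <- Rmult_plus_distr_l.
      rewrite <- (Rmult_1_l (Rabs t + Rabs x)) at 2. apply Rmult_le_compat_r; [|lra].
      generalize (Rabs_pos t) (Rabs_pos x); lra. }
    assert (E4 : B * (Rabs (t - s * t) + Rabs (x - s * x)) <= B * (Rabs t + Rabs x)) by (apply Rmult_le_compat_l; auto).
    replace (f (t, x) - f (0, 0)) with ((f (t, x) - f (s * t, s * x)) + (f (s * t, s * x) - f (0, 0))) by ring.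
    eapply Rle_trans; [apply Rabs_triang|]. lra. }
  exists d, B. split; [lra|]. split; [auto|]. intros t x t' x' HK HK'. split; [apply Bd; auto|].
  assert (Zero : forall t x, K d t x -> ~ 0 < t -> t = 0 /\ x = 0).
  { intros y z [A1 A2] Hn. assert (y = 0) by lra. subst y. rewrite !Rmult_0_r, Rminus_0_r in A2.
    split; auto. generalize (Rabs_pos z). intros. destruct (Req_dec z 0); auto. generalize (Rabs_pos_lt z); lra. }
  destruct (Rlt_dec 0 t) as [Ht|Ht], (Rlt_dec 0 t') as [Ht'|Ht'].
  - apply Main; auto.
  - destruct (Zero _ _ HK' Ht') as [-> ->]. apply Vertex; auto.
  - destruct (Zero _ _ HK Ht) as [-> ->]. rewrite (Rabs_minus_sym (f (0, 0))), (Rabs_minus_sym 0 t'), (Rabs_minus_sym 0 x').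
    apply Vertex; auto.
  - destruct (Zero _ _ HK Ht) as [-> ->], (Zero _ _ HK' Ht') as [-> ->].
    rewrite !Rminus_diag, Rabs_R0. lra.
Qed.

(** Second derivatives continuous up to the boundary make the first ones Lipschitz on the whole
    cone, apex included; the chain rule is claimed for $t>0$. *)
Lemma near11_Cn (be0 : R) (f : R * R -> R) : Cn [e1; e2] 2 D f ->
  near11 be0 V0 (fun z => let '(al, be, t, x) := z in f (t, x)).
Proof.
  intros Hf. destruct (Cn_partials D 1 f Hf) as [f1 [f2 [Hp [Hf1 Hf2]]]].
  destruct (Cn_partials D 0 f1 Hf1) as [f11 [f12 [Hp1 _]]].
  destruct (Cn_partials D 0 f2 Hf2) as [f21 [f22 [Hp2 _]]].
  destruct (cone_lipschitz f f1 f2 Hp) as [c0 [B0 [P0 [Q0 L0]]]].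
  destruct (cone_lipschitz f1 f11 f12 Hp1) as [c1 [B1 [P1 [Q1 L1]]]].
  destruct (cone_lipschitz f2 f21 f22 Hp2) as [c2 [B2 [P2 [Q2 L2]]]].
  set (c := Rmin c0 (Rmin c1 c2)).
  assert (Hc : 0 < c /\ c <= c0 /\ c <= c1 /\ c <= c2).
  { unfold c. generalize (Rmin_l c0 (Rmin c1 c2)) (Rmin_r c0 (Rmin c1 c2)) (Rmin_l c1 c2) (Rmin_r c1 c2).
    intros; repeat split; try lra. repeat apply Rmin_case; lra. }
  set (B := B0 + B1 + B2).
  exists c, (2 * B), (fun z h => let '(al, be, t, x) := z in let '(h1, h2, h3, h4) := h in
     f1 (t, x) * h3 + f2 (t, x) * h4).
  split; [lra|]. split; [unfold B; lra|].
  assert (SC : forall al be t x, shock_cone be0 V0 c (al, be, t, x) -> K c t x).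
  { intros al be t x [_ [_ H]]. exact H. }
  split.
  - intros [[[al be] t] x] Hz. apply SC in Hz.
    destruct (L0 t x t x) as [T _]; [apply (K_mono c); auto; lra|apply (K_mono c); auto; lra|]. unfold B; lra.
  - intros [[[al be] t] x] [[[al' be'] t'] x'] Hz Hz'. apply SC in Hz. apply SC in Hz'.
    destruct (L0 t x t' x') as [_ T]; [apply (K_mono c); auto; lra|apply (K_mono c); auto; lra|].
    eapply Rle_trans; [apply T|]. apply Rmult_le_compat; auto.
    + apply Rplus_le_le_0_compat; apply Rabs_pos.
    + unfold B; lra.
    + unfold q4_dist. generalize (Rabs_pos (al - al')) (Rabs_pos (be - be')); lra.
  - intros [[[al be] t] x] [[[h1 h2] h3] h4] Hz. apply SC in Hz.
    destruct (L1 t x t x) as [T1 _]; [apply (K_mono c); auto; lra|apply (K_mono c); auto; lra|].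
    destruct (L2 t x t x) as [T2 _]; [apply (K_mono c); auto; lra|apply (K_mono c); auto; lra|].
    assert (N := q4_norm_nonneg (h1, h2, h3, h4)). unfold q4_norm in *.
    assert (Hh : Rabs h3 + Rabs h4 <= Rabs h1 + Rabs h2 + Rabs h3 + Rabs h4) by (generalize (Rabs_pos h1) (Rabs_pos h2); lra).
    apply Rle_trans with (B * Rabs h3 + B * Rabs h4).
    + apply plus_bound; apply mult_bound; try lra; unfold B; lra.
    + assert (B * (Rabs h3 + Rabs h4) <= B * (Rabs h1 + Rabs h2 + Rabs h3 + Rabs h4)) by (apply Rmult_le_compat_l; [unfold B; lra|auto]).
      assert (0 <= B * (Rabs h1 + Rabs h2 + Rabs h3 + Rabs h4)) by (apply Rmult_le_pos; [unfold B; lra|auto]). lra.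
  - intros [[[al be] t] x] [[[al' be'] t'] x'] [[[h1 h2] h3] h4] [[[k1 k2] k3] k4] Hz Hz'. apply SC in Hz. apply SC in Hz'.
    assert (HB : 0 <= B) by (unfold B; lra).
    destruct (L1 t x t' x') as [S1 T1]; [apply (K_mono c); auto; lra|apply (K_mono c); auto; lra|].
    destruct (L2 t x t' x') as [S2 T2]; [apply (K_mono c); auto; lra|apply (K_mono c); auto; lra|].
    destruct (L1 t' x' t x) as [S1' _]; [apply (K_mono c); auto; lra|apply (K_mono c); auto; lra|].
    destruct (L2 t' x' t x) as [S2' _]; [apply (K_mono c); auto; lra|apply (K_mono c); auto; lra|].
    set (dz := q4_dist (al, be, t, x) (al', be', t', x')). set (nh := q4_norm (h1, h2, h3, h4)).
    set (dh := q4_dist (h1, h2, h3, h4) (k1, k2, k3, k4)).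
    assert (G1 : Rabs (t - t') + Rabs (x - x') <= dz) by (unfold dz, q4_dist; generalize (Rabs_pos (al - al')) (Rabs_pos (be - be')); lra).
    assert (G2 : Rabs h3 <= nh /\ Rabs h4 <= nh).
    { unfold nh, q4_norm. generalize (Rabs_pos h1) (Rabs_pos h2) (Rabs_pos h3) (Rabs_pos h4); lra. }
    assert (G3 : Rabs (h3 - k3) + Rabs (h4 - k4) <= dh) by (unfold dh, q4_dist; generalize (Rabs_pos (h1 - k1)) (Rabs_pos (h2 - k2)); lra).
    assert (G4 : 0 <= Rabs (t - t') + Rabs (x - x')) by (apply Rplus_le_le_0_compat; apply Rabs_pos).
    assert (U1 : B1 * (Rabs (t - t') + Rabs (x - x')) <= B * dz) by (apply Rmult_le_compat; auto; unfold B; lra).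
    assert (U2 : B2 * (Rabs (t - t') + Rabs (x - x')) <= B * dz) by (apply Rmult_le_compat; auto; unfold B; lra).
    assert (TT : forall y y' h h', Rabs y' <= B -> Rabs h <= nh -> Rabs (y - y') <= B * dz ->
       Rabs (y * h - y' * h') <= B * dz * nh + B * Rabs (h - h')).
    { intros y y' h h' A1 A2 A3. replace (y * h - y' * h') with ((y - y') * h + y' * (h - h')) by ring.
      apply plus_bound; apply mult_bound; auto using Rle_refl. }
    match goal with |- Rabs (?x1 + ?x2 - (?y1 + ?y2)) <= _ =>
      replace (x1 + x2 - (y1 + y2)) with ((x1 - y1) + (x2 - y2)) by ring end.
    eapply Rle_trans.
    + apply plus_bound; apply TT; try apply G2; try lra; unfold B; lra.
    + assert (B * (Rabs (h3 - k3) + Rabs (h4 - k4)) <= B * dh) by (apply Rmult_le_compat_l; lra).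
      assert (0 <= B * dh) by (apply Rmult_le_pos; [lra|unfold dh; apply q4_dist_nonneg]). lra.
  - intros x1 x2 x3 x4 s h1 h2 h3 h4 A1 A2 A3 A4 [Hs Ht].
    apply (is_derive_curve (fun t x => f (t, x)) x3 x4); auto.
    apply (partials_differentiable D); auto. apply K_in_D; auto.
    apply (K_mono c); [lra|]. exact (SC _ _ _ _ Hs).
Qed.

End Cone.

(** * Functions of three variables *)

Definition axes3 : list (R * R * R) := [(1, 0, 0); (0, 1, 0); (0, 0, 1)].

Definition continuous3 (f : R * R * R -> R) (x y z : R) : Prop :=
  forall e, 0 < e -> exists d, 0 < d /\ forall x' y' z',
    Rabs (x' - x) < d -> Rabs (y' - y) < d -> Rabs (z' - z) < d ->
    Rabs (f (x', y', z') - f (x, y, z)) < e.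

Definition partials3 (U : R * R * R -> Prop) (f f1 f2 f3 : R * R * R -> R) : Prop :=
  forall x y z, U (x, y, z) ->
    continuous3 f x y z /\ continuous3 f1 x y z /\ continuous3 f2 x y z /\ continuous3 f3 x y z /\
    is_derive (fun s => f (s, y, z)) x (f1 (x, y, z)) /\
    is_derive (fun s => f (x, s, z)) y (f2 (x, y, z)) /\
    is_derive (fun s => f (x, y, s)) z (f3 (x, y, z)).

Lemma open_box (U : R * R * R -> Prop) (x y z : R) : open U -> U (x, y, z) ->
  exists d, 0 < d /\ forall x' y' z', Rabs (x' - x) < d -> Rabs (y' - y) < d -> Rabs (z' - z) < d -> U (x', y', z').
Proof.
  intros HU Hz. destruct (HU _ Hz) as [d Hd]. exists d. split; [apply cond_pos|].
  intros. apply Hd. repeat split; auto.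
Qed.

Lemma within_open_continuous3 (U : R * R * R -> Prop) (f : R * R * R -> R) (x y z : R) :
  open U -> U (x, y, z) ->
  filterlim f (within U (locally (x, y, z))) (locally (f (x, y, z))) -> continuous3 f x y z.
Proof.
  intros HU Hz H e He.
  destruct (proj1 (filterlim_locally f (f (x, y, z))) H (mkposreal e He)) as [d Hd].
  destruct (open_box U x y z HU Hz) as [d' [Hd' HU']].
  exists (Rmin d d'). split; [apply Rmin_case; auto; apply cond_pos|].
  assert (M1 := Rmin_l d d'). assert (M2 := Rmin_r d d').
  intros x' y' z' H1 H2 H3. apply (Hd (x', y', z')).
  - split; [split|]; simpl; [apply Rlt_le_trans with (1 := H1)|apply Rlt_le_trans with (1 := H2)|apply Rlt_le_trans with (1 := H3)]; auto.
  - apply HU'; lra.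
Qed.

Lemma Cn_partials3 (U : R * R * R -> Prop) (n : nat) (f : R * R * R -> R) :
  open U -> Cn axes3 (S n) U f ->
  exists f1 f2 f3, partials3 U f f1 f2 f3 /\ Cn axes3 n U f1 /\ Cn axes3 n U f2 /\ Cn axes3 n U f3.
Proof.
  intros HU [Hc H]. destruct (H (1, 0, 0)) as [f1 [A1 B1]]; [left; auto|].
  destruct (H (0, 1, 0)) as [f2 [A2 B2]]; [right; left; auto|].
  destruct (H (0, 0, 1)) as [f3 [A3 B3]]; [right; right; left; auto|].
  exists f1, f2, f3. split; [|auto]. intros x y z Hz.
  assert (C : forall g, Cn axes3 n U g -> continuous3 g x y z).
  { intros g Hg. apply (within_open_continuous3 U); auto. destruct n; apply Hg, Hz. }
  split; [apply (within_open_continuous3 U); auto|].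
  split; [auto|]. split; [auto|]. split; [auto|].
  assert (HI : interior_pt U (x, y, z)) by (apply HU, Hz).
  split; [|split].
  - apply is_derive_shift. generalize (A1 _ HI). apply is_derive_ext. intros s. f_equal.
    unfold plus, scal; simpl. unfold prod_plus, prod_scal, plus, scal; simpl.
    unfold prod_plus, prod_scal, plus, scal; simpl. unfold mult; simpl. f_equal; [f_equal|]; ring.
  - apply is_derive_shift. generalize (A2 _ HI). apply is_derive_ext. intros s. f_equal.
    unfold plus, scal; simpl. unfold prod_plus, prod_scal, plus, scal; simpl.
    unfold prod_plus, prod_scal, plus, scal; simpl. unfold mult; simpl. f_equal; [f_equal|]; ring.
  - apply is_derive_shift. generalize (A3 _ HI). apply is_derive_ext. intros s. f_equal.
    unfold plus, scal; simpl. unfold prod_plus, prod_scal, plus, scal; simpl.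
    unfold prod_plus, prod_scal, plus, scal; simpl. unfold mult; simpl. f_equal; [f_equal|]; ring.
Qed.

(** Two applications of the rule for two variables: to $f(X(s),y,z)$ with the first slot frozen,
    then to $(x,t)\mapsto f(x,Y(t),Z(t))$ on the curve $(X(t),t)$. *)
Lemma chain3 (U : R * R * R -> Prop) (f f1 f2 f3 : R * R * R -> R) (X Y Z : R -> R) (s X' Y' Z' : R) :
  open U -> partials3 U f f1 f2 f3 -> U (X s, Y s, Z s) ->
  is_derive X s X' -> is_derive Y s Y' -> is_derive Z s Z' ->
  is_derive (fun s => f (X s, Y s, Z s)) s
    (f1 (X s, Y s, Z s) * X' + f2 (X s, Y s, Z s) * Y' + f3 (X s, Y s, Z s) * Z').
Proof.
  intros HU Hp Hs HX HY HZ. destruct (open_box U _ _ _ HU Hs) as [d [Hd HB]].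
  assert (CY := is_derive_continuous _ _ _ HY). assert (CZ := is_derive_continuous _ _ _ HZ).
  destruct (proj1 (continuous_eps _ _) CY d Hd) as [dy [Py Ey]].
  destruct (proj1 (continuous_eps _ _) CZ d Hd) as [dz [Pz Ez]].
  destruct (Hp _ _ _ Hs) as [_ [C1 [C2 [C3 [D1 [D2 D3]]]]]].
  assert (YZ : is_derive (fun s0 => f (X s, Y s0, Z s0)) s (f2 (X s, Y s, Z s) * Y' + f3 (X s, Y s, Z s) * Z')).
  { apply (is_derive_curve (fun y z => f (X s, y, z)) Y Z); auto.
    apply (differentiable_of_partials _ (fun y z => f2 (X s, y, z))); auto.
    - exists (mkposreal d Hd). simpl. intros y z A B. apply Hp. apply HB; auto. rewrite Rminus_diag, Rabs_R0; auto.
    - intros e. destruct (C2 e (cond_pos e)) as [dd [Pd Ed]]. exists (mkposreal dd Pd). simpl.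
      intros y z A B. apply Ed; auto. rewrite Rminus_diag, Rabs_R0; auto. }
  assert (G : differentiable_pt_lim (fun x t => f (x, Y t, Z t)) (X s) s
     (f1 (X s, Y s, Z s)) (f2 (X s, Y s, Z s) * Y' + f3 (X s, Y s, Z s) * Z')).
  { apply (differentiable_of_partials _ (fun x t => f1 (x, Y t, Z t))); auto.
    - assert (P : 0 < Rmin d (Rmin dy dz)) by (repeat apply Rmin_case; auto).
      exists (mkposreal _ P). simpl. intros x t A B.
      generalize (Rmin_l d (Rmin dy dz)) (Rmin_r d (Rmin dy dz)) (Rmin_l dy dz) (Rmin_r dy dz). intros.
      apply Hp, HB; [lra|apply Ey; lra|apply Ez; lra].
    - intros e. destruct (C1 e (cond_pos e)) as [dd [Pd Ed]].
      destruct (proj1 (continuous_eps _ _) CY dd Pd) as [dy' [Py' Ey']].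
      destruct (proj1 (continuous_eps _ _) CZ dd Pd) as [dz' [Pz' Ez']].
      assert (P : 0 < Rmin dd (Rmin dy' dz')) by (repeat apply Rmin_case; auto).
      exists (mkposreal _ P). simpl. intros x t A B.
      generalize (Rmin_l dd (Rmin dy' dz')) (Rmin_r dd (Rmin dy' dz')) (Rmin_l dy' dz') (Rmin_r dy' dz'). intros.
      apply Ed; [lra|apply Ey'; lra|apply Ez'; lra]. }
  assert (R := is_derive_curve (fun x t => f (x, Y t, Z t)) X (fun t => t) s _ _ X' 1 G HX (is_derive_id s)).
  rewrite Rmult_1_r, <- Rplus_assoc in R. exact R.
Qed.

(** The second derivatives are bounded on a small box; changing one coordinate at a time stays in
    the box and gives the Lipschitz bounds by the mean value theorem. *)
Lemma Cn2_box11 (U : R * R * R -> Prop) (f : R * R * R -> R) (x0 y0 z0 : R) :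
  open U -> U (x0, y0, z0) -> Cn axes3 2 U f ->
  exists m B p1 p2 p3, 0 < m /\ 0 <= B /\
    box11 x0 y0 z0 m B (fun x y z => f (x, y, z)) p1 p2 p3.
Proof.
  intros HU H0 Hf. destruct (Cn_partials3 U 1 f HU Hf) as [f1 [f2 [f3 [Hp [G1 [G2 G3]]]]]].
  destruct (Cn_partials3 U 0 f1 HU G1) as [f11 [f12 [f13 [Hp1 _]]]].
  destruct (Cn_partials3 U 0 f2 HU G2) as [f21 [f22 [f23 [Hp2 _]]]].
  destruct (Cn_partials3 U 0 f3 HU G3) as [f31 [f32 [f33 [Hp3 _]]]].
  destruct (open_box U _ _ _ HU H0) as [d [Hd HB]].
  assert (W : forall g, continuous3 g x0 y0 z0 -> exists c, 0 < c /\ forall x y z,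
     Rabs (x - x0) < c -> Rabs (y - y0) < c -> Rabs (z - z0) < c -> Rabs (g (x, y, z)) <= Rabs (g (x0, y0, z0)) + 1).
  { intros g Hg. destruct (Hg 1 ltac:(lra)) as [c [Pc Ec]]. exists c. split; auto. intros x y z A1 A2 A3.
    specialize (Ec x y z A1 A2 A3). replace (g (x, y, z)) with ((g (x, y, z) - g (x0, y0, z0)) + g (x0, y0, z0)) by ring.
    eapply Rle_trans; [apply Rabs_triang|]. lra. }
  assert (L : forall g g1 g2 g3, partials3 U g g1 g2 g3 -> exists m B, 0 < m /\ m < d /\ 0 <= B /\
     forall x y z x' y' z', box x0 y0 z0 m x y z -> box x0 y0 z0 m x' y' z' ->
       Rabs (g (x, y, z)) <= B /\
       Rabs (g (x, y, z) - g (x', y', z')) <= B * (Rabs (x - x') + Rabs (y - y') + Rabs (z - z'))).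
  { intros g g1 g2 g3 Hg. destruct (Hg _ _ _ H0) as [K0 [K1 [K2 [K3 _]]]].
    destruct (W g K0) as [c0 [P0 E0]]. destruct (W g1 K1) as [c1 [P1 E1]].
    destruct (W g2 K2) as [c2 [P2 E2]]. destruct (W g3 K3) as [c3 [P3 E3]].
    set (m := Rmin d (Rmin (Rmin c0 c1) (Rmin c2 c3)) / 2).
    assert (Hm : 0 < m /\ m < d /\ m < c0 /\ m < c1 /\ m < c2 /\ m < c3).
    { assert (0 < Rmin d (Rmin (Rmin c0 c1) (Rmin c2 c3))) by (repeat apply Rmin_case; lra).
      generalize (Rmin_l d (Rmin (Rmin c0 c1) (Rmin c2 c3))) (Rmin_r d (Rmin (Rmin c0 c1) (Rmin c2 c3)))
        (Rmin_l (Rmin c0 c1) (Rmin c2 c3)) (Rmin_r (Rmin c0 c1) (Rmin c2 c3))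
        (Rmin_l c0 c1) (Rmin_r c0 c1) (Rmin_l c2 c3) (Rmin_r c2 c3). unfold m. intros; repeat split; lra. }
    set (B := Rabs (g (x0, y0, z0)) + Rabs (g1 (x0, y0, z0)) + Rabs (g2 (x0, y0, z0)) + Rabs (g3 (x0, y0, z0)) + 1).
    generalize (Rabs_pos (g (x0, y0, z0))) (Rabs_pos (g1 (x0, y0, z0))) (Rabs_pos (g2 (x0, y0, z0))) (Rabs_pos (g3 (x0, y0, z0))).
    intros A0 A1 A2 A3.
    exists m, B. split; [lra|]. split; [lra|]. split; [unfold B; lra|].
    assert (Seg : forall c x x' w, Rabs (x - c) <= m -> Rabs (x' - c) <= m -> Rmin x' x <= w <= Rmax x' x -> Rabs (w - c) <= m).
    { intros c x x' w Hx Hx'. clear - Hx Hx'. unfold Rmin, Rmax. destruct (Rle_dec x' x); intros Hc; split_Rabs; lra. }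
    intros x y z x' y' z' [X1 [X2 X3]] [Y1 [Y2 Y3]]. split.
    - specialize (E0 x y z ltac:(lra) ltac:(lra) ltac:(lra)). unfold B; lra.
    - replace (g (x, y, z) - g (x', y', z')) with
        ((g (x, y, z) - g (x', y, z)) + (g (x', y, z) - g (x', y', z)) + (g (x', y', z) - g (x', y', z'))) by ring.
      rewrite !Rmult_plus_distr_l. apply plus_bound; [apply plus_bound|].
      + apply (mean_value_bound (fun s => g (s, y, z)) (fun s => g1 (s, y, z))); intros w Hw; assert (Sw := Seg _ _ _ _ X1 Y1 Hw).
        * apply Hg, HB; lra.
        * specialize (E1 w y z ltac:(lra) ltac:(lra) ltac:(lra)). unfold B; lra.
      + apply (mean_value_bound (fun s => g (x', s, z)) (fun s => g2 (x', s, z))); intros w Hw; assert (Sw := Seg _ _ _ _ X2 Y2 Hw).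
        * apply Hg, HB; lra.
        * specialize (E2 x' w z ltac:(lra) ltac:(lra) ltac:(lra)). unfold B; lra.
      + apply (mean_value_bound (fun s => g (x', y', s)) (fun s => g3 (x', y', s))); intros w Hw; assert (Sw := Seg _ _ _ _ X3 Y3 Hw).
        * apply Hg, HB; lra.
        * specialize (E3 x' y' w ltac:(lra) ltac:(lra) ltac:(lra)). unfold B; lra. }
  destruct (L _ _ _ _ Hp) as [m0 [B0 [P0 [Q0 [R0 L0]]]]].
  destruct (L _ _ _ _ Hp1) as [m1 [B1 [P1 [Q1 [R1 L1]]]]].
  destruct (L _ _ _ _ Hp2) as [m2 [B2 [P2 [Q2 [R2 L2]]]]].
  destruct (L _ _ _ _ Hp3) as [m3 [B3 [P3 [Q3 [R3 L3]]]]].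
  set (m := Rmin (Rmin m0 m1) (Rmin m2 m3)).
  assert (Hm : 0 < m /\ m <= m0 /\ m <= m1 /\ m <= m2 /\ m <= m3).
  { unfold m. generalize (Rmin_l (Rmin m0 m1) (Rmin m2 m3)) (Rmin_r (Rmin m0 m1) (Rmin m2 m3))
      (Rmin_l m0 m1) (Rmin_r m0 m1) (Rmin_l m2 m3) (Rmin_r m2 m3). intros; repeat split; try lra.
    repeat apply Rmin_case; lra. }
  set (B := B0 + B1 + B2 + B3).
  assert (S : forall m' x y z, m <= m' -> box x0 y0 z0 m x y z -> box x0 y0 z0 m' x y z).
  { intros m' x y z Hm' [A1 [A2 A3]]. repeat split; lra. }
  exists m, B, (fun x y z => f1 (x, y, z)), (fun x y z => f2 (x, y, z)), (fun x y z => f3 (x, y, z)).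
  split; [lra|]. split; [unfold B; lra|]. split.
  - intros x y z Hz.
    destruct (L0 x y z x y z) as [T0 _]; [apply (S m0); auto; lra|apply (S m0); auto; lra|].
    destruct (L1 x y z x y z) as [T1 _]; [apply (S m1); auto; lra|apply (S m1); auto; lra|].
    destruct (L2 x y z x y z) as [T2 _]; [apply (S m2); auto; lra|apply (S m2); auto; lra|].
    destruct (L3 x y z x y z) as [T3 _]; [apply (S m3); auto; lra|apply (S m3); auto; lra|].
    unfold B; repeat split; lra.
  - intros x y z x' y' z' Hz Hz' e.
    destruct (L0 x y z x' y' z') as [_ T0]; [apply (S m0); auto; lra|apply (S m0); auto; lra|].
    destruct (L1 x y z x' y' z') as [_ T1]; [apply (S m1); auto; lra|apply (S m1); auto; lra|].
    destruct (L2 x y z x' y' z') as [_ T2]; [apply (S m2); auto; lra|apply (S m2); auto; lra|].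
    destruct (L3 x y z x' y' z') as [_ T3]; [apply (S m3); auto; lra|apply (S m3); auto; lra|].
    fold e in T0, T1, T2, T3.
    assert (He : 0 <= e) by (unfold e; repeat apply Rplus_le_le_0_compat; apply Rabs_pos).
    assert (V : forall b, b <= B -> b * e <= B * e) by (intros; apply Rmult_le_compat_r; auto).
    assert (V0 := V B0 ltac:(unfold B; lra)). assert (V1 := V B1 ltac:(unfold B; lra)).
    assert (V2 := V B2 ltac:(unfold B; lra)). assert (V3 := V B3 ltac:(unfold B; lra)).
    repeat split; lra.
  - intros X Y Z s X' Y' Z' [Z1 [Z2 Z3]] HX HY HZ. apply (chain3 U); auto. apply HB; lra.
Qed.

(** * The state ahead of the shock *)

Lemma is_derive_within_eps (I : R -> Prop) (f : R -> R) (x l : R) :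
  is_derive_within I f x l -> forall e, 0 < e -> exists d, 0 < d /\
    forall y, I y -> Rabs (y - x) < d -> Rabs (f y - f x - l * (y - x)) <= e * Rabs (y - x).
Proof.
  intros [_ H] e He.
  assert (HF : is_filter_lim (within I (locally x)) x).
  { intros P HP. unfold within. revert HP. apply filter_imp. auto. }
  destruct (H x HF (mkposreal e He)) as [d Hd].
  exists d. split; [apply cond_pos|]. intros y HI Hy. specialize (Hd y Hy HI).
  unfold norm in Hd; simpl in Hd. unfold abs, minus, plus, opp, scal in Hd; simpl in Hd. unfold mult in Hd; simpl in Hd.
  replace (f y - f x - l * (y - x)) with (f y + - f x + - ((y + - x) * l)) by ring. exact Hd.
Qed.

Lemma is_derive_is_derive_within (I : R -> Prop) (f : R -> R) (x l : R) :
  I x -> is_derive f x l -> is_derive_within I f x l.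
Proof.
  intros HI [Hl H]. split; [exact Hl|]. intros y Hy e.
  assert (E : y = x).
  { destruct (Req_dec y x) as [|Hn]; auto. exfalso.
    assert (Hp : 0 < Rabs (x - y)) by (apply Rabs_pos_lt; lra).
    assert (B : locally y (fun z => Rabs (z - y) < Rabs (x - y))).
    { exists (mkposreal _ Hp). intros z Hz. exact Hz. }
    specialize (Hy _ B). unfold within in Hy. generalize (locally_singleton _ _ Hy HI). lra. }
  subst y. specialize (H x (fun P HP => HP) e). unfold within.
  revert H. apply filter_imp. auto.
Qed.

Section StateAhead.

Variables (p : R -> R) (T : R) (x0 : R -> R) (rho_data w_data : R -> R) (rhos ws : R * R -> R) (V0 : R).
Hypothesis dev : future_development p T x0 rho_data w_data rhos ws.
Hypothesis faster : ws (0, 0) + eta p (rhos (0, 0)) < V0.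

Let D := dev_domain T x0.

(** This uses the determinism condition ahead of the shock: the boundary [x0] leaves the origin with
    a slope below [V0], hence lies strictly to the left of a thin cone about $x=V_0t$ for small
    positive times. *)
Lemma cone_in_domain : exists d1, 0 < d1 /\ forall t x,
  0 <= t <= d1 /\ Rabs (x - V0 * t) <= d1 * t -> D (t, x) /\ (0 < t -> interior_pt D (t, x)).
Proof.
  assert (HT := dev_T _ _ _ _ _ _ _ dev).
  set (c0 := ws (0, 0) + eta p (rhos (0, 0))).
  assert (X0 := dev_origin _ _ _ _ _ _ _ dev).
  assert (Hc := dev_characteristic _ _ _ _ _ _ _ dev 0 ltac:(lra)). rewrite X0 in Hc. fold c0 in Hc.
  (* With $V_0=c_0+2e$ the boundary stays below $(c_0+e)t$ and the cone above $(V_0-d_1)t$, which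
     leaves the gap $(e-d_1)t$. *)
  set (e := (V0 - c0) / 2). assert (He : 0 < e) by (unfold e, c0; lra).
  destruct (is_derive_within_eps _ _ _ _ Hc e He) as [d [Hd Hx]].
  set (d1 := Rmin (Rmin (d / 2) (T / 2)) (e / 2)).
  assert (Hd1 : 0 < d1 /\ d1 <= d / 2 /\ d1 <= T / 2 /\ d1 <= e / 2).
  { unfold d1. generalize (Rmin_l (Rmin (d / 2) (T / 2)) (e / 2)) (Rmin_r (Rmin (d / 2) (T / 2)) (e / 2))
     (Rmin_l (d / 2) (T / 2)) (Rmin_r (d / 2) (T / 2)). intros; repeat split; try lra. repeat apply Rmin_case; lra. }
  exists d1. split; [lra|]. intros t x [Ht HK].
  assert (Hlow : x0 t + (e - d1) * t <= x).
  { assert (W := Hx t ltac:(lra) ltac:(rewrite Rminus_0_r, Rabs_pos_eq; lra)).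
    rewrite X0, !Rminus_0_r, (Rabs_pos_eq t) in W by lra.
    assert (x0 t - c0 * t <= e * t) by (generalize (Rle_abs (x0 t - c0 * t)); lra).
    assert (- (x - V0 * t) <= d1 * t) by (rewrite <- Rabs_Ropp in HK; generalize (Rle_abs (- (x - V0 * t))); lra).
    assert (V0 = c0 + 2 * e) by (unfold e; field).
    assert (V0 * t = c0 * t + 2 * e * t) by (rewrite H1; ring). lra. }
  assert (Het : 0 <= (e - d1) * t) by (apply Rmult_le_pos; lra).
  split; [split; simpl; [lra|lra]|].
  intros Ht0. assert (Het' : 0 < (e - d1) * t) by (apply Rmult_lt_0_compat; lra).
  set (gap := (e - d1) * t) in *.
  assert (Hct := dev_characteristic _ _ _ _ _ _ _ dev t ltac:(lra)).
  set (l := ws (t, x0 t) + eta p (rhos (t, x0 t))) in Hct.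
  destruct (is_derive_within_eps _ _ _ _ Hct 1 ltac:(lra)) as [d2 [Hd2 Hx2]].
  (* [L] bounds the difference quotients of [x0] at [t]. Nearby points use up a quarter of the gap
     for the motion of the boundary and a quarter for that of the point. *)
  set (L := Rabs l + 1). assert (HL : 0 < L) by (unfold L; generalize (Rabs_pos l); lra).
  set (m := Rmin (Rmin d2 (gap / (4 * L))) (Rmin (t / 2) (Rmin (T / 4) (gap / 4)))).
  assert (Hq : 0 < gap / (4 * L)) by (apply Rdiv_lt_0_compat; lra).
  assert (Hm : 0 < m /\ m <= d2 /\ m <= gap / (4 * L) /\ m <= t / 2 /\ m <= T / 4 /\ m <= gap / 4).
  { unfold m. generalize (Rmin_l (Rmin d2 (gap / (4 * L))) (Rmin (t / 2) (Rmin (T / 4) (gap / 4))))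
      (Rmin_r (Rmin d2 (gap / (4 * L))) (Rmin (t / 2) (Rmin (T / 4) (gap / 4))))
      (Rmin_l d2 (gap / (4 * L))) (Rmin_r d2 (gap / (4 * L)))
      (Rmin_l (t / 2) (Rmin (T / 4) (gap / 4))) (Rmin_r (t / 2) (Rmin (T / 4) (gap / 4)))
      (Rmin_l (T / 4) (gap / 4)) (Rmin_r (T / 4) (gap / 4)).
    clearbody gap. intros; repeat split; try lra. repeat apply Rmin_case; lra. }
  exists (mkposreal m (proj1 Hm)). intros [t' x'] [Bt Bx].
  change (Rabs (t' - t) < m) in Bt. change (Rabs (x' - x) < m) in Bx.
  assert (Bt1 := Rle_abs (t' - t)). assert (Bt2 := Rle_abs (- (t' - t))). rewrite Rabs_Ropp in Bt2.
  assert (Bx2 := Rle_abs (- (x' - x))). rewrite Rabs_Ropp in Bx2.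
  split; simpl; [lra|].
  assert (W := Hx2 t' ltac:(lra) ltac:(lra)).
  assert (W2 : Rabs (x0 t' - x0 t) <= L * Rabs (t' - t)).
  { replace (x0 t' - x0 t) with ((x0 t' - x0 t - l * (t' - t)) + l * (t' - t)) by ring.
    eapply Rle_trans; [apply Rabs_triang|]. rewrite (Rabs_mult l). unfold L; lra. }
  assert (W3 : L * Rabs (t' - t) <= L * (gap / (4 * L))) by (apply Rmult_le_compat_l; lra).
  replace (L * (gap / (4 * L))) with (gap / 4) in W3 by (field; lra).
  generalize (Rle_abs (x0 t' - x0 t)). lra.
Qed.

End StateAhead.

(** * The derivative of [H] with respect to $\alpha_+$ *)

Section Coefficients.

Variables (p : R -> R) (rref : R).
Hypothesis p_smooth : forall (n : nat) (r : R), 0 < r -> ex_derive_n p n r.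
Hypothesis dp_pos : forall r : R, 0 < r -> 0 < Derive p r.
Hypothesis rref_pos : 0 < rref.

Variables (rho0 V0 rm0 wm0 : R).
Hypothesis rho0_pos : 0 < rho0.
Hypothesis rm0_pos : 0 < rm0.
Hypothesis wm0_nonzero : wm0 <> 0.
Hypothesis jump0 : jump_conditions p rho0 0 rm0 wm0 V0.
Hypothesis V0_lt_eta0 : V0 < eta p rho0.
Hypothesis V0_pos : 0 < V0.

Let Fe := enthalpy_integral p rref.
Let eta0 := eta p rho0.
Let a := a_const eta0 V0.
Let be0 := Fe rho0.

Lemma a_range : 0 < a < 1.
Proof.
  unfold a, a_const. assert (0 < eta0 + V0) by (unfold eta0; lra). split.
  - apply Rdiv_lt_0_compat; unfold eta0; lra.
  - apply Rmult_lt_reg_r with (eta0 + V0); auto. field_simplify; lra.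
Qed.

(** Equal densities would reduce the mass condition to $\rho_-w_-=0$. *)
Lemma densities_distinct : rho0 <> rm0.
Proof.
  destruct jump0 as [J1 _]. intros E. rewrite E in J1. apply wm0_nonzero.
  apply Rmult_eq_reg_l with rm0; lra.
Qed.

Lemma be0_range : enthalpy_range p rref be0.
Proof. exists rho0. split; auto. Qed.

(** Differentiating [J = 0] in [alpha_+] gives [- (eta0 - V0)^2 / (eta0 + V0)^2]. *)
Lemma H_alpha (h : R -> R) (l : R) (alm bem : R) :
  alpha_of p rref rm0 wm0 = alm -> beta_of p rref rm0 wm0 = bem ->
  h be0 = be0 -> is_derive h be0 l ->
  locally be0 (fun s => J p rref s (h s) alm bem = 0) -> l = - (a * a).
Proof.
  intros <- <- H0 Hl HJ.
  set (sg := fun s => (s + h s) / 2).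
  assert (Hsg0 : sg be0 = be0) by (unfold sg; rewrite H0; field).
  assert (Dsg : is_derive sg be0 ((1 + l) / 2)).
  { apply (is_derive_ext (fun s => / 2 * (s + h s))); [intros s; unfold sg; simpl; field|].
    replace ((1 + l) / 2) with (/ 2 * (1 + l)) by field.
    apply is_derive_scal. apply @is_derive_plus; [apply @is_derive_id|exact Hl]. }
  assert (Dw : is_derive (fun s => (s - h s) / 2) be0 ((1 - l) / 2)).
  { apply (is_derive_ext (fun s => / 2 * (s - h s))); [intros s; simpl; field|].
    replace ((1 - l) / 2) with (/ 2 * (1 - l)) by field.
    apply is_derive_scal. apply @is_derive_minus; [apply @is_derive_id|exact Hl]. }
  set (rp := fun s => density p rref (sg s)). set (w := fun s => (s - h s) / 2) in Dw.
  assert (Hrp0 : rp be0 = rho0) by (unfold rp; rewrite Hsg0; apply density_enthalpy; auto).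
  assert (Hw0 : w be0 = 0) by (unfold w; rewrite H0; field).
  assert (He : 0 < eta0) by (apply eta_pos; auto).
  set (r1 := (1 + l) / 2 * (rho0 / eta0)).
  assert (Drp : is_derive rp be0 r1).
  { apply (is_derive_comp (density p rref) sg); auto.
    rewrite Hsg0. assert (K := density_derive p rref p_smooth dp_pos rref_pos be0 be0_range).
    unfold be0, Fe in K. rewrite density_enthalpy in K by auto. exact K. }
  set (w1 := (1 - l) / 2) in Dw.
  assert (Dp : is_derive (fun s => p (rp s)) be0 (r1 * (eta0 * eta0))).
  { apply (is_derive_comp p rp); auto. rewrite Hrp0. unfold eta0. rewrite eta_sqr by auto.
    apply Derive_correct. exact (p_smooth 1 rho0 rho0_pos). }
  destruct jump0 as [J1 J2].
  set (A := rm0 * wm0) in *. set (B := rm0 * wm0 ^ 2 + p rm0) in *.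
  set (Jf := fun s => (rp s * w s - A) * (rp s * w s - A) - ((rp s * (w s * w s) + p (rp s)) - B) * (rp s - rm0)).
  assert (EJ : locally be0 (fun s => 0 = Jf s)).
  { assert (Hr : locally be0 (fun s => enthalpy_range p rref (sg s))).
    { apply (is_derive_continuous _ _ _ Dsg). rewrite Hsg0. apply enthalpy_range_locally; auto. apply be0_range. }
    generalize (filter_and _ _ HJ Hr). apply filter_imp. intros s [E Hs].
    rewrite <- E. unfold J, Jf. rewrite (rho_of_density p rref p_smooth dp_pos rref_pos s (h s)) by exact Hs.
    rewrite rho_of_state, w_of_state by auto. unfold A, B, rp, w, sg, w_of. ring. }
  assert (Drw : is_derive (fun s => rp s * w s) be0 (rho0 * w1)).
  { evar_last; [apply (is_derive_mult rp w); eauto; intros; apply Rmult_comm|].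
    rewrite Hrp0, Hw0. unfold plus, mult; simpl. ring. }
  assert (DJ : is_derive Jf be0 (2 * (- A) * (rho0 * w1) - (r1 * (eta0 * eta0) * (rho0 - rm0) + (p rho0 - B) * r1))).
  { evar_last.
    - unfold Jf. apply @is_derive_minus.
      + apply (is_derive_mult (fun s => rp s * w s - A) (fun s => rp s * w s - A)); [| |intros; apply Rmult_comm];
        (apply @is_derive_minus; [exact Drw|apply @is_derive_const]).
      + apply (is_derive_mult (fun s => rp s * (w s * w s) + p (rp s) - B) (fun s => rp s - rm0)); [| |intros; apply Rmult_comm].
        * apply @is_derive_minus; [|apply @is_derive_const]. apply @is_derive_plus; [|exact Dp].
          apply (is_derive_mult rp (fun s => w s * w s)); eauto; [|intros; apply Rmult_comm].
          apply (is_derive_mult w w); eauto; intros; apply Rmult_comm.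
        * apply @is_derive_minus; [exact Drp|apply @is_derive_const].
    - rewrite Hrp0, Hw0. unfold minus, plus, opp, mult, zero; simpl. unfold zero; simpl. ring. }
  assert (E0 : 2 * (- A) * (rho0 * w1) - (r1 * (eta0 * eta0) * (rho0 - rm0) + (p rho0 - B) * r1) = 0).
  { rewrite <- (is_derive_unique _ _ _ DJ). apply is_derive_unique.
    apply (is_derive_ext_loc (fun _ => 0)); [exact EJ|]. exact (is_derive_const 0 be0). }
  (* Since $w_+=0$, the jump conditions express mass flux and momentum flux ahead through
     $[\rho]V_0$ and $[\rho]V_0^2$; the state ahead then enters only through the common factor
     $[\rho]$. *)
  assert (N1 : - A = (rho0 - rm0) * V0) by lra.
  assert (N2 : p rho0 - B = (rho0 - rm0) * V0 * V0) by (rewrite <- N1; lra).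
  rewrite N1, N2 in E0. assert (Hd := densities_distinct).
  assert (E1 : (rho0 - rm0) * (rho0 / eta0 / 2) * (2 * V0 * eta0 * (1 - l) - (1 + l) * (eta0 * eta0 + V0 * V0)) = 0).
  { rewrite <- E0. unfold r1, w1. field. lra. }
  apply Rmult_integral in E1. destruct E1 as [E1|E1].
  - apply Rmult_integral in E1. destruct E1 as [E1|E1]; [lra|].
    assert (0 < rho0 / eta0 / 2) by (repeat apply Rdiv_lt_0_compat; lra). lra.
  - assert (Hs : 0 < eta0 + V0) by lra.
    (* From $2V_0\eta_0(1-l)=(1+l)(\eta_0^2+V_0^2)$ the terms with [l] form a complete square. *)
    assert (E2 : l * ((eta0 + V0) * (eta0 + V0)) = - ((eta0 - V0) * (eta0 - V0))) by lra.
    unfold a, a_const.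
    apply Rmult_eq_reg_r with ((eta0 + V0) * (eta0 + V0)).
    + rewrite E2. field. lra.
    + assert (0 < (eta0 + V0) * (eta0 + V0)) by (apply Rmult_lt_0_compat; lra). lra.
Qed.

End Coefficients.

(** * Functions of characteristic coordinates and of [(t, x)] *)

(** This makes the filter in [pd] proper at [q]; for an improper filter [lim] would carry no
    information. *)
Definition adherent_interior (D : R * R -> Prop) (q : R * R) : Prop :=
  forall d, 0 < d -> exists z, interior_pt D z /\ Rabs (fst z - fst q) < d /\ Rabs (snd z - snd q) < d.

Lemma pd_limit (D : R * R -> Prop) (e : R * R) (f g : R * R -> R) (q : R * R) :
  D q -> adherent_interior D q ->
  (forall z, interior_pt D z -> is_derive (fun s : R => f (plus z (scal s e))) 0 (g z)) ->
  filterlim g (within D (locally q)) (locally (g q)) -> pd D e f q = g q.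
Proof.
  intros Hq Hadh Hd Hg. unfold pd.
  set (F := filtermap (fun z : R * R => Derive (fun s => f (plus z (scal s e))) 0) (within (interior_pt D) (locally q))).
  assert (FP : ProperFilter F).
  { apply filtermap_proper_filter. split.
    - intros P [d HP]. destruct (Hadh d (cond_pos d)) as [z [Hz [H1 H2]]]. exists z. apply HP; auto.
      split; auto.
    - apply within_filter, locally_filter. }
  assert (Fl : forall eps : posreal, F (ball (g q) eps)).
  { intros eps. assert (K := proj1 (filterlim_locally g (g q)) Hg eps). unfold F, filtermap, within in *.
    revert K. apply filter_imp. intros z K Hz.
    rewrite (is_derive_unique _ _ _ (Hd z Hz)). apply K. exact (locally_singleton _ _ Hz). }
  assert (HC : cauchy F) by (intros eps; exists (g q); apply Fl).
  assert (HL := complete_cauchy F FP HC).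
  apply Rminus_diag_uniq. destruct (Req_dec (lim F - g q) 0) as [|Hn]; auto. exfalso.
  assert (Hp : 0 < Rabs (lim F - g q) / 2) by (generalize (Rabs_pos_lt _ Hn); lra).
  destruct (filter_ex _ (filter_and _ _ (HL (mkposreal _ Hp)) (Fl (mkposreal _ Hp)))) as [y [Y1 Y2]].
  change (Rabs (y - lim F) < Rabs (lim F - g q) / 2) in Y1. change (Rabs (y - g q) < Rabs (lim F - g q) / 2) in Y2.
  assert (Rabs (lim F - g q) <= Rabs (y - lim F) + Rabs (y - g q)).
  { replace (lim F - g q) with (- (y - lim F) + (y - g q)) by ring. eapply Rle_trans; [apply Rabs_triang|].
    rewrite Rabs_Ropp. lra. }
  lra.
Qed.

Lemma pd_partials (D : R * R -> Prop) (f f1 f2 : R * R -> R) (q : R * R) :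
  partials D f f1 f2 -> D q -> adherent_interior D q -> pd D e1 f q = f1 q /\ pd D e2 f q = f2 q.
Proof.
  intros [_ [H1 [H2 H]]] Hq Ha. split; apply pd_limit; auto; intros [t x] Hz.
  - apply is_derive_e1, H, Hz.
  - apply is_derive_e2, H, Hz.
Qed.

Lemma Cn_of_partials (D : R * R -> Prop) (n : nat) (f f1 f2 : R * R -> R) :
  partials D f f1 f2 -> Cn [e1; e2] n D f1 -> Cn [e1; e2] n D f2 -> Cn [e1; e2] (S n) D f.
Proof.
  intros [H0 [H1 [H2 H]]] C1 C2. split; [exact H0|].
  intros e [<-|[<-|[]]]; [exists f1|exists f2]; split; auto; intros [t x] Hz.
  - apply is_derive_e1, H, Hz.
  - apply is_derive_e2, H, Hz.
Qed.

Lemma C2_of_partials (D : R * R -> Prop) (f f1 f2 f11 f12 f21 f22 : R * R -> R) :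
  partials D f f1 f2 -> partials D f1 f11 f12 -> partials D f2 f21 f22 -> C2 D f.
Proof.
  intros H0 H1 H2. apply (Cn_of_partials D 1 f f1 f2); auto.
  - apply (Cn_of_partials D 0 f1 f11 f12); auto; split; auto; apply H1.
  - apply (Cn_of_partials D 0 f2 f21 f22); auto; split; auto; apply H2.
Qed.

Definition uncurry2 (f : R -> R -> R) (q : R * R) : R := f (fst q) (snd q).

Lemma partials_of_square (r : R) (D : R * R -> Prop) (f fu fv : R -> R -> R) :
  (forall u v, D (u, v) -> square r u v) -> C1_square r f fu fv ->
  partials D (uncurry2 f) (uncurry2 fu) (uncurry2 fv).
Proof.
  intros HD Hf.
  assert (K : forall g, (forall u v, square r u v -> continuity_2d_pt g u v) ->
    forall q, D q -> filterlim (uncurry2 g) (within D (locally q)) (locally (uncurry2 g q))).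
  { intros g Hg [u v] Hq P HP.
    assert (W := proj1 (continuity_2d_pt_filterlim g u v) (Hg u v (HD u v Hq)) P HP).
    unfold filtermap, within in *. revert W. apply filter_imp. auto. }
  split; [apply K; eapply C1_square_continuous; eauto|].
  split; [apply K; intros; apply Hf; auto|]. split; [apply K; intros; apply Hf; auto|].
  intros u v Hz. assert (Hs : square r u v) by (apply HD; exact (locally_singleton _ _ Hz)).
  destruct (Hf u v Hs) as [H1 [H2 _]]. split; [exact H1|exact H2].
Qed.

(** * Geometry of the triangle *)

Lemma T_domain_iff (a eps u v : R) : 0 < a ->
  (T_domain a eps (u, v) <-> 0 <= u <= v /\ a * v <= u /\ u <= a * eps).
Proof.
  intros Ha. unfold T_domain; simpl. split.
  - intros [H1 [H2 H3]]. split; auto. split.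
    + apply Rle_trans with (a * (u / a)); [apply Rmult_le_compat_l; lra|right; field; lra].
    + apply Rle_trans with (a * (u / a)); [right; field; lra|apply Rmult_le_compat_l; lra].
  - intros [H1 [H2 H3]]. split; auto.
    assert (Hi : 0 < / a) by (apply Rinv_0_lt_compat; auto). split.
    + apply Rle_trans with (a * v / a); [right; field; lra|apply Rmult_le_compat_r; lra].
    + apply Rle_trans with (a * eps / a); [apply Rmult_le_compat_r; lra|right; field; lra].
Qed.

Lemma T_domain_interior (a eps u v : R) : 0 < a < 1 ->
  u < v -> a * v < u -> u < a * eps -> interior_pt (T_domain a eps) (u, v).
Proof.
  intros Ha H1 H2 H3.
  set (m := Rmin (v - u) (Rmin (u - a * v) (a * eps - u)) / 2).
  assert (Hm : 0 < m /\ 2 * m <= v - u /\ 2 * m <= u - a * v /\ 2 * m <= a * eps - u).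
  { assert (0 < Rmin (v - u) (Rmin (u - a * v) (a * eps - u))) by (repeat apply Rmin_case; lra).
    generalize (Rmin_l (v - u) (Rmin (u - a * v) (a * eps - u))) (Rmin_r (v - u) (Rmin (u - a * v) (a * eps - u)))
      (Rmin_l (u - a * v) (a * eps - u)) (Rmin_r (u - a * v) (a * eps - u)). unfold m. intros; repeat split; lra. }
  exists (mkposreal m (proj1 Hm)). intros [u' v'] [B1 B2].
  change (Rabs (u' - u) < m) in B1. change (Rabs (v' - v) < m) in B2.
  apply Rabs_def2 in B1. apply Rabs_def2 in B2. apply T_domain_iff; [lra|].
  assert (E1 : a * v' <= a * (v + m)) by (apply Rmult_le_compat_l; lra).
  assert (E2 : a * m <= 1 * m) by (apply Rmult_le_compat_r; lra).
  assert (E3 : a * u' <= a * v') by (apply Rmult_le_compat_l; lra).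
  assert (E4 : 0 <= u').
  { apply Rmult_le_reg_l with (1 - a); [lra|]. rewrite Rmult_0_r. lra. }
  repeat split; lra.
Qed.

(** The triangle is convex, so moving a little from any of its points towards the interior point
    [(uc, vc)] leads into the interior. *)
Lemma T_domain_adherent (a eps : R) (q : R * R) : 0 < a < 1 -> 0 < eps ->
  T_domain a eps q -> adherent_interior (T_domain a eps) q.
Proof.
  intros Ha He Hq d Hd. destruct q as [u v]. apply T_domain_iff in Hq; [|lra]. destruct Hq as [[H1 H2] [H3 H4]].
  (* At $u=$ [uc] the triangle extends from $v=a\varepsilon/2$ to $v=\varepsilon/2$, and [vc] is the
     midpoint. *)
  set (uc := a * eps / 2). set (vc := (1 + a) * eps / 4).
  assert (Hae : 0 < a * eps) by (apply Rmult_lt_0_compat; lra).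
  assert (Hae2 : a * eps < 1 * eps) by (apply Rmult_lt_compat_r; lra).
  assert (Huc : uc < vc /\ a * vc < uc /\ uc < a * eps).
  { unfold uc, vc. repeat split; try lra.
    assert ((1 - a) * (a * eps) > 0) by (apply Rmult_lt_0_compat; lra). lra. }
  set (M := Rabs (uc - u) + Rabs (vc - v) + 1).
  assert (HM : 0 < M) by (unfold M; generalize (Rabs_pos (uc - u)) (Rabs_pos (vc - v)); lra).
  set (s := Rmin (1 / 2) (d / (2 * M))).
  assert (Hs : 0 < s /\ s <= 1 / 2 /\ s <= d / (2 * M)).
  { unfold s. split; [apply Rmin_case; [lra|apply Rdiv_lt_0_compat; lra]|]. split; [apply Rmin_l|apply Rmin_r]. }
  assert (HsM : s * M < d).
  { apply Rle_lt_trans with (d / (2 * M) * M); [apply Rmult_le_compat_r; lra|].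
    replace (d / (2 * M) * M) with (d / 2) by (field; lra). lra. }
  assert (Bd : forall y, Rabs y <= M -> Rabs (s * y) < d).
  { intros y Hy. rewrite Rabs_mult, (Rabs_pos_eq s) by lra.
    apply Rle_lt_trans with (s * M); [apply Rmult_le_compat_l; lra|auto]. }
  exists (u + s * (uc - u), v + s * (vc - v)). simpl. split; [|split].
  - assert (S1 : 0 < s * (vc - uc)) by (apply Rmult_lt_0_compat; lra).
    assert (S2 : 0 < s * (uc - a * vc)) by (apply Rmult_lt_0_compat; lra).
    assert (S3 : 0 < s * (a * eps - uc)) by (apply Rmult_lt_0_compat; lra).
    assert (S4 : 0 <= (1 - s) * (v - u)) by (apply Rmult_le_pos; lra).
    assert (S5 : 0 <= (1 - s) * (u - a * v)) by (apply Rmult_le_pos; lra).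
    assert (S6 : 0 <= (1 - s) * (a * eps - u)) by (apply Rmult_le_pos; lra).
    apply T_domain_interior; auto; lra.
  - replace (u + s * (uc - u) - u) with (s * (uc - u)) by ring. apply Bd. unfold M. generalize (Rabs_pos (vc - v)); lra.
  - replace (v + s * (vc - v) - v) with (s * (vc - v)) by ring. apply Bd. unfold M. generalize (Rabs_pos (uc - u)); lra.
Qed.

Lemma is_derive_of_eps (f : R -> R) (x l : R) :
  (forall e, 0 < e -> exists d, 0 < d /\ forall y, Rabs (y - x) < d ->
     Rabs (f y - f x - l * (y - x)) <= e * Rabs (y - x)) -> is_derive f x l.
Proof.
  intros H. apply is_derive_Reals. intros e He. destruct (H (e / 2) ltac:(lra)) as [d [Hd K]].
  exists (mkposreal d Hd). intros h Hh Hhd. simpl in Hhd.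
  specialize (K (x + h)). replace (x + h - x) with h in K by ring. specialize (K Hhd).
  replace ((f (x + h) - f x) / h - l) with ((f (x + h) - f x - l * h) / h) by (field; auto).
  assert (Hp := Rabs_pos_lt h Hh). unfold Rdiv. rewrite Rabs_mult, Rabs_inv.
  apply Rle_lt_trans with (e / 2 * Rabs h * / Rabs h).
  - apply Rmult_le_compat_r; auto. left. apply Rinv_0_lt_compat; auto.
  - replace (e / 2 * Rabs h * / Rabs h) with (e / 2) by (field; lra). lra.
Qed.

(** * Functions of $(t,x)$ on the image of the triangle *)

Section Image.

Variables (r K : R) (D : R * R -> Prop) (t tu tv x xu xv : R -> R -> R).
Hypothesis D_square : forall u v, D (u, v) -> square r u v.
Hypothesis t_C1 : C1_square r t tu tv.
Hypothesis x_C1 : C1_square r x xu xv.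
Hypothesis K_pos : 0 < K.
Hypothesis expanding : forall u v u' v', D (u, v) -> D (u', v') ->
  Rabs (u - u') + Rabs (v - v') <= K * (Rabs (t u v - t u' v') + Rabs (x u v - x u' v')).

Let image := image_domain D (uncurry2 t) (uncurry2 x).

(** [f] read as a function of $(t,x)$. The expansion hypothesis makes the preimage, hence the value
    selected by [iota], unique. *)
Definition push (f : R -> R -> R) (z : R * R) : R :=
  iota (fun y => exists u v, D (u, v) /\ z = (t u v, x u v) /\ y = f u v).

Lemma coordinates_unique (u v u' v' : R) :
  D (u, v) -> D (u', v') -> (t u v, x u v) = (t u' v', x u' v') -> u = u' /\ v = v'.
Proof.
  intros H1 H2 E. injection E as E1 E2.
  assert (W := expanding u v u' v' H1 H2). rewrite E1, E2, !Rminus_diag, Rabs_R0, Rplus_0_r, Rmult_0_r in W.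
  assert (W1 := Rabs_pos (u - u')). assert (W2 := Rabs_pos (v - v')).
  split; apply Rminus_diag_uniq.
  - destruct (Req_dec (u - u') 0) as [|Hn]; auto. generalize (Rabs_pos_lt _ Hn). lra.
  - destruct (Req_dec (v - v') 0) as [|Hn]; auto. generalize (Rabs_pos_lt _ Hn). lra.
Qed.

Lemma push_value (f : R -> R -> R) (u v : R) : D (u, v) -> push f (t u v, x u v) = f u v.
Proof.
  intros Huv.
  assert (HP := iota_correct (fun y : R => exists u' v', D (u', v') /\ (t u v, x u v) = (t u' v', x u' v') /\ y = f u' v')).
  destruct HP as [u' [v' [H1 [H2 H3]]]].
  - exists (f u v). split; [exists u, v; auto|]. intros y [u' [v' [H1 [H2 H3]]]].
    destruct (coordinates_unique _ _ _ _ Huv H1 H2) as [-> ->]. auto.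
  - destruct (coordinates_unique _ _ _ _ Huv H1 H2) as [E1 E2]. rewrite <- E1, <- E2 in H3. exact H3.
Qed.

Lemma push_continuous (f : R -> R -> R) :
  (forall u v, square r u v -> continuity_2d_pt f u v) ->
  forall z, image z -> filterlim (push f) (within image (locally z)) (locally (push f z)).
Proof.
  intros Hf z [[u v] [Hq Hz]]. unfold uncurry2 in Hz; simpl in Hz. subst z.
  apply filterlim_locally. intros e. destruct (Hf u v (D_square u v Hq) e) as [d Hd].
  assert (Hp : 0 < d / (2 * K)) by (apply Rdiv_lt_0_compat; [apply cond_pos|lra]).
  exists (mkposreal _ Hp). intros z [B1 B2] [[u' v'] [Hq' Hz']]. unfold uncurry2 in Hz'; simpl in Hz'. subst z.
  change (Rabs (t u' v' - t u v) < d / (2 * K)) in B1. change (Rabs (x u' v' - x u v) < d / (2 * K)) in B2.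
  rewrite !push_value by auto.
  assert (W := expanding u' v' u v Hq' Hq).
  assert (W2 : K * (Rabs (t u' v' - t u v) + Rabs (x u' v' - x u v)) < K * (d / (2 * K) + d / (2 * K))) by (apply Rmult_lt_compat_l; lra).
  replace (K * (d / (2 * K) + d / (2 * K))) with (d : R) in W2 by (field; lra).
  generalize (Rabs_pos (u' - u)) (Rabs_pos (v' - v)). intros. apply Hd; lra.
Qed.

(** [A] and [B] solve the linear system for the gradient in $(t,x)$. The first order expansions of
    [f], [t] and [x] combine to an error relative to $|u'-u|+|v'-v|$, and the expansion hypothesis
    bounds that by the increment of $(t,x)$. *)
Lemma push_increment (f fu fv : R -> R -> R) (A B u v : R) :
  C1_square r f fu fv -> D (u, v) ->
  A * tu u v + B * xu u v = fu u v -> A * tv u v + B * xv u v = fv u v ->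
  forall e, 0 < e -> exists d, 0 < d /\ forall u' v', D (u', v') ->
    Rabs (t u' v' - t u v) + Rabs (x u' v' - x u v) < d ->
    Rabs (f u' v' - f u v - A * (t u' v' - t u v) - B * (x u' v' - x u v))
      <= e * (Rabs (t u' v' - t u v) + Rabs (x u' v' - x u v)).
Proof.
  intros Hf Hq EA EB e He. assert (Hs := D_square _ _ Hq).
  set (L := 1 + Rabs A + Rabs B). assert (HL : 0 < L) by (unfold L; generalize (Rabs_pos A) (Rabs_pos B); lra).
  (* [L] adds up the three expansion errors with their factors $1$, $|A|$, $|B|$; [K] converts
     increments of $(u,v)$ into those of $(t,x)$. *)
  assert (He' : 0 < e / (L * K)) by (apply Rdiv_lt_0_compat; [auto|apply Rmult_lt_0_compat; auto]).
  destruct (C1_square_differentiable _ _ _ _ Hf u v Hs (mkposreal _ He')) as [d1 G1].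
  destruct (C1_square_differentiable _ _ _ _ t_C1 u v Hs (mkposreal _ He')) as [d2 G2].
  destruct (C1_square_differentiable _ _ _ _ x_C1 u v Hs (mkposreal _ He')) as [d3 G3]. simpl in G1, G2, G3.
  set (m := Rmin d1 (Rmin d2 d3)).
  assert (Hm : 0 < m /\ m <= d1 /\ m <= d2 /\ m <= d3).
  { unfold m. generalize (Rmin_l d1 (Rmin d2 d3)) (Rmin_r d1 (Rmin d2 d3)) (Rmin_l d2 d3) (Rmin_r d2 d3).
    intros; repeat split; try lra. repeat apply Rmin_case; apply cond_pos. }
  exists (m / K). split; [apply Rdiv_lt_0_compat; lra|]. intros u' v' Hq' Hlt.
  assert (W := expanding u' v' u v Hq' Hq).
  set (S := Rabs (t u' v' - t u v) + Rabs (x u' v' - x u v)) in *.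
  assert (W2 : K * S < m).
  { apply Rlt_le_trans with (K * (m / K)); [apply Rmult_lt_compat_l; lra|right; field; lra]. }
  assert (Pu := Rabs_pos (u' - u)). assert (Pv := Rabs_pos (v' - v)).
  specialize (G1 u' v' ltac:(lra) ltac:(lra)). specialize (G2 u' v' ltac:(lra) ltac:(lra)). specialize (G3 u' v' ltac:(lra) ltac:(lra)).
  set (mx := Rmax (Rabs (u' - u)) (Rabs (v' - v))) in *.
  assert (Hmx : mx <= K * S) by (unfold mx; apply Rmax_lub; lra).
  assert (Hb : e / (L * K) * mx <= e / L * S).
  { apply Rle_trans with (e / (L * K) * (K * S)); [apply Rmult_le_compat_l; lra|right; field; lra]. }
  replace (f u' v' - f u v - A * (t u' v' - t u v) - B * (x u' v' - x u v)) with
    ((f u' v' - f u v - (fu u v * (u' - u) + fv u v * (v' - v)))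
     + (- (A * (t u' v' - t u v - (tu u v * (u' - u) + tv u v * (v' - v))))
        + - (B * (x u' v' - x u v - (xu u v * (u' - u) + xv u v * (v' - v))))))
    by (rewrite <- EA, <- EB; ring).
  apply Rle_trans with (e / L * S + (Rabs A * (e / L * S) + Rabs B * (e / L * S))).
  - apply plus_bound; [lra|]. apply plus_bound; rewrite Rabs_Ropp, Rabs_mult; apply Rmult_le_compat_l; try apply Rabs_pos; lra.
  - right. unfold L. field. fold L. lra.
Qed.

(** At an interior point of the image, changing one of the coordinates $t$, $x$ stays in the image,
    and [push_increment] with the other increment zero is the partial derivative. *)
Lemma push_partials (f fu fv f1 f2 : R -> R -> R) :
  C1_square r f fu fv ->
  (forall u v, square r u v -> continuity_2d_pt f1 u v) ->
  (forall u v, square r u v -> continuity_2d_pt f2 u v) ->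
  (forall u v, D (u, v) -> f1 u v * tu u v + f2 u v * xu u v = fu u v /\
     f1 u v * tv u v + f2 u v * xv u v = fv u v) ->
  partials image (push f) (push f1) (push f2).
Proof.
  intros Hf C1 C2 E.
  split; [apply push_continuous; eapply C1_square_continuous; eauto|].
  split; [apply push_continuous; auto|]. split; [apply push_continuous; auto|].
  intros z1 z2 Hz. assert (Hz0 := locally_singleton _ _ Hz). destruct Hz0 as [[u v] [Hq Eq]].
  unfold uncurry2 in Eq; simpl in Eq. injection Eq as -> ->. destruct (E u v Hq) as [EA EB].
  rewrite !push_value by auto. destruct Hz as [dz Hz].
  split; apply is_derive_of_eps; intros e He;
    destruct (push_increment f fu fv (f1 u v) (f2 u v) u v Hf Hq EA EB e He) as [d [Hd HK]];
    exists (Rmin d dz); (split; [apply Rmin_case; auto; apply cond_pos|]); intros y Hy;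
    assert (M1 := Rmin_l d dz); assert (M2 := Rmin_r d dz); cbv beta; rewrite ?push_value by auto.
  - destruct (Hz (y, x u v)) as [[u' v'] [Hq' Eq']].
    { split; [change (Rabs (y - t u v) < dz); lra|apply ball_center]. }
    assert (PV : push f (y, x u v) = f u' v') by (rewrite <- (push_value f u' v' Hq'); exact (f_equal (push f) Eq')).
    match goal with |- Rabs (?g - _ - _) <= _ => replace g with (f u' v') by (symmetry; exact PV) end.
    injection Eq' as E1 E2. unfold uncurry2 in E1, E2; simpl in E1, E2.
    specialize (HK u' v' Hq'). rewrite <- E1, <- E2, Rminus_diag, Rabs_R0, Rplus_0_r, Rmult_0_r, Rminus_0_r in HK.
    apply HK. lra.
  - destruct (Hz (t u v, y)) as [[u' v'] [Hq' Eq']].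
    { split; [apply ball_center|change (Rabs (y - x u v) < dz); lra]. }
    assert (PV : push f (t u v, y) = f u' v') by (rewrite <- (push_value f u' v' Hq'); exact (f_equal (push f) Eq')).
    match goal with |- Rabs (?g - _ - _) <= _ => replace g with (f u' v') by (symmetry; exact PV) end.
    injection Eq' as E1 E2. unfold uncurry2 in E1, E2; simpl in E1, E2.
    specialize (HK u' v' Hq'). rewrite <- E1, <- E2, Rminus_diag, Rabs_R0, Rplus_0_l, Rmult_0_r, Rminus_0_r in HK.
    apply HK. lra.
Qed.

End Image.

(** * Rules for [C1_square] and the expansion estimate *)

Lemma C1_square_swap (r : R) (f fu fv : R -> R -> R) :
  C1_square r f fu fv -> C1_square r (fun u v => f v u) (fun u v => fv v u) (fun u v => fu v u).
Proof.
  intros H u v Huv. destruct (H v u (square_swap _ _ _ Huv)) as [H1 [H2 [H3 H4]]].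
  split; [exact H2|]. split; [exact H1|]. split; [apply (continuity_2d_swap fv)|apply (continuity_2d_swap fu)]; auto.
Qed.

(** It lets a mixed derivative be replaced by an equal one, which puts two functions into the form
    required by [closed_form_potential]. *)
Lemma C1_square_ext_partials (r : R) (f fu fv fu' fv' : R -> R -> R) :
  (forall u v, square r u v -> fu u v = fu' u v /\ fv u v = fv' u v) ->
  C1_square r f fu fv -> C1_square r f fu' fv'.
Proof.
  intros E H u v Huv. destruct (H u v Huv) as [H1 [H2 [H3 H4]]].
  assert (Hl := square_locally r u v Huv). destruct (E u v Huv) as [E1 E2].
  split; [rewrite <- E1; exact H1|]. split; [rewrite <- E2; exact H2|].
  split; [apply (continuity_2d_pt_ext_loc fu)|apply (continuity_2d_pt_ext_loc fv)]; auto;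
    destruct Hl as [d Hd]; exists d; intros u' v' A B; apply E; auto.
Qed.

Lemma C1_square_ext (r : R) (f fu fv f' fu' fv' : R -> R -> R) : C1_square r f fu fv ->
  (forall u v, f u v = f' u v) -> (forall u v, square r u v -> fu u v = fu' u v) ->
  (forall u v, square r u v -> fv u v = fv' u v) -> C1_square r f' fu' fv'.
Proof.
  intros H E1 E2 E3 u v Huv.
  destruct (C1_square_ext_partials r f fu fv fu' fv' (fun u v K => conj (E2 u v K) (E3 u v K)) H u v Huv) as [H1 [H2 H34]].
  split; [|split; [|exact H34]].
  - apply (is_derive_ext (fun s => f s v)); auto.
  - apply (is_derive_ext (fun s => f u s)); auto.
Qed.

Lemma C1_square_plus (r : R) (f fu fv g gu gv : R -> R -> R) :
  C1_square r f fu fv -> C1_square r g gu gv ->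
  C1_square r (fun u v => f u v + g u v) (fun u v => fu u v + gu u v) (fun u v => fv u v + gv u v).
Proof.
  intros Hf Hg u v Huv. destruct (Hf u v Huv) as [F1 [F2 [F3 F4]]]. destruct (Hg u v Huv) as [G1 [G2 [G3 G4]]].
  split; [apply @is_derive_plus; auto|]. split; [apply @is_derive_plus; auto|].
  split; apply continuity_2d_pt_plus; auto.
Qed.

Lemma C1_square_mult (r : R) (f fu fv g gu gv : R -> R -> R) :
  C1_square r f fu fv -> C1_square r g gu gv ->
  C1_square r (fun u v => f u v * g u v) (fun u v => fu u v * g u v + f u v * gu u v)
    (fun u v => fv u v * g u v + f u v * gv u v).
Proof.
  intros Hf Hg u v Huv. assert (Cf := C1_square_continuous _ _ _ _ Hf u v Huv).
  assert (Cg := C1_square_continuous _ _ _ _ Hg u v Huv).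
  destruct (Hf u v Huv) as [F1 [F2 [F3 F4]]]. destruct (Hg u v Huv) as [G1 [G2 [G3 G4]]].
  split; [apply (is_derive_mult (fun s => f s v) (fun s => g s v)); auto; intros; apply Rmult_comm|].
  split; [apply (is_derive_mult (fun s => f u s) (fun s => g u s)); auto; intros; apply Rmult_comm|].
  split; apply continuity_2d_pt_plus; apply continuity_2d_pt_mult; auto.
Qed.

Lemma C1_square_const (r c : R) : C1_square r (fun _ _ => c) (fun _ _ => 0) (fun _ _ => 0).
Proof.
  intros u v _. split; [exact (is_derive_const c u)|]. split; [exact (is_derive_const c v)|].
  split; apply continuity_2d_pt_const.
Qed.

Lemma C1_square_left (r : R) (f f' : R -> R) :
  (forall u, Rabs u < r -> is_derive f u (f' u) /\ continuous f' u) ->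
  C1_square r (fun u _ => f u) (fun u _ => f' u) (fun _ _ => 0).
Proof.
  intros H u v [Hu _]. destruct (H u Hu). split; [auto|]. split; [exact (is_derive_const (f u) v)|].
  split; [apply continuity_2d_left; auto|apply continuity_2d_pt_const].
Qed.

Lemma C1_square_right (r : R) (f f' : R -> R) :
  (forall u, Rabs u < r -> is_derive f u (f' u) /\ continuous f' u) ->
  C1_square r (fun _ v => f v) (fun _ _ => 0) (fun _ v => f' v).
Proof. intros H. exact (C1_square_swap _ _ _ _ (C1_square_left r f f' H)). Qed.

Lemma C1_square_comp (r : R) (I : R -> Prop) (ph ph' : R -> R) (f fu fv : R -> R -> R) :
  (forall s, I s -> is_derive ph s (ph' s) /\ continuous ph' s) ->
  (forall u v, square r u v -> I (f u v)) -> C1_square r f fu fv ->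
  C1_square r (fun u v => ph (f u v)) (fun u v => fu u v * ph' (f u v)) (fun u v => fv u v * ph' (f u v)).
Proof.
  intros Hp HI Hf u v Huv. destruct (Hp _ (HI u v Huv)) as [P1 P2].
  assert (Cf := C1_square_continuous _ _ _ _ Hf u v Huv). destruct (Hf u v Huv) as [F1 [F2 [F3 F4]]].
  assert (Cp : continuity_2d_pt (fun u v => ph' (f u v)) u v).
  { apply continuity_1d_2d_pt_comp; auto. apply continuous_pt; auto. }
  split; [apply (is_derive_comp ph (fun s => f s v)); auto|].
  split; [apply (is_derive_comp ph (fun s => f u s)); auto|].
  split; apply continuity_2d_pt_mult; auto.
Qed.

Lemma square_increment (r c1 c2 sg : R) (f fu fv : R -> R -> R) (u v u' v' : R) :
  C1_square r f fu fv ->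
  (forall u v, square r u v -> Rabs (fu u v - c1) <= sg /\ Rabs (fv u v - c2) <= sg) ->
  square r u v -> square r u' v' ->
  Rabs (f u v - f u' v' - (c1 * (u - u') + c2 * (v - v'))) <= sg * (Rabs (u - u') + Rabs (v - v')).
Proof.
  intros Hf Hc [Hu Hv] [Hu' Hv'].
  assert (Seg : forall x y w, Rabs x < r -> Rabs y < r -> Rmin y x <= w <= Rmax y x -> Rabs w < r).
  { intros x y w Hx Hy. unfold Rmin, Rmax. destruct (Rle_dec y x); intros Hw; split_Rabs; lra. }
  assert (A1 : Rabs ((f u v - c1 * u) - (f u' v - c1 * u')) <= sg * Rabs (u - u')).
  { apply (mean_value_bound (fun s => f s v - c1 * s) (fun s => fu s v - c1)).
    - intros w Hw. apply @is_derive_minus; [|apply is_derive_linear]. apply Hf. split; eauto.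
    - intros w Hw. apply Hc. split; eauto. }
  assert (A2 : Rabs ((f u' v - c2 * v) - (f u' v' - c2 * v')) <= sg * Rabs (v - v')).
  { apply (mean_value_bound (fun s => f u' s - c2 * s) (fun s => fv u' s - c2)).
    - intros w Hw. apply @is_derive_minus; [|apply is_derive_linear]. apply Hf. split; eauto.
    - intros w Hw. apply Hc. split; eauto. }
  replace (f u v - f u' v' - (c1 * (u - u') + c2 * (v - v'))) with
    (((f u v - c1 * u) - (f u' v - c1 * u')) + ((f u' v - c2 * v) - (f u' v' - c2 * v'))) by ring.
  rewrite Rmult_plus_distr_l. apply plus_bound; auto.
Qed.

Lemma abs_sum_difference (x y : R) : Rabs x + Rabs y <= Rabs (x + y) + Rabs (y - x).
Proof. split_Rabs; lra. Qed.

(** The model map is $t=(u+v)/e_0$, $x=v-u$, for which $|du|+|dv|\le|du+dv|+|dv-du|$. Each of the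
    two deviations costs a quarter of $|du|+|dv|$; absorbing the resulting half explains the factor
    $2$. *)
Lemma square_expanding (r e0 : R) (t tu tv x xu xv : R -> R -> R) (u v u' v' : R) :
  0 < e0 -> C1_square r t tu tv -> C1_square r x xu xv ->
  (forall u v, square r u v -> Rabs (tu u v - / e0) <= / e0 / 4 /\ Rabs (tv u v - / e0) <= / e0 / 4) ->
  (forall u v, square r u v -> Rabs (xu u v - -1) <= / 4 /\ Rabs (xv u v - 1) <= / 4) ->
  square r u v -> square r u' v' ->
  Rabs (u - u') + Rabs (v - v') <= 2 * (e0 + 1) * (Rabs (t u v - t u' v') + Rabs (x u v - x u' v')).
Proof.
  intros He Ht Hx Ct Cx H1 H2. assert (Hi : 0 < / e0) by (apply Rinv_0_lt_compat; auto).
  assert (A := square_increment r (/ e0) (/ e0) (/ e0 / 4) t tu tv u v u' v' Ht Ct H1 H2).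
  assert (B := square_increment r (-1) 1 (/ 4) x xu xv u v u' v' Hx Cx H1 H2).
  set (du := u - u') in *. set (dv := v - v') in *.
  set (dt := t u v - t u' v') in *. set (dx := x u v - x u' v') in *.
  assert (A' : Rabs (e0 * dt - (du + dv)) <= / 4 * (Rabs du + Rabs dv)).
  { replace (e0 * dt - (du + dv)) with (e0 * (dt - (/ e0 * du + / e0 * dv))) by (field; lra).
    rewrite Rabs_mult, (Rabs_pos_eq e0) by lra.
    apply Rle_trans with (e0 * (/ e0 / 4 * (Rabs du + Rabs dv))); [apply Rmult_le_compat_l; lra|right; field; lra]. }
  assert (C := abs_sum_difference du dv).
  assert (A2 : Rabs (du + dv) <= e0 * Rabs dt + / 4 * (Rabs du + Rabs dv)).
  { replace (du + dv) with (e0 * dt - (e0 * dt - (du + dv))) by ring. unfold Rminus at 1.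
    eapply Rle_trans; [apply Rabs_triang|]. rewrite Rabs_Ropp, Rabs_mult, (Rabs_pos_eq e0) by lra. lra. }
  assert (B2 : Rabs (dv - du) <= Rabs dx + / 4 * (Rabs du + Rabs dv)).
  { replace (dv - du) with (dx - (dx - (-1 * du + 1 * dv))) by ring. unfold Rminus at 1.
    eapply Rle_trans; [apply Rabs_triang|]. rewrite Rabs_Ropp. lra. }
  assert (P1 := Rabs_pos dt). assert (P2 := Rabs_pos dx).
  assert (0 <= e0 * Rabs dx) by (apply Rmult_le_pos; lra). lra.
Qed.

Lemma continuity_2d_close_square (f : R -> R -> R) (sg : R) : 0 < sg -> continuity_2d_pt f 0 0 ->
  exists d, 0 < d /\ forall u v, square d u v -> Rabs (f u v - f 0 0) <= sg.
Proof.
  intros Hs H. destruct (H (mkposreal sg Hs)) as [d Hd]. exists d. split; [apply cond_pos|].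
  intros u v [Hu Hv]. left. apply Hd; rewrite Rminus_0_r; auto.
Qed.

(** * The reflected flow *)

Section NearPredicates.

Variables (be0 V0 : R).
Let q0 : q4 := (be0, be0, 0, 0).

Definition near_shock (P : q4 -> Prop) : Prop :=
  exists d, 0 < d /\ forall z, shock_cone be0 V0 d z -> P z.

Lemma near_shock_and (P Q : q4 -> Prop) :
  near_shock P -> near_shock Q -> near_shock (fun z => P z /\ Q z).
Proof.
  intros [d1 [H1 P1]] [d2 [H2 P2]]. exists (Rmin d1 d2). split; [apply Rmin_case; auto|].
  intros z Hz. split; [apply P1|apply P2]; eapply shock_cone_mono; eauto; [apply Rmin_l|apply Rmin_r].
Qed.

Lemma near_shock_imp (P Q : q4 -> Prop) : (forall z, P z -> Q z) -> near_shock P -> near_shock Q.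
Proof. intros H [d [Hd HP]]. exists d. auto. Qed.

Lemma near_shock_close (f : q4 -> R) (m : R) : near11 be0 V0 f -> 0 < m ->
  near_shock (fun z => Rabs (f z - f q0) <= m).
Proof.
  intros Hf Hm. destruct (near11_close be0 V0 f m Hf Hm) as [d [Hd H]]. exists d. split; auto.
  intros z Hz. apply (H d); auto. lra.
Qed.

Lemma near_shock_pos (f : q4 -> R) : near11 be0 V0 f -> 0 < f q0 -> near_shock (fun z => 0 < f z).
Proof.
  intros Hf Hp. apply (near_shock_imp (fun z => Rabs (f z - f q0) <= f q0 / 2)).
  - intros z Hz. generalize (Rle_abs (- (f z - f q0))). rewrite Rabs_Ropp. lra.
  - apply near_shock_close; auto. lra.
Qed.

End NearPredicates.

Section Reflection.

Variables (p : R -> R) (rref : R).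
Hypothesis p_smooth : forall (n : nat) (r : R), 0 < r -> ex_derive_n p n r.
Hypothesis dp_pos : forall r : R, 0 < r -> 0 < Derive p r.
Hypothesis rref_pos : 0 < rref.
Variables (T : R) (x0 rho_data w_data : R -> R) (rhos ws : R * R -> R).
Hypothesis dev : future_development p T x0 rho_data w_data rhos ws.
Hypothesis w_origin : ws (0, 0) <> 0.
Variables (rho0 V0 : R).
Hypothesis rho0_pos : 0 < rho0.
Hypothesis jump0 : jump_conditions p rho0 0 (rhos (0, 0)) (ws (0, 0)) V0.
Hypothesis V0_determinism : ws (0, 0) + eta p (rhos (0, 0)) < V0 < eta p rho0.
Hypothesis V0_pos : 0 < V0.

Let D := dev_domain T x0.
Let als := fun q => alpha_of p rref (rhos q) (ws q).
Let bes := fun q => beta_of p rref (rhos q) (ws q).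
Let eta0 := eta p rho0.
Let a := a_const eta0 V0.
Let Fe := enthalpy_integral p rref.
Let be0 := Fe rho0.
Let dFe (r : R) : R := eta p r / r.

Variables (H H1 H2 H3 : R * R * R -> R) (U : R * R * R -> Prop) (rt rx wt wx : R * R -> R).
Hypothesis H_origin : H (be0, als (0, 0), bes (0, 0)) = be0.
Hypothesis U_open : open U.
Hypothesis U_origin : U (be0, als (0, 0), bes (0, 0)).
Hypothesis H_smooth : smooth3 U H.
Hypothesis H_partials : partials3 U H H1 H2 H3.
Hypothesis H1_C2 : Cn axes3 2 U H1.
Hypothesis H2_C2 : Cn axes3 2 U H2.
Hypothesis H3_C2 : Cn axes3 2 U H3.
Hypothesis H_jump : forall al alm bem, U (al, alm, bem) -> J p rref al (H (al, alm, bem)) alm bem = 0.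
Hypothesis rho_partials : partials D rhos rt rx.
Hypothesis w_partials : partials D ws wt wx.
Hypothesis rt_C2 : Cn [e1; e2] 2 D rt.
Hypothesis rx_C2 : Cn [e1; e2] 2 D rx.
Hypothesis wt_C2 : Cn [e1; e2] 2 D wt.
Hypothesis wx_C2 : Cn [e1; e2] 2 D wx.

Let q0 : q4 := (be0, be0, 0, 0).

Lemma origin_in_D : D (0, 0).
Proof.
  split; simpl; [generalize (dev_T _ _ _ _ _ _ _ dev); lra|].
  rewrite (dev_origin _ _ _ _ _ _ _ dev). lra.
Qed.

Lemma rm0_pos : 0 < rhos (0, 0).
Proof. apply (dev_rho_pos _ _ _ _ _ _ _ dev), origin_in_D. Qed.

Lemma eta0_pos : 0 < eta0.
Proof. apply eta_pos; auto. Qed.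

Lemma a_01 : 0 < a < 1.
Proof. apply a_range; try tauto. Qed.

Lemma rho0_distinct : rho0 <> rhos (0, 0).
Proof. apply (densities_distinct p rho0 V0 (rhos (0, 0)) (ws (0, 0))); auto using rm0_pos. Qed.

(** Functions of the point [(t, x)] of the shock and of the Riemann invariants
    [al], [be] behind it.  With [nu = t_v] and [t_u (a v, v) = nu (v, a v)], the condition
    [dx = V dt] reads [nu (a v, v) = gZ * nu (v, a v)], and differentiating
    [be v = H (be (a v), almZ, bemZ)] gives [th v = PZ * th (a v) + SZ * nu (v, a v)]. *)
Definition at_tx (f : R * R -> R) (z : q4) : R := let '(al, be, t, x) := z in f (t, x).
Definition alZ (z : q4) : R := let '(al, be, t, x) := z in al.
Definition beZ (z : q4) : R := let '(al, be, t, x) := z in be.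
Definition sZ (z : q4) : R := / 2 * (alZ z + beZ z).
Definition wpZ (z : q4) : R := / 2 * (alZ z - beZ z).
Definition rpZ (z : q4) : R := density p rref (sZ z).
Definition ssZ (z : q4) : R := sound_speed p rref (sZ z).
Definition VZ (z : q4) : R :=
  (rpZ z * wpZ z - at_tx rhos z * at_tx ws z) / (rpZ z - at_tx rhos z).
(** On $u=av$ one has $dt_+/dv=a\,t_u+t_v$ and $dx_+/dv=a\,c_{\rm in}t_u+c_{\rm out}t_v$. The
    condition $dx_+=V\,dt_+$ thus reads $(c_{\rm out}-V)\,t_v=a\,(V-c_{\rm in})\,t_u$, and [gZ] is
    the ratio $t_v/t_u$. *)
Definition gZ (z : q4) : R := a * (VZ z - (wpZ z - ssZ z)) / (wpZ z + ssZ z - VZ z).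
Definition QZ (z : q4) : R := a * (wpZ z - ssZ z) + gZ z * (wpZ z + ssZ z).
Definition almZ (z : q4) : R := Fe (at_tx rhos z) + at_tx ws z.
Definition bemZ (z : q4) : R := Fe (at_tx rhos z) - at_tx ws z.
Definition PZ (z : q4) : R := a * H1 (alZ z, almZ z, bemZ z).
(** [htZ] and [hxZ] are the derivatives of $H(\alpha_+,\alpha^\ast,\beta^\ast)$ in [t] and [x] at
    fixed $\alpha_+$. *)
Definition htZ (z : q4) : R :=
  H2 (alZ z, almZ z, bemZ z) * (dFe (at_tx rhos z) * at_tx rt z + at_tx wt z)
  + H3 (alZ z, almZ z, bemZ z) * (dFe (at_tx rhos z) * at_tx rt z - at_tx wt z).
Definition hxZ (z : q4) : R :=
  H2 (alZ z, almZ z, bemZ z) * (dFe (at_tx rhos z) * at_tx rx z + at_tx wx z)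
  + H3 (alZ z, almZ z, bemZ z) * (dFe (at_tx rhos z) * at_tx rx z - at_tx wx z).
Definition SZ (z : q4) : R := htZ z * (a + gZ z) + hxZ z * QZ z.

(** * Values of the coefficients at the origin *)

Lemma s_origin : sZ q0 = be0.
Proof. unfold sZ, alZ, beZ, q0. field. Qed.

Lemma wp_origin : wpZ q0 = 0.
Proof. unfold wpZ, alZ, beZ, q0. ring. Qed.

Lemma rp_origin : rpZ q0 = rho0.
Proof. unfold rpZ. rewrite s_origin. apply density_enthalpy; auto. Qed.

Lemma ss_origin : ssZ q0 = eta0.
Proof. unfold ssZ, sound_speed. fold (rpZ q0). rewrite rp_origin. reflexivity. Qed.

Lemma V_origin : VZ q0 = V0.
Proof.
  unfold VZ. rewrite rp_origin, wp_origin. simpl. destruct jump0 as [J1 _].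
  generalize rho0_distinct. intros. apply Rmult_eq_reg_r with (rho0 - rhos (0, 0)); [|lra].
  unfold Rdiv. rewrite Rmult_assoc, Rinv_l by lra. lra.
Qed.

(** Here the value of [a] comes from: at the origin $t_u=t_v$, so the shock must lie on a line
    $u=av$ with $a(V_0+\eta_0)=\eta_0-V_0$. *)
Lemma g_origin : gZ q0 = 1.
Proof.
  unfold gZ. rewrite V_origin, wp_origin, ss_origin. unfold a, a_const.
  generalize eta0_pos. intros. unfold eta0 in *. field. lra.
Qed.

(** Multiplied by [nu (0, 0)], which is $1/\eta_0$, this is $x_+'(0)=1-a$. Together with
    $t_+'(0)=(1+a)/\eta_0$ it explains the weights of the $x$- and $t$-derivatives in $b$ and
    $c$. *)
Lemma Q_origin : QZ q0 = eta0 * (1 - a).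
Proof. unfold QZ. rewrite g_origin, wp_origin, ss_origin. ring. Qed.

Lemma be0_in_range : locally be0 (enthalpy_range p rref).
Proof. apply enthalpy_range_locally; auto. exists rho0; auto. Qed.

Lemma near_cone : exists d1, 0 < d1 /\ forall t x,
  0 <= t <= d1 /\ Rabs (x - V0 * t) <= d1 * t -> D (t, x) /\ (0 < t -> interior_pt D (t, x)).
Proof. apply (cone_in_domain p T x0 rho_data w_data rhos ws V0 dev). tauto. Qed.

(** * Regularity of the coefficients near the origin *)

Notation near11' := (near11 be0 V0).

Lemma near_at_tx (f : R * R -> R) : Cn [e1; e2] 2 D f -> near11' (at_tx f).
Proof.
  intros Hf. destruct near_cone as [d1 [Hd HK]]. apply (near11_Cn V0 D d1 Hd HK be0 f Hf).
Qed.

Lemma near_rm : near11' (at_tx rhos).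
Proof. apply near_at_tx, (dev_smooth_rho _ _ _ _ _ _ _ dev). Qed.
Lemma near_wm : near11' (at_tx ws).
Proof. apply near_at_tx, (dev_smooth_w _ _ _ _ _ _ _ dev). Qed.
Lemma near_al : near11' alZ.
Proof. apply (near11_coordinates be0 V0). Qed.
Lemma near_be : near11' beZ.
Proof. apply (near11_coordinates be0 V0). Qed.
Lemma near_s : near11' sZ.
Proof. apply near11_mult; [apply near11_const|]. apply near11_plus; [apply near_al|apply near_be]. Qed.
Lemma near_wp : near11' wpZ.
Proof. apply near11_mult; [apply near11_const|]. apply near11_minus; [apply near_al|apply near_be]. Qed.
Lemma near_rp : near11' rpZ.
Proof.
  apply (near11_smooth1 be0 V0 (enthalpy_range p rref) (density p rref)).
  - apply near_s.
  - fold q0. rewrite s_origin. apply be0_in_range.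
  - apply smooth1_density; auto.
Qed.
Lemma near_ss : near11' ssZ.
Proof.
  apply (near11_smooth1 be0 V0 (enthalpy_range p rref) (sound_speed p rref)).
  - apply near_s.
  - fold q0. rewrite s_origin. apply be0_in_range.
  - apply smooth1_sound_speed; auto.
Qed.
Lemma near_V : near11' VZ.
Proof.
  apply near11_div.
  - apply near11_minus; apply near11_mult; auto using near_rp, near_wp, near_rm, near_wm.
  - apply near11_minus; auto using near_rp, near_rm.
  - fold q0. rewrite rp_origin. simpl. generalize rho0_distinct; lra.
Qed.
Lemma near_g : near11' gZ.
Proof.
  apply near11_div.
  - apply near11_mult; [apply near11_const|]. apply near11_minus; [apply near_V|].
    apply near11_minus; auto using near_wp, near_ss.
  - apply near11_minus; [apply near11_plus|]; auto using near_wp, near_ss, near_V.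
  - fold q0. rewrite wp_origin, ss_origin, V_origin. unfold eta0. lra.
Qed.
Lemma near_Q : near11' QZ.
Proof.
  apply near11_plus; apply near11_mult; auto using near11_const, near_g.
  - apply near11_minus; auto using near_wp, near_ss.
  - apply near11_plus; auto using near_wp, near_ss.
Qed.
Lemma near_positive (ph : R -> R) : smooth1 2 (fun r => 0 < r) ph -> near11' (fun z => ph (at_tx rhos z)).
Proof.
  intros Hp. apply (near11_smooth1 be0 V0 (fun r => 0 < r) ph); auto using near_rm.
  apply (open_gt 0). apply rm0_pos.
Qed.
Lemma near_alm : near11' almZ.
Proof. apply near11_plus; [|apply near_wm]. apply (near_positive Fe). apply smooth1_enthalpy; auto. Qed.
Lemma near_bem : near11' bemZ.
Proof. apply near11_minus; [|apply near_wm]. apply (near_positive Fe). apply smooth1_enthalpy; auto. Qed.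
Lemma near_H (h : R * R * R -> R) : Cn axes3 2 U h -> near11' (fun z => h (alZ z, almZ z, bemZ z)).
Proof.
  intros Hh. destruct (Cn2_box11 U h be0 (als (0, 0)) (bes (0, 0)) U_open U_origin Hh)
    as [m [B [p1 [p2 [p3 [Hm [HB HX]]]]]]].
  apply (near11_comp be0 V0 (fun x y z => h (x, y, z)) p1 p2 p3 alZ almZ bemZ m B);
    auto using near_al, near_alm, near_bem.
Qed.
Lemma near_P : near11' PZ.
Proof. apply near11_mult; [apply near11_const|]. apply near_H; auto. Qed.
Lemma near_dFe : near11' (fun z => dFe (at_tx rhos z)).
Proof. apply near_positive. apply smooth1_eta_over; auto. Qed.
Lemma near_ht : near11' htZ.
Proof.
  apply near11_plus; apply near11_mult; auto using near_H;
  [apply near11_plus|apply near11_minus]; auto using near_at_tx; apply near11_mult; auto using near_at_tx, near_dFe.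
Qed.
Lemma near_hx : near11' hxZ.
Proof.
  apply near11_plus; apply near11_mult; auto using near_H;
  [apply near11_plus|apply near11_minus]; auto using near_at_tx; apply near11_mult; auto using near_at_tx, near_dFe.
Qed.
Lemma near_S : near11' SZ.
Proof.
  apply near11_plus; apply near11_mult; auto using near_ht, near_hx, near_Q.
  apply near11_plus; auto using near11_const, near_g.
Qed.

Lemma H1_origin : H1 (be0, als (0, 0), bes (0, 0)) = - (a * a).
Proof.
  apply (H_alpha p rref p_smooth dp_pos rref_pos rho0 V0 (rhos (0, 0)) (ws (0, 0)))
    with (h := fun s => H (s, als (0, 0), bes (0, 0))) (alm := als (0, 0)) (bem := bes (0, 0)); auto.
  - apply rm0_pos.
  - apply H_partials, U_origin.
  - destruct (open_box U _ _ _ U_open U_origin) as [d [Hd HB]]. exists (mkposreal d Hd). intros s Hs.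
    apply H_jump. apply HB; [exact Hs| |]; rewrite Rminus_diag, Rabs_R0; auto.
Qed.

Lemma P_origin : PZ q0 = - (a * a * a).
Proof.
  unfold PZ, almZ, bemZ. simpl. change (Fe (rhos (0, 0)) + ws (0, 0)) with (als (0, 0)).
  change (Fe (rhos (0, 0)) - ws (0, 0)) with (bes (0, 0)). rewrite H1_origin. ring.
Qed.

(** What the shock conditions and the contraction need at a single point, apart from $J=0$, which
    follows from $\beta_+=H$. The inequalities are strict at [q0] and so persist nearby; the
    statements about [D] come from the cone. *)
Definition good_state (z : q4) : Prop :=
  let '(al, be, t, x) := z in
  enthalpy_range p rref (sZ z) /\ rpZ z <> at_tx rhos z /\ D (t, x) /\ (0 < t -> interior_pt D (t, x)) /\
  U (alZ z, almZ z, bemZ z) /\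
  at_tx ws z + eta p (at_tx rhos z) < VZ z < wpZ z + ssZ z /\
  a * Rabs (PZ z) <= (1 + a) / 2 /\ a * Rabs (gZ z) <= (1 + a) / 2.

(** For $c=a$ the bound is the constant [kappa] of the iteration, midway between $a$ and $1$: at the
    origin both [gZ] and [PZ] have modulus at most $1$. *)
Lemma small_product (c y y0 : R) : 0 < c < 1 -> Rabs y0 <= 1 -> Rabs (y - y0) <= (1 - c) / 2 ->
  c * Rabs y <= (1 + c) / 2.
Proof.
  intros Hc H0 Hy. assert (Rabs y <= 1 + (1 - c) / 2).
  { replace y with ((y - y0) + y0) by ring. eapply Rle_trans; [apply Rabs_triang|]. lra. }
  assert (c * Rabs y <= c * (1 + (1 - c) / 2)) by (apply Rmult_le_compat_l; lra).
  assert (c * ((1 - c) / 2) <= 1 * ((1 - c) / 2)) by (apply Rmult_le_compat_r; lra). lra.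
Qed.

Lemma near_good_state : near_shock be0 V0 good_state.
Proof.
  assert (Ha := a_01).
  destruct be0_in_range as [m0 Hm0].
  destruct (open_box U _ _ _ U_open U_origin) as [m1 [Hm1 HU]].
  destruct near_cone as [d1 [Hd1 HK]].
  assert (G1 : near_shock be0 V0 (fun z => Rabs (sZ z - sZ q0) <= m0 / 2)).
  { apply near_shock_close; [apply near_s|]. generalize (cond_pos m0). lra. }
  assert (G2 : near_shock be0 V0 (fun z => Rabs ((rpZ z - at_tx rhos z) - (rpZ q0 - at_tx rhos q0)) <= Rabs (rho0 - rhos (0, 0)) / 2)).
  { apply (near_shock_close be0 V0 (fun z => rpZ z - at_tx rhos z)); [apply near11_minus; auto using near_rp, near_rm|].
    assert (0 < Rabs (rho0 - rhos (0, 0))) by (apply Rabs_pos_lt; generalize rho0_distinct; lra). lra. }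
  assert (G3 : near_shock be0 V0 (fun z => Rabs (alZ z - alZ q0) <= m1 / 2)) by (apply near_shock_close; [apply near_al|lra]).
  assert (G4 : near_shock be0 V0 (fun z => Rabs (almZ z - almZ q0) <= m1 / 2)) by (apply near_shock_close; [apply near_alm|lra]).
  assert (G5 : near_shock be0 V0 (fun z => Rabs (bemZ z - bemZ q0) <= m1 / 2)) by (apply near_shock_close; [apply near_bem|lra]).
  assert (G6 : near_shock be0 V0 (fun z => 0 < VZ z - (at_tx ws z + eta p (at_tx rhos z)))).
  { apply near_shock_pos.
    - apply near11_minus; [apply near_V|]. apply near11_plus; [apply near_wm|]. apply near_positive, smooth1_eta; auto.
    - fold q0. rewrite V_origin. simpl. lra. }
  assert (G7 : near_shock be0 V0 (fun z => 0 < wpZ z + ssZ z - VZ z)).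
  { apply near_shock_pos.
    - apply near11_minus; [|apply near_V]. apply near11_plus; auto using near_wp, near_ss.
    - fold q0. rewrite V_origin, wp_origin, ss_origin. unfold eta0. lra. }
  assert (G8 : near_shock be0 V0 (fun z => Rabs (PZ z - PZ q0) <= (1 - a) / 2)) by (apply near_shock_close; [apply near_P|lra]).
  assert (G9 : near_shock be0 V0 (fun z => Rabs (gZ z - gZ q0) <= (1 - a) / 2)) by (apply near_shock_close; [apply near_g|lra]).
  assert (G0 : near_shock be0 V0 (shock_cone be0 V0 d1)) by (exists d1; auto).
  generalize (near_shock_and _ _ _ _ G0 (near_shock_and _ _ _ _ G1 (near_shock_and _ _ _ _ G2 (near_shock_and _ _ _ _ G3
    (near_shock_and _ _ _ _ G4 (near_shock_and _ _ _ _ G5 (near_shock_and _ _ _ _ G6 (near_shock_and _ _ _ _ G7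
    (near_shock_and _ _ _ _ G8 G9))))))))).
  apply near_shock_imp. clear G0 G1 G2 G3 G4 G5 G6 G7 G8 G9.
  intros z [F0 [F1 [F2 [F3 [F4 [F5 [F6 [F7 [F8 F9]]]]]]]]].
  rewrite s_origin in F1. rewrite rp_origin in F2. simpl in F2. rewrite P_origin in F8. rewrite g_origin in F9.
  assert (F10 : rpZ z <> at_tx rhos z).
  { intros E. rewrite E in F2. rewrite Rminus_diag, Rminus_0_l, Rabs_Ropp in F2.
    assert (0 < Rabs (rho0 - rhos (0, 0))) by (apply Rabs_pos_lt; generalize rho0_distinct; lra). lra. }
  assert (F11 : enthalpy_range p rref (sZ z)).
  { apply Hm0. change (Rabs (sZ z - be0) < m0). generalize (cond_pos m0). lra. }
  assert (F12 : U (alZ z, almZ z, bemZ z)).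
  { apply HU; eapply Rle_lt_trans; try eassumption; lra. }
  assert (F13 : a * Rabs (PZ z) <= (1 + a) / 2).
  { apply small_product with (- (a * a * a)); auto.
    assert (Q1 : Rabs (a * a) <= 1 * 1) by (apply mult_bound; rewrite Rabs_pos_eq; lra).
    rewrite Rabs_Ropp. replace 1 with (1 * 1 * 1) by ring. apply mult_bound; auto. rewrite Rabs_pos_eq; lra. }
  assert (F14 : a * Rabs (gZ z) <= (1 + a) / 2).
  { apply small_product with 1; auto. rewrite Rabs_R1; lra. }
  destruct z as [[[al be] t] x].
  destruct (HK t x (proj2 (proj2 F0))) as [K1 K2].
  refine (conj F11 (conj F10 (conj K1 (conj K2 (conj F12 (conj _ (conj F13 F14))))))). lra.
Qed.

(** With $c=1$ and $c=-1$ this covers both Riemann invariants of the state ahead. *)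
Lemma partials_invariant (c : R) :
  partials D (fun q => Fe (rhos q) + c * ws q)
    (fun q => dFe (rhos q) * rt q + c * wt q) (fun q => dFe (rhos q) * rx q + c * wx q).
Proof.
  destruct rho_partials as [R0 [R1 [R2 R3]]]. destruct w_partials as [W0 [W1 [W2 W3]]].
  assert (Comp : forall (h : R -> R), (forall r, 0 < r -> continuous h r) -> forall q, D q ->
    filterlim (fun z => h (rhos z)) (within D (locally q)) (locally (h (rhos q)))).
  { intros h Hh q Hq. apply (filterlim_comp _ _ _ rhos h _ (locally (rhos q))); auto.
    apply Hh, (dev_rho_pos _ _ _ _ _ _ _ dev _ Hq). }
  assert (Plus : forall (q : R * R) (f g : R * R -> R) (l m : R), filterlim f (within D (locally q)) (locally l) ->
    filterlim g (within D (locally q)) (locally m) -> filterlim (fun z => f z + g z) (within D (locally q)) (locally (l + m))).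
  { intros q f g l m Hf Hg. eapply filterlim_comp_2; [exact Hf|exact Hg|exact (@filterlim_plus R_AbsRing R_NormedModule l m)]. }
  assert (Mult : forall (q : R * R) (f g : R * R -> R) (l m : R), filterlim f (within D (locally q)) (locally l) ->
    filterlim g (within D (locally q)) (locally m) -> filterlim (fun z => f z * g z) (within D (locally q)) (locally (l * m))).
  { intros q f g l m Hf Hg. eapply filterlim_comp_2; [exact Hf|exact Hg|exact (@filterlim_mult R_AbsRing l m)]. }
  assert (CF : forall r, 0 < r -> continuous Fe r).
  { intros r Hr. exact (is_derive_continuous _ _ _ (enthalpy_derive p rref p_smooth dp_pos rref_pos r Hr)). }
  assert (CdF : forall r, 0 < r -> continuous dFe r).
  { intros r Hr. exact (smooth1_eta_over p p_smooth dp_pos 0 r Hr). }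
  split; [|split; [|split]].
  - intros q Hq. apply Plus; [apply (Comp Fe); auto|]. apply Mult; auto. apply filterlim_const.
  - intros q Hq. apply Plus; apply Mult; auto; try (apply (Comp dFe); auto). apply filterlim_const.
  - intros q Hq. apply Plus; apply Mult; auto; try (apply (Comp dFe); auto). apply filterlim_const.
  - intros t x Hi. assert (Hr := dev_rho_pos _ _ _ _ _ _ _ dev _ (locally_singleton _ _ Hi)).
    assert (HF := enthalpy_derive p rref p_smooth dp_pos rref_pos _ Hr).
    destruct (R3 t x Hi) as [R4 R5]. destruct (W3 t x Hi) as [W4 W5]. split.
    + apply @is_derive_plus; [|apply is_derive_scal; exact W4].
      evar_last; [apply (is_derive_comp Fe (fun s => rhos (s, x))); [exact HF|exact R4]|apply Rmult_comm].
    + apply @is_derive_plus; [|apply is_derive_scal; exact W5].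
      evar_last; [apply (is_derive_comp Fe (fun s => rhos (t, s))); [exact HF|exact R5]|apply Rmult_comm].
Qed.

(** Points of the line $x=V_0t$ with small positive [t] are interior, by the determinism
    condition. *)
Lemma adherent_origin : adherent_interior D (0, 0).
Proof.
  intros d Hd. destruct (cone_in_domain p T x0 rho_data w_data rhos ws V0 dev (proj1 V0_determinism)) as [d1 [Hd1 K]].
  set (m := Rmin d1 (Rmin (d / 2) (d / (2 * V0)))).
  assert (Hq : 0 < d / (2 * V0)) by (apply Rdiv_lt_0_compat; lra).
  assert (Hm : 0 < m /\ m <= d1 /\ m <= d / 2 /\ m <= d / (2 * V0)).
  { unfold m. generalize (Rmin_l d1 (Rmin (d / 2) (d / (2 * V0)))) (Rmin_r d1 (Rmin (d / 2) (d / (2 * V0))))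
      (Rmin_l (d / 2) (d / (2 * V0))) (Rmin_r (d / 2) (d / (2 * V0))).
    intros; repeat split; try lra. repeat apply Rmin_case; lra. }
  assert (Hv : V0 * m <= V0 * (d / (2 * V0))) by (apply Rmult_le_compat_l; lra).
  replace (V0 * (d / (2 * V0))) with (d / 2) in Hv by (field; lra).
  exists (m, V0 * m). split; [|simpl].
  - apply K; [|tauto]. split; [lra|]. rewrite Rminus_diag, Rabs_R0. apply Rmult_le_pos; lra.
  - assert (0 < V0 * m) by (apply Rmult_lt_0_compat; tauto).
    rewrite !Rminus_0_r, !Rabs_pos_eq; lra.
Qed.

(** This is where the definition of [beta0'] comes from: [th = beta'] must satisfy the
    differentiated shock relation at the origin, where [P = - a^3]. *)
Lemma beta0'_relation :
  let th := beta0' D als bes H eta0 V0 be0 in th = PZ q0 * th + SZ q0 * / eta0.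
Proof.
  intros th. assert (Ha := a_01). assert (He := eta0_pos).
  destruct (pd_partials D _ _ _ _ (partials_invariant 1) origin_in_D adherent_origin) as [A1 A2].
  destruct (pd_partials D _ _ _ _ (partials_invariant (-1)) origin_in_D adherent_origin) as [B1 B2].
  assert (Al : (fun q => Fe (rhos q) + 1 * ws q) = als).
  { apply functional_extensionality. intros q. unfold als, alpha_of. fold Fe. ring. }
  assert (Be : (fun q => Fe (rhos q) + -1 * ws q) = bes).
  { apply functional_extensionality. intros q. unfold bes, beta_of. fold Fe. ring. }
  rewrite Al in A1, A2. rewrite Be in B1, B2.
  destruct (H_partials _ _ _ U_origin) as [_ [_ [_ [_ [_ [K2 K3]]]]]].
  assert (Eth : th * (1 + a ^ 3) = H3 (be0, als (0, 0), bes (0, 0)) * (pd D e1 bes (0, 0) * ((1 + a) / eta0) + pd D e2 bes (0, 0) * (1 - a))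
     + H2 (be0, als (0, 0), bes (0, 0)) * (pd D e1 als (0, 0) * ((1 + a) / eta0) + pd D e2 als (0, 0) * (1 - a))).
  { rewrite <- (is_derive_unique _ _ _ K2), <- (is_derive_unique _ _ _ K3).
    assert (0 < a ^ 3) by (apply pow_lt; lra).
    apply Rmult_eq_reg_l with (1 / (1 + a ^ 3)); [|apply Rgt_not_eq, Rdiv_lt_0_compat; lra].
    transitivity th; [field; lra|reflexivity]. }
  rewrite A1, A2, B1, B2 in Eth.
  rewrite P_origin; auto. unfold SZ. rewrite g_origin, Q_origin; auto.
  replace (htZ q0) with (H2 (be0, als (0, 0), bes (0, 0)) * (dFe (rhos (0, 0)) * rt (0, 0) + wt (0, 0))
    + H3 (be0, als (0, 0), bes (0, 0)) * (dFe (rhos (0, 0)) * rt (0, 0) - wt (0, 0))) by reflexivity.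
  replace (hxZ q0) with (H2 (be0, als (0, 0), bes (0, 0)) * (dFe (rhos (0, 0)) * rx (0, 0) + wx (0, 0))
    + H3 (be0, als (0, 0), bes (0, 0)) * (dFe (rhos (0, 0)) * rx (0, 0) - wx (0, 0))) by reflexivity.
  apply Rplus_eq_reg_r with (a * a * a * th).
  replace (th + a * a * a * th) with (th * (1 + a ^ 3)) by ring. rewrite Eth.
  fold a. fold eta0. field. lra.
Qed.

(** * The unknown functions on a full square *)

Variable ss' : R -> R.
Hypothesis ss_derive : forall s, enthalpy_range p rref s -> is_derive (sound_speed p rref) s (ss' s).
Hypothesis ss'_smooth : smooth1 2 (enthalpy_range p rref) ss'.

(** The hodograph equation is [t_uv = - hodo_coef (beta u + beta v) (beta'(v) t_u + beta'(u) t_v)]. *)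
Definition hodo_coef (s : R) : R := (1 + ss' (/ 2 * s)) / (4 * sound_speed p rref (/ 2 * s)).

Lemma hodo_coef_smooth : smooth1 2 (fun s => enthalpy_range p rref (/ 2 * s)) hodo_coef.
Proof.
  assert (Hh : smooth1 2 (fun s => enthalpy_range p rref (/ 2 * s)) (fun s => / 2 * s)).
  { apply smooth1_mult; [apply smooth1_const|apply smooth1_id]. }
  apply smooth1_div.
  - apply smooth1_plus; [apply smooth1_const|]. apply (smooth1_comp 2 _ (enthalpy_range p rref)); auto.
  - apply smooth1_mult; [apply smooth1_const|].
    apply (smooth1_comp 2 _ (enthalpy_range p rref)); auto. apply smooth1_sound_speed; auto.
  - intros s Hs. generalize (sound_speed_pos p rref p_smooth dp_pos rref_pos _ Hs). lra.
Qed.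

Variable th0 : R.
Hypothesis th0_eq : th0 = PZ q0 * th0 + SZ q0 * / eta0.

(** The iteration solves the shock relation for $\beta$ only in differentiated form. What is added
    here is the relation $\beta_+=H(\alpha_+,\alpha_-,\beta_-)$ itself, started from its validity at
    the origin. *)
Lemma reflection_functions :
  exists eps (th b be tp xp : R -> R) (nu E N : R -> R -> R), 0 < eps /\
    (forall v, Rabs v < eps -> continuous b v /\ is_derive th v (b v) /\ is_derive be v (th v)) /\
    (forall u v, square eps u v -> enthalpy_range p rref (/ 2 * (be u + be v))) /\
    C1_square eps nu E N /\
    be 0 = be0 /\ th 0 = th0 /\ nu 0 0 = / eta0 /\ tp 0 = 0 /\ xp 0 = 0 /\
    (forall u v, square eps u v ->
      E u v = - (hodo_coef (be u + be v) * (th v * nu v u + th u * nu u v))) /\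
    forall v, 0 <= v < eps -> let q := (be (a * v), be v, tp v, xp v) in
      good_state q /\ (0 < v -> 0 < tp v) /\
      is_derive tp v ((a + gZ q) * nu v (a * v)) /\ is_derive xp v (QZ q * nu v (a * v)) /\
      nu (a * v) v = gZ q * nu v (a * v) /\ be v = H (be (a * v), almZ q, bemZ q).
Proof.
  assert (Ha := a_01). assert (He := eta0_pos). assert (Hi : 0 < / eta0) by (apply Rinv_0_lt_compat; auto).
  destruct be0_in_range as [m0 Hm0].
  assert (HD : locally (2 * be0) (fun s => enthalpy_range p rref (/ 2 * s))).
  { assert (P : 0 < m0) by apply cond_pos. exists m0. intros s Hs. apply Hm0. change (Rabs (s - 2 * be0) < m0) in Hs.
    change (Rabs (/ 2 * s - be0) < m0). replace (/ 2 * s - be0) with (/ 2 * (s - 2 * be0)) by field.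
    rewrite Rabs_mult, Rabs_pos_eq by lra. generalize (Rabs_pos (s - 2 * be0)). lra. }
  destruct (smooth1_box11 _ hodo_coef (2 * be0) 0 0 HD hodo_coef_smooth) as [m [Br [r' [Hm [HBr Hbox]]]]].
  destruct (near11_at _ _ _ near_P) as [dP [HdP [BP [DP [HBP FP]]]]].
  destruct (near11_at _ _ _ near_S) as [dS [HdS [BS [DS [HBS FS]]]]].
  destruct (near11_at _ _ _ near_g) as [dg [Hdg [Bg [Dg [HBg Fg]]]]].
  destruct (near11_at _ _ _ near_Q) as [dQ [HdQ [BQ [DQ [HBQ FQ]]]]].
  destruct (near11_at _ _ _ (near_H H (H_smooth 2%nat))) as [dH [HdH [BH [DH [HBH FH]]]]].
  destruct near_good_state as [dG [HdG FG]].
  set (B := Br + BP + BS + Bg + BQ).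
  set (d := Rmin (Rmin (Rmin dP dS) (Rmin dg dQ)) (Rmin dG dH)).
  assert (Hd : 0 < d /\ d <= dP /\ d <= dS /\ d <= dg /\ d <= dQ /\ d <= dG /\ d <= dH).
  { unfold d. generalize (Rmin_l (Rmin (Rmin dP dS) (Rmin dg dQ)) (Rmin dG dH)) (Rmin_r (Rmin (Rmin dP dS) (Rmin dg dQ)) (Rmin dG dH))
      (Rmin_l (Rmin dP dS) (Rmin dg dQ)) (Rmin_r (Rmin dP dS) (Rmin dg dQ)) (Rmin_l dP dS) (Rmin_r dP dS)
      (Rmin_l dg dQ) (Rmin_r dg dQ) (Rmin_l dG dH) (Rmin_r dG dH). intros; repeat split; try lra.
    repeat apply Rmin_case; lra. }
  clearbody d.
  set (tau := (1 + a) * / eta0). assert (Htau : 0 < tau) by (apply Rmult_lt_0_compat; lra).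
  set (xi := QZ q0 * / eta0).
  (* The initial velocity of the shock point has slope [V0], so points close to it relative to [v]
     lie in the cone about $x=V_0t$. *)
  assert (Hxi : xi = V0 * tau).
  { unfold xi, tau. rewrite Q_origin. unfold a, a_const, eta0 in *. field. lra. }
  assert (HV : 0 < 1 + V0) by lra.
  (* The entries [m0 / 2] and [m / 2] keep $\beta$ where sound speed and hodograph coefficient are
     controlled, [tau / 2] gives $t\ge\tau v/2$, [d / (2 * tau)] limits the height in the cone, and
     the last entry its opening. *)
  set (dl := Rmin (Rmin (m0 / 2) (m / 2)) (Rmin (Rmin d (tau / 2)) (Rmin (d / (2 * tau)) (d * tau / (2 * (1 + V0)))))).
  assert (Hq1 : 0 < d / (2 * tau)) by (apply Rdiv_lt_0_compat; lra).
  assert (Hdt : 0 < d * tau) by (apply Rmult_lt_0_compat; lra).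
  assert (Hq2 : 0 < d * tau / (2 * (1 + V0))) by (apply Rdiv_lt_0_compat; lra).
  assert (Hdl : 0 < dl /\ dl <= m0 / 2 /\ dl <= m / 2 /\ dl <= d /\ dl <= tau / 2 /\ dl <= d / (2 * tau) /\ dl <= d * tau / (2 * (1 + V0))).
  { assert (0 < m0) by apply cond_pos.
    unfold dl. generalize (Rmin_l (Rmin (m0 / 2) (m / 2)) (Rmin (Rmin d (tau / 2)) (Rmin (d / (2 * tau)) (d * tau / (2 * (1 + V0))))))
      (Rmin_r (Rmin (m0 / 2) (m / 2)) (Rmin (Rmin d (tau / 2)) (Rmin (d / (2 * tau)) (d * tau / (2 * (1 + V0))))))
      (Rmin_l (m0 / 2) (m / 2)) (Rmin_r (m0 / 2) (m / 2))
      (Rmin_l (Rmin d (tau / 2)) (Rmin (d / (2 * tau)) (d * tau / (2 * (1 + V0)))))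
      (Rmin_r (Rmin d (tau / 2)) (Rmin (d / (2 * tau)) (d * tau / (2 * (1 + V0)))))
      (Rmin_l d (tau / 2)) (Rmin_r d (tau / 2))
      (Rmin_l (d / (2 * tau)) (d * tau / (2 * (1 + V0)))) (Rmin_r (d / (2 * tau)) (d * tau / (2 * (1 + V0)))).
    clearbody tau. intros; repeat split; try lra. repeat apply Rmin_case; lra. }
  clearbody dl.
  assert (Hcone : forall v al be t x, 0 <= v <= dl ->
    Rabs (al - be0) <= dl -> Rabs (be - be0) <= dl ->
    Rabs (t - tau * v) <= dl * v -> Rabs (x - xi * v) <= dl * v ->
    shock_cone be0 V0 d (al, be, t, x) /\ (0 < v -> 0 < t)).
  { intros v al be t x Hv Hal Hbe Ht Hx.
    assert (T1 := Rle_abs (t - tau * v)). assert (T2 := Rle_abs (- (t - tau * v))). rewrite Rabs_Ropp in T2.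
    assert (T3 : dl * v <= tau / 2 * v) by (apply Rmult_le_compat_r; lra).
    assert (T4 : 0 <= tau / 2 * v) by (apply Rmult_le_pos; lra).
    assert (T5 : 2 * tau * v <= d).
    { apply Rle_trans with (2 * tau * (d / (2 * tau))); [apply Rmult_le_compat_l; lra|right; field; lra]. }
    split.
    - split; [lra|]. split; [lra|]. split; [lra|].
      replace (x - V0 * t) with ((x - xi * v) + V0 * (tau * v - t)) by (rewrite Hxi; ring).
      eapply Rle_trans; [apply Rabs_triang|]. rewrite Rabs_mult, (Rabs_pos_eq V0), (Rabs_minus_sym (tau * v)) by lra.
      assert (V0 * Rabs (t - tau * v) <= V0 * (dl * v)) by (apply Rmult_le_compat_l; lra).
      assert (W : (1 + V0) * dl <= (1 + V0) * (d * tau / (2 * (1 + V0)))) by (apply Rmult_le_compat_l; lra).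
      replace ((1 + V0) * (d * tau / (2 * (1 + V0)))) with (d * (tau / 2)) in W by (field; lra).
      assert (W2 : (1 + V0) * dl * v <= d * (tau / 2) * v) by (apply Rmult_le_compat_r; lra).
      assert (W3 : d * (tau / 2 * v) <= d * t) by (apply Rmult_le_compat_l; lra). lra.
    - intros Hv0. assert (0 < tau / 2 * v) by (apply Rmult_lt_0_compat; lra). lra. }
  assert (HBall : 0 <= B) by (unfold B; lra).
  destruct (shock_iteration_solution a ((1 + a) / 2) B dl be0 th0 (/ eta0) (shock_cone be0 V0 d) (shock_cone_int be0 V0 d)
     PZ SZ gZ QZ DP DS Dg DQ hodo_coef r') as [eps [Heps [th [b [be [tp [xp [nu [E [N
       [Q1 [Q2 [Q3 [Q4 [Q5 [Q6 [Q7 [Q8 Q9]]]]]]]]]]]]]]]]]].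
  - exact Ha.
  - lra.
  - lra.
  - apply FP; unfold B; lra.
  - apply FS; unfold B; lra.
  - apply Fg; unfold B; lra.
  - apply FQ; unfold B; lra.
  - intros z Hz. assert (G : good_state z) by (apply FG; eapply shock_cone_mono; [|exact Hz]; lra).
    destruct z as [[[? ?] ?] ?]. apply G.
  - intros z Hz. assert (G : good_state z) by (apply FG; eapply shock_cone_mono; [|exact Hz]; lra).
    destruct z as [[[? ?] ?] ?]. apply G.
  - intros s Hs.
    assert (Bx : box (2 * be0) 0 0 m s 0 0) by (unfold box; rewrite Rminus_0_r, Rabs_R0; repeat split; lra).
    destruct (box_bound _ _ _ _ _ _ _ _ _ Hbox s 0 0 Bx) as [B1 [B2 _]].
    split; [unfold B; lra|]. split; [unfold B; lra|].
    assert (K := box_chain _ _ _ _ _ _ _ _ _ Hbox (fun s => s) (fun _ => 0) (fun _ => 0) s 1 0 0 Bx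
       (is_derive_id s) (is_derive_const 0 s) (is_derive_const 0 s)). cbv beta in K.
    replace (r' s) with (r' s * 1 + 0 * 0 + 0 * 0) by ring. exact K.
  - intros s s' Hs Hs'.
    assert (Bx : box (2 * be0) 0 0 m s 0 0) by (unfold box; rewrite Rminus_0_r, Rabs_R0; repeat split; lra).
    assert (Bx' : box (2 * be0) 0 0 m s' 0 0) by (unfold box; rewrite Rminus_0_r, Rabs_R0; repeat split; lra).
    destruct (box_lip _ _ _ _ _ _ _ _ _ Hbox _ _ _ _ _ _ Bx Bx') as [B1 [B2 _]].
    rewrite Rminus_diag, Rabs_R0, !Rplus_0_r in B1, B2.
    assert (Br * Rabs (s - s') <= B * Rabs (s - s')) by (apply Rmult_le_compat_r; [apply Rabs_pos|unfold B; lra]).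
    lra.
  - intros v al be t x Hv Hal Hbe Ht Hx. destruct (Hcone v al be t x Hv Hal Hbe Ht Hx) as [K1 K2].
    split; [exact K1|]. intros Hv0. split; [exact K1|auto].
  - exact g_origin.
  - exact th0_eq.
  - exists eps, th, b, be, tp, xp, nu, E, N.
    assert (Hbe : forall v, Rabs v < eps -> Rabs (be v - be0) <= dl) by (intros v Hv; apply Q1; auto).
    assert (Hq : forall v, 0 <= v < eps -> good_state (be (a * v), be v, tp v, xp v)).
    { intros v Hv. apply FG, (shock_cone_mono be0 V0 d dG); [lra|exact (proj1 (Q9 v Hv))]. }
    assert (Htp : forall v, 0 <= v < eps -> 0 < v -> 0 < tp v).
    { intros v Hv Hv0. destruct (Q9 v Hv) as [_ [K _]]. apply (K Hv0). }
    split; [apply Heps|]. split.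
    { intros v Hv. destruct (Q1 v Hv) as [K1 [K2 [K3 _]]]. auto. }
    split.
    { intros u v [Hu Hv]. apply Hm0. assert (K1 := Hbe u Hu). assert (K2 := Hbe v Hv).
      change (Rabs (/ 2 * (be u + be v) - be0) < m0).
      replace (/ 2 * (be u + be v) - be0) with (/ 2 * ((be u - be0) + (be v - be0))) by field.
      rewrite Rabs_mult, (Rabs_pos_eq (/ 2)) by lra. generalize (Rabs_triang (be u - be0) (be v - be0)).
      assert (0 < m0) by apply cond_pos. lra. }
    split; [exact Q2|]. split; [exact Q3|]. split; [exact Q4|]. split; [exact Q5|]. split; [exact Q6|].
    split; [exact Q7|]. split; [exact Q8|].
    intros v Hv q. destruct (Q9 v Hv) as [K1 [K2 [K3 [K4 [K5 K6]]]]].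
    split; [apply Hq; auto|]. split; [apply Htp; auto|]. split; [exact K3|]. split; [exact K4|]. split; [exact K6|].
    (* The equation for [th] says that $\beta_+-H$ has zero derivative; the chain rule applies for
       positive [v], when the shock point is interior to [D]. *)
    set (qv := fun v => (be (a * v), be v, tp v, xp v)).
    set (Hq' := fun v => H (alZ (qv v), almZ (qv v), bemZ (qv v))).
    change (be v = Hq' v). apply Rminus_diag_uniq.
    assert (Q0 : qv 0 = q0) by (unfold qv; rewrite Rmult_0_r, Q3, Q6, Q7; reflexivity).
    rewrite (constant_of_zero_derive (fun v => be v - Hq' v) eps); [| | |exact Hv].
    + unfold Hq'. rewrite Q0, Q3. unfold almZ, bemZ; simpl.
      change (Fe (rhos (0, 0)) + ws (0, 0)) with (als (0, 0)).
      change (Fe (rhos (0, 0)) - ws (0, 0)) with (bes (0, 0)). rewrite H_origin. ring.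
    + intros s Hs. assert (Hs' : Rabs s < eps) by (rewrite Rabs_pos_eq; lra).
      assert (Has : Rabs (a * s) < eps).
      { rewrite Rabs_mult, (Rabs_pos_eq a) by lra. apply Rle_lt_trans with (1 * Rabs s); [apply Rmult_le_compat_r; [apply Rabs_pos|lra]|lra]. }
      destruct (Q9 s ltac:(lra)) as [L1 [L2 [L3 [L4 [L5 L6]]]]]. specialize (Hq s ltac:(lra)).
      fold (qv s) in L3, L4, L5, L6, Hq.
      destruct Hq as [_ [_ [GD [GI [GU _]]]]]. specialize (Htp s ltac:(lra) ltac:(lra)). specialize (GI Htp).
      assert (Hrm := dev_rho_pos _ _ _ _ _ _ _ dev _ GD).
      set (t' := (a + gZ (qv s)) * nu s (a * s)) in *. set (x' := QZ (qv s) * nu s (a * s)) in *.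
      assert (Dr : is_derive (fun v => rhos (tp v, xp v)) s (rt (tp s, xp s) * t' + rx (tp s, xp s) * x')).
      { apply (is_derive_curve (fun t x => rhos (t, x)) tp xp); auto. apply (partials_differentiable D); auto. }
      assert (Dw : is_derive (fun v => ws (tp v, xp v)) s (wt (tp s, xp s) * t' + wx (tp s, xp s) * x')).
      { apply (is_derive_curve (fun t x => ws (t, x)) tp xp); auto. apply (partials_differentiable D); auto. }
      assert (DF : is_derive (fun v => Fe (rhos (tp v, xp v))) s
         ((rt (tp s, xp s) * t' + rx (tp s, xp s) * x') * dFe (rhos (tp s, xp s)))).
      { apply (is_derive_comp Fe (fun v => rhos (tp v, xp v))); auto. apply enthalpy_derive; auto. }
      assert (Dalm : is_derive (fun v => almZ (qv v)) s (dFe (rhos (tp s, xp s)) * (rt (tp s, xp s) * t' + rx (tp s, xp s) * x') + (wt (tp s, xp s) * t' + wx (tp s, xp s) * x'))).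
      { evar_last; [apply (@is_derive_plus R_AbsRing R_NormedModule); [exact DF|exact Dw]|]. unfold plus; simpl. ring. }
      assert (Dbem : is_derive (fun v => bemZ (qv v)) s (dFe (rhos (tp s, xp s)) * (rt (tp s, xp s) * t' + rx (tp s, xp s) * x') - (wt (tp s, xp s) * t' + wx (tp s, xp s) * x'))).
      { evar_last; [apply (@is_derive_minus R_AbsRing R_NormedModule); [exact DF|exact Dw]|]. unfold minus, plus, opp; simpl. ring. }
      assert (Dal : is_derive (fun v => alZ (qv v)) s (a * th (a * s))).
      { apply (is_derive_comp be (fun v => a * v)); [apply Q1; auto|apply is_derive_linear]. }
      assert (DHq := chain3 U H H1 H2 H3 _ _ _ s _ _ _ U_open H_partials GU Dal Dalm Dbem).
      evar_last; [apply (@is_derive_minus R_AbsRing R_NormedModule); [exact (proj1 (proj2 (proj2 (Q1 s Hs'))))|exact DHq]|].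
      rewrite L5. unfold SZ, htZ, hxZ, PZ, minus, plus, opp; simpl. unfold t', x'. simpl. ring.
    (* At the apex, continuity of the composite with [H] comes from its Lipschitz bound on the
       cone. *)
    + intros e He0. assert (Zin : Rabs 0 < eps) by (rewrite Rabs_R0; lra).
      assert (Ce : forall f : R -> R, continuous f 0 -> forall e, 0 < e -> locally 0 (fun s => Rabs (f s - f 0) <= e)).
      { intros f Hf e1 He1. apply continuous_locally; auto. }
      assert (Hbe1 : continuous be 0) by (exact (is_derive_continuous _ _ _ (proj1 (proj2 (proj2 (Q1 0 Zin)))))).
      assert (Hbe2 : continuous (fun s => be (a * s)) 0).
      { apply continuous_comp; [apply continuous_linear|]. rewrite Rmult_0_r. exact Hbe1. }
      destruct (Q9 0 ltac:(lra)) as [_ [_ [L3 [L4 _]]]].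
      assert (Htp1 := is_derive_continuous _ _ _ L3). assert (Hxp1 := is_derive_continuous _ _ _ L4).
      set (e' := e / (4 * (BH + 1) + 2)). assert (He' : 0 < e') by (apply Rdiv_lt_0_compat; lra).
      assert (Ee : (4 * (BH + 1) + 2) * e' = e) by (unfold e'; field; lra).
      assert (Lo := filter_and _ _ (Ce _ Hbe2 e' He') (filter_and _ _ (Ce _ Hbe1 e' He')
        (filter_and _ _ (Ce _ Htp1 e' He') (filter_and _ _ (Ce _ Hxp1 e' He') (locally_abs_lt eps 0 Zin))))).
      destruct Lo as [dd Hdd]. exists dd. split; [apply cond_pos|]. intros s Hs.
      destruct (Hdd s) as [M1 [M2 [M3 [M4 M5]]]].
      { change (Rabs (s - 0) < dd). rewrite Rminus_0_r, Rabs_pos_eq; lra. }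
      rewrite Rabs_pos_eq in M5 by lra.
      assert (MH : Rabs (Hq' s - Hq' 0) <= BH * (4 * e')).
      { assert (FH' := FH d BH ltac:(lra) ltac:(lra)).
        eapply Rle_trans; [apply (C11_lip _ _ _ _ _ FH'); [exact (proj1 (Q9 s ltac:(lra)))|exact (proj1 (Q9 0 ltac:(lra)))]|].
        apply Rmult_le_compat_l; auto. unfold qv, q4_dist. lra. }
      replace (be s - Hq' s - (be 0 - Hq' 0)) with ((be s - be 0) + - (Hq' s - Hq' 0)) by ring.
      eapply Rle_lt_trans; [apply plus_bound; [exact M2|rewrite Rabs_Ropp; exact MH]|]. lra.
Qed.

(** * The solution of the reflection problem in the triangle *)

Lemma square_mono (r1 r u v : R) : r1 <= r -> square r1 u v -> square r u v.
Proof. intros Hr [H4 H5]. split; lra. Qed.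

Lemma C1_square_mono (r1 r : R) (f fu fv : R -> R -> R) : r1 <= r -> C1_square r f fu fv -> C1_square r1 f fu fv.
Proof. intros Hr Hf u v Huv. apply Hf. eapply square_mono; eauto. Qed.

Lemma c_out_in_range (al be : R) : enthalpy_range p rref (/ 2 * (al + be)) ->
  c_out p rref al be = / 2 * (al - be) + sound_speed p rref (/ 2 * (al + be)) /\
  c_in p rref al be = / 2 * (al - be) - sound_speed p rref (/ 2 * (al + be)) /\
  rho_of p rref al be = density p rref (/ 2 * (al + be)) /\ admissible p rref al be.
Proof.
  intros Hr. assert (E : / 2 * (al + be) = (al + be) / 2) by field.
  assert (W : w_of al be = / 2 * (al - be)) by (unfold w_of; field).
  rewrite E in *. assert (R0 := rho_of_density p rref p_smooth dp_pos rref_pos al be Hr).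
  unfold c_out, c_in, sound_speed. rewrite R0, W. repeat split; auto.
  exists (density p rref ((al + be) / 2)). apply has_density_iff. apply density_spec; auto.
Qed.

(** In terms of the shock curve this is $dx_+=V\,dt_+$, both sides divided by [nu (v, a v)]. *)
Lemma g_V_relation (z : q4) : VZ z < wpZ z + ssZ z -> QZ z = VZ z * (a + gZ z).
Proof. intros Hz. unfold QZ, gZ. field. lra. Qed.

Lemma good_state_shock (al be t x : R) : good_state (al, be, t, x) ->
  let z := (al, be, t, x) in
  rho_of p rref al be = rpZ z /\ w_of al be = wpZ z /\
  rho_of p rref (als (t, x)) (bes (t, x)) = at_tx rhos z /\ w_of (als (t, x)) (bes (t, x)) = at_tx ws z /\
  shock_speed p rref al be (als (t, x)) (bes (t, x)) = VZ z /\
  c_out p rref al be = wpZ z + ssZ z /\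
  c_out p rref (als (t, x)) (bes (t, x)) = at_tx ws z + eta p (at_tx rhos z).
Proof.
  intros [G1 [G2 [G3 _]]] z. destruct (c_out_in_range al be G1) as [W1 [_ [W2 _]]].
  assert (W3 : w_of al be = wpZ z) by (unfold w_of, wpZ; simpl; field).
  assert (Hr := dev_rho_pos _ _ _ _ _ _ _ dev _ G3).
  assert (W4 : rho_of p rref (als (t, x)) (bes (t, x)) = at_tx rhos z) by (apply rho_of_state; auto).
  assert (W5 : w_of (als (t, x)) (bes (t, x)) = at_tx ws z) by apply w_of_state.
  split; [exact W2|]. split; [exact W3|]. split; [exact W4|]. split; [exact W5|].
  split; [|split; [exact W1|]].
  - unfold shock_speed. rewrite W2, W3, W4, W5. reflexivity.
  - unfold c_out. rewrite W4, W5. reflexivity.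
Qed.

(** The functions are constructed on one open square that contains the triangles for all admissible
    [eps], so regularity up to the boundary is obtained by restriction. *)
Lemma reflection_solved : exists eps0 : R, 0 < eps0 /\
  forall eps : R, 0 < eps <= eps0 ->
    exists al be t x : R * R -> R,
      (C2 (T_domain a eps) al /\ C2 (T_domain a eps) be /\ C2 (T_domain a eps) t /\ C2 (T_domain a eps) x) /\
      shock_reflection_problem p rref D als bes a be0 th0 V0 eps al be t x /\
      (forall q, T_domain a eps q -> jacobian (T_domain a eps) t x q <> 0) /\
      C2_function_of (T_domain a eps) t x al /\ C2_function_of (T_domain a eps) t x be.
Proof.
  assert (Ha := a_01). assert (He := eta0_pos). assert (Hi : 0 < / eta0) by (apply Rinv_0_lt_compat; auto).
  destruct reflection_functions as [r [th [b [be [tp [xp [nu [E [N [Hr [F1 [F2 [F3 [F4 [F5 [F6 [F7 [F8 [F9 F10]]]]]]]]]]]]]]]]]]].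
  assert (Cbe : forall u, Rabs u < r -> is_derive be u (th u) /\ continuous th u).
  { intros u Hu. destruct (F1 u Hu) as [K1 [K2 K3]]. split; auto. exact (is_derive_continuous _ _ _ K2). }
  assert (Cth : forall u, Rabs u < r -> is_derive th u (b u) /\ continuous b u).
  { intros u Hu. destruct (F1 u Hu) as [K1 [K2 K3]]. auto. }
  assert (Lbe := C1_square_left r be th Cbe). assert (Rbe := C1_square_right r be th Cbe).
  assert (Lth := C1_square_left r th b Cth). assert (Rth := C1_square_right r th b Cth).
  assert (Hsg := C1_square_mult r _ _ _ _ _ _ (C1_square_const r (/ 2)) (C1_square_plus r _ _ _ _ _ _ Lbe Rbe)).
  assert (Hdf := C1_square_mult r _ _ _ _ _ _ (C1_square_const r (/ 2))
     (C1_square_plus r _ _ _ _ _ _ Lbe (C1_square_mult r _ _ _ _ _ _ (C1_square_const r (-1)) Rbe))).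
  assert (Hes := C1_square_comp r (enthalpy_range p rref) (sound_speed p rref) ss' _ _ _
     (fun s Hs => conj (ss_derive s Hs) (smooth1_continuous 2 _ _ ss'_smooth s Hs)) F2 Hsg).
  set (cin := fun u v => / 2 * (be u - be v) - sound_speed p rref (/ 2 * (be u + be v))).
  set (cout := fun u v => / 2 * (be u - be v) + sound_speed p rref (/ 2 * (be u + be v))).
  assert (Hcout : C1_square r cout (fun u v => / 2 * th u * (1 + ss' (/ 2 * (be u + be v))))
     (fun u v => - / 2 * th v * (1 - ss' (/ 2 * (be u + be v))))).
  { apply (C1_square_ext r _ _ _ _ _ _ (C1_square_plus r _ _ _ _ _ _ Hdf Hes)); intros; unfold cout; simpl; field. }
  assert (Hcin : C1_square r cin (fun u v => / 2 * th u * (1 - ss' (/ 2 * (be u + be v))))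
     (fun u v => - / 2 * th v * (1 + ss' (/ 2 * (be u + be v))))).
  { apply (C1_square_ext r _ _ _ _ _ _ (C1_square_plus r _ _ _ _ _ _ Hdf
      (C1_square_mult r _ _ _ _ _ _ (C1_square_const r (-1)) Hes))); intros; unfold cin; simpl; field. }
  assert (Fsw := C1_square_swap r _ _ _ F3).
  set (A := fun u v => cin u v * nu v u). set (B := fun u v => cout u v * nu u v).
  assert (HA := C1_square_mult r _ _ _ _ _ _ Hcin Fsw). assert (HB := C1_square_mult r _ _ _ _ _ _ Hcout F3).
  fold A in HA. fold B in HB.
  match type of HA with C1_square _ _ ?x ?y => set (Au := x) in HA; set (Av := y) in HA end.
  match type of HB with C1_square _ _ ?x ?y => set (Bu := x) in HB; set (Bv := y) in HB end.
  (* The hodograph right-hand side is symmetric in [u] and [v]; this is the closedness of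
     $\nu(v,u)\,du+\nu(u,v)\,dv$. *)
  assert (Esym : forall u v, square r u v -> E v u = E u v).
  { intros u v Huv. rewrite (F9 u v Huv), (F9 v u (square_swap _ _ _ Huv)). rewrite (Rplus_comm (be v)). ring. }
  (* Closedness of the form for [x] is $(c_{\rm in}t_u)_v=(c_{\rm out}t_v)_u$, which is the
     hodograph equation solved for $t_{uv}$, with $c_{\rm out}-c_{\rm in}=2\eta$. *)
  assert (HA' : C1_square r A Au Bu).
  { apply (C1_square_ext_partials r A Au Av); auto. intros u v Huv. split; auto. unfold Av, Bu. rewrite (Esym u v Huv), (F9 u v Huv).
    assert (Hs := F2 u v Huv). assert (Hss := sound_speed_pos p rref p_smooth dp_pos rref_pos _ Hs).
    unfold cin, cout, hodo_coef. field. lra. }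
  assert (Ht' : C1_square r (fun u v => nu v u) (fun u v => N v u) E).
  { apply (C1_square_ext_partials r _ _ _ _ _ ltac:(intros u v Huv; split; [reflexivity|exact (Esym u v Huv)]) Fsw). }
  destruct (closed_form_potential r _ _ _ _ _ Hr Ht' F3) as [t [Ht t00]].
  destruct (closed_form_potential r A Au B Bv Bu Hr HA' HB) as [x [Hx x00]].
  assert (Zr : square r 0 0) by (split; rewrite Rabs_R0; auto).
  assert (Ess : sound_speed p rref (/ 2 * (be0 + be0)) = eta0).
  { replace (/ 2 * (be0 + be0)) with be0 by field. unfold sound_speed, be0, Fe. rewrite density_enthalpy; auto. }
  (* At the origin $t_u=t_v=1/\eta_0$, $x_u=-1$ and $x_v=1$, the linear model of
     [square_expanding]. *)
  assert (A00 : A 0 0 = -1) by (unfold A, cin; rewrite F4, F6, Ess; field; lra).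
  assert (B00 : B 0 0 = 1) by (unfold B, cout; rewrite F4, F6, Ess; field; lra).
  destruct (continuity_2d_close_square (fun u v => nu v u) (/ eta0 / 4) ltac:(lra) (C1_square_continuous _ _ _ _ Fsw 0 0 Zr)) as [c1 [P1 G1]].
  destruct (continuity_2d_close_square nu (/ eta0 / 4) ltac:(lra) (C1_square_continuous _ _ _ _ F3 0 0 Zr)) as [c2 [P2 G2]].
  destruct (continuity_2d_close_square A (/ 4) ltac:(lra) (C1_square_continuous _ _ _ _ HA 0 0 Zr)) as [c3 [P3 G3]].
  destruct (continuity_2d_close_square B (/ 4) ltac:(lra) (C1_square_continuous _ _ _ _ HB 0 0 Zr)) as [c4 [P4 G4]].
  rewrite A00 in G3. rewrite B00 in G4. rewrite F6 in G1, G2.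
  set (r1 := Rmin r (Rmin (Rmin c1 c2) (Rmin c3 c4))).
  assert (Hr1 : 0 < r1 /\ r1 <= r /\ r1 <= c1 /\ r1 <= c2 /\ r1 <= c3 /\ r1 <= c4).
  { unfold r1. generalize (Rmin_l r (Rmin (Rmin c1 c2) (Rmin c3 c4))) (Rmin_r r (Rmin (Rmin c1 c2) (Rmin c3 c4)))
     (Rmin_l (Rmin c1 c2) (Rmin c3 c4)) (Rmin_r (Rmin c1 c2) (Rmin c3 c4)) (Rmin_l c1 c2) (Rmin_r c1 c2) (Rmin_l c3 c4) (Rmin_r c3 c4).
    intros; repeat split; try lra. repeat apply Rmin_case; lra. }
  clearbody r1.
  assert (Gt : forall u v, square r1 u v -> Rabs (nu v u - / eta0) <= / eta0 / 4 /\ Rabs (nu u v - / eta0) <= / eta0 / 4).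
  { intros u v Huv. split; [apply G1|apply G2]; eapply square_mono; eauto; lra. }
  assert (Gx : forall u v, square r1 u v -> Rabs (A u v - -1) <= / 4 /\ Rabs (B u v - 1) <= / 4).
  { intros u v Huv. split; [apply G3|apply G4]; eapply square_mono; eauto; lra. }
  assert (Hexp := fun u v u' v' => square_expanding r1 eta0 t (fun u v => nu v u) nu x A B u v u' v' He
     (C1_square_mono r1 r _ _ _ ltac:(lra) Ht) (C1_square_mono r1 r _ _ _ ltac:(lra) Hx) Gt Gx).
  assert (Hjac : forall u v, square r1 u v -> 0 < nu v u * B u v - nu u v * A u v).
  { intros u v Huv. destruct (Gt u v Huv) as [K1 K2]. destruct (Gx u v Huv) as [K3 K4].
    apply Rabs_le_between in K1. apply Rabs_le_between in K2. apply Rabs_le_between in K3. apply Rabs_le_between in K4.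
    assert (0 < nu v u * B u v) by (apply Rmult_lt_0_compat; lra).
    assert (0 < nu u v * - A u v) by (apply Rmult_lt_0_compat; lra). lra. }
  (* The potentials restricted to $u=av$ have the same derivatives as [tp] and [xp] and start from
     the same point, so the shock curve of the iteration is the one of the potentials. *)
  assert (Hshock : forall v, 0 <= v < r -> t (a * v) v = tp v /\ x (a * v) v = xp v /\
     is_derive (fun s => t (a * s) s) v ((a + gZ (be (a * v), be v, tp v, xp v)) * nu v (a * v)) /\
     is_derive (fun s => x (a * s) s) v (QZ (be (a * v), be v, tp v, xp v) * nu v (a * v))).
  { assert (Sq : forall v, 0 <= v < r -> square r (a * v) v).
    { intros v Hv. split; rewrite Rabs_pos_eq; try lra; [|apply Rmult_le_pos; lra].
      apply Rle_lt_trans with (1 * v); [apply Rmult_le_compat_r|]; lra. }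
    assert (Dt : forall v, 0 <= v < r -> is_derive (fun s => t (a * s) s) v ((a + gZ (be (a * v), be v, tp v, xp v)) * nu v (a * v))).
    { intros v Hv. destruct (F10 v Hv) as [_ [_ [_ [_ [K _]]]]].
      assert (W := is_derive_curve t (fun s => a * s) (fun s => s) v _ _ a 1
         (C1_square_differentiable _ _ _ _ Ht _ _ (Sq v Hv)) (is_derive_linear a v) (is_derive_id v)).
      cbv beta in W. rewrite K in W. replace ((a + gZ (be (a * v), be v, tp v, xp v)) * nu v (a * v))
        with (nu v (a * v) * a + gZ (be (a * v), be v, tp v, xp v) * nu v (a * v) * 1) by ring. exact W. }
    assert (Dx : forall v, 0 <= v < r -> is_derive (fun s => x (a * s) s) v (QZ (be (a * v), be v, tp v, xp v) * nu v (a * v))).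
    { intros v Hv. destruct (F10 v Hv) as [_ [_ [_ [_ [K _]]]]].
      assert (W := is_derive_curve x (fun s => a * s) (fun s => s) v _ _ a 1
         (C1_square_differentiable _ _ _ _ Hx _ _ (Sq v Hv)) (is_derive_linear a v) (is_derive_id v)).
      unfold A, B in W. cbv beta in W. rewrite K in W.
      replace (QZ (be (a * v), be v, tp v, xp v) * nu v (a * v)) with
        (cin (a * v) v * nu v (a * v) * a + cout (a * v) v * (gZ (be (a * v), be v, tp v, xp v) * nu v (a * v)) * 1); [exact W|].
      unfold QZ, cin, cout, wpZ, ssZ, sZ; simpl. ring. }
    assert (Eq : forall f g : R -> R, f 0 = g 0 -> (forall s, 0 <= s < r -> exists l, is_derive f s l /\ is_derive g s l) ->
       forall v, 0 <= v < r -> f v = g v).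
    { intros f g H0 Hfg v Hv. apply Rminus_diag_uniq.
      rewrite (constant_of_zero_derive (fun s => f s - g s) r); auto; [lra| |].
      - intros s Hs. destruct (Hfg s ltac:(lra)) as [l [L1 L2]]. replace 0 with (l - l) by ring.
        apply @is_derive_minus; auto.
      - intros e He0. destruct (Hfg 0 ltac:(lra)) as [l [L1 L2]].
        assert (Cd : continuous (fun s => f s - g s) 0).
        { apply (@continuous_minus R_UniformSpace R_AbsRing R_NormedModule);
          [exact (is_derive_continuous _ _ _ L1)|exact (is_derive_continuous _ _ _ L2)]. }
        destruct (proj1 (continuous_eps _ _) Cd e He0) as [d [Hd Hd']]. exists d. split; auto.
        intros s Hs. apply Hd'. rewrite Rminus_0_r, Rabs_pos_eq; lra. }
    intros v Hv. split; [|split; [|split; auto]].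
    - apply (Eq (fun v => t (a * v) v) tp); [rewrite Rmult_0_r, t00, F7; auto| |auto].
      intros s Hs. eexists. split; [apply Dt; auto|apply (F10 s Hs)].
    - apply (Eq (fun v => x (a * v) v) xp); [rewrite Rmult_0_r, x00, F8; auto| |auto].
      intros s Hs. eexists. split; [apply Dx; auto|apply (F10 s Hs)]. }
  (* On the wall $c_{\rm in}=-c_{\rm out}$, so the two contributions to the derivative of [x] along
     the diagonal cancel. *)
  assert (Hwall : forall u, 0 <= u < r -> x u u = 0).
  { intros u Hu. assert (Dx : forall s, 0 <= s < r -> is_derive (fun s => x s s) s 0).
    { intros s Hs. assert (Ss : square r s s) by (split; rewrite Rabs_pos_eq; lra).
      assert (W := is_derive_curve x (fun s => s) (fun s => s) s _ _ 1 1
         (C1_square_differentiable _ _ _ _ Hx _ _ Ss) (is_derive_id s) (is_derive_id s)).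
      replace (A s s * 1 + B s s * 1) with 0 in W by (unfold A, B, cin, cout; ring). exact W. }
    rewrite (constant_of_zero_derive (fun s => x s s) r); auto.
    - intros s Hs. apply Dx; lra.
    - intros e He0. destruct (proj1 (continuous_eps _ _) (is_derive_continuous _ _ _ (Dx 0 ltac:(lra))) e He0) as [d [Hd Hd']].
      exists d. split; auto. intros s Hs. apply Hd'. rewrite Rminus_0_r, Rabs_pos_eq; lra. }
  (* Half of [r1], since the closed triangle has to lie in the open square. *)
  exists (r1 / 2). split; [lra|]. intros eps Heps.
  set (Te := T_domain a eps).
  assert (TS : forall u v, Te (u, v) -> 0 <= u /\ u <= v /\ v <= eps /\ square r1 u v).
  { intros u v Hq. apply T_domain_iff in Hq; [|lra]. destruct Hq as [[K1 K2] [K3 K4]].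
    assert (v <= eps) by (apply Rmult_le_reg_l with a; lra).
    repeat split; try lra; rewrite Rabs_pos_eq; lra. }
  assert (TSr : forall u v, Te (u, v) -> square r u v).
  { intros u v Hq. eapply square_mono; [|apply TS; exact Hq]. lra. }
  assert (Tadh : forall q, Te q -> adherent_interior Te q) by (intros q Hq; apply T_domain_adherent; auto; lra).
  set (pS := fun f fu fv => partials_of_square r Te f fu fv TSr).
  assert (Pal := pS _ _ _ Lbe). assert (Pbe := pS _ _ _ Rbe). assert (Pt := pS _ _ _ Ht). assert (Px := pS _ _ _ Hx).
  assert (PZ0 := pS _ _ _ (C1_square_const r 0)).
  exists (uncurry2 (fun u _ => be u)), (uncurry2 (fun _ v => be v)), (uncurry2 t), (uncurry2 x).
  assert (pdt := fun q Hq => pd_partials Te _ _ _ q Pt Hq (Tadh q Hq)).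
  assert (pdx := fun q Hq => pd_partials Te _ _ _ q Px Hq (Tadh q Hq)).
  assert (pdal := fun q Hq => pd_partials Te _ _ _ q Pal Hq (Tadh q Hq)).
  assert (pdbe := fun q Hq => pd_partials Te _ _ _ q Pbe Hq (Tadh q Hq)).
  assert (T00 : Te (0, 0)).
  { apply T_domain_iff; [lra|]. assert (0 <= a * eps) by (apply Rmult_le_pos; lra). lra. }
  split; [|split; [|split]].
  - split; [|split; [|split]].
    + apply (C2_of_partials Te _ _ _ _ _ _ _ Pal (pS _ _ _ Lth) PZ0).
    + apply (C2_of_partials Te _ _ _ _ _ _ _ Pbe PZ0 (pS _ _ _ Rth)).
    + apply (C2_of_partials Te _ _ _ _ _ _ _ Pt (pS _ _ _ Ht') (pS _ _ _ F3)).
    + apply (C2_of_partials Te _ _ _ _ _ _ _ Px (pS _ _ _ HA') (pS _ _ _ HB)).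
  - split.
    + intros [u v] Hq. apply (c_out_in_range (be u) (be v)). apply F2, TSr, Hq.
    + intros [u v] Hq. fold Te. rewrite (proj1 (pdx _ Hq)), (proj1 (pdt _ Hq)). unfold uncurry2; simpl.
      destruct (c_out_in_range (be u) (be v) (F2 u v (TSr _ _ Hq))) as [_ [K _]]. rewrite K. reflexivity.
    + intros [u v] Hq. fold Te. rewrite (proj2 (pdx _ Hq)), (proj2 (pdt _ Hq)). unfold uncurry2; simpl.
      destruct (c_out_in_range (be u) (be v) (F2 u v (TSr _ _ Hq))) as [K _]. rewrite K. reflexivity.
    + intros q Hq. exact (proj2 (pdal q Hq)).
    + intros q Hq. exact (proj1 (pdbe q Hq)).
    + intros u Hq. unfold uncurry2; simpl. split; auto. apply Hwall. destruct (TS u u Hq) as [K1 [K2 [K3 K4]]]. lra.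
    + intros v Hv. assert (Hvr : 0 <= v < r) by lra.
      destruct (Hshock v Hvr) as [S1 [S2 [S3 S4]]]. destruct (F10 v Hvr) as [G [_ [_ [_ [_ L]]]]].
      unfold uncurry2; simpl. rewrite S1, S2.
      destruct (good_state_shock _ _ _ _ G) as [W1 [W2 [W3 [W4 [W5 [W6 W7]]]]]].
      rewrite W1, W3, W5, W6, W7. destruct G as [_ [G5 [G6 [_ [G7 [G8 _]]]]]].
      split; [exact G6|]. split; [exact G5|]. split; [|split; [|exact G8]].
      * eexists. eexists. split; [apply is_derive_is_derive_within; [lra|exact S3]|].
        split; [apply is_derive_is_derive_within; [lra|exact S4]|].
        rewrite g_V_relation by apply G8. ring.
      * assert (EJ := H_jump _ _ _ G7). simpl in EJ. rewrite <- L in EJ. exact EJ.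
    + unfold uncurry2; simpl. exact t00.
    + fold Te. rewrite (proj2 (pdx _ T00)). exact B00.
    + unfold uncurry2; simpl. exact F4.
    + fold Te. rewrite (proj2 (pdbe _ T00)). exact F5.
    + unfold uncurry2; simpl. rewrite t00, x00, F4.
      destruct (F10 0 ltac:(lra)) as [G _]. rewrite Rmult_0_r, F4, F7, F8 in G.
      destruct (good_state_shock _ _ _ _ G) as [_ [_ [_ [_ [W5 _]]]]]. rewrite W5. apply V_origin.
  - intros [u v] Hq. fold Te. unfold jacobian. rewrite (proj1 (pdx _ Hq)), (proj2 (pdx _ Hq)), (proj1 (pdt _ Hq)), (proj2 (pdt _ Hq)).
    unfold uncurry2; simpl. destruct (TS u v Hq) as [_ [_ [_ K]]]. generalize (Hjac u v K). lra.
  - assert (TS1 : forall u v, Te (u, v) -> square r1 u v) by (intros u v Hq; apply TS, Hq).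
    assert (M := fun f fu fv => C1_square_mono r1 r f fu fv ltac:(lra)).
    assert (HK : 0 < 2 * (eta0 + 1)) by lra.
    assert (HexpT : forall u v u' v', Te (u, v) -> Te (u', v') ->
      Rabs (u - u') + Rabs (v - v') <= 2 * (eta0 + 1) * (Rabs (t u v - t u' v') + Rabs (x u v - x u' v'))) by (intros; apply Hexp; auto).
    set (jc := fun u v => nu v u * B u v - nu u v * A u v).
    assert (Hjc : C1_square r1 jc (fun u v => (N v u * B u v + nu v u * Bu u v) - (E u v * A u v + nu u v * Au u v))
       (fun u v => (E u v * B u v + nu v u * Bv u v) - (N u v * A u v + nu u v * Bu u v))).
    { assert (W := C1_square_plus r _ _ _ _ _ _ (C1_square_mult r _ _ _ _ _ _ Ht' HB)
         (C1_square_mult r _ _ _ _ _ _ (C1_square_const r (-1)) (C1_square_mult r _ _ _ _ _ _ F3 HA'))).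
      apply M. apply (C1_square_ext r _ _ _ _ _ _ W); intros; unfold jc; simpl; ring. }
    assert (Hij := C1_square_comp r1 (fun s => 0 < s) Rinv (fun s => - / (s * s)) jc _ _
       ltac:(intros s Hs; split; [evar_last; [apply is_derive_inv; [apply @is_derive_id|lra]|unfold one; simpl; field; lra]|
         apply (smooth1_continuous 0 (fun s => 0 < s)); auto;
         apply (smooth1_ext 0 (fun s => 0 < s) (fun s => -1 * / (s * s)));
         [intros y Hy; apply (open_gt 0), Hy|intros; ring|
          apply smooth1_mult; [apply smooth1_const|apply smooth1_inv; [apply smooth1_mult; apply smooth1_id|
            intros y Hy; assert (0 < y * y) by (apply Rmult_lt_0_compat; auto); lra]]]]) Hjac Hjc).
    match type of Hij with C1_square _ _ ?x ?y => set (iju := x) in Hij; set (ijv := y) in Hij end.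
    (* Cramer's rule for the partial derivatives with respect to (t, x). *)
    assert (Push : forall f fu fv fuu fuv fvu fvv, C1_square r1 f fu fv -> C1_square r1 fu fuu fuv -> C1_square r1 fv fvu fvv ->
       C2_function_of Te (uncurry2 t) (uncurry2 x) (uncurry2 f)).
    { assert (Grad : forall f fu fv fuu fuv fvu fvv, C1_square r1 f fu fv -> C1_square r1 fu fuu fuv -> C1_square r1 fv fvu fvv ->
         exists f1 f2 f1u f1v f2u f2v, C1_square r1 f1 f1u f1v /\ C1_square r1 f2 f2u f2v /\
           partials (image_domain Te (uncurry2 t) (uncurry2 x)) (push Te t x f) (push Te t x f1) (push Te t x f2)).
      { intros f fu fv fuu fuv fvu fvv Q0 Q1 Q2.
        assert (W1 := C1_square_mult r1 _ _ _ _ _ _ (C1_square_plus r1 _ _ _ _ _ _ (C1_square_mult r1 _ _ _ _ _ _ Q1 (M _ _ _ HB))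
           (C1_square_mult r1 _ _ _ _ _ _ (C1_square_const r1 (-1)) (C1_square_mult r1 _ _ _ _ _ _ Q2 (M _ _ _ HA')))) Hij).
        assert (W2 := C1_square_mult r1 _ _ _ _ _ _ (C1_square_plus r1 _ _ _ _ _ _ (C1_square_mult r1 _ _ _ _ _ _ Q2 (M _ _ _ Ht'))
           (C1_square_mult r1 _ _ _ _ _ _ (C1_square_const r1 (-1)) (C1_square_mult r1 _ _ _ _ _ _ Q1 (M _ _ _ F3)))) Hij).
        do 6 eexists. split; [exact W1|]. split; [exact W2|].
        apply (push_partials r1 (2 * (eta0 + 1)) Te t _ _ x _ _ TS1 (M _ _ _ Ht) (M _ _ _ Hx) HK HexpT f fu fv); auto.
        - eapply C1_square_continuous; exact W1.
        - eapply C1_square_continuous; exact W2.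
        - intros u v Hq. assert (K := Hjac u v (TS1 _ _ Hq)). unfold jc. split; field; lra. }
      intros f fu fv fuu fuv fvu fvv Q0 Q1 Q2.
      destruct (Grad f fu fv fuu fuv fvu fvv Q0 Q1 Q2) as [f1 [f2 [f1u [f1v [f2u [f2v [W1 [W2 W3]]]]]]]].
      (* For second derivatives the same formula is applied to the functions found by [Grad]; their
         gradients need only be continuous. *)
      assert (Cont : forall h hu hv, C1_square r1 h hu hv ->
        exists h1 h2, (forall q, image_domain Te (uncurry2 t) (uncurry2 x) q ->
           filterlim h1 (within (image_domain Te (uncurry2 t) (uncurry2 x)) (locally q)) (locally (h1 q))) /\
         partials (image_domain Te (uncurry2 t) (uncurry2 x)) (push Te t x h) h1 h2).
      { intros h hu hv Qh.
        exists (push Te t x (fun u v => (hu u v * B u v - hv u v * A u v) * / jc u v)),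
          (push Te t x (fun u v => (hv u v * nu v u - hu u v * nu u v) * / jc u v)).
        assert (Ci : forall u v, square r1 u v -> continuity_2d_pt (fun u v => / jc u v) u v) by (eapply C1_square_continuous; exact Hij).
        assert (CB := C1_square_continuous _ _ _ _ (M _ _ _ HB)). assert (CA := C1_square_continuous _ _ _ _ (M _ _ _ HA')).
        assert (Cn1 := C1_square_continuous _ _ _ _ (M _ _ _ Ht')). assert (Cn2 := C1_square_continuous _ _ _ _ (M _ _ _ F3)).
        assert (Chu : forall u v, square r1 u v -> continuity_2d_pt hu u v) by (intros; apply Qh; auto).
        assert (Chv : forall u v, square r1 u v -> continuity_2d_pt hv u v) by (intros; apply Qh; auto).
        assert (Y : partials (image_domain Te (uncurry2 t) (uncurry2 x)) (push Te t x h)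
           (push Te t x (fun u v => (hu u v * B u v - hv u v * A u v) * / jc u v))
           (push Te t x (fun u v => (hv u v * nu v u - hu u v * nu u v) * / jc u v))).
        { apply (push_partials r1 (2 * (eta0 + 1)) Te t _ _ x _ _ TS1 (M _ _ _ Ht) (M _ _ _ Hx) HK HexpT h hu hv); auto.
          - intros u v Huv. apply continuity_2d_pt_mult; auto. apply continuity_2d_pt_minus; apply continuity_2d_pt_mult; auto.
          - intros u v Huv. apply continuity_2d_pt_mult; auto. apply continuity_2d_pt_minus; apply continuity_2d_pt_mult; auto.
          - intros u v Hq. assert (K := Hjac u v (TS1 _ _ Hq)). unfold jc. split; field; lra. }
        split; [apply Y|exact Y]. }
      destruct (Cont _ _ _ W1) as [h11 [h12 [_ Y1]]]. destruct (Cont _ _ _ W2) as [h21 [h22 [_ Y2]]].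
      exists (push Te t x f). split.
      - exact (C2_of_partials _ _ _ _ _ _ _ _ W3 Y1 Y2).
      - intros [u v] Hq. unfold uncurry2; simpl.
        exact (push_value (2 * (eta0 + 1)) Te t x HexpT f u v Hq). }
    split.
    + apply (Push _ _ _ _ _ _ _ (M _ _ _ Lbe) (M _ _ _ Lth) (C1_square_const r1 0)).
    + apply (Push _ _ _ _ _ _ _ (M _ _ _ Rbe) (C1_square_const r1 0) (M _ _ _ Rth)).
Qed.

End Reflection.

(** * Passage from the given data to the hypotheses of [reflection_solved] *)

Theorem theorem1
  (p : R -> R) (rref : R)
  (p_smooth : forall (n : nat) (r : R), 0 < r -> ex_derive_n p n r)
  (dp_pos : forall r : R, 0 < r -> 0 < Derive p r)
  (rref_pos : 0 < rref)
  (T : R) (x0 rho_data w_data : R -> R) (rhos ws : R * R -> R)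
  (dev : future_development p T x0 rho_data w_data rhos ws)
  (w_origin : ws (0, 0) <> 0)
  (rho0 V0 : R)
  (rho0_pos : 0 < rho0)
  (jump0 : jump_conditions p rho0 0 (rhos (0, 0)) (ws (0, 0)) V0)
  (V0_determinism : ws (0, 0) + eta p (rhos (0, 0)) < V0 < eta p rho0)
  (V0_pos : 0 < V0)
  (H : R * R * R -> R) :
  let D := dev_domain T x0 in
  let als := fun q => alpha_of p rref (rhos q) (ws q) in
  let bes := fun q => beta_of p rref (rhos q) (ws q) in
  let eta0 := eta p rho0 in
  let a := a_const eta0 V0 in
  let al0 := alpha_of p rref rho0 0 in
  let be0 := beta_of p rref rho0 0 in
  implicit_solution p rref al0 be0 (als (0, 0)) (bes (0, 0)) H ->
  exists eps0 : R, 0 < eps0 /\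
    forall eps : R, 0 < eps <= eps0 ->
      exists al be t x : R * R -> R,
        (C2 (T_domain a eps) al /\ C2 (T_domain a eps) be /\
         C2 (T_domain a eps) t /\ C2 (T_domain a eps) x) /\
        shock_reflection_problem p rref D als bes a be0
          (beta0' D als bes H eta0 V0 al0) V0 eps al be t x /\
        (forall q, T_domain a eps q -> jacobian (T_domain a eps) t x q <> 0) /\
        C2_function_of (T_domain a eps) t x al /\
        C2_function_of (T_domain a eps) t x be.
Proof.
  intros D als bes eta0 a al0 be0 HI.
  (* Behind the shock the fluid is at rest at the origin, so both invariants equal the enthalpy
     integral. *)
  assert (Eal : al0 = enthalpy_integral p rref rho0) by (unfold al0, alpha_of; ring).
  assert (Ebe : be0 = enthalpy_integral p rref rho0) by (unfold be0, beta_of; ring).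
  clearbody al0 be0. subst al0 be0.
  destruct HI as [H_origin [U [U_open [U_origin [H_smooth H_jump]]]]].
  (* Order $3$ leaves the first partial derivatives with two derivatives, as the $C^{1,1}$ bounds on
     the coefficients require; the same holds for the state ahead. *)
  destruct (Cn_partials3 U 2 H U_open (H_smooth 3%nat)) as [H1 [H2 [H3 [H_partials [H1_C2 [H2_C2 H3_C2]]]]]].
  destruct (Cn_partials D 2 rhos (dev_smooth_rho _ _ _ _ _ _ _ dev 3%nat)) as [rt [rx [rho_partials [rt_C2 rx_C2]]]].
  destruct (Cn_partials D 2 ws (dev_smooth_w _ _ _ _ _ _ _ dev 3%nat)) as [wt [wx [w_partials [wt_C2 wx_C2]]]].
  destruct (smooth1_sound_speed p rref p_smooth dp_pos rref_pos 3) as [ss' [ss_derive ss'_smooth]].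
  apply (reflection_solved p rref p_smooth dp_pos rref_pos T x0 rho_data w_data rhos ws dev w_origin
    rho0 V0 rho0_pos jump0 V0_determinism V0_pos H H1 H2 H3 U rt rx wt wx) with (ss' := ss'); auto.
  apply (beta0'_relation p rref p_smooth dp_pos rref_pos T x0 rho_data w_data rhos ws dev w_origin
    rho0 V0 rho0_pos jump0 V0_determinism V0_pos H H1 H2 H3 U rt rx wt wx); auto.
Qed.
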